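(* There is an algorithm which, given a (possibly nonbipartite) weighted graph $G=(V,E)$ with $n$ vertices and $m$ edges and vertex capacities $b_i$, whose edges are presented as a read-only list of triples $(i,j,w_{ij})$ in arbitrary order, and given any $\delta$ with $\frac{1}{\sqrt{5n}}<\delta\le\frac1{16}$, finds a fractional solution $y$ feasible for the linear program (LP1) below with $\sum_{(i,j)\in E}w_{ij}y_{ij}\ge(1-14\delta)\beta^*$, where $\beta^*$ is the optimum value of (LP1). The algorithm uses additional work space (excluding the read-only input) $O(n\,\mathrm{poly}(\delta^{-1},\ln n))$, makes $T=O(\delta^{-4}\ln(1/\delta)\ln n)$ passes over the list of edges, and runs in time $O(mT+n\,\mathrm{poly}(\delta^{-1},\ln n))$.
   Context: $G=(V,E)$ is an undirected graph without self-loops, $|V|=n$, $|E|=m$; each vertex $i$ has an integer capacity $b_i\in[0,\mathrm{poly}(n)]$, and input integers are bounded by $\mathrm{poly}(n)$. For $U\subseteq V$, $\|U\|_b=\sum_{i\in U}b_i$, and $\mathcal O=\{U\subseteq V:\|U\|_b\text{ odd}\}$. (LP1) is: maximize $\sum_{(i,j)\in E}w_{ij}y_{ij}$ subject to $\sum_{j:(i,j)\in E}y_{ij}\le b_i$ for all $i\in V$; $\sum_{(i,j)\in E:\,i,j\in U}y_{ij}\le\lfloor\|U\|_b/2\rfloor$ for all $U\in\mathcal O$; $y_{ij}\ge 0$ for all $(i,j)\in E$ (one variable per undirected edge). Space is measured in words. *)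

(* Defs.v *)
From HB Require Import structures.
From mathcomp Require Import all_boot all_order all_algebra.
From mathcomp Require Import boolp classical_sets reals exp.

Set Implicit Arguments.
Unset Strict Implicit.
Unset Printing Implicit Defensive.

Import Order.TTheory GRing.Theory Num.Theory.

Local Open Scope ring_scope.

(** * Capacitated weighted graphs and the linear program (LP1) *)

(* An undirected edge is a two-element vertex set, so there are neither loops
   nor parallel edges, and (LP1) has one variable per undirected edge. *)
Record bgraph (n : nat) := BGraph {
  edges : {set {set 'I_n}};
  edges_card2 : forall e, e \in edges -> #|e| = 2%N;
  weight : {set 'I_n} -> int;
  cap : 'I_n -> nat
}.

Section LP1.
Variables (R : realType) (n : nat) (G : bgraph n).

Definition bnorm (U : {set 'I_n}) : nat := (\sum_(i in U) cap G i)%N.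

(* Only the values of [y] on [edges G] matter. *)
Definition lp_feasible (y : {set 'I_n} -> R) : Prop :=
  [/\ forall i : 'I_n,
        \sum_(e in edges G | i \in e) y e <= (cap G i)%:R,
      forall U : {set 'I_n}, odd (bnorm U) ->
        \sum_(e in edges G | e \subset U) y e <= ((bnorm U)./2)%:R
    & forall e, e \in edges G -> 0 <= y e].

Definition lp_value (y : {set 'I_n} -> R) : R :=
  \sum_(e in edges G) (weight G e)%:~R * y e.

(* The feasible values are bounded and include 0, so this is a genuine
   supremum. *)
Definition lp_opt : R :=
  sup (fun v : R => exists2 y, lp_feasible y & v = lp_value y).

End LP1.

(* [es] lists every edge of [G] exactly once, in an arbitrary order and with an
   arbitrary orientation. *)
Definition presents (n : nat) (G : bgraph n)
    (es : seq ('I_n * 'I_n * int)) : Prop :=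
  perm_eq [seq [set t.1.1; t.1.2] | t <- es] (enum (edges G)) /\
  (forall t, t \in es -> t.2 = weight G [set t.1.1; t.1.2]).

(** * A word RAM with a read-only edge stream

   The machine has registers (a given program uses only a fixed number of
   them), a random-access work memory of [S] words, a read-only stream that can
   only be scanned from its beginning, and an append-only output.  A word is an
   integer of absolute value at most [W].  A run gets stuck, hence does not
   terminate in the sense of [exec], when it produces a value that is not a word
   or uses an address outside [0, S). *)

Definition triple := (int * int * int)%type.
Definition record4 := (int * int * int * int)%type.

Inductive binop := Add | Sub | Mul | Div.

Definition binop_eval (o : binop) (u v : int) : int :=
  match o with
  | Add => u + v
  | Sub => u - v
  | Mul => u * v
  | Div => (u %/ v)%Z
  end.

Inductive instr :=
| Const of nat & int                (* r_x := k *)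
| Op of binop & nat & nat & nat     (* r_x := r_y o r_z *)
| Fetch of nat & nat                (* r_x := mem[r_y] *)
| Store of nat & nat                (* mem[r_x] := r_y *)
| Rewind                            (* start a new pass *)
| Next of nat & nat & nat & nat     (* r_f := 1 and (r_x, r_y, r_z) := next
                                       triple; r_f := 0 if the pass is over *)
| Emit of nat & nat & nat & nat.    (* append (r_x, r_y, r_z, r_u) *)

Inductive prog :=
| Basic of instr
| Seq of prog & prog
| If of nat & nat & prog & prog     (* tests r_x <= r_y *)
| While of nat & nat & prog.        (* as long as r_x <= r_y *)

Record state := State {
  reg : nat -> int;
  mem : nat -> int;
  rest : seq triple;                (* unread part of the current pass *)
  passes : nat;
  out : seq record4
}.

Section Machine.
Variables (es : seq triple) (S W : nat).

Definition upd (f : nat -> int) (x : nat) (v : int) : nat -> int :=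
  fun y => if y == x then v else f y.

Definition set_reg (x : nat) (v : int) (s : state) : option state :=
  if (`|v| <= W)%N
  then Some (State (upd (reg s) x v) (mem s) (rest s) (passes s) (out s))
  else None.

Definition addr (v : int) : option nat :=
  if v is Posz a then (if (a < S)%N then Some a else None) else None.

Definition step (i : instr) (s : state) : option state :=
  match i with
  | Const x k => set_reg x k s
  | Op o x y z => set_reg x (binop_eval o (reg s y) (reg s z)) s
  | Fetch x y =>
      if addr (reg s y) is Some a then set_reg x (mem s a) s else None
  | Store x y =>
      if addr (reg s x) is Some a
      then Some (State (reg s) (upd (mem s) a (reg s y))
                       (rest s) (passes s) (out s))
      else None
  | Rewind => Some (State (reg s) (mem s) es (passes s).+1 (out s))
  | Next f x y z =>
      if rest s is (i, j, w) :: l then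
        obind (set_reg f 1) (obind (set_reg z w) (obind (set_reg y j)
          (set_reg x i (State (reg s) (mem s) l (passes s) (out s)))))
      else set_reg f 0 s
  | Emit x y z u =>
      Some (State (reg s) (mem s) (rest s) (passes s)
                  (rcons (out s) (reg s x, reg s y, reg s z, reg s u)))
  end.

(* [exec p s t s']: from [s], [p] halts in [s'] after [t] unit-cost
   instructions and tests. *)
Inductive exec : prog -> state -> nat -> state -> Prop :=
| ExecBasic i s s' of step i s = Some s' : exec (Basic i) s 1 s'
| ExecSeq p q s1 s2 s3 t1 t2 of exec p s1 t1 s2 & exec q s2 t2 s3 :
    exec (Seq p q) s1 (t1 + t2) s3
| ExecIfT x y p q s s' t of reg s x <= reg s y & exec p s t s' :
    exec (If x y p q) s t.+1 s'
| ExecIfF x y p q s s' t of reg s y < reg s x & exec q s t s' :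
    exec (If x y p q) s t.+1 s'
| ExecWhileT x y p s1 s2 s3 t1 t2 of reg s1 x <= reg s1 y &
    exec p s1 t1 s2 & exec (While x y p) s2 t2 s3 :
    exec (While x y p) s1 (t1 + t2).+1 s3
| ExecWhileF x y p s of reg s y < reg s x : exec (While x y p) s 1 s.

End Machine.

(** * Input and output conventions *)

Definition edge_stream (n : nat) (es : seq ('I_n * 'I_n * int)) : seq triple :=
  [seq ((nat_of_ord t.1.1)%:Z, (nat_of_ord t.1.2)%:Z, t.2) | t <- es].

(* The memory initially holds n, the numerator and denominator of delta, the n
   capacities, and then zeros; no pass has been started. *)
Definition init_state (n : nat) (G : bgraph n) (dnum dden : nat) : state :=
  State (fun=> 0)
        (nth 0 ([:: n%:Z; dnum%:Z; dden%:Z] ++ [seq (cap G i)%:Z | i : 'I_n]))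
        [::] 0 [::].

(* The output [o] is a sparse list of the vector [y]: an entry (i, j, a, d)
   says that y_ij = a / d, and the edges that are not listed have y_ij = 0. *)
Definition outputs (R : realType) (n : nat) (G : bgraph n) (o : seq record4)
    (y : {set 'I_n} -> R) : Prop :=
  exists ys : seq ('I_n * 'I_n * int * int),
    let edge (r : 'I_n * 'I_n * int * int) := [set r.1.1.1; r.1.1.2] in
    [/\ o = [seq ((nat_of_ord r.1.1.1)%:Z, (nat_of_ord r.1.1.2)%:Z,
                  r.1.2, r.2) | r <- ys],
        uniq (map edge ys),
        forall r, r \in ys ->
          [/\ edge r \in edges G, r.2 != 0 & y (edge r) = r.1.2%:~R / r.2%:~R]
      & forall e, e \in edges G -> e \notin map edge ys -> y e = 0].

(* All input integers are at most n ^ c in absolute value. *)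
Definition poly_bounded (c n : nat) (G : bgraph n) (dnum dden : nat) : Prop :=
  [/\ forall i, (cap G i <= n ^ c)%N,
      forall e, e \in edges G -> (`|weight G e| <= n ^ c)%N,
      (dnum <= n ^ c)%N
    & (dden <= n ^ c)%N].

(* Main.v *)
(* The linear program is solved by multiplicative weights on its dual with
   additive precision eps = c * delta. A vertex potential X_i grows by a factor
   1 + eps/b_i per unit of load and is discounted by 1 - eps after each of the
   N = O(eps^-2 log n) passes; in a pass every edge that is not covered by
   X_i + X_j >= w F is loaded until it is. The potential sum b_i X_i controls the
   value of the accumulated loads by duality, and ln X_i bounds the load of i.
   Scaling by 1 + O(eps) leaves slack in the vertex constraints, which pays for
   every odd set of weight at least 1/eps. Smaller odd sets only contain edges
   between vertices of capacity at most 1/eps; such an edge is touched at most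
   once, so these edges form a stored graph of bounded degree, and between two
   passes an inner packing loop repairs their odd set constraints. Violated odd
   sets are found as minimal minimizers of a cut function, by at most Q unit
   augmentations, so that the search is local and linear in n. *)
Require Import Defs.
From Stdlib Require Import FunctionalExtensionality.
From mathcomp Require Import all_boot all_order all_algebra.
From mathcomp Require Import reals exp.
From mathcomp Require Import zify ring lra.

Set Implicit Arguments.
Unset Strict Implicit.
Unset Printing Implicit Defensive.

(** * A structured language over natural numbers and its compilation to the word RAM *)

Module MachineTh.
Import Defs.
Import Order.TTheory GRing.Theory Num.Theory.

Local Notation "n %:Z" := (Posz n) : nat_scope.

(** Minimum odd cuts are usually read off a Gomory-Hu tree, a global object. It is replaced by one
    certificate per vertex: by submodularity and posimodularity, parity only has to be tested on
    minimal minimizers that separate points of a set of O(Q) vertices. Two facts make this cheap.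
    The sink capacity (Q+1) b_x - load(x) of a vertex stays at least b_x, so a search after f unit
    augmentations has visited at most f+2 vertices. Lowering the loads adds a monotone function to
    the cut function, so a certificate survives all later repairs, and each vertex needs only one
    final successful check per level. The other obstacle is that words are integers. Potentials and
    loads are integers at polynomially large scales (F for potentials, Fy for inner loads, Y0 for
    the smallest load that is ever lowered), chosen so that each rounding costs either a relative
    error of order eps or an additive error that the scale absorbs. With eps = 1/E and E at least
    100/delta, the accumulated loss 29 eps is far below 14 delta. *)

Definition NA := 48.

Inductive bop := Plus | Minus | Times | Quot.
(** Memory is split into [NA] interleaved arrays, element i of array k being at address
    [NA * i + k]; the arrays then need no base addresses and all have the same capacity. [Raw] reads
    the same memory by absolute address and serves to fetch the input, which is laid out
    contiguously. *)
Inductive ex := K of nat | V of nat | A of nat & ex | Raw of ex | B of bop & ex & ex.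

(** [clk] is a ghost clock with one tick per command or test; only [comp_ok] relates it to machine
    instructions. All contents are natural numbers: negative integers occur only inside compiled
    subtractions and in the edge weights before clipping. *)
Record st := St { rg : nat -> nat; ar : nat -> nat -> nat;
 rs : seq (nat * nat * nat); ps : nat; ot : seq (nat * nat * nat * nat); clk : nat }.

Definition bopv (o : bop) (x y : nat) : nat :=
 match o with Plus => x + y | Minus => x - y | Times => x * y | Quot => x %/ y end.

Fixpoint ev (e : ex) (s : st) : nat :=
 match e with
 | K k => k
 | V r => rg s r
 | A k e => ar s k (ev e s)
 | Raw e => ar s (ev e s %% NA) (ev e s %/ NA)
 | B o e1 e2 => bopv o (ev e1 s) (ev e2 s)
 end.

Inductive cmd :=
| Asg of nat & ex
| Put of nat & ex & ex
| Sq of cmd & cmd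
| Ite of ex & ex & cmd & cmd
| Whl of ex & ex & cmd
| Rew
| Nxt of nat & nat & nat & nat
| Emt of nat & nat & nat & nat.

Definition updf (T : Type) (f : nat -> T) (x : nat) (v : T) : nat -> T :=
 fun y => if y == x then v else f y.

Definition setr (r v : nat) (s : st) : st :=
 St (updf (rg s) r v) (ar s) (rs s) (ps s) (ot s) (clk s).+1.
Definition seta (k i v : nat) (s : st) : st :=
 St (rg s) (updf (ar s) k (updf (ar s k) i v)) (rs s) (ps s) (ot s) (clk s).+1.
Definition tick (s : st) : st :=
 St (rg s) (ar s) (rs s) (ps s) (ot s) (clk s).+1.
Definition rewi es (s : st) : st :=
 St (rg s) (ar s) es (ps s).+1 (ot s) (clk s).+1.
Definition nxt0 f (s : st) : st :=
 St (updf (rg s) f 0) (ar s) (rs s) (ps s) (ot s) (clk s).+1.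
Definition nxt1 f x y z (i j w : nat) l (s : st) : st :=
 St (updf (updf (updf (updf (rg s) x i) y j) z w) f 1)
   (ar s) l (ps s) (ot s) (clk s).+1.
Definition emi x y z u (s : st) : st :=
 St (rg s) (ar s) (rs s) (ps s) (rcons (ot s) (rg s x, rg s y, rg s z, rg s u)) (clk s).+1.

Section Sem.
Variables (Lm M0 : nat) (es : seq (nat * nat * nat)).

Fixpoint ok (e : ex) (s : st) : Prop :=
 match e with
 | K _ | V _ => True
 | A k e => ok e s /\ ev e s < Lm
 | Raw e => ok e s /\ ev e s < NA * Lm
 | B _ e1 e2 => ok e1 s /\ ok e2 s
 end.

(** The bound [Lm] on indices and the bound [M0] on stored values belong to the semantics, so an
    execution carries the evidence that the compiled program never gets stuck. Intermediate values
    of an expression may exceed [M0]; they are controlled by [wt]. *)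
Inductive aexec : cmd -> st -> st -> Prop :=
| XAsg r e s of ok e s & ev e s <= M0 : aexec (Asg r e) s (setr r (ev e s) s)
| XPut k e1 e2 s of ok e1 s & ok e2 s & ev e1 s < Lm & ev e2 s <= M0 :
  aexec (Put k e1 e2) s (seta k (ev e1 s) (ev e2 s) s)
| XSeq c1 c2 s1 s2 s3 of aexec c1 s1 s2 & aexec c2 s2 s3 : aexec (Sq c1 c2) s1 s3
| XIteT e1 e2 c1 c2 s s' of ok e1 s & ok e2 s & ev e1 s <= ev e2 s &
  aexec c1 (tick s) s' : aexec (Ite e1 e2 c1 c2) s s'
| XIteF e1 e2 c1 c2 s s' of ok e1 s & ok e2 s & ev e2 s < ev e1 s &
  aexec c2 (tick s) s' : aexec (Ite e1 e2 c1 c2) s s'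
| XWhlT e1 e2 c s s1 s2 of ok e1 s & ok e2 s & ev e1 s <= ev e2 s &
  aexec c (tick s) s1 & aexec (Whl e1 e2 c) s1 s2 : aexec (Whl e1 e2 c) s s2
| XWhlF e1 e2 c s of ok e1 s & ok e2 s & ev e2 s < ev e1 s :
  aexec (Whl e1 e2 c) s (tick s)
| XRew s : aexec Rew s (rewi es s)
| XNxt0 f x y z s of rs s = [::] : aexec (Nxt f x y z) s (nxt0 f s)
| XNxt1 f x y z i j w l s of rs s = (i, j, w) :: l :
  aexec (Nxt f x y z) s (nxt1 f x y z i j w l s)
| XEmt x y z u s : aexec (Emt x y z u) s (emi x y z u s).

End Sem.

(** Exponent of a polynomial bound: with contents at most [M0], the value of e is at most
    [M0 ^ wt e]. Sums may be weighted like products because of [add_le_mul]. *)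
Fixpoint wt (e : ex) : nat :=
 match e with
 | K _ | V _ => 1
 | A _ e => wt e | Raw e => wt e
 | B _ e1 e2 => wt e1 + wt e2
 end.

Fixpoint wfe (e : ex) : bool :=
 match e with
 | K k => k <= 100
 | V r => r < 100
 | A k e => (k < NA) && wfe e
 | Raw e => wfe e
 | B _ e1 e2 => wfe e1 && wfe e2
 end.

Definition wfx e := wfe e && (wt e <= 30).

Fixpoint wfc (c : cmd) : bool :=
 match c with
 | Asg r e => (r < 100) && wfx e
 | Put k e1 e2 => [&& k < NA, wfx e1 & wfx e2]
 | Sq c1 c2 => wfc c1 && wfc c2
 | Ite e1 e2 c1 c2 => [&& wfx e1, wfx e2, wfc c1 & wfc c2]
 | Whl e1 e2 c => [&& wfx e1, wfx e2 & wfc c]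
 | Rew => true
 | Nxt f x y z => [&& f < 100, x < 100, y < 100, z < 100 & uniq [:: f; x; y; z]]
 | Emt x y z u => [&& x < 100, y < 100, z < 100 & u < 100]
 end.

Declare Scope pr_scope.
Notation "p ;;; q" := (Seq p q) (at level 60, right associativity) : pr_scope.
Local Open Scope pr_scope.

Definition tm d := 100 + d.
Definition cst r (k : nat) := Basic (Const r k%:Z).
Definition opp o r x y := Basic (Op o r x y).

(* Address of the element of array [k] whose index is in temporary [d]. *)
Definition adr k d : prog :=
 cst (tm d.+1) NA ;;; opp Mul (tm d) (tm d) (tm d.+1) ;;;
 cst (tm d.+1) k ;;; opp Add (tm d) (tm d) (tm d.+1).

(** The result goes to temporary d and no register below [tm d] is written, so a left operand
    survives the evaluation of the right one. The machine has no move instruction, hence the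
    additions of 0. After a subtraction a negative result is replaced by 0, which is the truncated
    subtraction of [bopv]. *)
Fixpoint ce (e : ex) (d : nat) : prog :=
 match e with
 | K k => cst (tm d) k
 | V r => cst (tm d.+1) 0 ;;; opp Add (tm d) r (tm d.+1)
 | A k e => ce e d ;;; adr k d ;;; Basic (Fetch (tm d) (tm d))
 | Raw e => ce e d ;;; Basic (Fetch (tm d) (tm d))
 | B o e1 e2 => ce e1 d ;;; ce e2 d.+1 ;;;
  match o with
  | Plus => opp Add (tm d) (tm d) (tm d.+1)
  | Times => opp Mul (tm d) (tm d) (tm d.+1)
  | Quot => opp Div (tm d) (tm d) (tm d.+1)
  | Minus => opp Sub (tm d) (tm d) (tm d.+1) ;;; cst (tm d.+1) 0 ;;;
    If (tm d.+1) (tm d) (cst (tm d.+1) 0) (cst (tm d) 0)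
  end
 end.

Definition tst e1 e2 : prog := ce e1 0 ;;; ce e2 1.

(** A machine loop tests two registers, so the body ends by recomputing both sides of the test.
    After [Next] the weight is clipped at 0: an edge of negative weight behaves like one of weight
    0, and such an edge never receives any load. *)
Fixpoint comp (c : cmd) : prog :=
 match c with
 | Asg r e => ce e 0 ;;; cst (tm 1) 0 ;;; opp Add r (tm 0) (tm 1)
 | Put k e1 e2 => ce e1 0 ;;; adr k 0 ;;; ce e2 1 ;;; Basic (Store (tm 0) (tm 1))
 | Sq c1 c2 => comp c1 ;;; comp c2
 | Ite e1 e2 c1 c2 => tst e1 e2 ;;; If (tm 0) (tm 1) (comp c1) (comp c2)
 | Whl e1 e2 c => tst e1 e2 ;;; While (tm 0) (tm 1) (comp c ;;; tst e1 e2)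
 | Rew => Basic Rewind
 | Nxt f x y z => Basic (Next f x y z) ;;; cst (tm 0) 0 ;;;
   If (tm 0) z (cst (tm 0) 0) (cst z 0)
 | Emt x y z u => Basic (Emit x y z u)
 end.

Definition ztr (t : nat * nat * int) : triple := (t.1.1%:Z, t.1.2%:Z, t.2).
Definition clip (w : int) : nat := if w is Posz a then a else 0.
Definition ntr (t : nat * nat * int) : nat * nat * nat := (t.1.1, t.1.2, clip t.2).
Definition z4 (r : nat * nat * nat * nat) : record4 :=
 (r.1.1.1%:Z, r.1.1.2%:Z, r.1.2%:Z, r.2%:Z).

Lemma add_le_mul x y p q : x <= p -> y <= q -> 1 < p -> 1 < q -> x + y <= p * q.
Proof.
move=> hx hy hp hq; apply: leq_trans (leq_add hx hy) _.
case: p q hp hq {hx hy} => [|p] [|q] // hp hq; rewrite mulSn mulnS; nia.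
Qed.

Section Comp.
Variables (Lm M0 W : nat) (eL : seq (nat * nat * int)).
Hypothesis M0big : 100 <= M0.
Hypothesis M0W : forall j, j <= 31 -> M0 ^ j <= W.
Hypothesis Wadr : NA * Lm <= W.
Hypothesis eLb : forall t, t \in eL -> [/\ t.1.1 <= M0, t.1.2 <= M0 & (`|t.2| <= M0)%N].

Notation S := (NA * Lm).
Notation es := (map ztr eL).
Notation esn := (map ntr eL).
Notation Exec := (exec es S W).

Record sim (a : st) (s : state) : Prop := Sim {
 sim_r : forall r, r < 100 -> reg s r = (rg a r)%:Z;
 sim_m : forall k i, k < NA -> i < Lm -> mem s (NA * i + k) = (ar a k i)%:Z;
 sim_l : exists2 l, {subset l <= eL} & rest s = map ztr l /\ rs a = map ntr l;
 sim_p : passes s = ps a;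
 sim_o : out s = map z4 (ot a);
 sim_rb : forall r, r < 100 -> rg a r <= M0;
 sim_mb : forall k i, k < NA -> i < Lm -> ar a k i <= M0 }.

Lemma M0W1 : M0 <= W.
Proof. by rewrite -(expn1 M0); exact: M0W. Qed.

Lemma ev_bound a s e : sim a s -> wfe e -> ok Lm e a -> ev e a <= M0 ^ wt e.
Proof.
move=> Hs; elim: e => [k|r|k e IH|e IH|o e1 IH1 e2 IH2] /=.
- by move=> h _; rewrite expn1; lia.
- by move=> h _; rewrite expn1; apply: (sim_rb Hs).
- move=> /andP[hk hw] [h1 h2]; apply: leq_trans (sim_mb Hs hk h2) _.
 have -> : M0 = M0 ^ 1 by rewrite expn1.
 rewrite -expnM mul1n leq_pexp2l; [by []|lia|].
 by elim: (e) => //= ? ? ? ? ?; lia.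
- move=> hw [h1 h2]; apply: leq_trans (sim_mb Hs _ _) _; first by rewrite ltn_mod.
  by rewrite ltn_divLR // mulnC.
 have -> : M0 = M0 ^ 1 by rewrite expn1.
 rewrite -expnM mul1n leq_pexp2l; [by []|lia|].
 by elim: (e) => //= ? ? ? ? ?; lia.
- move=> /andP[w1 w2] [o1 o2]; move: (IH1 w1 o1) (IH2 w2 o2); rewrite expnD.
 set x := ev e1 a; set y := ev e2 a => hx hy.
 have wp e : 0 < wt e by elim: e => //= *; lia.
 have p1 : 1 < M0 ^ wt e1 by apply: leq_trans (_ : M0 ^ 1 <= _); rewrite ?leq_pexp2l ?expn1 //; lia.
 have p2 : 1 < M0 ^ wt e2 by apply: leq_trans (_ : M0 ^ 1 <= _); rewrite ?leq_pexp2l ?expn1 //; lia.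
 have hl : x <= M0 ^ wt e1 * M0 ^ wt e2 by apply: leq_trans hx (leq_pmulr _ _); lia.
 case: o => /=; [exact: add_le_mul|exact: leq_trans (leq_subr _ _) hl|exact: leq_mul|].
 exact: leq_trans (leq_div _ _) hl.
Qed.

Definition same (d : nat) (s s' : state) : Prop :=
 [/\ forall r, r < tm d -> reg s' r = reg s r, mem s' = mem s, rest s' = rest s,
   passes s' = passes s & out s' = out s].

Lemma same_refl d s : same d s s. Proof. by split. Qed.
Lemma same_trans d d' s1 s2 s3 : d <= d' -> same d s1 s2 -> same d' s2 s3 -> same d s1 s3.
Proof.
move=> dd [a1 a2 a3 a4 a5] [b1 b2 b3 b4 b5]; split; try congruence.
by move=> r hr; rewrite b1 ?a1 //; rewrite /tm in hr *; lia.
Qed.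
Lemma same_sim a s s' d : same d s s' -> sim a s -> sim a s'.
Proof.
case=> h1 h2 h3 h4 h5 [*]; split; rewrite ?h2 ?h3 ?h4 ?h5 //.
by move=> r hr; rewrite h1 ?/tm; [auto|lia].
Qed.

Definition wr (s : state) r v : state :=
 State (upd (reg s) r v) (mem s) (rest s) (passes s) (out s).
Lemma same_wr d r s v : tm d <= r -> same d s (wr s r v).
Proof. by move=> h; split=> //= q hq; rewrite /upd; case: eqP => // ?; lia. Qed.

Lemma same_wrr d r s s' v : tm d <= r -> same d s s' -> same d s (wr s' r v).
Proof. by move=> h h'; apply: (same_trans (leqnn d) h'); exact: same_wr. Qed.

Lemma ex_cst r k s : k <= W -> Exec (cst r k) s 1 (wr s r k%:Z).
Proof. by move=> h; apply: ExecBasic; rewrite /= /set_reg absz_nat h. Qed.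
Lemma ex_op o r x y s v : binop_eval o (reg s x) (reg s y) = v -> (`|v| <= W)%N ->
 Exec (opp o r x y) s 1 (wr s r v).
Proof. by move=> e h; apply: ExecBasic; rewrite /= /set_reg e h. Qed.

Definition cost (e : ex) : nat :=
 (fix go e := match e with K _ => 1 | V _ => 2 | A _ e => go e + 5 | Raw e => go e + 1
  | B _ e1 e2 => go e1 + go e2 + 5 end) e.

Lemma ex_adr k d s v : k < NA -> v < Lm -> reg s (tm d) = v%:Z ->
 exists2 s', Exec (adr k d) s 4 s' & same d s s' /\ reg s' (tm d) = (NA * v + k)%:Z.
Proof.
move=> hk hv hr.
have hW : NA * v + k <= W by apply: leq_trans Wadr; rewrite /NA in hk *; lia.
eexists.
 apply: (ExecSeq (t1 := 1) (t2 := 3)); first by apply: ex_cst; apply: leq_trans M0W1; rewrite /NA; lia.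
 apply: (ExecSeq (t1 := 1) (t2 := 2)).
  apply: (@ex_op _ _ _ _ _ (v * NA)%:Z); last by rewrite absz_nat; lia.
  by rewrite /= /upd eqxx; case: eqP => [|_]; [rewrite /tm; lia|rewrite hr PoszM].
 apply: (ExecSeq (t1 := 1) (t2 := 1)); first by apply: ex_cst; lia.
 apply: (@ex_op _ _ _ _ _ (v * NA + k)%:Z); last by rewrite absz_nat; lia.
 rewrite /= /upd eqxx.
 case: eqP => [|_]; first by rewrite /tm; lia.
 by rewrite eqxx PoszD.
split; last by rewrite /= /upd eqxx; congr (Posz _); lia.
do 4 (apply: same_wrr; first by rewrite /tm; lia).
exact: same_refl.
Qed.

Lemma ex_fetch d s v x : v < S -> reg s (tm d) = v%:Z -> mem s v = x%:Z -> x <= W ->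
 Exec (Basic (Fetch (tm d) (tm d))) s 1 (wr s (tm d) x%:Z).
Proof.
move=> hv hr hm hx; apply: ExecBasic; rewrite /= hr /= hv hm /set_reg absz_nat hx //.
Qed.

Lemma adr_lt k v : k < NA -> v < Lm -> NA * v + k < S.
Proof. by rewrite /NA => *; lia. Qed.

Lemma ce_ok a e : wfe e -> ok Lm e a -> wt e <= 30 -> forall d s, sim a s ->
 exists s' t, [/\ Exec (ce e d) s t s', t <= cost e, same d s s' & reg s' (tm d) = (ev e a)%:Z].
Proof.
elim: e => [k|r|k e IH|e IH|o e1 IH1 e2 IH2] /=.
- move=> h _ _ d s Hs; exists (wr s (tm d) k%:Z), 1; split=> //.
 + by apply: ex_cst; have := M0W1; lia.
 + exact: same_wr.
 + by rewrite /= /upd eqxx.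
- move=> h _ _ d s Hs; eexists _, _; split.
 + apply: (ExecSeq (t1 := 1) (t2 := 1)); first exact: ex_cst.
  apply: (@ex_op _ _ _ _ _ (rg a r)%:Z); last by rewrite absz_nat (leq_trans (sim_rb Hs h)) // M0W1.
  by rewrite /= /upd eqxx; case: eqP => [|_]; [rewrite /tm; lia|rewrite (sim_r Hs) // addr0].
 + by [].
 + do 2 (apply: same_wrr; first by rewrite /tm; lia).
  exact: same_refl.
 + by rewrite /= /upd eqxx.
- move=> /andP[hk hw] [h1 h2] ht d s Hs.
 have [s1 [t1 [x1 c1 m1 r1]]] := IH hw h1 ht d s Hs.
 have [s2 x2 [m2 r2]] := ex_adr hk h2 r1.
 have S2 : sim a s2 by apply: same_sim m2 _; apply: same_sim m1 _.
 eexists _, _; split.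
 + apply: (ExecSeq x1); apply: (ExecSeq x2).
  apply: (ex_fetch (adr_lt hk h2) r2 (sim_m S2 hk h2)).
  by apply: leq_trans (sim_mb S2 hk h2) M0W1.
 + lia.
 + apply: same_wrr => //; exact: same_trans (leqnn d) m1 m2.
 + by rewrite /= /upd eqxx.
- move=> hw [h1 h2] ht d s Hs.
 have [s1 [t1 [x1 c1 m1 r1]]] := IH hw h1 ht d s Hs.
 have S1 : sim a s1 by apply: same_sim m1 _.
 have hq : ev e a %/ NA < Lm by rewrite ltn_divLR // mulnC.
 have hm : ev e a %% NA < NA by rewrite ltn_mod.
 have E1 := sim_m S1 hm hq.
 have E2 : NA * (ev e a %/ NA) + ev e a %% NA = ev e a by rewrite mulnC -divn_eq.
 rewrite E2 in E1.
 eexists _, _; split.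
 + apply: (ExecSeq x1); apply: (ex_fetch h2 r1 E1).
  by apply: leq_trans (sim_mb S1 hm hq) M0W1.
 + lia.
 + exact: same_wrr.
 + by rewrite /= /upd eqxx.
- move=> /andP[w1 w2] [o1 o2] ht d s Hs.
 have [|s1 [t1 [x1 c1 m1 r1]]] := IH1 w1 o1 _ d s Hs; first by lia.
 have S1 : sim a s1 by apply: same_sim m1 _.
 have [|s2 [t2 [x2 c2 m2 r2]]] := IH2 w2 o2 _ d.+1 s1 S1; first by lia.
 have r1' : reg s2 (tm d) = (ev e1 a)%:Z by case: m2 => -> //; rewrite /tm; lia.
 have S2 : sim a s2 by apply: same_sim m2 _.
 have m12 : same d s s2 by exact: same_trans (leqnSn d) m1 m2.
 have bB : bopv o (ev e1 a) (ev e2 a) <= W.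
  apply: leq_trans (@ev_bound a s2 (B o e1 e2) S2 _ _) _ => /=; rewrite ?w1 ?w2 //.
  by apply: M0W; lia.
 have b2 : ev e2 a <= W by apply: leq_trans (ev_bound S2 w2 o2) (M0W _); lia.
 have b1 : ev e1 a <= W by apply: leq_trans (ev_bound S2 w1 o1) (M0W _); lia.
 have dd : (tm d == tm d.+1) = false by rewrite /tm; lia.
 have common op : binop_eval op (ev e1 a)%:Z (ev e2 a)%:Z = (bopv o (ev e1 a) (ev e2 a))%:Z ->
   exists s' t, [/\ Exec (ce e1 d ;;; ce e2 d.+1 ;;; opp op (tm d) (tm d) (tm d.+1)) s t s',
    t <= cost e1 + cost e2 + 5, same d s s' & reg s' (tm d) = (bopv o (ev e1 a) (ev e2 a))%:Z].
  move=> eo; eexists _, _; split.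
  + apply: (ExecSeq x1); apply: (ExecSeq x2); apply: ex_op; first by rewrite r1' r2 eo.
   by rewrite absz_nat.
  + lia.
  + exact: same_wrr.
  + by rewrite /= /upd eqxx.
 case: o bB common => bB common; try by apply: common; rewrite /= ?PoszD ?PoszM ?divz_nat.
 case: (leqP (ev e2 a) (ev e1 a)) => hc.
 + eexists _, _; split.
  * apply: (ExecSeq x1); apply: (ExecSeq x2).
   apply: (ExecSeq (t1 := 1)).
    by apply: (@ex_op _ _ _ _ _ (ev e1 a - ev e2 a)%N%:Z); [rewrite r1' r2 /= subzn|exact: bB].
   apply: (ExecSeq (t1 := 1)); first exact: ex_cst.
   apply: ExecIfT; last exact: ex_cst.
   by rewrite /= /upd eqxx dd eqxx.
  * lia.
  * do 3 (apply: same_wrr; first by rewrite /tm; lia).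
   exact: m12.
  * by rewrite /= /upd eqxx dd.
 + eexists _, _; split.
  * apply: (ExecSeq x1); apply: (ExecSeq x2).
   apply: (ExecSeq (t1 := 1)).
    by apply: (@ex_op _ _ _ _ _ (Posz (ev e1 a) - Posz (ev e2 a))%R); [rewrite r1' r2|lia].
   apply: (ExecSeq (t1 := 1)); first exact: ex_cst.
   apply: ExecIfF; last exact: ex_cst.
   by rewrite /= /upd eqxx dd eqxx; lia.
  * lia.
  * do 3 (apply: same_wrr; first by rewrite /tm; lia).
   exact: m12.
  * by rewrite /= /upd eqxx; congr Posz; lia.
Qed.

(** Instructions paid for by one tick: [wcc] limits each expression to 300 instructions, a command
    or test involves at most two of them, and addressing and control add only a few more. *)
Definition KC := 1000.

Fixpoint wcc (c : cmd) : bool :=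
 match c with
 | Asg _ e => cost e <= 300
 | Put _ e1 e2 => (cost e1 <= 300) && (cost e2 <= 300)
 | Sq c1 c2 => wcc c1 && wcc c2
 | Ite e1 e2 c1 c2 => [&& cost e1 <= 300, cost e2 <= 300, wcc c1 & wcc c2]
 | Whl e1 e2 c => [&& cost e1 <= 300, cost e2 <= 300 & wcc c]
 | _ => true
 end.

Lemma sim_tick a s : sim a s -> sim (tick a) s.
Proof. by case=> *; split. Qed.

Lemma tst_ok a s e1 e2 : wfx e1 -> wfx e2 -> ok Lm e1 a -> ok Lm e2 a -> sim a s ->
 exists s' t, [/\ Exec (tst e1 e2) s t s', t <= cost e1 + cost e2, sim a s',
  reg s' (tm 0) = (ev e1 a)%:Z & reg s' (tm 1) = (ev e2 a)%:Z].
Proof.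
move=> /andP[w1 t1] /andP[w2 t2] o1 o2 Hs.
have [s1 [k1 [x1 c1 m1 r1]]] := ce_ok w1 o1 t1 0 Hs.
have S1 := same_sim m1 Hs.
have [s2 [k2 [x2 c2 m2 r2]]] := ce_ok w2 o2 t2 1 S1.
have S2 := same_sim m2 S1.
exists s2, (k1 + k2); split=> //; [exact: ExecSeq x1 x2|lia|].
by case: m2 => -> //.
Qed.

Lemma sim_setr a s r v : r < 100 -> v <= M0 -> sim a s ->
 sim (setr r v a) (wr s r v%:Z).
Proof.
move=> hr hv [h1 h2 h3 h4 h5 h6 h7]; split=> //= q hq; rewrite /upd /updf; case: eqP => // _; auto.
Qed.

(** Induction on the abstract execution. Time is stated as a difference of clock values, so that it
    adds up along sequences and loops without a separate account. *)
Theorem comp_ok c a a' : aexec Lm M0 esn c a a' -> wfc c -> wcc c ->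
 forall s, sim a s ->
 exists s' t, [/\ Exec (comp c) s t s', sim a' s' & t + KC * clk a <= KC * clk a'].
Proof.
rewrite /KC; elim=> {c a a'}.
- move=> r e a o1 b1 /=/andP[hr /andP[w1 w2]] c1 s Hs.
 have [s1 [t1 [x1 k1 m1 r1]]] := ce_ok w1 o1 w2 0 Hs.
 have S1 := same_sim m1 Hs.
 have bW : ev e a <= W by apply: leq_trans b1 M0W1.
 eexists _, _; split.
 + apply: (ExecSeq x1); apply: (ExecSeq (t1 := 1)); first exact: ex_cst.
  apply: (@ex_op _ _ _ _ _ (ev e a)%:Z); last by rewrite absz_nat.
  by rewrite /= /upd /= r1 addr0.
 + apply: sim_setr => //; apply: (same_sim (d := 0)) S1; exact: same_wr.
 + by rewrite /=; lia.
- move=> k e1 e2 a o1 o2 l1 l2 /=/and3P[hk /andP[w1 t1] /andP[w2 t2]] /andP[c1 c2] s Hs.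
 have [s1 [k1 [x1 d1 m1 r1]]] := ce_ok w1 o1 t1 0 Hs.
 have S1 := same_sim m1 Hs.
 have [s2 x2 [m2 r2]] := ex_adr hk l1 r1.
 have S2 := same_sim m2 S1.
 have [s3 [k3 [x3 d3 m3 r3]]] := ce_ok w2 o2 t2 1 S2.
 have S3 := same_sim m3 S2.
 have r2' : reg s3 (tm 0) = (NA * ev e1 a + k)%:Z by case: m3 => -> //.
 eexists _, _; split.
 + apply: (ExecSeq x1); apply: (ExecSeq x2); apply: (ExecSeq x3); apply: ExecBasic.
  by rewrite /= r2' /= adr_lt //.
 + case: S3 => h1 h2 h3 h4 h5 h6 h7; split=> //=.
  * move=> k' i' hk' hi'; rewrite /upd /updf.
   case: (k' =P k) => [->|nk].
    case: (i' =P ev e1 a) => [->|ni]; first by rewrite eqxx.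
    by case: eqP => [|_]; [rewrite /NA; lia|rewrite h2].
   case: eqP; last by rewrite h2.
   by move=> eqa; rewrite /NA in hk hk' eqa; case: nk; lia.
  * move=> k' i' hk' hi'; rewrite /updf.
   by case: eqP => [e|_]; [case: eqP => // _; subst; auto|auto].
 + by rewrite /=; lia.
- move=> c1 c2 a1 a2 a3 _ I1 _ I2 /=/andP[w1 w2] /andP[d1 d2] s Hs.
 have [s1 [t1 [x1 S1 k1]]] := I1 w1 d1 s Hs.
 have [s2 [t2 [x2 S2 k2]]] := I2 w2 d2 s1 S1.
 by exists s2, (t1 + t2); split=> //; [exact: ExecSeq x1 x2|lia].
- move=> e1 e2 c1 c2 a a' o1 o2 le _ IH /=/and4P[w1 w2 w3 w4] /and4P[d1 d2 d3 d4] s Hs.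
 have [s1 [t1 [x1 k1 S1 r1 r2]]] := tst_ok w1 w2 o1 o2 Hs.
 have [s2 [t2 [x2 S2 k2]]] := IH w3 d3 s1 (sim_tick S1).
 exists s2, (t1 + t2.+1); split=> //; last by rewrite /= in k2; lia.
 by apply: (ExecSeq x1); apply: ExecIfT x2; rewrite r1 r2.
- move=> e1 e2 c1 c2 a a' o1 o2 le _ IH /=/and4P[w1 w2 w3 w4] /and4P[d1 d2 d3 d4] s Hs.
 have [s1 [t1 [x1 k1 S1 r1 r2]]] := tst_ok w1 w2 o1 o2 Hs.
 have [s2 [t2 [x2 S2 k2]]] := IH w4 d4 s1 (sim_tick S1).
 exists s2, (t1 + t2.+1); split=> //; last by rewrite /= in k2; lia.
 by apply: (ExecSeq x1); apply: ExecIfF x2; rewrite r1 r2.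
- move=> e1 e2 c a a1 a2 o1 o2 le _ IH1 _ IH2 /=/and3P[w1 w2 w3] /and3P[d1 d2 d3] s Hs.
 have [s1 [t1 [x1 k1 S1 r1 r2]]] := tst_ok w1 w2 o1 o2 Hs.
 have [s2 [t2 [x2 S2 k2]]] := IH1 w3 d3 s1 (sim_tick S1).
 have w' : wfc (Whl e1 e2 c) by rewrite /= w1 w2 w3.
 have d' : wcc (Whl e1 e2 c) by rewrite /= d1 d2 d3.
 have [s3 [t3 [x3 S3 k3]]] := IH2 w' d' s2 S2.
 (* The induction hypothesis yields a run of the test followed by the loop. Splitting off the test
    turns it into the end of the compiled loop body. *)
 inversion x3; subst.
 eexists _, _; split; [|exact: S3|].
 + apply: (ExecSeq x1); apply: ExecWhileT; first by rewrite r1 r2.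
   exact: (ExecSeq x2 H1).
  exact: H5.
 + by rewrite /= in k2; lia.
- move=> e1 e2 c a o1 o2 le /=/and3P[w1 w2 w3] /and3P[d1 d2 d3] s Hs.
 have [s1 [t1 [x1 k1 S1 r1 r2]]] := tst_ok w1 w2 o1 o2 Hs.
 exists s1, (t1 + 1); split; [|exact: sim_tick|by rewrite /=; lia].
 by apply: (ExecSeq x1); apply: ExecWhileF; rewrite r1 r2.
- move=> a _ _ s [h1 h2 h3 h4 h5 h6 h7]; eexists _, _; split.
 + by apply: ExecBasic.
 + by split=> //=; [exists eL|rewrite h4].
 + by rewrite /=; lia.
- move=> f x y z a e0 /=/and5P[hf hx hy hz hu] _ s Hs.
 have [l ls [e1 e2]] := sim_l Hs.
 have l0 : l = [::] by case: l e1 e2 {ls} => //=; rewrite e0.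
 have zf : (z == f) = false by move: hu; rewrite /= !inE; case: (f =P z) => [->|/eqP]; rewrite ?eqxx ?orbT //= eq_sym => /negPf ->.
 have rz : exists v : nat, reg s z = v%:Z by exists (rg a z); rewrite (sim_r Hs).
 case: rz => v rz.
 eexists _, _; split.
 + apply: (ExecSeq (t1 := 1)); first by apply: ExecBasic; rewrite /= e1 l0 /=.
  apply: (ExecSeq (t1 := 1)); first exact: ex_cst.
  apply: ExecIfT; last exact: ex_cst.
  rewrite /= /upd eqxx; have -> : (z == tm 0) = false by rewrite /tm; lia.
  by rewrite zf rz.
 + apply: (same_sim (d := 0)); first exact: same_wr.
  apply: (same_sim (d := 0)); first exact: same_wr.
  case: Hs => h1 h2 h3 h4 h5 h6 h7; split=> //=.
  * by move=> r hr; rewrite /upd /updf; case: eqP => // _; auto.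
  * by move=> r hr; rewrite /updf; case: eqP => // _; auto.
 + by rewrite /=; lia.
- move=> f x y z i j w l a e0 /=/and5P[hf hx hy hz hu] _ s Hs.
 have [l0 ls [e1 e2]] := sim_l Hs.
 case: l0 ls e1 e2 => [|[[i' j'] w'] l'] ls e1; rewrite e0 //= => -[] -> -> -> lE.
 have [b1 b2 b3] := eLb (ls _ (mem_head _ _)); rewrite /= in b1 b2 b3.
 have M1 := M0W1.
 move: hu; rewrite /= !inE !negb_or => /and4P[/and3P[fx fy fz] /andP[xy xz] yz _].
 have zf : (z == f) = false by rewrite eq_sym (negPf fz).
 have sx : exec es S W (Basic (Next f x y z)) s 1
   (State (upd (upd (upd (upd (reg s) x i') y j') z w') f 1) (mem s) (map ztr l') (passes s) (out s)).
  apply: ExecBasic; rewrite /= e1 /= /set_reg !absz_nat.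
  rewrite (leq_trans b1 M1) /= (leq_trans b2 M1) /= (leq_trans b3 M1) /=.
  by rewrite (leq_trans _ M1) //; lia.
 have h0 : (z == tm 0) = false by rewrite /tm; lia.
 case: w' b3 {e1} ls sx => [w'|w'] b3 ls sx.
 + eexists _, _; split.
  * apply: (ExecSeq sx); apply: (ExecSeq (t1 := 1)); first exact: ex_cst.
   apply: ExecIfT; last exact: ex_cst.
   by rewrite /= /upd eqxx h0 zf eqxx.
  * apply: (same_sim (d := 0)); first exact: same_wr.
   apply: (same_sim (d := 0)); first exact: same_wr.
   case: Hs => h1 h2 h3 h4 h5 h6 h7; split=> //=.
   - by move=> r hr; rewrite /upd /updf; do 4 (case: ifP => // _); auto.
   - by exists l' => // t ht; apply: ls; rewrite inE ht orbT.
   - by move=> r hr; rewrite /updf; do 4 (case: ifP => [_|_]; first lia); auto.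
  * by rewrite /=; lia.
 + eexists _, _; split.
  * apply: (ExecSeq sx); apply: (ExecSeq (t1 := 1)); first exact: ex_cst.
   apply: ExecIfF; last exact: ex_cst.
   by rewrite /= /upd eqxx h0 zf eqxx.
  * case: Hs => h1 h2 h3 h4 h5 h6 h7; split=> //=.
   - move=> r hr; rewrite /upd /updf.
    have -> : (r == tm 0) = false by rewrite /tm; lia.
    case: (r =P z) => [->|_]; first by rewrite zf.
    by do 3 (case: ifP => // _); auto.
   - by exists l' => // t ht; apply: ls; rewrite inE ht orbT.
   - by move=> r hr; rewrite /updf; do 4 (case: ifP => [_|_]; first lia); auto.
  * by rewrite /=; lia.
- move=> x y z u a /=/and4P[hx hy hz hu] _ s Hs.
 eexists _, _; split.
 + by apply: ExecBasic.
 + case: Hs => h1 h2 h3 h4 h5 h6 h7; split=> //=.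
  by rewrite map_rcons h5 /z4 /= !h1.
 + by rewrite /=; lia.
Qed.

End Comp.

End MachineTh.

(** * Frames, total correctness rules and notations *)

Module HoareTh.
Import Defs MachineTh.
Arguments updf {T} f x v y /.

Fixpoint modr (c : cmd) : seq nat :=
 match c with
 | Asg r _ => [:: r]
 | Put _ _ _ | Rew | Emt _ _ _ _ => [::]
 | Sq c1 c2 | Ite _ _ c1 c2 => modr c1 ++ modr c2
 | Whl _ _ c => modr c
 | Nxt f x y z => [:: f; x; y; z]
 end.
Fixpoint moda (c : cmd) : seq nat :=
 match c with
 | Put k _ _ => [:: k]
 | Sq c1 c2 | Ite _ _ c1 c2 => moda c1 ++ moda c2
 | Whl _ _ c => moda c
 | _ => [::]
 end.
Fixpoint sio (c : cmd) : bool :=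
 match c with
 | Rew | Nxt _ _ _ _ | Emt _ _ _ _ => true
 | Sq c1 c2 | Ite _ _ c1 c2 => sio c1 || sio c2
 | Whl _ _ c => sio c
 | _ => false
 end.

(** Read off the syntax of c. Since [run_call] delivers the frame with every call, specifications
    only have to list what changes. *)
Record frame (c : cmd) (s s' : st) : Prop := Frame {
 fr_r : forall r, r \notin modr c -> rg s' r = rg s r;
 fr_a : forall k, k \notin moda c -> ar s' k = ar s k;
 fr_s : ~~ sio c -> [/\ rs s' = rs s, ps s' = ps s & ot s' = ot s];
 fr_c : clk s <= clk s' }.

Section Run.
Variables (Lm M0 : nat) (es : seq (nat * nat * nat)).
Notation aexec := (aexec Lm M0 es).
Notation ok := (ok Lm).

Lemma aexec_frame c s s' : aexec c s s' -> frame c s s'.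
Proof.
have cat_n (x : nat) (l1 l2 : seq nat) : x \notin l1 ++ l2 -> x \notin l1 /\ x \notin l2.
 by rewrite mem_cat negb_or => /andP.
elim=> {c s s'}.
- by move=> r e s _ _; split=> //= q; rewrite inE; case: eqP.
- by move=> k e1 e2 s _ _ _ _; split=> //= q; rewrite inE; case: eqP.
- move=> c1 c2 s1 s2 s3 _ [a1 b1 d1 e1] _ [a2 b2 d2 e2]; split=> /=.
 + by move=> r /cat_n[h1 h2]; rewrite a2 // a1.
 + by move=> r /cat_n[h1 h2]; rewrite b2 // b1.
 + by rewrite negb_or => /andP[h1 h2]; have [-> -> ->] := d2 h2; exact: d1.
 + exact: leq_trans e2.
- move=> e1 e2 c1 c2 s s' _ _ _ _ [a1 b1 d1 h1]; split=> /=.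
 + by move=> r /cat_n[]; auto.
 + by move=> r /cat_n[]; auto.
 + by rewrite negb_or => /andP[]; auto.
 + by apply: leq_trans h1.
- move=> e1 e2 c1 c2 s s' _ _ _ _ [a1 b1 d1 h1]; split=> /=.
 + by move=> r /cat_n[]; auto.
 + by move=> r /cat_n[]; auto.
 + by rewrite negb_or => /andP[]; auto.
 + by apply: leq_trans h1.
- move=> e1 e2 c s s1 s2 _ _ _ _ [a1 b1 d1 h1] _ [a2 b2 d2 h2]; split=> /=.
 + by move=> r h; rewrite a2 // a1.
 + by move=> r h; rewrite b2 // b1.
 + by move=> h; have [-> -> ->] := d2 h; exact: d1.
 + by apply: leq_trans h2; apply: leq_trans h1.
- by move=> e1 e2 c s _ _ _; split.
- by move=> s; split.
- by move=> f x y z s _; split=> //= q; rewrite !inE !negb_or => /and4P[] /negPf->.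
- move=> f x y z i j w l s _; split=> //= q; rewrite !inE !negb_or.
 by move=> /and4P[] /negPf-> /negPf-> /negPf-> /negPf->.
- by move=> x y z u s; split.
Qed.

Definition run c s (Q : st -> Prop) := exists2 s', aexec c s s' & Q s'.

Lemma run_frame c s Q : run c s Q -> run c s (fun s' => Q s' /\ frame c s s').
Proof. by case=> s' x q; exists s' => //; split=> //; exact: aexec_frame. Qed.

Lemma run_call c s (Q Q' : st -> Prop) : run c s Q ->
 (forall s', Q s' -> frame c s s' -> Q' s') -> run c s Q'.
Proof. by move=> /run_frame[s' x [q fr]] h; exists s' => //; exact: h. Qed.

Lemma run_sq c1 c2 s Q : run c1 s (fun s1 => run c2 s1 Q) -> run (Sq c1 c2) s Q.
Proof. by case=> s1 x [s2 y q]; exists s2 => //; exact: XSeq x y. Qed.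

Lemma run_asg r e s (Q : st -> Prop) : ok e s -> ev e s <= M0 -> Q (setr r (ev e s) s) ->
 run (Asg r e) s Q.
Proof. by move=> o h q; exists (setr r (ev e s) s) => //; exact: XAsg. Qed.

Lemma run_put k e1 e2 s (Q : st -> Prop) : ok e1 s -> ok e2 s -> ev e1 s < Lm ->
 ev e2 s <= M0 -> Q (seta k (ev e1 s) (ev e2 s) s) -> run (Put k e1 e2) s Q.
Proof. by move=> *; eexists; [exact: XPut|]. Qed.

Lemma run_ite e1 e2 c1 c2 s Q : ok e1 s -> ok e2 s ->
 (ev e1 s <= ev e2 s -> run c1 (tick s) Q) ->
 (ev e2 s < ev e1 s -> run c2 (tick s) Q) -> run (Ite e1 e2 c1 c2) s Q.
Proof.
move=> o1 o2 h1 h2; case: (leqP (ev e1 s) (ev e2 s)) => h.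
 by have [s' x q] := h1 h; exists s' => //; exact: XIteT.
by have [s' x q] := h2 h; exists s' => //; exact: XIteF.
Qed.

Lemma run_whl (I : st -> Prop) (mu : st -> nat) e1 e2 c s (Q : st -> Prop) : I s ->
 (forall s, I s -> [/\ ok e1 s, ok e2 s,
   ev e1 s <= ev e2 s -> run c (tick s) (fun s' => I s' /\ mu s' < mu s)
   & ev e2 s < ev e1 s -> Q (tick s)]) ->
 run (Whl e1 e2 c) s Q.
Proof.
move=> Is h; have [j] := ubnP (mu s); elim: j s Is => // j IH s Is hj.
have [o1 o2 h1 h2] := h s Is; case: (leqP (ev e1 s) (ev e2 s)) => hc.
 have [s1 x1 [I1 m1]] := h1 hc.
 have [|s2 x2 q2] := IH s1 I1; first by lia.
 by exists s2 => //; exact: XWhlT x2.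
by exists (tick s); [exact: XWhlF|exact: h2].
Qed.

Definition For r e c :=
 Sq (Asg r (K 0)) (Whl (B Plus (V r) (K 1)) e (Sq c (Asg r (B Plus (V r) (K 1))))).

(** The invariant is indexed by the counter and asked of the state in which the counter already has
    its new value, hence [setr r k.+1 s']. The bound e is evaluated at every turn, so the invariant
    has to determine its value N. *)
Lemma run_for (I : nat -> st -> Prop) N r e c s (Q : st -> Prop) :
 r \notin modr c -> N <= M0 ->
 (forall k s, I k s -> rg s r = k -> ok e s /\ ev e s = N) ->
 I 0 (setr r 0 s) ->
 (forall k s, k < N -> I k s -> rg s r = k ->
   run c (tick s) (fun s' => I k.+1 (setr r k.+1 s'))) ->
 (forall s, I N s -> rg s r = N -> Q (tick s)) ->
 run (For r e c) s Q.
Proof.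
move=> nr NM he I0 hI hQ; apply: run_sq; apply: run_asg => //=.
apply: (@run_whl (fun s => [/\ I (rg s r) s & rg s r <= N]) (fun s => N - rg s r)).
 by rewrite /= eqxx.
move=> s1 [I1 le1]; have [o1 e1] := he _ _ I1 erefl; split=> //=.
- rewrite e1 addn1 => lt; apply: run_sq; apply: (run_call (hI _ _ lt I1 erefl)) => s2 I2 fr.
 have er : rg s2 r = rg s1 r by rewrite (fr_r fr).
 apply: run_asg => //=; first by rewrite er; lia.
 by rewrite er eqxx addn1; split=> //; lia.
- by rewrite e1 addn1 ltnS => ge; have eN : rg s1 r = N by [lia]; apply: hQ; rewrite -?eN.
Qed.

End Run.

(** Register 99 is a scratch target that no program reads. *)
Definition skip := Asg 99 (K 0).

Declare Scope al_scope.
Delimit Scope al_scope with al.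
Bind Scope al_scope with ex.
Notation "x + y" := (B Plus x y) : al_scope.
Notation "x - y" := (B Minus x y) : al_scope.
Notation "x * y" := (B Times x y) : al_scope.
Notation "x %/ y" := (B Quot x y) : al_scope.
(** A bare number in a program is therefore a register; constants carry a [#]. *)
Coercion V : nat >-> ex.
Notation "k `[ e ]" := (A k e%al) (at level 2, e at level 200, format "k `[ e ]").
Notation "r <~ e" := (Asg r e%al) (at level 70).
Notation "k ~[ i ] <~ e" := (Put k i%al e%al) (at level 70, i at level 200).
Notation "c ;; d" := (Sq c d) (at level 80, right associativity).
Notation "'IF' a <=: b 'THEN' c 'ELSE' d" := (Ite a%al b%al c d) (at level 75, a at level 60, b at level 60, c at level 79, d at level 75).
Notation "'WHEN' a <=: b 'DO' c" := (Ite a%al b%al c skip) (at level 75, a at level 60, b at level 60, c at level 79).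
Notation "'WHILE' a <=: b 'DO' c" := (Whl a%al b%al c) (at level 75, a at level 60, b at level 60, c at level 79).
Notation "'FOR' r 'TO' e 'DO' c" := (For r e%al c) (at level 75, e at level 60, c at level 79).
Notation "# k" := (K k) (at level 1, format "# k") : al_scope.

End HoareTh.

(** * Cut functions and local certificates that no small cut is odd *)

Module CutsTh.
Import Defs.
(* [lia] also decides boolean combinations of its hypotheses, which is slow when there are many. *)
Ltac nlia := repeat match goal with H : ?T |- _ => lazymatch T with
 | is_true (leq _ _) => fail | @eq nat _ _ => fail | nat => fail | _ => clear H end end; lia.

Section CutFun.
Variables (V I : finType) (t h : I -> V) (c : I -> nat) (T : V -> nat).

(** Capacity of the cut around A in the network in which each vertex x has an arc of capacity [T x]
    to a common sink outside A and each edge i has the undirected capacity [c i]. *)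
Definition cut (A : {set V}) : nat :=
 \sum_(x in A) T x + \sum_i ((t i \in A) (+) (h i \in A)) * c i.

Lemma cut_submod A B : cut (A :&: B) + cut (A :|: B) <= cut A + cut B.
Proof.
rewrite /cut !(big_mkcond (fun x => x \in _)) /= [X in X <= _]addnACA [X in _ <= X]addnACA.
rewrite -!big_split /= leq_add //; apply: leq_sum => i _; rewrite !inE.
 by case: (i \in A) (i \in B) => -[] /=; lia.
by do 4 (case: (_ \in _) => /=); lia.
Qed.

(** The crossing term is symmetric under complement and the sink term is nonnegative and additive;
    for submodular functions in general this inequality fails. *)
Lemma cut_posimod A B : cut (A :\: B) + cut (B :\: A) <= cut A + cut B.
Proof.
rewrite /cut !(big_mkcond (fun x => x \in _)) /= [X in X <= _]addnACA [X in _ <= X]addnACA.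
rewrite -!big_split /= leq_add //; apply: leq_sum => i _; rewrite !inE.
 by case: (i \in A) (i \in B) => -[] /=; lia.
by do 4 (case: (_ \in _) => /=); lia.
Qed.

End CutFun.

Section Parity.
Variables (V : finType) (b : V -> nat).
Definition par (A : {set V}) : bool := odd (\sum_(x in A) b x).

Lemma parID A B : par A = par (A :&: B) (+) par (A :\: B).
Proof. by rewrite /par (big_setID B) oddD. Qed.

Lemma parUI A B : par (A :|: B) (+) par (A :&: B) = par A (+) par B.
Proof.
rewrite (parID (A :|: B) A) setUK setDUl setDv set0U (parID B A) (setIC B A).
by do 3 case: (par _).
Qed.

Lemma par_neq0 A : par A -> exists p, p \in A.
Proof. by case: (set_0Vmem A) => [->|[p ?]]; [rewrite /par big_set0|exists p]. Qed.
End Parity.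

Section Sub.
Variables (V : finType) (f : {set V} -> nat).
Hypothesis sub : forall A B, f (A :&: B) + f (A :|: B) <= f A + f B.

Definition rin (r : option V) (A : {set V}) := if r is Some b then b \in A else false.
Definition sep (a : V) (r : option V) (A : {set V}) := (a \in A) && ~~ rin r A.
(** The minimal minimizer of f among the sets that contain a and avoid r, where [None] forbids
    nothing. It is contained in every other minimizer, and it is what a maximum flow exhibits as the
    set reachable from a. *)
Definition ismin a r M :=
 sep a r M /\ (forall A, sep a r A -> f M <= f A /\ (f A <= f M -> M \subset A)).

Lemma sepI a r A B p q : sep a r A -> sep p q B -> a \in B -> sep a r (A :&: B).
Proof.
rewrite /sep => /andP[h1 h2] _ h3; rewrite inE h1 h3 /=.
by case: r h2 => //= b; rewrite inE negb_and => ->.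
Qed.
Lemma sepU a r A B : sep a r A -> ~~ rin r B -> sep a r (A :|: B).
Proof.
rewrite /sep => /andP[h1 h2] h3; rewrite inE h1 /=.
by case: r h2 h3 => //= b; rewrite inE negb_or => -> ->.
Qed.

(** Minimize f first and cardinality second. If A is another minimizer, submodularity makes the
    intersection with A a minimizer too, and it cannot be smaller. *)
Lemma ex_ismin a r : r != Some a -> exists M, ismin a r M.
Proof.
move=> ra; have s1 : sep a r [set a].
 by rewrite /sep set11 /=; case: r ra => //= b; rewrite inE; apply: contra => /eqP ->.
pose w A := f A * #|V|.+1 + #|A|.
case: (arg_minnP w s1) => M sM mM; exists M; split=> // A sA.
have cV (B : {set V}) : #|B| <= #|V| by exact: max_card.
have le B : sep a r B -> f M <= f B.
 by move=> sB; have := mM B sB; rewrite /w; have := cV M; have := cV B; nia.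
split; [exact: le|move=> AM].
have sI : sep a r (M :&: A) by apply: (sepI sM sA); case/andP: sA.
have sU : sep a r (M :|: A) by apply: (sepU sM); case/andP: sA.
have eI : f (M :&: A) = f M by have := sub M A; have := le _ sI; have := le _ sU; nlia.
have := mM _ sI; rewrite /w eI leq_add2l => cI.
have /eqP <- : M :&: A == M by rewrite eqEcard subsetIl.
exact: subsetIr.
Qed.

(** The intersection of M and Y competes with M, and their union competes with Y. Submodularity then
    makes the intersection a minimizer for M, so M lies in it. *)
Lemma ismin_sub a r c q M Y : ismin a r M -> ismin c q Y -> a \in Y -> ~~ rin q M ->
 M \subset Y.
Proof.
move=> [sM mM] [sY mY] aY qM.
have [_ /(_ _)/subset_trans->//] := mM _ (sepI sM sY aY); last exact: subsetIr.
have := sub M Y; have [h _] := mY _ (sepU sY qM); rewrite setUC in h; nlia.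
Qed.

Variable b : V -> nat.
Notation par := (par b).
Variable th : nat.
Hypothesis pos : forall A B, f (A :\: B) + f (B :\: A) <= f A + f B.

(** Equivalence of vertices that no cut below the threshold separates. Closed sets are unions of
    classes; every set of value below [th] is closed. The parity arguments decompose closed sets,
    which is why closedness is carried along instead of cut values. *)
Definition eqv p q := [forall A : {set V}, (f A < th) ==> ((p \in A) == (q \in A))].
Definition closed (C : {set V}) := forall p q, p \in C -> eqv p q -> q \in C.

Lemma eqv_sym p q : eqv p q = eqv q p.
Proof. by apply: eq_forallb => A; rewrite eq_sym. Qed.
Lemma closed_lt A : f A < th -> closed A.
Proof. by move=> fA p q pA /forallP/(_ A); rewrite fA pA eq_sym => /eqP. Qed.
Lemma closedI A B : closed A -> closed B -> closed (A :&: B).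
Proof. by move=> a c p q; rewrite !inE => /andP[x y] e; rewrite (a p) // (c p). Qed.
Lemma closedD A B : closed A -> closed B -> closed (A :\: B).
Proof.
move=> a c p q; rewrite !inE => /andP[x y] e; rewrite (a p) // andbT.
by apply: contra x => x; rewrite (c q) // eqv_sym.
Qed.

Section Local.
Variables (X : {set V}).
Hypothesis even : forall a r M, a \in X -> (if r is Some d then d \in X else true) ->
 ismin a r M -> f M < th -> ~~ par M.

(** Y is minimum among all sets that separate c from r, whichever of the two they contain. This
    symmetric form is needed to apply posimodularity. *)
Definition glob c r Y := forall A : {set V}, (c \in A) != rin r A -> f Y <= f A.

(** Uncrossing as for Gomory-Hu trees. If N1 avoids r, submodularity nests it in Y. If N1 contains
    r, then [N1 :\: Y] separates c from r and costs at least f Y, so posimodularity gives that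
    [Y :\: N1] costs at most f N1, hence at most f N2, and N2 is nested in it. Either way a strictly
    smaller minimal minimizer inside Y separates p from q, and the induction hypothesis applies to
    it. *)
Lemma sep_step k (Y : {set V}) c r p q (N1 N2 : {set V}) :
 (forall (Y : {set V}) c r, #|Y| < k -> c \in X -> (if r is Some d then d \in X else true) ->
   ismin c r Y -> glob c r Y -> f Y < th -> Y \subset X ->
   forall C, closed C -> C \subset Y -> ~~ par C) ->
 #|Y| <= k -> ismin c r Y -> glob c r Y -> Y \subset X ->
 p \in Y -> q \in Y -> ~~ eqv p q ->
 ismin p (Some q) N1 -> ismin q (Some p) N2 -> f N1 <= f N2 ->
 exists M : {set V}, (p \in M) != (q \in M) /\ closed M /\ forall C, closed C -> C \subset M -> ~~ par C.
Proof.
move=> IH Yk mY gY YX pY qY npq m1 m2 le12.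
have [/andP[pN1 /= qN1] mm1] := m1; have [/andP[qN2 /= pN2] mm2] := m2.
have gl (A : {set V}) : (p \in A) != (q \in A) -> f N1 <= f A.
 case pA: (p \in A); case qA: (q \in A) => // _.
  by case: (mm1 A); rewrite /sep /= ?pA ?qA.
 by case: (mm2 A); rewrite /sep /= ?pA ?qA //; nlia.
have [A0 lt0 s0] : exists2 A : {set V}, f A < th & (p \in A) != (q \in A).
 by move: npq; rewrite negb_forall => /existsP[A]; rewrite negb_imply => /andP[? ?]; exists A.
have N1t : f N1 < th by apply: leq_ltn_trans lt0; exact: gl.
have pX := subsetP YX p pY; have qX := subsetP YX q qY.
case rN: (rin r N1).
 case: r rN mY gY => [d|] //= dN [/andP[cY /= dY] mmY] gY.
 have h1 : f Y <= f (N1 :\: Y) by apply: gY; rewrite /= !inE cY dN (negPf dY).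
 have h2 : f N2 <= f (Y :\: N1) by case: (mm2 (Y :\: N1)); rewrite // /sep /= !inE qY qN1 pN1.
 have h3 := pos N1 Y.
 have [|_ sN2] := mm2 (Y :\: N1); first by rewrite /sep /= !inE qY qN1 pN1.
 have {}sN2 : N2 \subset Y :\: N1 by apply: sN2; nlia.
 have N2Y : N2 \subset Y by apply: subset_trans sN2 (subsetDl _ _).
 have N2t : f N2 < th by nlia.
 exists N2; rewrite qN2 (negPf pN2); split=> //; split; first exact: closed_lt.
 apply: (IH _ q (Some p)) => //.
 - apply: leq_trans Yk; apply: proper_card; rewrite properE N2Y /=.
  by apply/subsetPn; exists p.
 - by move=> A h; apply: leq_trans (gl A _); [nlia|rewrite eq_sym].
 - exact: subset_trans YX.
have N1Y : N1 \subset Y by apply: ismin_sub m1 mY pY _; rewrite rN.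
exists N1; rewrite pN1 (negPf qN1); split=> //; split; first exact: closed_lt.
apply: (IH _ p (Some q)) => //; last exact: subset_trans YX.
apply: leq_trans Yk; apply: proper_card; rewrite properE N1Y /=.
by apply/subsetPn; exists q.
Qed.

(** Y itself is even by hypothesis, so an odd closed C inside Y would make [Y :\: C] a second odd
    closed set, disjoint from C; [two] excludes such a pair. *)
Lemma closed_even k (Y : {set V}) c r : #|Y| < k -> c \in X -> (if r is Some d then d \in X else true) ->
 ismin c r Y -> glob c r Y -> f Y < th -> Y \subset X ->
 forall C, closed C -> C \subset Y -> ~~ par C.
Proof.
elim: k Y c r => // k IH Y c r Yk cX rX mY gY Yt YX.
(* Points p of C and q of D are not equivalent, and [sep_step] supplies a set M between them all of
   whose closed subsets are even. Subtracting M from the one of C and D whose point lies in M keeps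
   that set odd and closed, and lowers the sum of cardinalities. *)
have two : forall j (C D : {set V}), #|C| + #|D| < j -> closed C -> closed D -> C \subset Y -> D \subset Y ->
  par C -> par D -> ~~ [disjoint C & D].
 elim=> // j IHj C D cj cC cD CY DY pC pD; apply/negP => dis.
 have [p pinC] := par_neq0 pC; have [q qD] := par_neq0 pD.
 have npq : ~~ eqv p q.
  by apply/negP => e; move: (disjointFr dis (cC _ _ pinC e)); rewrite qD.
 have pY := subsetP CY p pinC; have qY := subsetP DY q qD.
 have nqp : p != q by apply: contra npq => /eqP ->; apply/forallP => A; rewrite eqxx implybT.
 have [|N1 m1] := @ex_ismin p (Some q); first by apply: contra nqp => /eqP[->].
 have [|N2 m2] := @ex_ismin q (Some p); first by apply: contra nqp => /eqP[->].
 have [M [sM [cM eM]]] : exists M : {set V}, (p \in M) != (q \in M) /\ closed M /\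
   forall C, closed C -> C \subset M -> ~~ par C.
  case: (leqP (f N1) (f N2)) => [le|/ltnW le].
   exact: (sep_step IH _ mY gY YX pY qY npq m1 m2 le).
  rewrite eqv_sym in npq.
  have [M [h1 h2]] := sep_step IH (Yk : #|Y| <= k) mY gY YX qY pY npq m2 m1 le.
  by exists M; rewrite eq_sym.
 have eCM := eM _ (closedI cC cM) (subsetIr C M).
 have eDM := eM _ (closedI cD cM) (subsetIr D M).
 case pM: (p \in M) sM; case qM: (q \in M) => // _.
  have pC' : par (C :\: M) by move: pC; rewrite (parID b C M) (negPf eCM).
  have : [disjoint C :\: M & D] by apply: disjointWl dis; exact: subsetDl.
  apply/negP; apply: IHj => //; [|exact: closedD|by apply: subset_trans CY; exact: subsetDl].
  have : #|C :\: M| < #|C|; last by nlia.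
  apply: proper_card; rewrite properE subsetDl /=; apply/subsetPn; exists p => //.
  by rewrite inE pM.
 have pD' : par (D :\: M) by move: pD; rewrite (parID b D M) (negPf eDM).
 have : [disjoint C & D :\: M] by apply: disjointWr dis; exact: subsetDl.
 apply/negP; apply: IHj => //; [|exact: closedD|by apply: subset_trans DY; exact: subsetDl].
 have : #|D :\: M| < #|D|; last by nlia.
 apply: proper_card; rewrite properE subsetDl /=; apply/subsetPn; exists q => //.
 by rewrite inE qM.
move=> C cC CY; apply/negP => pC.
have eY : ~~ par Y by apply: even mY Yt.
have pD : par (Y :\: C) by move: eY; rewrite (parID b Y C) (setIidPr CY) pC; case: (par _).
have cY := closed_lt Yt.
have := two _ C (Y :\: C) (ltnSn _) cC (closedD cY cC) CY (subsetDl _ _) pC pD.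
by rewrite -setI_eq0 setDE setICA setICr setI0 eqxx.
Qed.

(** Peel an odd closed C inside A: the minimal minimizer Y of a point p of C lies in X, and costs
    less than the threshold because A contains p. The part of C in Y is even by [closed_even], so
    the rest of C is odd and smaller. *)
Lemma local_even v : ismin v None X -> forall A : {set V}, A \subset X -> f A < th -> ~~ par A.
Proof.
move=> mX A AX At.
have main : forall j (C : {set V}), #|C| < j -> closed C -> C \subset A -> ~~ par C.
 elim=> // j IHj C Cj cC CA; apply/negP => pC.
 have [p pinC] := par_neq0 pC; have pA := subsetP CA p pinC; have pX := subsetP AX p pA.
 have [//|Y mY] := @ex_ismin p None.
 have [/andP[pY _] mmY] := mY.
 have YA : f Y <= f A by case: (mmY A); rewrite // /sep pA.
 have YX : Y \subset X by apply: ismin_sub mY mX pX _.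
 have gY : glob p None Y by move=> B; rewrite eqbF_neg negbK => pB; case: (mmY B); rewrite // /sep pB.
 have Yt : f Y < th by nlia.
 have cY := closed_lt Yt.
 have := @closed_even _ Y p None (ltnSn _) pX isT mY gY Yt YX _ (closedI cC cY) (subsetIr _ _) => e.
 have pD : par (C :\: Y) by move: pC; rewrite (parID b C Y) (negPf e).
 move: pD; apply/negP; apply: IHj; [|exact: closedD|by apply: subset_trans CA; exact: subsetDl].
 have : #|C :\: Y| < #|C|; last by nlia.
 apply: proper_card; rewrite properE subsetDl /=; apply/subsetPn; exists p => //.
 by rewrite inE pY.
exact: (main _ A (ltnSn _) (closed_lt At) (subxx _)).
Qed.

End Local.

(** What a search from v leaves behind: either v lies in no set below the threshold, or parity is
    settled for the subsets of the minimal minimizer of v only. Nothing is claimed about other sets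
    through v; combining the certificates is the task of [cert_even]. *)
Definition cert v := (forall A : {set V}, v \in A -> th <= f A) \/
 exists X : {set V}, ismin v None X /\ forall A : {set V}, A \subset X -> f A < th -> ~~ par A.

(** Take a counterexample U with f minimal and then cardinality maximal. For v in U let M be the
    minimal minimizer of v. Both M and its intersection with U are even by the certificate, so the
    union with U is odd; it costs no more than U, and maximality of U gives that M is contained in
    U. Removing such sets one by one exhausts U by even pieces. *)
Lemma cert_even : (forall v, cert v) -> forall A : {set V}, f A < th -> ~~ par A.
Proof.
move=> ce A0 A0t; apply/negP => pA0.
pose P A := (f A < th) && par A; have P0 : P A0 by rewrite /P A0t.
pose w A := f A * #|V|.+1 + (#|V| - #|A|).
case: (arg_minnP w P0) => U /andP[Ut pU] mU.
have cV (B : {set V}) : #|B| <= #|V| by exact: max_card.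
have mf v : exists M, ismin v None M by apply: ex_ismin.
have key v M : v \in U -> ismin v None M -> ~~ par M /\ M \subset U.
 move=> vU mM; have [/andP[vM _] mm] := mM.
 have h1 : f M <= f (M :&: U) by case: (mm (M :&: U)); rewrite // /sep inE vM vU.
 have h2 : f M <= f (M :|: U) by case: (mm (M :|: U)); rewrite // /sep inE vM.
 have h3 := sub M U.
 have MU : f M <= f U by case: (mm U); rewrite // /sep vU.
 have [nX|[X [mX eX]]] := ce v; first by have := nX U vU; nlia.
 have [/andP[vX _] _] := mX.
 have MX : M \subset X by apply: ismin_sub mM mX vX _.
 have e1 : ~~ par (M :&: U) by apply: eX; [apply: subset_trans MX; exact: subsetIl|nlia].
 have e2 : ~~ par M by apply: eX => //; nlia.
 split=> //.
 have pMU : par (M :|: U) by have := parUI b M U; rewrite (negPf e1) (negPf e2) pU addbF.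
 have := mU (M :|: U); rewrite /P pMU andbT => /(_ _) hh.
 have {}hh : w U <= w (M :|: U) by apply: hh; nlia.
 have cU : #|M :|: U| <= #|U|.
  have fl : f (M :|: U) <= f U by nlia.
  have := leq_trans hh (leq_add (leq_mul fl (leqnn _)) (leqnn _)).
  by rewrite leq_add2l; have := cV U; have := cV (M :|: U); nlia.
 have /eqP -> : U == M :|: U by rewrite eqEcard subsetUr.
 exact: subsetUl.
pose cl (C : {set V}) := forall v M, v \in C -> ismin v None M -> M \subset C.
have main : forall j (C : {set V}), #|C| < j -> C \subset U -> cl C -> ~~ par C.
 elim=> // j IHj C Cj CU cC; apply/negP => pC.
 have [p pinC] := par_neq0 pC.
 have exP : exists n, [exists v, exists M : {set V}, [&& v \in C, #|M| == n,
   M \subset C & [forall A : {set V}, (v \in A) ==> ((f M <= f A) && ((f A <= f M) ==> (M \subset A)))] && (v \in M)]].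
  have [M mM] := mf p; have [/andP[pM _] mm] := mM; exists #|M|; apply/existsP; exists p; apply/existsP; exists M.
  rewrite pinC eqxx (cC p M) // pM /= andbT; apply/forallP => A; apply/implyP => pA.
  have [|h1 h2] := mm A; first by rewrite /sep pA.
  by rewrite h1; apply/implyP.
 have ub n : [exists v, exists M : {set V}, [&& v \in C, #|M| == n,
   M \subset C & [forall A : {set V}, (v \in A) ==> ((f M <= f A) && ((f A <= f M) ==> (M \subset A)))] && (v \in M)]] -> n <= #|V|.
  by case/existsP=> v /existsP[M /and4P[_ /eqP <- _ _]].
 (* A largest minimal minimizer of a point of C is removed. If u remains and its minimal minimizer N
    contained v, then N would properly contain M; so v is not in N, and posimodularity shows that N
    avoids M. Hence the rest is again closed under taking minimal minimizers. *)
 case: (ex_maxnP exP ub) => n /existsP[v /existsP[M /and4P[vC /eqP cM MC /andP[/forallP mm vM]]]] mx.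
 have mM : ismin v None M.
  split=> [|A]; rewrite /sep ?vM // andbT => vA; have := mm A; rewrite vA => /andP[? /implyP ?]; split=> //.
 have eM : ~~ par M by apply: (proj1 (key v M _ mM)); exact: (subsetP CU).
 have pD : par (C :\: M) by move: pC; rewrite (parID b C M) (setIidPr MC) (negPf eM).
 move: pD; apply/negP; apply: IHj.
 - have : #|C :\: M| < #|C|; last by nlia.
  apply: proper_card; rewrite properE subsetDl /=; apply/subsetPn; exists v => //.
  by rewrite inE vM.
 - by apply: subset_trans CU; exact: subsetDl.
 move=> u N; rewrite inE => /andP[uM uC] mN.
 have NC := cC _ _ uC mN; have [/andP[uN _] mmN] := mN; have [_ mmM] := mM.
 have vN : v \notin N.
  apply/negP => vN; have MN : M \subset N by apply: ismin_sub mM mN vN _.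
  have lt : #|M| < #|N| by apply: proper_card; rewrite properE MN /=; apply/subsetPn; exists u.
  suff : #|N| <= n by rewrite -cM leqNgt lt.
  apply: mx; apply/existsP; exists u; apply/existsP; exists N; rewrite uC eqxx NC uN /= andbT.
  apply/forallP => A; apply/implyP => pA.
  have [|h1 h2] := mmN A; first by rewrite /sep pA.
  by rewrite h1; apply/implyP.
 rewrite subsetD NC /=.
 have [|h1 h1'] := mmM (M :\: N); first by rewrite /sep inE vN vM.
 have [|h2 h2'] := mmN (N :\: M); first by rewrite /sep inE uN uM.
 have h3 := pos M N.
 have s : N \subset N :\: M by apply: h2'; nlia.
 by move: s; rewrite subsetD => /andP[_].
have clU : cl U by move=> v M vU mM; case: (key v M vU mM).
by move: pU; apply/negP; exact: (main _ U (ltnSn _) (subxx _) clU).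
Qed.

End Sub.

Section Mono.
Variables (V : finType) (b : V -> nat) (th : nat) (f f' g : {set V} -> nat).
Hypothesis sub : forall A B, f (A :&: B) + f (A :|: B) <= f A + f B.
Hypothesis sub' : forall A B, f' (A :&: B) + f' (A :|: B) <= f' A + f' B.
Hypothesis fg : forall A, f' A = f A + g A.
Hypothesis gm : forall A B : {set V}, A \subset B -> g A <= g B.

(** Adding a monotone function favours smaller sets: the minimal minimizer for f' is contained in
    the one for f, because intersecting with X lowers both f and g. The sets to be controlled only
    become fewer, so the old certificate still covers them. *)
Lemma cert_mono v : cert f b th v -> cert f' b th v.
Proof.
case=> [h|[X [mX eX]]]; first by left=> A vA; rewrite fg; have := h A vA; nlia.
right; have [//|M mM] := @ex_ismin V f' sub' v None; exists M; split=> // A AM At.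
apply: eX; last by move: At; rewrite fg; nlia.
apply: subset_trans AM _.
have [/andP[vX _] mmX] := mX; have [/andP[vM _] mmM] := mM.
have [|_ hh] := mmM (M :&: X); first by rewrite /sep inE vM vX.
apply: subset_trans (hh _) (subsetIr _ _).
have [|h1 _] := mmX (M :|: X); first by rewrite /sep inE vX orbT.
have := sub M X; have := gm (subsetIl M X); rewrite !fg; nlia.
Qed.
End Mono.

End CutsTh.

(** * Programs of the inner packing loop *)

Module InnerCodeTh.
Import Defs MachineTh HoareTh.
Notation vn := 1 (only parsing). Notation vE := 2 (only parsing).
Notation vN := 3 (only parsing). Notation vQ := 4 (only parsing).
Notation vD := 5 (only parsing). Notation vF := 6 (only parsing).
Notation vFy := 7 (only parsing). Notation vY0 := 8 (only parsing).
Notation vRM := 10 (only parsing). Notation vme := 11 (only parsing).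
Notation vcnt := 12 (only parsing).
Notation aCAP := 3 (only parsing). Notation aX := 4 (only parsing).
Notation aDG := 5 (only parsing). Notation aSL := 6 (only parsing).
Notation aHD := 7 (only parsing). Notation aER := 8 (only parsing).
Notation aEP := 9 (only parsing). Notation aEY := 10 (only parsing).
Notation aEB := 11 (only parsing). Notation aRC := 12 (only parsing).
Notation aT := 13 (only parsing). Notation aVIS := 14 (only parsing).
Notation aPAR := 15 (only parsing). Notation aQUE := 16 (only parsing).
Notation aTL := 17 (only parsing). Notation aXL := 18 (only parsing).
Notation aBL := 19 (only parsing). Notation aLD := 20 (only parsing).
Notation aLT := 21 (only parsing). Notation aLI := 22 (only parsing).
Notation aLJ := 23 (only parsing). Notation aLW := 24 (only parsing).
Notation aLU := 25 (only parsing). Notation aLH := 26 (only parsing).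
Notation bLT := 27 (only parsing). Notation bLI := 28 (only parsing).
Notation bLJ := 29 (only parsing). Notation bLW := 30 (only parsing).
Notation bLU := 31 (only parsing). Notation bLH := 32 (only parsing).
Notation aUL := 33 (only parsing).

Notation vS := 30 (only parsing). Notation vT := 31 (only parsing).
Notation fF := 32 (only parsing). Notation go2 := 33 (only parsing).
Notation qh := 34 (only parsing). Notation cn := 35 (only parsing).
Notation nf := 36 (only parsing). Notation fw := 37 (only parsing).
Notation rx := 38 (only parsing). Notation rk := 39 (only parsing).
Notation ra := 40 (only parsing). Notation ry := 41 (only parsing).
Notation tl := 42 (only parsing). Notation ru := 43 (only parsing).
Notation uk := 44 (only parsing). Notation ua := 45 (only parsing).
Notation uc := 46 (only parsing). Notation us := 47 (only parsing).
Notation k2 := 48 (only parsing). Notation fv := 50 (only parsing).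
Notation kx := 51 (only parsing). Notation ia := 52 (only parsing).
Notation ib := 53 (only parsing). Notation fnd := 54 (only parsing).
Notation vpar := 55 (only parsing). Notation ip := 56 (only parsing).
Notation kb := 57 (only parsing). Notation am := 58 (only parsing).
Notation bi := 59 (only parsing). Notation be := 60 (only parsing).
Notation bu := 61 (only parsing). Notation ku := 62 (only parsing).
Notation sv := 64 (only parsing). Notation sL := 65 (only parsing).
Notation sk := 66 (only parsing). Notation lv := 67 (only parsing).
Notation ie := 68 (only parsing). Notation iv := 69 (only parsing).
Notation go3 := 70 (only parsing).

(* Arcs 2e and 2e+1 are the two directions of edge e. *)
Notation rev_ a := (a + #1 - #2 * (a - #2 * (a %/ #2)))%al.
Notation half_ a := (a %/ #2)%al.
Notation odd_ a := (a - #2 * (a %/ #2))%al.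

(** Loads enter the flow network in units of Fy/Q, rounded down, with the same residual capacity in
    both directions. The sink capacity of a vertex is (Q+1) times its capacity minus its rounded
    load; the additional copy of the capacity is what keeps the searches local. *)
Definition RESET : cmd :=
 us <~ #0 ;;
 FOR uk TO aDG`[ru] DO (
  ua <~ aSL`[ru * vD + uk] ;;
  uc <~ aEY`[half_ ua] * vQ %/ vFy ;;
  aRC~[ua] <~ uc ;;
  aRC~[rev_ ua] <~ uc ;;
  us <~ us + uc ) ;;
 aT~[ru] <~ (vQ + #1) * aCAP`[ru] - us.

Definition SCAN : cmd :=
 ra <~ aSL`[rx * vD + rk] ;;
 ry <~ aHD`[ra] ;;
 WHEN #1 <=: (aRC`[ra] * nf) DO (
  WHEN (aVIS`[ry]) <=: #0 DO (
   cn <~ cn + #1 ;;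
   aVIS~[ry] <~ cn ;;
   aPAR~[ry] <~ ra ;;
   aQUE~[cn - #1] <~ ry ;;
   WHEN #1 <=: (aT`[ry]) DO (nf <~ #0 ;; fw <~ ry))).

(** [nf] is 1 until a vertex [fw] with positive sink capacity is met; as a factor of the loop bound
    it ends the search at that moment. [aVIS] holds the queue position plus one, and 0 for unvisited
    vertices. *)
Definition BFS : cmd :=
 aQUE~[#0] <~ vS ;; aVIS~[vS] <~ #1 ;; cn <~ #1 ;; qh <~ #0 ;; nf <~ #1 ;; fw <~ vS ;;
 (WHEN #1 <=: (aT`[vS]) DO nf <~ #0) ;;
 WHILE (qh + #1) <=: (cn * nf) DO (
  rx <~ aQUE`[qh] ;; qh <~ qh + #1 ;;
  FOR rk TO aDG`[rx] DO SCAN).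

Definition PUSH : cmd :=
 ry <~ fw ;;
 aT~[ry] <~ aT`[ry] - #1 ;;
 WHILE #2 <=: (aVIS`[ry]) DO (
  ra <~ aPAR`[ry] ;;
  aRC~[ra] <~ aRC`[ra] - #1 ;;
  aRC~[rev_ ra] <~ aRC`[rev_ ra] + #1 ;;
  ry <~ aHD`[rev_ ra]).

Definition CLR : cmd :=
 FOR rk TO cn DO (
  ry <~ aQUE`[rk] ;; aVIS~[ry] <~ #0 ;; aTL~[tl] <~ ry ;; tl <~ tl + #1).

(** Raising the sink capacity of [vT] by Q makes every set containing [vT] cost at least Q. For
    values below Q, minimizing over the sets through [vS] is thus the same as minimizing over those
    that also avoid [vT], and Q augmentations decide whether the minimum is below Q. *)
Definition FLOW : cmd :=
 aT~[vT] <~ aT`[vT] + vQ ;; fF <~ #0 ;; tl <~ #0 ;; go2 <~ #1 ;;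
 WHILE #1 <=: go2 DO (
  BFS ;;
  IF nf <=: #0 THEN (
   PUSH ;; CLR ;; fF <~ fF + #1 ;; WHEN vQ <=: fF DO go2 <~ #0)
  ELSE go2 <~ #0).

(** Only the vertices recorded in [aTL] and [vT] itself are reset, so undoing a flow costs as little
    as computing it and does not depend on n. *)
Definition CLEAN : cmd :=
 (FOR rk TO cn DO aVIS~[aQUE`[rk]] <~ #0) ;;
 (FOR k2 TO tl DO (ru <~ aTL`[k2] ;; RESET)) ;;
 ru <~ vT ;; RESET.

(** Vertex n is a dummy without edges; avoiding it is no restriction. The first flow finds the
    minimal minimizer X of [fv]; the double loop tests the parity of the minimal minimizers for all
    pairs from X, the dummy being appended to X as a second end. If the first flow reaches Q, [kx]
    is 0 and no pair is tested. *)
Definition FIND : cmd :=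
 fnd <~ #0 ;; vS <~ fv ;; vT <~ vn ;; FLOW ;; kx <~ #0 ;;
 (IF vQ <=: fF THEN skip
  ELSE ((FOR ip TO cn DO aXL~[ip] <~ aQUE`[ip]) ;; kx <~ cn)) ;;
 CLEAN ;; aXL~[kx] <~ vn ;;
 FOR ia TO kx DO
  FOR ib TO (kx + #1) DO
   WHEN fnd <=: #0 DO (
    vS <~ aXL`[ia] ;; vT <~ aXL`[ib] ;; FLOW ;;
    (IF vQ <=: fF THEN skip
     ELSE (
      vpar <~ #0 ;;
      (FOR ip TO cn DO vpar <~ vpar + aCAP`[aQUE`[ip]]) ;;
      WHEN #1 <=: (odd_ vpar) DO (
       fnd <~ #1 ;; ku <~ cn ;;
       FOR ip TO cn DO aUL~[ip] <~ aQUE`[ip]))) ;;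
    CLEAN).

(** Each load of at least Y0 in the list loses the fraction eps am / er, rounded up, where [am] is
    the least reduced weight among these loads. The weighted loss er_e y_e is then proportional to
    y_e alone, and the edge attaining the minimum loses the full fraction eps. Smaller loads are
    spared because rounding would be too coarse for them. *)
Definition BUMP : cmd :=
 am <~ vRM ;;
 (FOR bi TO kb DO (
   be <~ aBL`[bi] ;;
   WHEN vY0 <=: (aEY`[be]) DO
    WHEN (aER`[be]) <=: am DO am <~ aER`[be])) ;;
 FOR bi TO kb DO (
   be <~ aBL`[bi] ;;
   WHEN vY0 <=: (aEY`[be]) DO
    aEY~[be] <~ aEY`[be] - (aEY`[be] * am + vE * aER`[be] - #1) %/ (vE * aER`[be])).

Definition BUMPSET : cmd :=
 (FOR bu TO ku DO aVIS~[aUL`[bu]] <~ #1) ;;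
 kb <~ #0 ;;
 (FOR bu TO ku DO (
   rx <~ aUL`[bu] ;;
   FOR rk TO aDG`[rx] DO (
    ra <~ aSL`[rx * vD + rk] ;;
    WHEN #1 <=: (aVIS`[aHD`[ra]]) DO
     WHEN (odd_ ra) <=: #0 DO (aBL~[kb] <~ half_ ra ;; kb <~ kb + #1)))) ;;
 BUMP ;;
 (FOR bu TO ku DO aVIS~[aUL`[bu]] <~ #0) ;;
 FOR bu TO ku DO (ru <~ aUL`[bu] ;; RESET).

Definition FINDBUMP : cmd :=
 go3 <~ #1 ;;
 WHILE #1 <=: go3 DO (
  FIND ;; IF fnd <=: #0 THEN go3 <~ #0 ELSE BUMPSET).

Definition LOAD : cmd :=
 sL <~ #0 ;;
 FOR sk TO aDG`[sv] DO sL <~ sL + aEY`[half_ aSL`[sv * vD + sk]].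

Definition STAR : cmd :=
 LOAD ;;
 WHILE (aCAP`[sv] * vFy + #1) <=: sL DO (
  (FOR sk TO aDG`[sv] DO aBL~[sk] <~ half_ aSL`[sv * vD + sk]) ;;
  kb <~ aDG`[sv] ;; BUMP ;; LOAD).

(** The vertex constraints are repaired before the odd sets, because the sink capacities need loads
    within the vertex capacities; repairs only lower loads, so they stay within. [aEB] sums the
    repaired loads over the levels, so that dividing by N yields an average of nearly feasible
    vectors. *)
Definition INNER : cmd :=
 FOR lv TO vN DO (
  (FOR ie TO vme DO aEY~[ie] <~ aEY`[ie] + aEY`[ie] %/ vE) ;;
  (FOR iv TO vn DO (sv <~ iv ;; STAR)) ;;
  (FOR iv TO (vn + #1) DO (ru <~ iv ;; RESET)) ;;
  (FOR iv TO vn DO (fv <~ iv ;; FINDBUMP)) ;;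
  FOR ie TO vme DO aEB~[ie] <~ aEB`[ie] + aEY`[ie]).

Definition rva a := if odd a then a.-1 else a.+1.
Lemma ev_rev a : a + 1 - 2 * (a - 2 * (a %/ 2)) = rva a.
Proof.
rewrite /rva; have := odd_double_half a; rewrite divn2.
by case: (odd a) => /=; lia.
Qed.
Lemma ev_odd a : a - 2 * (a %/ 2) = odd a.
Proof. by have := odd_double_half a; rewrite divn2; lia. Qed.
Lemma rvaK a : rva (rva a) = a.
Proof.
rewrite /rva; case h: (odd a); last by rewrite /= h.
by case: a h => //= a /negbTE ->.
Qed.
Lemma rva_half a : (rva a)./2 = a./2.
Proof. by have := odd_double_half a; rewrite /rva; case: ifP => h; lia. Qed.
Lemma rva_lt a m : a < m.*2 -> rva a < m.*2.
Proof. by have := odd_double_half a; rewrite /rva; case: ifP => h; lia. Qed.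
Lemma rva_neq a : rva a != a.
Proof. by rewrite /rva; case: ifP; case: a => //= *; lia. Qed.

End InnerCodeTh.

(** * The stored graph and the initial state of its flow network *)

Module ResetTh.
Import Defs MachineTh HoareTh InnerCodeTh.
Ltac nlia := repeat match goal with H : ?T |- _ => lazymatch T with
 | is_true (leq _ _) => fail | is_true (leq _ _ && leq _ _) => fail | @eq nat _ _ => fail
 | ~ (@eq nat _ _) => fail | nat => fail | _ => clear H end end; lia.

Section Graph.
Variables (Lm M0 : nat) (es : seq (nat * nat * nat)).
Variables (n E Q D Fy Y0 RM me : nat) (hd sl dg cap er : nat -> nat).
Notation run := (run Lm M0 es).

Definition outs x := [seq a <- iota 0 me.*2 | hd (rva a) == x].

Record stat (s : st) : Prop := Stat {
 s_n : rg s 1 = n; s_E : rg s 2 = E; s_Q : rg s 4 = Q; s_D : rg s 5 = D; s_Fy : rg s 7 = Fy;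
 s_Y0 : rg s 8 = Y0; s_RM : rg s 10 = RM; s_me : rg s 11 = me;
 s_cap : ar s aCAP = cap; s_dg : ar s aDG = dg; s_sl : ar s aSL = sl;
 s_hd : ar s aHD = hd; s_er : ar s aER = er }.

Lemma stat_frame c s s' : frame c s s' ->
 all (fun r => r \notin modr c) [:: 1; 2; 4; 5; 7; 8; 10; 11] ->
 all (fun k => k \notin moda c) [:: 3; 5; 6; 7; 8] -> stat s -> stat s'.
Proof.
move=> fr /= /and5P[a1 a2 a3 a4 /and5P[a5 a6 a7 a8 _]] /and5P[b1 b2 b3 b4 /andP[b5 _]].
by case=> *; split; rewrite ?(fr_r fr) ?(fr_a fr).
Qed.

Record graph : Prop := Graph {
 g_hd : forall a, a < me.*2 -> hd a < n;
 g_out : forall x, x <= n -> [seq sl (x * D + k) | k <- iota 0 (dg x)] = outs x;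
 g_dg : forall x, x <= n -> dg x <= D;
 g_nl : forall a, a < me.*2 -> hd (rva a) != hd a;
 g_simple : forall a b, a < me.*2 -> b < me.*2 -> hd a = hd b -> hd (rva a) = hd (rva b) -> a = b;
 g_cap : forall a, a < me.*2 -> 1 <= cap (hd a) <= E;
 g_cap0 : cap n = 0;
 g_bcap : forall x, x <= n -> (Q + 1) * cap x + Q <= M0;
 g_D : n.+1 * D <= Lm; g_n : n < Lm; g_m : me.*2 <= Lm;
 g_M : Lm <= M0 }.
Hypothesis gr : graph.

Lemma outs_lt x a : a \in outs x -> a < me.*2.
Proof. by rewrite mem_filter mem_iota => /andP[]. Qed.
Lemma outs_tl x a : a \in outs x -> hd (rva a) = x.
Proof. by rewrite mem_filter => /andP[/eqP]. Qed.
Lemma mem_outs a : a < me.*2 -> a \in outs (hd (rva a)).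
Proof. by move=> h; rewrite mem_filter eqxx mem_iota. Qed.
Lemma size_outs x : x <= n -> size (outs x) = dg x.
Proof. by move=> h; rewrite -(g_out gr h) size_map size_iota. Qed.
Lemma slot x k : x <= n -> k < dg x -> sl (x * D + k) = nth 0 (outs x) k.
Proof.
by move=> h hk; rewrite -(g_out gr h) (nth_map 0) ?size_iota // nth_iota.
Qed.
Lemma slot_lt x k : x <= n -> k < dg x -> x * D + k < Lm.
Proof.
move=> h hk; apply: leq_trans (g_D gr); have := g_dg gr h; rewrite mulSn.
by have : x * D <= n * D by [rewrite leq_mul2r h orbT]; lia.
Qed.
Lemma slot_in x k : x <= n -> k < dg x -> sl (x * D + k) \in outs x.
Proof. by move=> h hk; rewrite slot // mem_nth // size_outs. Qed.
Lemma hd_le a : a < me.*2 -> hd a <= n.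
Proof. by move=> h; apply: ltnW; exact: (g_hd gr). Qed.

Definition yq (y : nat -> nat) e := y e * Q %/ Fy.
Definition T0 y x := (Q + 1) * cap x - \sum_(a <- outs x) yq y a./2.

Lemma reset_ok s y : stat s -> rg s ru <= n -> ar s aEY = y ->
 (forall e, e < me -> yq y e <= Q * E) -> D * (Q * E) <= M0 -> Q * E <= M0 ->
 run RESET s (fun s' => [/\ forall x, ar s' aT x = if x == rg s ru then T0 y x else ar s aT x,
   forall a, a < me.*2 -> ar s' aRC a = if (hd a == rg s ru) || (hd (rva a) == rg s ru)
    then yq y a./2 else ar s aRC a
   & clk s' <= clk s + (10 * D + 10)]).
Proof.
move=> Hs; set u := rg s ru => un ey yb DM QM.
have dgu := g_dg gr un; have gn := g_n gr; have gM := g_M gr; have gm := g_m gr.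
have DL : D <= Lm by apply: leq_trans (g_D gr); rewrite leq_pmull.
apply: run_sq; apply: run_asg => //=.
apply: run_sq.
apply: (@run_for _ _ _ (fun k s' => [/\ stat s', rg s' ru = u, ar s' aEY = y, ar s' aT = ar s aT &
  [/\ rg s' us = \sum_(a <- take k (outs u)) yq y a./2,
  forall a, a < me.*2 -> ar s' aRC a = if (a \in take k (outs u)) || (rva a \in take k (outs u))
    then yq y a./2 else ar s aRC a & clk s' <= clk s + (k * 10 + 5)]]) (dg u)) => //.
- lia.
- by move=> k s1 [S1 e1 _ _ _] _; rewrite /= e1 (s_dg S1); split=> //; split=> //; lia.
- by split=> //=; [case: Hs=> *; split|rewrite take0; split=> //; rewrite ?big_nil //; lia].
- move=> k s1 ku [S1 e1 ey1 t1 [u1 r1 c1]] ek.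
 have [a aE] : exists a, a = sl (u * D + k) by eexists.
 have ain : a \in outs u by rewrite aE slot_in.
 have alt := outs_lt ain; have hlt := rva_lt alt.
 have e2 : a./2 < me by lia.
 have tk : take k.+1 (outs u) = rcons (take k (outs u)) a.
  by rewrite (take_nth 0) ?size_outs // aE slot.
 have sb : \sum_(b <- take k (outs u)) yq y b./2 + yq y a./2 <= D * (Q * E).
  have <- : \sum_(b <- take k.+1 (outs u)) yq y b./2 = \sum_(b <- take k (outs u)) yq y b./2 + yq y a./2.
   by rewrite tk big_rcons.
  apply: leq_trans (_ : \sum_(b <- take k.+1 (outs u)) Q * E <= _).
   rewrite big_seq [X in _ <= X]big_seq; apply: leq_sum => b /mem_take /outs_lt bl.
   by apply: yb; lia.
  by rewrite big_const_seq count_predT iter_addn_0 mulnC leq_mul2r size_take size_outs //; case: ifP; lia.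
 apply: run_sq; apply: run_asg => /=.
 + by rewrite e1 (s_D S1) ek slot_lt.
 + by rewrite e1 (s_D S1) ek (s_sl S1) -aE; lia.
 rewrite e1 (s_D S1) ek (s_sl S1) -aE.
 apply: run_sq; apply: run_asg => /=; rewrite ?ey1 ?(s_Q S1) ?(s_Fy S1) divn2.
 + by split=> //; lia.
 + exact: leq_trans (yb _ e2) QM.
 rewrite -/(yq y a./2).
 apply: run_sq; apply: run_put => //=; [lia|exact: leq_trans (yb _ e2) QM|].
 apply: run_sq; apply: run_put => //=; [rewrite ev_rev; lia|exact: leq_trans (yb _ e2) QM|].
 rewrite ev_rev -/(yq y a./2).
 apply: run_asg => //=; rewrite u1 -/(yq y a./2); first exact: leq_trans sb DM.
 split=> //=; [by case: S1=> *; split|split; rewrite -?/(yq y a./2)].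
 + by rewrite tk big_rcons.
 + move=> b bl; rewrite tk !mem_rcons !inE r1 //.
  case: (b =P rva a) => [->|nb].
   by rewrite rvaK !eqxx /= ?orbT /= rva_half.
  case: (b =P a) => [->|nb'] //=.
  have -> // : (rva b == a) = false by apply/eqP => h; case: nb; rewrite -h rvaK.
 + lia.
move=> s1 [S1 e1 ey1 t1 [u1 r1 c1]] ek.
have ts : take (dg u) (outs u) = outs u by rewrite -size_outs // take_size.
apply: run_put => //=.
- by rewrite e1; do !split; lia.
- by rewrite e1; lia.
- rewrite (s_Q S1) (s_cap S1) e1; have := g_bcap gr un; lia.
split.
- by move=> x /=; rewrite e1 t1 (s_Q S1) (s_cap S1) u1 ts; case: eqP => [->|].
- move=> a al /=; rewrite r1 // ts !mem_filter rvaK !mem_iota /= al rva_lt // !andbT orbC.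
 by [].
- by move: c1 => /=; have : dg u * 10 <= 10 * D by [lia]; lia.
Qed.

End Graph.

End ResetTh.

(** * Breadth-first search in the residual network *)

Module SearchTh.
Import Defs MachineTh HoareTh InnerCodeTh ResetTh.
Section Flow.
Variables (Lm M0 : nat) (es : seq (nat * nat * nat)).
Variables (n E Q D Fy Y0 RM me : nat) (hd sl dg cap er : nat -> nat).
Notation run := (run Lm M0 es).
Notation outs := (outs me hd).
Notation stat := (stat n E Q D Fy Y0 RM me hd sl dg cap er).
Notation graph := (graph Lm M0 n E Q D me hd sl dg cap).
Hypothesis gr : graph.

Record queue (s : nat) (v q : nat -> nat) (c : nat) : Prop := Queue {
 q_c : 0 < c;
 q_n : forall i, i < c -> q i <= n /\ v (q i) = i.+1;
 q_v : forall x, x <= n -> v x = 0 \/ (v x <= c /\ q (v x).-1 = x);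
 q_s : q 0 = s }.

Lemma queue_le s v q c : queue s v q c -> c <= n.+1.
Proof.
move=> h; rewrite -(size_iota 0 c) -(size_map q) -(size_iota 0 n.+1).
apply: uniq_leq_size.
 rewrite map_inj_in_uniq ?iota_uniq // => i j; rewrite !mem_iota !add0n => hi hj e.
 by have [_ h1] := q_n h hi; have [_ h2] := q_n h hj; rewrite e h2 in h1; case: h1.
move=> x /mapP[i]; rewrite !mem_iota !add0n => hi ->.
by have [] := q_n h hi.
Qed.

Lemma queue_push s v q c y : queue s v q c -> y <= n -> v y = 0 ->
 queue s (updf v y c.+1) (updf q c y) c.+1.
Proof.
move=> [h1 h2 h3 h4] yn vy; split=> //=.
- move=> i; rewrite ltnS leq_eqVlt => /orP[/eqP->|hi]; first by rewrite !eqxx.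
 have [a b] := h2 i hi; have -> : (i == c) = false by lia.
 by split=> //; case: eqP => // e; rewrite e vy in b.
- move=> x xn; case: eqP => [->|nx]; first by right; rewrite /= eqxx.
 have [->|[a b]] := h3 x xn; [by left|right; split; first lia].
 have nz : v x != 0 by apply/eqP => z; rewrite z /= in b; have [_] := h2 0 h1; rewrite b z.
 by have -> : ((v x).-1 == c) = false by lia.
- by have -> : (0 == c) = false by lia.
Qed.

Section Bfs.
Variables (s0 : st) (s : nat).
Notation T := (ar s0 aT).
Notation R := (ar s0 aRC).
Hypothesis Hs0 : stat s0.
Hypothesis sn : s <= n.
Hypothesis es0 : rg s0 vS = s.
Hypothesis V0 : forall x, x <= n -> ar s0 aVIS x = 0.
Hypothesis nM : n.+2 <= M0.
Hypothesis RM1 : forall a, a < me.*2 -> R a <= M0.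

Record binv (h : nat) (s1 : st) : Prop := Binv {
 b_st : stat s1; b_T : ar s1 aT = T; b_R : ar s1 aRC = R;
 b_q : queue s (ar s1 aVIS) (ar s1 aQUE) (rg s1 cn);
 b_h : h <= rg s1 cn;
 b_p : forall i, 0 < i -> i < rg s1 cn -> let a := ar s1 aPAR (ar s1 aQUE i) in
   [/\ a < me.*2, hd a = ar s1 aQUE i, 0 < R a &
     0 < ar s1 aVIS (hd (rva a)) <= i];
 b_f : (rg s1 nf = 1 /\ forall i, i < rg s1 cn -> T (ar s1 aQUE i) = 0) \/
   [/\ rg s1 nf = 0, 0 < T (rg s1 fw), rg s1 fw <= n, ar s1 aVIS (rg s1 fw) = rg s1 cn &
    forall i, i.+1 < rg s1 cn -> T (ar s1 aQUE i) = 0];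
 b_d : forall i, i < h -> rg s1 nf = 1 -> forall a, a \in outs (ar s1 aQUE i) -> 0 < R a ->
   0 < ar s1 aVIS (hd a) }.

Lemma binv_tick h s1 : binv h s1 -> binv h (tick s1).
Proof. by case=> S *; split=> //; case: S => *; split. Qed.

Lemma binv_setr h r v s1 : r \notin [:: 1; 2; 4; 5; 7; 8; 10; 11; 35; 36; 37] ->
 binv h s1 -> binv h (setr r v s1).
Proof.
rewrite !inE !negb_or => /and5P[n1 n2 n4 n5 /and5P[n7 n8 n10 n11 /and3P[n35 n36 n37]]].
case=> S1 *; split=> //=; rewrite ?(eq_sym _ r) ?(negbTE n35) ?(negbTE n36) ?(negbTE n37) //.
by case: S1 => *; split=> //=; rewrite (eq_sym _ r) ?(negbTE n1) ?(negbTE n2) ?(negbTE n4)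
 ?(negbTE n5) ?(negbTE n7) ?(negbTE n8) ?(negbTE n10) ?(negbTE n11).
Qed.

Lemma scan_ok h k x s1 : rg s1 rx = x -> rg s1 rk = k -> x <= n -> k < dg x -> binv h s1 ->
 ar s1 aQUE h = x -> h < rg s1 cn ->
 (rg s1 nf = 1 -> forall a, a \in take k (outs x) -> 0 < R a -> 0 < ar s1 aVIS (hd a)) ->
 run SCAN s1 (fun s2 => [/\ binv h s2, ar s2 aQUE h = x, h < rg s2 cn,
   (rg s2 nf = 1 -> forall a, a \in take k.+1 (outs x) -> 0 < R a -> 0 < ar s2 aVIS (hd a)) &
   clk s2 <= clk s1 + 14]).
Proof.
move=> ex ek xn kd [S1 T1 R1 q1 h1 p1 f1 d1] qh hc tk.
have gn := g_n gr; have gM := g_M gr; have gm := g_m gr.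
have [a aE] : exists a, a = sl (x * D + k) by eexists.
have ain : a \in outs x by rewrite aE (slot_in gr).
have alt := outs_lt ain; have hlt := rva_lt alt.
have tkE : take k.+1 (outs x) = rcons (take k (outs x)) a.
 by rewrite (take_nth 0) ?(size_outs gr) // aE (slot gr).
have yn := g_hd gr alt; have yn' : hd a <= n by exact: ltnW.
have cn1 := queue_le q1.
apply: run_sq; apply: run_asg => /=.
- by rewrite ex (s_D S1) ek (slot_lt gr).
- by rewrite ex (s_D S1) ek (s_sl S1) -aE; nlia.
rewrite ex (s_D S1) ek (s_sl S1) -aE.
apply: run_sq; apply: run_asg => /=; rewrite ?(s_hd S1); [nlia|nlia|].
have nf1 : rg s1 nf <= 1 by case: f1 => [[->]|[->]].
apply: run_ite => //=; first by split=> //; split=> //; nlia.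
all: rewrite R1.
 move=> Rnf; have nfE : rg s1 nf = 1 by case: (rg s1 nf) nf1 Rnf => [|[|j]] //; rewrite muln0.
 have R0 : 0 < R a by rewrite nfE muln1 in Rnf.
 have {f1}[_ f1] : rg s1 nf = 1 /\ forall i, i < rg s1 cn -> T (ar s1 aQUE i) = 0.
  by case: f1 => // -[]; rewrite nfE.
 apply: run_ite => //=; first by split=> //; nlia.
  rewrite leqn0 => /eqP vy.
  have Q2 := queue_push q1 yn' vy.
  have cn2 := queue_le Q2.
  have hcn : (h == rg s1 cn) = false by lia.
  apply: run_sq; apply: run_asg => //=; first nlia.
  apply: run_sq; apply: run_put => //=; [nlia|nlia|].
  apply: run_sq; apply: run_put => //=; [nlia|nlia|].
  apply: run_sq; apply: run_put => //=; [nlia|nlia|].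
  rewrite !addn1 subn1 /=.
  have p2 : forall i, 0 < i -> i < (rg s1 cn).+1 ->
   let a0 := updf (ar s1 aPAR) (hd a) a (updf (ar s1 aQUE) (rg s1 cn) (hd a) i) in
   [/\ a0 < me.*2, hd a0 = updf (ar s1 aQUE) (rg s1 cn) (hd a) i, 0 < R a0 &
     0 < updf (ar s1 aVIS) (hd a) (rg s1 cn).+1 (hd (rva a0)) <= i].
   move=> i i0; rewrite ltnS leq_eqVlt => /orP[/eqP->|hi].
    rewrite /= !eqxx; split=> //; rewrite (negbTE (g_nl gr alt)).
    by rewrite (outs_tl ain) -qh; have [_ ->] := q_n q1 hc.
   rewrite /=; have -> : (i == rg s1 cn) = false by lia.
   have [b1 b2 b3 b4] := p1 i i0 hi.
   have -> : (ar s1 aQUE i == hd a) = false.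
    by apply/eqP => e; have [_] := q_n q1 hi; rewrite e vy.
   split=> //; case: eqP => // e; move: b4; rewrite e vy //.
  apply: run_ite => //=; first by split=> //; nlia.
   rewrite T1 => T0; apply: run_sq; apply: run_asg => //=; apply: run_asg => //=; first nlia.
   rewrite hcn; split=> //; try nlia.
   split=> //=; try nlia; first by case: S1=> *; split.
    right; split=> //; first by rewrite eqxx.
    move=> i hi; have -> : (i == rg s1 cn) = false by lia.
    exact: f1.
  rewrite T1 ltnS leqn0 => /eqP T0.
  apply: run_asg => //=; rewrite hcn; split=> //; try nlia.
   split=> //=; try nlia; first by case: S1=> *; split.
    left; split=> // i; rewrite ltnS leq_eqVlt => /orP[/eqP->|hi]; first by rewrite eqxx.
    have -> : (i == rg s1 cn) = false by lia.
    exact: f1.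
   move=> i hi _ b; have -> : (i == rg s1 cn) = false by lia.
   by move=> bo Rb; case: eqP => // _; apply: (d1 i).
  move=> _ b; rewrite tkE mem_rcons inE => /orP[/eqP->|bo] Rb; first by rewrite eqxx.
  by case: eqP => // _; exact: tk.
 rewrite /= => vy; apply: run_asg => //=; split=> //; last nlia.
  by split=> //=; [case: S1=> *; split|left].
 move=> _ b; rewrite tkE mem_rcons inE => /orP[/eqP->//|bo Rb]; exact: tk.
rewrite ltnS leqn0 muln_eq0 => /orP[/eqP Ra|/eqP nf0].
 apply: run_asg => //=; split=> //; last nlia.
  by split=> //=; case: S1=> *; split.
 by move=> e b; rewrite tkE mem_rcons inE => /orP[/eqP->|bo Rb]; [rewrite Ra|exact: tk].
apply: run_asg => //=; split=> //; last nlia.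
 by split=> //=; case: S1=> *; split.
by rewrite nf0.
Qed.

Lemma bfs_ok : run BFS s0 (fun s1 => exists h, [/\ binv h s1,
  rg s1 nf = 1 -> h = rg s1 cn & clk s1 <= clk s0 + rg s1 cn * (20 * D + 20) + 20]).
Proof.
have gn := g_n gr; have gM := g_M gr; have gm := g_m gr.
have DL : D <= Lm by apply: leq_trans (g_D gr); rewrite leq_pmull.
apply: run_sq; apply: run_put => //=; rewrite ?es0; [nlia|nlia|].
apply: run_sq; apply: run_put => //=; rewrite ?es0; [nlia|nlia|].
do 3 (apply: run_sq; apply: run_asg => //=; try nlia).
apply: run_sq; apply: run_asg => //=; rewrite es0; first nlia.
pose I s1 := [/\ binv (rg s1 qh) s1 & clk s1 <= clk s0 + rg s1 qh * (20 * D + 20) + 15].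
have main s1 : I s1 -> run (WHILE (qh + #1) <=: (cn * nf) DO (
  rx <~ aQUE`[qh] ;; qh <~ qh + #1 ;; FOR rk TO aDG`[rx] DO SCAN)) s1 (fun s1 => exists h, [/\ binv h s1,
  rg s1 nf = 1 -> h = rg s1 cn & clk s1 <= clk s0 + rg s1 cn * (20 * D + 20) + 20]).
 move=> I1; apply: (@run_whl _ _ _ I (fun s => n.+1 - rg s qh)) => // {I1}s1 [B1 c1].
 have [S1 T1 R1 q1 h1 p1 f1 d1] := B1; have cn1 := queue_le q1.
 split=> //=; last first.
  rewrite addn1 => lt; exists (rg s1 qh); split.
  - by split=> //=; case: S1=> *; split.
  - by move=> /= e; rewrite e muln1 in lt; move: h1 lt => /=; nlia.
  - rewrite /=; have : rg s1 qh * (20 * D + 20) <= rg s1 cn * (20 * D + 20) by rewrite leq_mul2r h1 orbT.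
   by nlia.
 rewrite addn1 => lt.
 have nfE : rg s1 nf = 1 by case: f1 lt => [[->]|[->]]; rewrite ?muln0.
 rewrite nfE muln1 in lt.
 have [xn vx] := q_n q1 lt.
 have [x xE] : exists x, x = ar s1 aQUE (rg s1 qh) by eexists.
 rewrite -xE in xn vx.
 have dgx := g_dg gr xn.
 apply: run_sq; apply: run_asg => //=; [by split=> //; nlia|by rewrite -xE; nlia|].
 apply: run_sq; apply: run_asg => //=; first nlia.
 rewrite -xE addn1; have [h hE] : exists h, h = rg s1 qh by eexists.
 rewrite -hE.
 apply: (@run_for _ _ _ (fun k s2 => [/\ binv h s2, rg s2 rx = x, rg s2 qh = h.+1,
   ar s2 aQUE h = x & [/\ h < rg s2 cn,
   (rg s2 nf = 1 -> forall a, a \in take k (outs x) -> 0 < R a -> 0 < ar s2 aVIS (hd a)) &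
   clk s2 <= clk s1 + 4 + k * 18]]) (dg x)) => //.
 - by nlia.
 - by move=> k s2 [[S2 _ _ _ _ _ _ _] e2 _ _ _] _; rewrite /= e2 (s_dg S2); split=> //; split=> //; nlia.
 - split=> //=; rewrite ?hE ?xE //; last by split=> //; [rewrite take0|nlia].
  by do 3 (apply: binv_setr => //); exact: binv_tick.
 - move=> k s2 kd [B2 e2 eh eq [hc tk c2]] ek.
  apply: (run_call (@scan_ok h k x (tick s2) e2 ek xn kd _ eq hc tk)).
   exact: binv_tick.
  move=> s3 [B3 q3 h3 t3 c3] fr; split=> //=.
  + exact: binv_setr.
  + by rewrite (fr_r fr).
  + by rewrite (fr_r fr).
  + by split=> //; move: c3 => /=; nlia.
 - move=> s2 [B2 e2 eh eq [hc tk c2]] ek; split; last first.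
   by rewrite /= eh; nlia.
  split; last first.
   rewrite /= eh; have : dg x * 18 <= D * 18 by rewrite leq_mul2r dgx orbT.
   by rewrite -hE in c1; nlia.
  rewrite /= eh; case: B2 => S2 T2 R2 q2 h2 p2 f2 d2; split=> //=.
   by case: S2=> *; split.
  move=> i; rewrite ltnS leq_eqVlt => /orP[/eqP->|hi] e a.
   by rewrite eq => ao; apply: tk => //; rewrite -(size_outs gr) // take_size.
  exact: d2.
have Q1 : queue s (updf (ar s0 aVIS) s 1) (updf (ar s0 aQUE) 0 s) 1.
 split=> //=.
 - by case=> //= _; rewrite eqxx.
 - by move=> x xn; case: eqP => [->|nx]; [right|left; exact: V0].
have b0 s1 : stat s1 -> ar s1 aT = T -> ar s1 aRC = R -> ar s1 aVIS = updf (ar s0 aVIS) s 1 ->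
  ar s1 aQUE = updf (ar s0 aQUE) 0 s -> rg s1 cn = 1 -> rg s1 fw = s ->
  (rg s1 nf = 1 /\ T s = 0) \/ (rg s1 nf = 0 /\ 0 < T s) -> binv 0 s1.
 move=> S1 t1 r1 v1 q1 c1 f1 H; split=> //; rewrite ?v1 ?q1 ?c1 ?f1 //.
 - by case=> // [[|i]].
 - case: H => [[-> t]|[-> t]]; [left|right]; split=> //; last by rewrite /= eqxx.
  by case=> //=.
apply: run_sq; apply: run_ite => //=; first by split=> //; nlia.
 rewrite es0 => t0; apply: run_asg => //=; apply: main; split=> /=; last nlia.
 apply: b0 => //=; last by right.
 by case: Hs0=> *; split.
rewrite es0 ltnS leqn0 => /eqP t0; apply: run_asg => //=; apply: main; split=> /=; last nlia.
apply: b0 => //=; last by left.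
by case: Hs0=> *; split.
Qed.

End Bfs.

End Flow.

End SearchTh.

(** * Unit augmentations and restoring the network *)

Module PushTh.
Import Defs MachineTh HoareTh InnerCodeTh ResetTh SearchTh.
Lemma sum_upd m (g g' : nat -> nat) i0 : i0 < m -> (forall i, i < m -> i != i0 -> g' i = g i) ->
 \sum_(i < m) g' i + g i0 = \sum_(i < m) g i + g' i0.
Proof.
move=> h e; rewrite (bigD1 (Ordinal h)) //= [in RHS](bigD1 (Ordinal h)) //=.
rewrite (eq_bigr (fun i : 'I_m => g i)); first by nlia.
by move=> i ni; apply: e => //; apply: contra ni => /eqP ni; apply/eqP/val_inj.
Qed.

Lemma sum_inj N (q f : nat -> nat) (l : seq nat) : uniq (map q l) ->
 (forall i, i \in l -> q i <= N) -> \sum_(i <- l) f (q i) <= \sum_(x < N.+1) f x.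
Proof.
move=> u h; rewrite -(big_mkord xpredT f) -(big_map q xpredT f) /index_iota subn0.
set s := map q l in u *.
have pe : perm_eq (iota 0 N.+1) (s ++ [seq x <- iota 0 N.+1 | x \notin s]).
 rewrite -(perm_filterC (fun x => x \in s)) perm_cat2r; apply: uniq_perm => //.
  by rewrite filter_uniq // iota_uniq.
 move=> x; rewrite mem_filter mem_iota /= add0n; case xs: (x \in s) => //=.
 by case/mapP: xs => i il ->; rewrite ltnS h.
by rewrite (perm_big _ pe) /= big_cat leq_addr.
Qed.

Section Flow.
Variables (Lm M0 : nat) (es : seq (nat * nat * nat)).
Variables (n E Q D Fy Y0 RM me : nat) (hd sl dg cap er : nat -> nat).
Notation run := (run Lm M0 es).
Notation outs := (outs me hd).
Notation stat := (stat n E Q D Fy Y0 RM me hd sl dg cap er).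
Notation graph := (graph Lm M0 n E Q D me hd sl dg cap).
Notation queue := (queue n).
Hypothesis gr : graph.

Lemma stat_tick s : stat s -> stat (tick s). Proof. by case=> *; split. Qed.
Lemma stat_setr r v s : r \notin [:: 1; 2; 4; 5; 7; 8; 10; 11] -> stat s -> stat (setr r v s).
Proof.
rewrite !inE !negb_or => /and5P[n1 n2 n4 n5 /and4P[n7 n8 n10 n11]].
by case=> *; split=> //=; rewrite (eq_sym _ r) ?(negbTE n1) ?(negbTE n2) ?(negbTE n4)
 ?(negbTE n5) ?(negbTE n7) ?(negbTE n8) ?(negbTE n10) ?(negbTE n11).
Qed.
Lemma stat_seta k i v s : k \notin [:: 3; 5; 6; 7; 8] -> stat s -> stat (seta k i v s).
Proof.
rewrite !inE !negb_or => /and5P[n1 n2 n4 n5 n7].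
by case=> *; split=> //=; rewrite (eq_sym _ k) ?(negbTE n1) ?(negbTE n2) ?(negbTE n4)
 ?(negbTE n5) ?(negbTE n7).
Qed.

(** Residual capacity of the cut around A: remaining sink capacities in A plus residual arcs leaving
    A. An augmentation from s lowers it by one for each A through s and keeps it for all others. *)
Definition fR (T R : nat -> nat) (A : pred nat) : nat :=
 \sum_(x < n.+1) A x * T x + \sum_(a < me.*2) (A (hd (rva a)) && ~~ A (hd a)) * R a.

Lemma fR_T T T' R A x0 : x0 <= n -> T' x0 + 1 = T x0 -> (forall x, x <= n -> x != x0 -> T' x = T x) ->
 fR T' R A + A x0 = fR T R A.
Proof.
move=> h e1 e2; rewrite /fR.
have K i : i < n.+1 -> i != x0 -> A i * T' i = A i * T i by move=> hi ni; rewrite e2.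
have hh := @sum_upd n.+1 (fun x => A x * T x) (fun x => A x * T' x) x0 h K.
by move: hh; rewrite -e1 mulnDr muln1; nlia.
Qed.

(** Pushing a unit along an arc changes the residual cut by the membership of the head minus that of
    the tail. Along the path from the source these terms telescope. *)
Lemma fR_push T R R' A a : a < me.*2 -> R' a + 1 = R a -> R' (rva a) = R (rva a) + 1 ->
 (forall b, b < me.*2 -> b != a -> b != rva a -> R' b = R b) ->
 fR T R' A + A (hd (rva a)) = fR T R A + A (hd a).
Proof.
move=> h e1 e2 e3; rewrite /fR.
pose w b := nat_of_bool (A (hd (rva b)) && ~~ A (hd b)).
pose R'' b := if b == a then R' a else R b.
have h2 := rva_lt h; have na := rva_neq a.
have K1 : forall i, i < me.*2 -> i != rva a -> w i * R' i = w i * R'' i.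
 by move=> i hi ni; rewrite /R''; case: eqP => [->//|/eqP ni']; rewrite e3.
have K2 : forall i, i < me.*2 -> i != a -> w i * R'' i = w i * R i.
 by move=> i hi /negbTE ni; rewrite /R'' ni.
have := @sum_upd me.*2 (fun x => w x * R'' x) (fun x => w x * R' x) (rva a) h2 K1.
have := @sum_upd me.*2 (fun x => w x * R x) (fun x => w x * R'' x) a h K2.
have Ra : R'' a = R' a by rewrite /R'' eqxx.
have Rb : R'' (rva a) = R (rva a) by rewrite /R'' (negbTE na).
rewrite /= Ra Rb e2 -e1 => H1 H2.
move: H1 H2; rewrite /w rvaK !mulnDr !muln1.
by case: (A (hd a)); case: (A (hd (rva a))) => /=; nlia.
Qed.

Lemma fR_ge T R (A : pred nat) a : a < me.*2 -> A (hd (rva a)) -> ~~ A (hd a) -> R a <= fR T R A.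
Proof.
move=> h h1 h2; rewrite /fR (bigD1 (Ordinal h)) //= h1 h2 mul1n; nlia.
Qed.

Section Push.
Variables (s c : nat) (v q P T R : nat -> nat) (x0 : nat).
Hypothesis hq : queue s v q c.
Hypothesis hp : forall i, 0 < i -> i < c -> let a := P (q i) in
   [/\ a < me.*2, hd a = q i, 0 < R a & 0 < v (hd (rva a)) <= i].
Hypothesis x0n : x0 <= n.
Hypothesis Tx0 : 0 < T x0.
Hypothesis vx0 : 0 < v x0.
Hypothesis RMp : forall a, a < me.*2 -> R a + R (rva a) <= M0.

(** The third clause confines the changes of residual capacities to arcs between visited vertices,
    so resetting the visited vertices undoes them. The last clause bounds residual capacities
    throughout the flow. *)
Definition pushed (T2 R2 : nat -> nat) : Prop :=
 [/\ forall A : pred nat, fR T2 R2 A + A s = fR T R A,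
   forall x, x <= n -> T2 x = if x == x0 then T x - 1 else T x,
   forall a, a < me.*2 -> v (hd a) = 0 \/ v (hd (rva a)) = 0 -> R2 a = R a &
   forall a, a < me.*2 -> R2 a + R2 (rva a) = R a + R (rva a)].

Lemma push_ok s1 : stat s1 -> ar s1 aVIS = v -> ar s1 aPAR = P -> ar s1 aT = T -> ar s1 aRC = R ->
 rg s1 fw = x0 -> T x0 <= M0 ->
 run PUSH s1 (fun s2 => pushed (ar s2 aT) (ar s2 aRC) /\ clk s2 <= clk s1 + 10 + 6 * c).
Proof.
move=> S1 ev1 ep1 et1 er1 ef TM.
have gn := g_n gr; have gM := g_M gr; have gm := g_m gr.
apply: run_sq; apply: run_asg => //=; first by nlia.
apply: run_sq; apply: run_put => //=; rewrite ?ef ?et1; [by split=> //; nlia|nlia|nlia|].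
apply: (@run_whl _ _ _ (fun s2 => [/\ stat s2, ar s2 aVIS = v, ar s2 aPAR = P &
 [/\ rg s2 ry <= n, 0 < v (rg s2 ry),
  forall x, ar s2 aT x = if x == x0 then T x - 1 else T x,
  forall A : pred nat, fR (ar s2 aT) (ar s2 aRC) A + A (rg s2 ry) = fR T R A &
  [/\ forall i, 0 < i -> i < v (rg s2 ry) -> 0 < ar s2 aRC (P (q i)),
  forall a, a < me.*2 -> v (hd a) = 0 \/ v (hd (rva a)) = 0 -> ar s2 aRC a = R a,
  forall a, a < me.*2 -> ar s2 aRC a + ar s2 aRC (rva a) = R a + R (rva a) &
  clk s2 + 6 * v (rg s2 ry) <= clk s1 + 6 * c + 5]]]) (fun s2 => v (rg s2 ry))).
 have vc : v x0 <= c by case: (q_v hq x0n) vx0 => [->|[]].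
 split=> //=; [by do ?[apply: stat_seta|apply: stat_setr]|split; rewrite ?er1 ?et1 //].
 - by move=> x; case: eqP => [->|].
 - move=> A; apply: fR_T => //=; first by rewrite eqxx; nlia.
  by move=> x _ /negbTE ->.
 - split=> //; last by nlia.
  move=> i i0 hi; have ic : i < c by nlia.
  by have [] := hp i0 ic.
move=> s2 [S2 ev2 ep2 [yn vy t2 f2 [p2 u2 r2 c2]]].
have [y yE] : exists y, y = rg s2 ry by eexists.
rewrite -yE in yn vy f2 p2 c2.
split=> //=; rewrite ?ev2 -?yE; [by split=> //; nlia| |].
 move=> v2.
 have [qy vc] : q (v y).-1 = y /\ v y <= c by case: (q_v hq yn) => [e|[? ?]]; [nlia|split].
 have i0 : 0 < (v y).-1 by nlia.
 have ic : (v y).-1 < c by nlia.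
 have [] := hp i0 ic; rewrite qy; set a := P y => al hda Ra /andP[vp vp'].
 have al2 := rva_lt al; have nra := rva_neq a.
 have Ra2 : 0 < ar s2 aRC a by have := p2 _ i0; rewrite qy; apply; nlia.
 have pn := g_hd gr al2.
 have RMa := RMp al; have r2a := r2 a al.
 apply: run_sq; apply: run_asg => //=; rewrite ?ep2 ?ev2 -?yE -/a; [by split=> //; nlia|nlia|].
 apply: run_sq; apply: run_put => //=; [by nlia|nlia|nlia|].
 apply: run_sq; apply: run_put => //=; rewrite ?ev_rev; [by split=> //; nlia|nlia|..].
  by rewrite (negbTE nra); nlia.
 rewrite (negbTE nra).
 apply: run_asg => //=; rewrite ?ev_rev ?(s_hd S2); [by split=> //; nlia|nlia|].
 have nry : (rva a == rva a) = true by rewrite eqxx.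
 have eR b : updf (updf (ar s2 aRC) a (ar s2 aRC a - 1)) (rva a) (ar s2 aRC (rva a) + 1) b =
   if b == rva a then ar s2 aRC (rva a) + 1 else if b == a then ar s2 aRC a - 1 else ar s2 aRC b.
  by [].
 split=> //=; last by nlia.
 split=> //=; first by do ?[apply: stat_seta|apply: stat_setr|apply: stat_tick].
 split=> //=; first by nlia.
  move=> A; rewrite -f2 -hda; apply: fR_push => //=.
  - by rewrite eq_sym (negbTE nra) eqxx; nlia.
  - by rewrite eqxx.
  - by move=> b _ /negbTE -> /negbTE ->.
 split.
 - move=> i i0' hi; have hi2 : i < v y by nlia.
  have ic' : i < c by nlia.
  have p2i := p2 i i0' hi2.
  have [_ hdi _ _] := hp i0' ic'.
  have -> : (P (q i) == a) = false.
   apply/eqP => e; have e2 : q i = y by rewrite -hdi e hda.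
   by have [_] := q_n hq ic'; rewrite e2; nlia.
  by case: eqP => // e; nlia.
 - move=> b bl hb; rewrite -u2 //.
  case: (b =P rva a) hb => [->|_]; first by rewrite rvaK hda; nlia.
  case: (b =P a) => [->|_] //; by rewrite hda; nlia.
 - move=> b bl; rewrite -r2 //.
  case: (b =P a) => [->|nb]; first by rewrite eqxx eq_sym (negbTE nra); nlia.
  case: (b =P rva a) => [->|nb2]; first by rewrite rvaK eqxx eq_sym (negbTE nra); nlia.
  have -> : (rva b == rva a) = false by apply/eqP => e; apply: nb; rewrite -(rvaK b) e rvaK.
  by have -> : (rva b == a) = false by apply/eqP => e; apply: nb2; rewrite -e rvaK.
 - by nlia.
move=> lt; have v1 : v y = 1 by nlia.
have ys : y = s.
 case: (q_v hq yn) => [e|[_ e]]; first by nlia.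
 by rewrite -e v1 /= (q_s hq).
split; last by rewrite /=; nlia.
by split=> //= A; rewrite -f2 ys.
Qed.
End Push.

Lemma clr_ok s s1 : stat s1 -> queue s (ar s1 aVIS) (ar s1 aQUE) (rg s1 cn) ->
 rg s1 tl + rg s1 cn <= Lm ->
 run CLR s1 (fun s2 => [/\ forall x, x <= n -> ar s2 aVIS x = 0,
  rg s2 tl = rg s1 tl + rg s1 cn,
  forall i, ar s2 aTL i = if rg s1 tl <= i < rg s1 tl + rg s1 cn then ar s1 aQUE (i - rg s1 tl)
    else ar s1 aTL i &
  clk s2 <= clk s1 + 6 * rg s1 cn + 5]).
Proof.
move=> S1 hq tL; have cn1 := queue_le hq.
have gn := g_n gr; have gM := g_M gr.
apply: (@run_for _ _ _ (fun k s2 => [/\ rg s2 cn = rg s1 cn, ar s2 aQUE = ar s1 aQUE,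
  forall x, x <= n -> ar s2 aVIS x = if (0 < ar s1 aVIS x <= k) then 0 else ar s1 aVIS x,
  rg s2 tl = rg s1 tl + k &
  (forall i, ar s2 aTL i = if rg s1 tl <= i < rg s1 tl + k then ar s1 aQUE (i - rg s1 tl)
    else ar s1 aTL i) /\ clk s2 <= clk s1 + 6 * k + 3]) (rg s1 cn)) => //.
- by nlia.
- by move=> k s2 [e _ _ _ _] _ /=; split.
- split=> //=; [by move=> x _; case: ifP => //; nlia|by nlia|split; last by nlia].
 by move=> i; case: ifP => //; nlia.
- move=> k s2 kc [e1 e2 v2 t2 [l2 c2]] ek.
 have [yn vy] := q_n hq kc.
 apply: run_sq; apply: run_asg => //=; rewrite ?ek ?e2; [by split=> //; nlia|nlia|].
 apply: run_sq; apply: run_put => //=; first by nlia.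
 apply: run_sq; apply: run_put => //=; rewrite ?t2; [nlia|nlia|].
 apply: run_asg => //=; rewrite ?t2; first by nlia.
 split=> //=; [|by nlia|split; last by nlia].
  move=> x xn; rewrite v2 //; case: eqP => [->|nx]; first by rewrite vy; case: ifP => //; nlia.
  have : ar s1 aVIS x <> k.+1.
   by move=> e; case: (q_v hq xn); rewrite e => // -[_ /= h]; apply: nx.
  by move=> h; clear -h; congr (if _ then _ else _); lia.
 move=> i; rewrite l2; case: eqP => [->|ni].
  by have -> : rg s1 tl + k - rg s1 tl = k by [nlia]; case: ifP => //; nlia.
 by clear -ni; congr (if _ then _ else _); lia.
move=> s2 [e1 e2 v2 t2 [l2 c2]] ek; split=> //=; last by nlia.
move=> x xn; rewrite v2 //; case: (q_v hq xn) => [->//|[h _]].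
by case: ifP => //; nlia.
Qed.

Section Clean.
Variable y : nat -> nat.
Notation T0 := (T0 Q Fy me hd cap).
Notation yq := (yq Q Fy).
Hypothesis yb : forall e, e < me -> yq y e <= Q * E.
Hypothesis DM : D * (Q * E) <= M0.
Hypothesis QM : Q * E + Q * E <= M0.
Hypothesis Q0 : 0 < Q.
Hypothesis nM : n.+2 <= M0.
Hypothesis QL : Q * (Q + 2) <= Lm.

Definition clean (s : st) : Prop :=
 [/\ forall x, x <= n -> ar s aT x = T0 y x,
   forall a, a < me.*2 -> ar s aRC a = yq y a./2 &
   forall x, x <= n -> ar s aVIS x = 0].

Lemma clean_ok s1 t : stat s1 -> ar s1 aEY = y -> rg s1 vT = t -> t <= n ->
 (forall i, i < rg s1 cn -> ar s1 aQUE i <= n) -> rg s1 cn <= M0 -> rg s1 cn <= Lm ->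
 (forall x, x <= n -> ar s1 aVIS x = 0 \/ exists2 i, i < rg s1 cn & ar s1 aQUE i = x) ->
 (forall i, i < rg s1 tl -> ar s1 aTL i <= n) -> rg s1 tl <= Lm ->
 (forall x, x <= n -> ar s1 aT x <> T0 y x -> x = t \/ exists2 i, i < rg s1 tl & ar s1 aTL i = x) ->
 (forall a, a < me.*2 -> ar s1 aRC a <> yq y a./2 -> exists2 i, i < rg s1 tl & ar s1 aTL i = hd a) ->
 run CLEAN s1 (fun s2 => clean s2 /\
  clk s2 <= clk s1 + 4 * rg s1 cn + rg s1 tl * (10 * D + 20) + 10 * D + 30).
Proof.
move=> S1 ey et tn qn cM cL vq ln lL dT dR.
have gn := g_n gr; have gM := g_M gr.
apply: run_sq.
apply: (@run_for _ _ _ (fun k s2 => [/\ stat s2, rg s2 cn = rg s1 cn /\ rg s2 tl = rg s1 tl,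
  (rg s2 vT = t /\ forall x, x <= n -> ar s2 aVIS x = 0 \/ exists2 i, k <= i < rg s1 cn & ar s1 aQUE i = x) &
  [/\ ar s2 aQUE = ar s1 aQUE, ar s2 aTL = ar s1 aTL, ar s2 aT = ar s1 aT, ar s2 aRC = ar s1 aRC & ar s2 aEY = y /\ clk s2 <= clk s1 + 4 * k + 3]]) (rg s1 cn)) => //.
- by move=> k s2 [_ [e _] _ _] _ /=; split.
- split=> //=; [exact: stat_setr|by split=> //; split=> //; nlia].
- move=> k s2 kc [S2 [e2 e3] [et2 v2] [q2 l2 t2 r2 [ey2 c2]]] ek.
 have kL : k < Lm by nlia.
 have qk := qn k kc.
 apply: run_put => //=; rewrite ?ek ?q2; [by split=> //; nlia|nlia|].
 split=> //=; [by do ?[apply: stat_seta|apply: stat_setr|apply: stat_tick]| |by split=> //; split=> //; nlia].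
 split=> // x xn; case: eqP => [_|nx]; first by left.
 case: (v2 x xn) => [->|[i hi ei]]; [by left|right; exists i => //].
 by have : i <> k by [move=> e; apply: nx; rewrite -ei e]; nlia.
move=> s2 [S2 [e2 e3] [et2 v2] [q2 l2 t2 r2 [ey2 c2]]] ek.
have {}v2 x : x <= n -> ar s2 aVIS x = 0 by move=> xn; case: (v2 x xn) => // -[i]; nlia.
apply: run_sq.
apply: (@run_for _ _ _ (fun k s3 => [/\ stat s3, rg s3 tl = rg s1 tl /\ rg s3 vT = t, ar s3 aTL = ar s1 aTL /\ ar s3 aEY = y,
  (forall x, x <= n -> ar s3 aVIS x = 0) &
  [/\ (forall x, x <= n -> ar s3 aT x <> T0 y x -> x = t \/ exists2 i, k <= i < rg s1 tl & ar s1 aTL i = x),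
    (forall a, a < me.*2 -> ar s3 aRC a <> yq y a./2 -> exists2 i, k <= i < rg s1 tl & ar s1 aTL i = hd a) &
    clk s3 <= clk s2 + k * (10 * D + 15) + 3]]) (rg s1 tl)) => //.
- by nlia.
- by move=> k s3 [_ [e _] _ _ _] _ /=; split.
- split=> //=; first by do ?[apply: stat_tick|apply: stat_setr].
 by rewrite t2 r2; split=> //; nlia.
- move=> k s3 kt [S3 [e4 et3] [l3 ey3] v3 [t3 r3 c3]] ek3.
 have un := ln k kt.
 apply: run_sq; apply: run_asg => //=; rewrite ?ek3 ?l3; [by split=> //; nlia|nlia|].
 have SS : stat (setr ru (ar s1 aTL k) (tick s3)) by apply: stat_setr => //; apply: stat_tick.
 apply: (run_call (reset_ok es gr SS _ (y := y) _ yb DM _)) => //=; first by nlia.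
 move=> s4 [T4 R4 c4] fr4; split=> //=.
 + by apply: stat_setr => //; apply: stat_frame fr4 _ _ SS.
 + by rewrite !(fr_r fr4).
 + by rewrite !(fr_a fr4).
 + by move=> x xn; rewrite (fr_a fr4) //=; exact: v3.
 + split; last by move: c4 => /=; nlia.
   move=> x xn; rewrite T4 /=; case: eqP => // nx h.
   case: (t3 x xn h) => [|[i hi ei]]; [by left|right; exists i => //].
   by have : i <> k by [move=> e; apply: nx; rewrite -ei e]; nlia.
  move=> a al; rewrite R4 //=; case: ifP => // /norP[/eqP na _] h.
  case: (r3 a al h) => i hi ei; exists i => //.
  by have : i <> k by [move=> e; apply: na; rewrite -ei e]; nlia.
move=> s3 [S3 [e4 et3] [l3 ey3] v3 [t3 r3 c3]] ek3.
apply: run_sq; apply: run_asg => //=; rewrite ?et3; first by nlia.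
have SS : stat (setr ru t (tick s3)) by apply: stat_setr => //; apply: stat_tick.
apply: (run_call (reset_ok es gr SS _ (y := y) _ yb DM _)) => //=; first by nlia.
move=> s4 [T4 R4 c4] fr4; split; last first.
 move: c4 => /=; have : rg s1 tl * (10 * D + 15) <= rg s1 tl * (10 * D + 20) by rewrite leq_mul2l; apply/orP; right; nlia.
 by nlia.
split.
- move=> x xn; rewrite T4 /=; case: eqP => // nx.
 by case: (ar s3 aT x =P T0 y x) => // h; case: (t3 x xn h) => // -[i]; nlia.
- move=> a al; rewrite R4 //=; case: ifP => // _.
 by case: (ar s3 aRC a =P yq y a./2) => // h; case: (r3 a al h) => i; nlia.
- by move=> x xn; rewrite (fr_a fr4) //=; exact: v3.
Qed.

End Clean.
End Flow.

End PushTh.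

(** * Flows of value at most Q and minimal minimum cuts *)

Module FlowTh.
Import Defs MachineTh HoareTh InnerCodeTh ResetTh SearchTh PushTh.
Section Flow.
Variables (Lm M0 : nat) (es : seq (nat * nat * nat)).
Variables (n E Q D Fy Y0 RM me : nat) (hd sl dg cap er : nat -> nat).
Notation run := (run Lm M0 es).
Notation outs := (outs me hd).
Notation stat := (stat n E Q D Fy Y0 RM me hd sl dg cap er).
Notation graph := (graph Lm M0 n E Q D me hd sl dg cap).
Notation queue := (queue n).
Notation fR := (fR n me hd).
Notation T0 := (T0 Q Fy me hd cap).
Notation yq := (yq Q Fy).
Hypothesis gr : graph.
Variable y : nat -> nat.
Hypothesis yb : forall e, e < me -> yq y e <= Q * E.
Hypothesis deg : forall x, x <= n -> \sum_(a <- outs x) yq y a./2 <= Q * cap x.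
Hypothesis DM : D * (Q * E) <= M0.
Hypothesis QM : Q * E + Q * E <= M0.
Hypothesis Q0 : 0 < Q.
Hypothesis nM : n.+2 <= M0.
Hypothesis QL : Q * (Q + 2) <= Lm.
Hypothesis Q2L : Q + 2 <= Lm.

Lemma T0_ge x : x <= n -> cap x <= T0 y x.
Proof. by move=> h; have := deg h; rewrite /T0 mulnDl mul1n; nlia. Qed.

Variables (s t : nat).
Hypothesis sn : s <= n.
Hypothesis tn : t <= n.
Notation T1 := (fun x => T0 y x + (x == t) * Q).
Notation R1 := (fun a => yq y a./2).

Lemma T1_M x : x <= n -> T1 x <= M0.
Proof. by move=> h; have := g_bcap gr h; rewrite /T0 /=; case: (x == t); nlia. Qed.

Record fcore (s0 s1 : st) : Prop := FC {
 c_st : stat s1; c_t : rg s1 vT = t; c_y : ar s1 aEY = y;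
 c_l : rg s1 tl <= rg s1 fF * (Q + 2);
 c_ln : forall i, i < rg s1 tl -> ar s1 aTL i <= n;
 c_dT : forall x, x <= n -> ar s1 aT x <> T1 x -> exists2 i, i < rg s1 tl & ar s1 aTL i = x;
 c_dR : forall a, a < me.*2 -> ar s1 aRC a <> R1 a ->
  exists2 i, i < rg s1 tl & ar s1 aTL i = hd a }.

Definition cF := (Q + 2) * (20 * D + 40) + 60.

(** In the first outcome Q units were sent and every set through s costs at least Q. In the second,
    the set visited by the failing search costs exactly the flow value and is contained in every set
    through s of that cost, so it is the minimal minimizer. *)
Definition fpost (s0 s1 : st) : Prop :=
 [/\ fcore s0 s1, rg s1 fF <= Q, rg s1 cn <= Q + 2,
   forall i, i < rg s1 cn -> ar s1 aQUE i <= n &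
  clk s1 <= clk s0 + 10 + Q.+1 * cF /\
  ((rg s1 fF = Q /\ (forall x, x <= n -> ar s1 aVIS x = 0) /\
    forall A : pred nat, A s -> Q <= fR T1 R1 A) \/
  (rg s1 fF < Q /\ queue s (ar s1 aVIS) (ar s1 aQUE) (rg s1 cn) /\
   let M x := 0 < ar s1 aVIS x in fR T1 R1 M = rg s1 fF /\
   forall A : pred nat, A s -> rg s1 fF <= fR T1 R1 A /\
    (fR T1 R1 A <= rg s1 fF -> forall x, x <= n -> M x -> A x)))].

Record finv (s0 s1 : st) : Prop := FI {
 i_c : fcore s0 s1; i_s : rg s1 vS = s; i_F : rg s1 fF < Q;
 i_v : forall x, x <= n -> ar s1 aVIS x = 0;
 i_f : forall A : pred nat, fR (ar s1 aT) (ar s1 aRC) A + rg s1 fF * A s = fR T1 R1 A;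
 i_T : forall x, x <= n -> ar s1 aT x <= T1 x;
 i_S : \sum_(x < n.+1) ar s1 aT x + rg s1 fF = \sum_(x < n.+1) T1 x;
 i_R : forall a, a < me.*2 -> ar s1 aRC a + ar s1 aRC (rva a) = R1 a + R1 (rva a);
 i_k : clk s1 <= clk s0 + 8 + rg s1 fF * cF }.

(** Every visited vertex other than the source and the last one has used up its sink capacity. That
    capacity was at least 1, since the vertex is the head of an arc and so has positive capacity,
    and all units used so far sum to the flow value. *)
Lemma visited s0 s1 h : binv n E Q D Fy Y0 RM me hd sl dg cap er s0 s h s1 ->
 (forall x, x <= n -> ar s0 aT x <= T1 x) ->
 \sum_(x < n.+1) ar s0 aT x + rg s0 fF = \sum_(x < n.+1) T1 x ->
 rg s1 cn <= rg s0 fF + 2.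
Proof.
move=> B le sm; have q1 := b_q B.
have zero i : i.+1 < rg s1 cn -> ar s0 aT (ar s1 aQUE i) = 0.
 by move=> hi; case: (b_f B) => [[_ f]|[_ _ _ _ f]]; apply: f; nlia.
have dif : \sum_(x < n.+1) (T1 x - ar s0 aT x) = rg s0 fF.
 have : \sum_(x < n.+1) (T1 x - ar s0 aT x) + \sum_(x < n.+1) ar s0 aT x = \sum_(x < n.+1) T1 x.
  by rewrite -big_split /=; apply: eq_bigr => x _; rewrite subnK // le // -ltnS.
 by rewrite -sm; nlia.
(* Queue positions 0 and cn - 1 are left out: the source need not have had any sink capacity, and
   the last vertex may be the one on which the search has just stopped. *)
set l := iota 1 (rg s1 cn - 2).
have ul : uniq (map (ar s1 aQUE) l).
 rewrite map_inj_in_uniq ?iota_uniq // => i j; rewrite !mem_iota => hi hj e.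
 have [ci cj] : i < rg s1 cn /\ j < rg s1 cn by split; lia.
 have [_ h1] := q_n q1 ci; have [_ h2] := q_n q1 cj.
 by rewrite e h2 in h1; case: h1.
have ll i : i \in l -> 0 < i /\ i.+1 < rg s1 cn by rewrite mem_iota => ?; split; lia.
have := @sum_inj n (ar s1 aQUE) (fun x => T1 x - ar s0 aT x) l ul.
rewrite dif => /(_ _) H.
have {}H : \sum_(i <- l) (T1 (ar s1 aQUE i) - ar s0 aT (ar s1 aQUE i)) <= rg s0 fF.
 apply: H => i /ll[_ hi]; have hc : i < rg s1 cn by nlia.
 by have [] := q_n q1 hc.
have : \sum_(i <- l) 1 <= rg s0 fF.
 apply: leq_trans H; rewrite big_seq [X in _ <= X]big_seq; apply: leq_sum => i /ll[i0 hi].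
 rewrite (zero i hi) subn0; have hc : i < rg s1 cn by nlia.
 have [al hda _ _] := b_p B i0 hc; have [qn _] := q_n q1 hc.
 have /andP[c1 _] := g_cap gr al; rewrite hda in c1.
 by apply: leq_trans c1 (leq_trans (T0_ge qn) (leq_addr _ _)).
by rewrite sum1_size size_iota; nlia.
Qed.

Lemma flow_ok s0 : stat s0 -> ar s0 aEY = y -> clean n Q Fy me hd cap y s0 ->
 rg s0 vS = s -> rg s0 vT = t -> run FLOW s0 (fpost s0).
Proof.
move=> S0 ey0 [cT cR cV] es0 et0.
have gn := g_n gr; have gM := g_M gr; have gm := g_m gr.
have T1t := T1_M tn.
apply: run_sq; apply: run_put => //=; rewrite ?et0 ?cT ?(s_Q S0) //; [by split=> //; nlia|nlia| |].
 by move: T1t; rewrite eqxx mul1n.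
apply: run_sq; apply: run_asg => //=; apply: run_sq; apply: run_asg => //=.
apply: run_sq; apply: run_asg => //=; first by nlia.
have R1M a : a < me.*2 -> R1 a + R1 (rva a) <= M0.
 by move=> al; rewrite /= rva_half; have := yb (e := a./2); nlia.
(* The second disjunct is stated for all states that differ from s1 only in bookkeeping, so that the
   postcondition absorbs the tick of the last test. The factor [go2] lets the variant drop to 0 when
   the loop is left. *)
apply: (@run_whl _ _ _ (fun s1 => (rg s1 go2 = 1 /\ finv s0 s1) \/
  (rg s1 go2 = 0 /\ forall s2, rg s2 = rg s1 -> ar s2 = ar s1 -> clk s2 <= (clk s1).+1 -> fpost s0 s2))
  (fun s1 => rg s1 go2 * (Q.+1 - rg s1 fF))).
 left; split=> //; split=> //=; last 1 first.
 - by nlia.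
 - split=> //=; first by do ?[apply: stat_setr|apply: stat_seta].
  + by move=> x xn; case: eqP => [->|_] H; case: H; rewrite ?cT // ?mul1n ?mul0n ?addn0.
  + by move=> a al H; case: H; rewrite cR.
 - move=> A; rewrite addn0 /PushTh.fR; congr (_ + _); apply: eq_bigr => i _.
   have iN : i <= n by rewrite -ltnS.
   by congr (_ * _); rewrite /=; case: eqP => [->|_]; rewrite ?cT // ?mul1n ?mul0n ?addn0.
  by rewrite cR.
 - by move=> x xn; case: eqP => [->|_]; rewrite ?cT // ?mul1n ?mul0n ?addn0.
 - rewrite addn0; apply: eq_bigr => i _; have iN : i <= n by rewrite -ltnS.
  by case: eqP => [->|_]; rewrite ?cT // ?mul1n ?mul0n ?addn0.
 - by move=> a al; rewrite !cR // rva_lt.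
move=> s1 I1; split=> //=; last first.
 by case: I1 => [[-> _]|[g P]] // _; apply: P => //=.
move=> g1; case: I1 => [[g1e I1]|[g _]]; last by rewrite g in g1.
have [C1 vs1 F1 V1 f1 T1' S1' R1' k1] := I1.
have [st1 t1 y1 l1 ln1 dT1 dR1] := C1.
have tM x : x <= n -> ar s1 aT x <= M0 by move=> xn; apply: leq_trans (T1' x xn) (T1_M xn).
apply: run_sq.
have RM1 a : a < me.*2 -> ar s1 aRC a <= M0.
 by move=> al; have := R1' a al; have := R1M a al; rewrite /=; nlia.
apply: (run_call (bfs_ok es gr (stat_tick st1) sn _ _ _)) => //; try exact: stat_tick.
move=> s2 [h [B2 h2 k2]] fr2.
have [S2 eT2 eR2 q2 hc2 p2 f2 d2] := B2.
have cn2 : rg s2 cn <= rg s1 fF + 2 by apply: (visited B2 T1' S1').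
have cnk : rg s2 cn * (20 * D + 20) <= (Q + 2) * (20 * D + 20) by rewrite leq_mul2r; apply/orP; right; nlia.
have eF2 : rg s2 fF = rg s1 fF by rewrite (fr_r fr2).
have etl2 : rg s2 tl = rg s1 tl by rewrite (fr_r fr2).
have eTL2 : ar s2 aTL = ar s1 aTL by rewrite (fr_a fr2).
have eEY2 : ar s2 aEY = y by rewrite (fr_a fr2).
have et2 : rg s2 vT = t by rewrite (fr_r fr2).
have ecF : cF = (Q + 2) * (20 * D + 20) + (Q + 2) * 20 + 60 by rewrite /cF; lia.
apply: run_ite => //=.
 rewrite leqn0 => /eqP nf0.
 case: f2 => [[nf1]|[_ Tf fwn vfw f2]]; first by rewrite nf0 in nf1.
 apply: run_sq.
 have vf0 : 0 < ar s2 aVIS (rg s2 fw) by rewrite vfw (q_c q2).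
 have Rp a : a < me.*2 -> ar s1 aRC a + ar s1 aRC (rva a) <= M0.
  by move=> al; rewrite R1' // R1M.
 apply: (run_call (push_ok es gr q2 p2 fwn Tf vf0 Rp (stat_tick S2) _ _ _ _ _ _)) => //; try exact: stat_tick; try exact: tM.
 move=> s3 [[A3 T3 U3 W3] k3] fr3.
 apply: run_sq.
 have st3 : stat s3 by apply: stat_frame fr3 _ _ _ => //; exact: stat_tick.
 have eq3 : ar s3 aQUE = ar s2 aQUE by rewrite (fr_a fr3).
 have ev3 : ar s3 aVIS = ar s2 aVIS by rewrite (fr_a fr3).
 have ec3 : rg s3 cn = rg s2 cn by rewrite (fr_r fr3).
 have et3 : rg s3 tl = rg s1 tl by rewrite (fr_r fr3).
 have hl3 : rg s1 fF * (Q + 2) + (Q + 2) <= Q * (Q + 2).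
  by rewrite -[X in _ + X]mul1n -mulnDl leq_mul2r; apply/orP; right; nlia.
 apply: (run_call (clr_ok es gr (s := s) st3 _ _)); first by rewrite eq3 ev3 ec3.
  by rewrite et3 ec3; nlia.
 move=> s4 [V4 t4 L4 k4] fr4.
 have eF4 : rg s4 fF = rg s1 fF by rewrite (fr_r fr4) // (fr_r fr3).
 have st4 : stat s4 by apply: stat_frame fr4 _ _ st3.
 apply: run_sq; apply: run_asg => //=; rewrite eF4; first by nlia.
 have eT4 : ar s4 aT = ar s3 aT by rewrite (fr_a fr4).
 have eR4 : ar s4 aRC = ar s3 aRC by rewrite (fr_a fr4).
 have ev4 : rg s4 vS = s by rewrite (fr_r fr4) // (fr_r fr3) //= (fr_r fr2).
 have et4 : rg s4 vT = t by rewrite (fr_r fr4) // (fr_r fr3).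
 have eY4 : ar s4 aEY = y by rewrite (fr_a fr4) // (fr_a fr3).
 have eq4 : ar s4 aQUE = ar s2 aQUE by rewrite (fr_a fr4).
 have ec4 : rg s4 cn = rg s2 cn by rewrite (fr_r fr4).
 have eTL3 : ar s3 aTL = ar s1 aTL by rewrite (fr_a fr3).
 have vis_in x : x <= n -> 0 < ar s2 aVIS x -> exists2 i, i < rg s4 tl & ar s4 aTL i = x.
  move=> xn vx; case: (q_v q2 xn) => [e|[h1' h2']]; first by rewrite e in vx.
  exists (rg s1 tl + (ar s2 aVIS x).-1); first by rewrite t4 et3 ec3; nlia.
  rewrite L4 et3 ec3 eq3 addKn h2'.
  by have -> : rg s1 tl <= rg s1 tl + (ar s2 aVIS x).-1 < rg s1 tl + rg s2 cn by nlia.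
 have old_in x i : i < rg s1 tl -> ar s1 aTL i = x -> exists2 i, i < rg s4 tl & ar s4 aTL i = x.
  move=> hi ei; exists i; first by rewrite t4 et3; nlia.
  rewrite L4 et3 eTL3; have -> : (rg s1 tl <= i) = false by apply/negbTE; rewrite -ltnNge.
  by [].
 have tl4 : rg s4 tl <= (rg s1 fF).+1 * (Q + 2) by rewrite t4 et3 ec3 mulSn; nlia.
 have core4 s5 : rg s5 = updf (rg s4) fF (rg s1 fF).+1 \/ (exists2 v, rg s5 = updf (updf (rg s4) fF (rg s1 fF).+1) go2 v & True) \/ (exists2 v, rg s5 = updf (updf (rg s4) fF (rg s1 fF).+1) 99 v & True) -> ar s5 = ar s4 -> fcore s0 s5.
  move=> eg ea.
  have eg' r : r != fF -> r != go2 -> r != 99 -> rg s5 r = rg s4 r.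
   by move=> /negbTE h1 /negbTE h2' /negbTE h3; case: eg => [->|[[v -> _]|[v -> _]]] /=; rewrite ?h1 ?h2' ?h3.
  have eF : rg s5 fF = (rg s1 fF).+1 by case: eg => [->|[[v -> _]|[v -> _]]].
  split; rewrite ?eF ?eg' ?ea //.
  - by case: (st4) => *; split; rewrite ?eg' ?ea.
  - move=> i; rewrite t4 et3 ec3 => hi; rewrite L4 et3 ec3 eq3 eTL3; case: ifP => hh.
    by have hc : i - rg s1 tl < rg s2 cn by [nlia]; have [] := q_n q2 hc.
   by apply: ln1; lia.
  - move=> x xn; rewrite eT4 T3 // => hx.
   case: (posnP (ar s2 aVIS x)) => [v0|vp]; last exact: vis_in.
   case: (x =P rg s2 fw) hx => [e|_] hx; first by rewrite -e v0 in vf0.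
   by case: (dT1 x xn hx) => i hi ei; apply: old_in hi ei.
  - move=> a al; rewrite eR4 => hx.
   case: (posnP (ar s2 aVIS (hd a))) => [v0|vp]; last by apply: vis_in => //; apply: ltnW; exact: (g_hd gr).
   rewrite U3 in hx; [|by []|by left].
   by case: (dR1 a al hx) => i hi ei; apply: old_in hi ei.
 have F3 A : fR (ar s4 aT) (ar s4 aRC) A + (rg s1 fF).+1 * A s = fR T1 R1 A.
  by rewrite eT4 eR4 -f1 -A3; nlia.
 have kk : clk s4 <= clk s0 + 8 + rg s1 fF * cF + (cF - 6).
  move: k2 k3 k4; rewrite /= ec3 ecF; nlia.
 have kF : (rg s1 fF).+1 * cF <= Q * cF by rewrite leq_mul2r F1 orbT.
 have cF6 : 60 <= cF by rewrite /cF leq_addl.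
 apply: run_ite => //=; rewrite addn1 (s_Q st4).
  move=> FQ; have eFQ : (rg s1 fF).+1 = Q by nlia.
  apply: run_asg => //=; split; last by rewrite mul0n muln_gt0 g1; nlia.
  right; split=> // s5 eg ea kc; split.
  - by apply: core4 => //; right; left; exists 0.
  - by rewrite eg /= eFQ.
  - by rewrite eg /= ec4; nlia.
  - by rewrite eg ea /= ec4 eq4 => i hi; have [] := q_n q2 hi.
  - split; first by move: kc kk kF => /=; rewrite mulSn; nlia.
   left; rewrite eg ea /= eFQ; split=> //; split=> // A As.
   by rewrite -F3 As muln1 eFQ leq_addl.
 move=> FQ; apply: run_asg => //=; split; last first.
  have -> : rg s4 go2 = rg s1 go2 by rewrite (fr_r fr4) // (fr_r fr3) //= (fr_r fr2).
  by rewrite ltn_mul2l g1 /=; nlia.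
 left; split.
  have -> : rg s4 go2 = rg s1 go2 by rewrite (fr_r fr4) // (fr_r fr3) //= (fr_r fr2).
  exact: g1e.
 split=> //=; first by apply: core4 => //; right; right; exists 0.
 - by move=> x xn; rewrite eT4 T3 //; apply: leq_trans (T1' x xn); case: ifP => // _; exact: leq_subr.
 - rewrite eT4 -S1'.
  have K i : i < n.+1 -> i != rg s2 fw -> ar s3 aT i = ar s1 aT i.
   by move=> hi /negbTE ni; rewrite T3 // ni.
  have := @sum_upd n.+1 (ar s1 aT) (ar s3 aT) (rg s2 fw) fwn K.
  have Tp : 0 < ar s1 aT (rg s2 fw) := Tf.
  have := T3 _ fwn; rewrite eqxx ?eT2 /= => -> HH.
  by nlia.
 - by move=> a al; rewrite eR4 W3 // R1'.
 - by rewrite mulSn; move: kk cF6; nlia.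
move=> nfp; have nf1 : rg s2 nf = 1 by case: f2 => [[]//|[e]]; rewrite e in nfp.
have {}f2 : forall i, i < rg s2 cn -> ar s1 aT (ar s2 aQUE i) = 0.
 by case: f2 => [[]//|[e]]; rewrite e in nfp.
have hE := h2 nf1.
apply: run_asg => //=; split; last by rewrite mul0n muln_gt0 g1; nlia.
right; split=> // s5 eg ea kc.
have eg' r : r != go2 -> rg s5 r = rg s2 r by rewrite eg /= => /negbTE ->.
have core5 : fcore s0 s5.
 split; rewrite ?eg' ?ea ?eF2 ?etl2 ?eTL2 //=.
 - by case: (S2) => *; split; rewrite ?eg' ?ea.
 - by rewrite eT2.
 - by rewrite eR2.
have kF : rg s1 fF * cF + cF <= Q * cF by rewrite addnC -mulSn leq_mul2r F1 orbT.
split=> //; rewrite ?eg' ?ea ?eF2 //=; [by nlia|by nlia|by move=> i hi; have [] := q_n q2 hi|].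
split; first by move: kc k2 kF; rewrite /= mulSn ecF; nlia.
right; split=> //; split=> //.
set M := fun x => 0 < ar s2 aVIS x.
have Mq x : x <= n -> M x -> exists2 i, i < rg s2 cn & ar s2 aQUE i = x /\ ar s2 aVIS x = i.+1.
 move=> xn; rewrite /M; case: (q_v q2 xn) => [->//|[h1 h3]] vp.
 by exists (ar s2 aVIS x).-1; [nlia|split=> //; nlia].
have Ms : M s by rewrite /M; have [_] := q_n q2 (q_c q2); rewrite (q_s q2) => ->.
have clos a : a < me.*2 -> M (hd (rva a)) -> ~~ M (hd a) -> ar s1 aRC a = 0.
 move=> al m1 m2; case: (posnP (ar s1 aRC a)) => // Rp.
 have pn : hd (rva a) <= n by apply: ltnW; apply: (g_hd gr); exact: rva_lt.
 have [i ic [qi _]] := Mq _ pn m1.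
 have /negP[] := m2; apply: (d2 i) => //; first by rewrite hE.
 by rewrite qi mem_outs.
have f0 : fR (ar s1 aT) (ar s1 aRC) M = 0.
 rewrite /PushTh.fR !big1 // => [a _|x _].
  by case m1: (M (hd (rva a))); case m2: (M (hd a)) => //=; rewrite clos ?m1 ?m2 // muln0.
 have xn : x <= n by rewrite -ltnS.
 case m1: (M x) => //=; have [i ic [qi _]] := Mq _ xn m1.
 by have := f2 i ic; rewrite qi => ->.
split; first by rewrite -f1 f0 Ms muln1.
move=> A As; have fA := f1 A; rewrite As muln1 in fA; split; first by rewrite -fA leq_addl.
rewrite -fA => le; have z : fR (ar s1 aT) (ar s1 aRC) A = 0 by nlia.
(* A set through s with residual cut 0 is closed under residual arcs, so it contains the whole
   search tree; induction on the queue position. *)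
have main : forall j x, x <= n -> M x -> ar s2 aVIS x <= j -> A x.
 elim=> [|j IH] x xn Mx vj; first by move: Mx; rewrite /M; nlia.
 have [[|i] ic [qi vx]] := Mq x xn Mx; first by rewrite -qi (q_s q2).
 have [al hda Rp /andP[vp vp']] := p2 i.+1 isT ic.
 set a := ar s2 aPAR _ in al hda Rp vp vp'.
 have pn : hd (rva a) <= n by apply: ltnW; apply: (g_hd gr); exact: rva_lt.
 have Ap : A (hd (rva a)) by apply: IH => //; nlia.
 case Ax : (A x) => //; exfalso.
 have := @fR_ge n me hd (ar s1 aT) (ar s1 aRC) A a al Ap; rewrite hda qi Ax => /(_ isT).
 by have Rp' : 0 < ar s1 aRC a := Rp; rewrite z; nlia.
by move=> x xn Mx; apply: (main (ar s2 aVIS x)).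
Qed.

End Flow.

End FlowTh.

(** * Finding a small odd cut or certifying a vertex *)

Module FindTh.
Import Defs MachineTh HoareTh CutsTh InnerCodeTh ResetTh SearchTh PushTh FlowTh.
Ltac nlia := repeat match goal with H : ?T |- _ => lazymatch T with
 | is_true (leq _ _) => fail | is_true (leq _ _ && leq _ _) => fail | @eq nat _ _ => fail
 | ~ (@eq nat _ _) => fail | nat => fail | _ => clear H end end; lia.

Lemma sum_double m (g : nat -> nat) :
 \sum_(a < m.*2) g a = \sum_(e < m) (g e.*2 + g e.*2.+1).
Proof.
elim: m => [|m IH]; first by rewrite !big_ord0.
by rewrite doubleS !big_ord_recr /= IH addnA.
Qed.

Lemma rva_double e : rva e.*2 = e.*2.+1.
Proof. by rewrite /rva odd_double. Qed.
Lemma rva_doubleS e : rva e.*2.+1 = e.*2.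
Proof. by rewrite /rva /= odd_double. Qed.

Section Find.
Variables (Lm M0 : nat) (es : seq (nat * nat * nat)).
Variables (n E Q D Fy Y0 RM me : nat) (hd sl dg cap er : nat -> nat).
Notation run := (run Lm M0 es).
Notation outs := (outs me hd).
Notation stat := (stat n E Q D Fy Y0 RM me hd sl dg cap er).
Notation graph := (graph Lm M0 n E Q D me hd sl dg cap).
Notation fR := (fR n me hd).
Notation T0 := (T0 Q Fy me hd cap).
Notation yq := (yq Q Fy).
Notation clean := (clean n Q Fy me hd cap).
Hypothesis gr : graph.

Notation W := 'I_n.+1.
Definition etl (e : 'I_me) : W := inord (hd e.*2.+1).
Definition ehd (e : 'I_me) : W := inord (hd e.*2).
Definition ycut (y : nat -> nat) : {set W} -> nat :=
 cut etl ehd (fun e : 'I_me => yq y e) (fun x : W => T0 y x).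
Definition wcap (x : W) := cap x.
Notation par := (par wcap).

Lemma fR_ext T R T' R' (A B : pred nat) : (forall x, x <= n -> T x = T' x) ->
 (forall a, a < me.*2 -> R a = R' a) -> (forall x, x <= n -> A x = B x) -> fR T R A = fR T' R' B.
Proof.
move=> eT eR eA; rewrite /PushTh.fR; congr (_ + _); apply: eq_bigr => i _.
 by rewrite eT ?eA // -ltnS.
by rewrite eR // !eA // (hd_le gr) // rva_lt.
Qed.

(** Of the two arcs of an edge exactly one leaves S when the edge crosses S, so the arcs add up to
    the undirected cut. The bonus Q given to t appears as a separate term. *)
Lemma fR_cut y t (S : {set W}) : t <= n ->
 fR (fun x => T0 y x + (x == t) * Q) (fun a => yq y a./2) (fun x => inord x \in S) =
 ycut y S + (inord t \in S) * Q.
Proof.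
move=> tn; rewrite /PushTh.fR /ycut /cut.
rewrite (sum_double me (fun a => ((inord (hd (rva a)) \in S) && (inord (hd a) \notin S)) * yq y a./2)).
have -> : \sum_(i < n.+1) ((inord i \in S) * (T0 y i + (i == t :> nat) * Q)) =
     \sum_(x in S) T0 y x + (inord t \in S) * Q.
 rewrite (eq_bigr (fun i : W => (i \in S) * T0 y i + (i \in S) * ((i == inord t) * Q))); last first.
  move=> i _; rewrite inord_val mulnDr; congr (_ + _ * (_ * _)).
  by rewrite -val_eqE /= inordK.
 rewrite big_split /=; congr (_ + _).
  by rewrite [RHS]big_mkcond; apply: eq_bigr => i _; case: (i \in S); rewrite ?mul1n.
 rewrite (bigD1 (inord t)) //= eqxx mul1n big1 ?addn0 // => i /negbTE ->.
 by rewrite mul0n muln0.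
rewrite addnAC; congr (_ + _); congr (_ + _); apply: eq_bigr => e _.
have h2 : (e.*2.+1)./2 = e by lia.
rewrite rva_double rva_doubleS doubleK h2 -mulnDl; congr (_ * _).
by rewrite /etl /ehd; case: (_ \in S); case: (_ \in S).
Qed.

Section FixY.
Variable y : nat -> nat.
Hypothesis yb : forall e, e < me -> yq y e <= Q * E.
Hypothesis deg : forall x, x <= n -> \sum_(a <- outs x) yq y a./2 <= Q * cap x.
Hypothesis DM : D * (Q * E) <= M0.
Hypothesis QM : Q * E + Q * E <= M0.
Hypothesis Q0 : 0 < Q.
Hypothesis nM : n.+2 <= M0.
Hypothesis QL : Q * (Q + 2) <= Lm.
Hypothesis Q2L : Q + 3 <= Lm.
Hypothesis cM : (Q + 2) * (Q * E) + Q * E <= M0.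
Hypothesis E0 : 0 < E.
Notation f := (ycut y).

Record dirty (t : nat) (s1 : st) : Prop := Dirty {
 d_st : stat s1; d_y : ar s1 aEY = y; d_t : rg s1 vT = t;
 d_c : rg s1 cn <= Q + 2; d_q : forall i, i < rg s1 cn -> ar s1 aQUE i <= n;
 d_v : forall x, x <= n -> ar s1 aVIS x = 0 \/ exists2 i, i < rg s1 cn & ar s1 aQUE i = x;
 d_ln : forall i, i < rg s1 tl -> ar s1 aTL i <= n; d_l : rg s1 tl <= Q * (Q + 2);
 d_T : forall x, x <= n -> ar s1 aT x <> T0 y x -> x = t \/ exists2 i, i < rg s1 tl & ar s1 aTL i = x;
 d_R : forall a, a < me.*2 -> ar s1 aRC a <> yq y a./2 -> exists2 i, i < rg s1 tl & ar s1 aTL i = hd a }.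

Lemma dirty_eq t s1 s2 : dirty t s1 -> stat s2 -> rg s2 vT = rg s1 vT -> rg s2 cn = rg s1 cn ->
 rg s2 tl = rg s1 tl -> ar s2 aEY = ar s1 aEY -> ar s2 aQUE = ar s1 aQUE -> ar s2 aVIS = ar s1 aVIS ->
 ar s2 aTL = ar s1 aTL -> ar s2 aT = ar s1 aT -> ar s2 aRC = ar s1 aRC -> dirty t s2.
Proof.
case=> a b c d e g h i j k S e1 e2 e3 e4 e5 e6 e7 e8 e9.
by split=> //; rewrite ?e1 ?e2 ?e3 ?e4 ?e5 ?e6 ?e7 ?e8 ?e9.
Qed.

Definition setof (l : seq nat) : {set W} := [set x | val x \in l].
Definition quel (s1 : st) := [seq ar s1 aQUE i | i <- iota 0 (rg s1 cn)].

(** Translation from flows to the set function. The reached set avoids t because the bonus Q would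
    otherwise exceed the flow value. *)
Lemma fpost_set s t s0 s1 : s <= n -> t <= n ->
 fpost n E Q D Fy Y0 RM me hd sl dg cap er y s t s0 s1 ->
 [/\ dirty t s1, clk s1 <= clk s0 + 10 + Q.+1 * cF Q D &
  (Q <= rg s1 fF /\ forall A : {set W}, inord s \in A -> inord t \notin A -> Q <= f A) \/
  (rg s1 fF < Q /\ [/\ uniq (quel s1), f (setof (quel s1)) < Q &
   ismin f (inord s) (Some (inord t)) (setof (quel s1))])].
Proof.
move=> sn tn [[S1 e1 y1 l1 ln1 dT1 dR1] F1 c1 q1 [k1 H]].
have dirt : dirty t s1.
 split=> //.
 - move=> x xn; case: H => [[_ [v _]]|[_ [hq _]]]; first by left; exact: v.
  case: (q_v hq xn) => [->|[h1 h2]]; [by left|].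
  case: (posnP (ar s1 aVIS x)) => [->|vp]; [by left|right].
  by exists (ar s1 aVIS x).-1 => //; nlia.
 - by apply: leq_trans l1 _; rewrite leq_mul2r F1 orbT.
 - move=> x xn; case: (x =P t) => [->|/eqP xt] h; [by left|right].
  by apply: dT1 => //; rewrite (negbTE xt) mul0n addn0.
split=> //.
case: H => [[eF [_ H]]|[lF [hq [H1 H2]]]]; [left|right].
 rewrite eF; split=> // A sA tA; have := H (fun x => inord x \in A) sA.
 by rewrite fR_cut // (negbTE tA) addn0.
split=> //.
have inq x : x <= n -> (x \in quel s1) = (0 < ar s1 aVIS x).
 move=> xn; apply/mapP/idP => [[i]|vp].
  by rewrite mem_iota => hi ->; have [_ ->] := q_n hq hi.
 case: (q_v hq xn) => [e|[h1 h2]]; first by rewrite e in vp.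
 by exists (ar s1 aVIS x).-1 => //; rewrite mem_iota /= add0n; nlia.
have eS x : x <= n -> (inord x \in setof (quel s1)) = (0 < ar s1 aVIS x).
 by move=> xn; rewrite inE /= inordK // inq.
have fS : f (setof (quel s1)) + (inord t \in setof (quel s1)) * Q = rg s1 fF.
 by rewrite -fR_cut // -H1; apply: fR_ext.
have tS : inord t \notin setof (quel s1).
 by apply/negP => h; move: fS; rewrite h; nlia.
have {}fS : f (setof (quel s1)) = rg s1 fF by rewrite -fS (negbTE tS) addn0.
split; last split.
- rewrite /quel map_inj_in_uniq ?iota_uniq // => i j; rewrite !mem_iota !add0n => hi hj e.
 by have [_ h1] := q_n hq hi; have [_ h2] := q_n hq hj; rewrite e h2 in h1; case: h1.
- by rewrite fS.
- rewrite /sep /= tS andbT eS //; have [_] := q_n hq (q_c hq); rewrite (q_s hq) => -> //.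
move=> A; rewrite /sep /= => /andP[sA tA].
have [h1 h2] := H2 (fun x => inord x \in A) sA.
rewrite fR_cut // (negbTE tA) addn0 in h1 h2; rewrite fS; split=> // le.
apply/subsetP => x; rewrite inE => xq; have xn : val x <= n by rewrite -ltnS ltn_ord.
by have := h2 le x xn; rewrite inord_val; apply; rewrite -inq.
Qed.

Lemma ismin_uniq a r M N : ismin f a r M -> ismin f a r N -> M = N.
Proof.
move=> [m1 m2] [n1 n2]; have [h1 h2] := m2 _ n1; have [h3 h4] := n2 _ m1.
by apply/eqP; rewrite eqEsubset h2 ?h4.
Qed.

Lemma outs_n : outs n = [::].
Proof.
apply/eqP; rewrite -size_eq0 size_filter -leqn0 leqNgt -has_count; apply/negP => /hasP[a].
rewrite mem_iota add0n => al /eqP e; have := g_hd gr (rva_lt al); rewrite e; nlia.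
Qed.

(** The dummy carries neither capacity nor edges, so adding or removing it changes no cut. Hence
    minimizers that avoid it are the same as unrestricted ones, and [None] needs no separate
    code. *)
Lemma f_dummy (A : {set W}) : f (A :\ inord n) = f A.
Proof.
rewrite /f /ycut /cut; congr (_ + _).
 rewrite [RHS](big_setID [set inord n]) /= [X in _ = X + _]big1 ?add0n //.
 move=> x; rewrite !inE => /andP[_ /eqP ->]; rewrite inordK // /ResetTh.T0 outs_n big_nil (g_cap0 gr).
 by rewrite muln0.
have ne a : a < me.*2 -> (inord (hd a) == inord n :> W) = false.
 move=> al; have h := g_hd gr al; rewrite -val_eqE /= !inordK //; nlia.
by apply: eq_bigr => e _; rewrite !inE /etl /ehd !ne //; have := ltn_ord e; lia.
Qed.

Lemma ismin_dummy a M : a < n -> ismin f (inord a) (Some (inord n)) M <-> ismin f (inord a) None M.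
Proof.
move=> an; have na : (inord a == inord n :> W) = false.
 by rewrite -val_eqE /= !inordK //; nlia.
split=> -[/andP[h1 h2] h3].
 split=> [|A]; rewrite /sep ?h1 //= andbT => aA.
 have [|k1 k2] := h3 (A :\ inord n); first by rewrite /sep /= !inE na eqxx aA.
 rewrite f_dummy in k1 k2; split=> // /k2 h; apply: subset_trans h _; exact: subsetDl.
have nM' : inord n \notin M.
 have [|_ k] := h3 (M :\ inord n); first by rewrite /sep /= !inE na h1.
 by move: k; rewrite f_dummy => /(_ (leqnn _)); rewrite subsetD1 => /andP[].
split=> [|A]; first by rewrite /sep h1.
by move=> /andP[aA _]; apply: h3; rewrite /sep aA.
Qed.

Lemma fsub A B : f (A :&: B) + f (A :|: B) <= f A + f B. Proof. exact: cut_submod. Qed.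
Lemma fpos A B : f (A :\: B) + f (B :\: A) <= f A + f B. Proof. exact: cut_posimod. Qed.

Definition cCL := (10 + Q.+1 * cF Q D) + (4 * (Q + 2) + Q * (Q + 2) * (10 * D + 20) + 10 * D + 30)
  + 20 * (Q + 2) + 40.
Definition cFIND := (Q + 3) * ((Q + 3) * (cCL + 10) + 10) + cCL + 40.

Lemma clean_dirty t s1 : t <= n -> dirty t s1 -> run CLEAN s1 (fun s2 => clean y s2 /\
  clk s2 <= clk s1 + (4 * (Q + 2) + Q * (Q + 2) * (10 * D + 20) + 10 * D + 30)).
Proof.
move=> tn [S1 y1 t1 c1 q1 v1 ln1 l1 T1 R1]; have gM := g_M gr.
apply: (run_call (clean_ok es gr yb DM QM Q0 nM QL S1 y1 t1 tn q1 _ _ v1 ln1 _ T1 R1)); try nlia.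
move=> s2 [C2 k2] _; split=> //.
have : rg s1 tl * (10 * D + 20) <= Q * (Q + 2) * (10 * D + 20) by rewrite leq_mul2r l1 orbT.
by nlia.
Qed.

Definition found (s1 : st) := let l := [seq ar s1 aUL i | i <- iota 0 (rg s1 ku)] in
 [/\ rg s1 ku <= Q + 2, uniq l, (forall x, x \in l -> x <= n), f (setof l) < Q & par (setof l)].

Lemma par_list l : uniq l -> (forall x, x \in l -> x <= n) -> par (setof l) = odd (\sum_(x <- l) cap x).
Proof.
move=> ul ln; rewrite /CutsTh.par /wcap; congr odd.
have -> : \sum_(x in setof l) cap x = \sum_(x <- [seq val x | x <- enum W & x \in setof l]) cap x.
 by rewrite big_map big_filter big_enum_cond.
apply: perm_big; apply: uniq_perm => //.
 by rewrite (map_inj_uniq val_inj) filter_uniq // enum_uniq.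
move=> x; apply/mapP/idP => [[w]|xl]; first by rewrite mem_filter inE => /andP[h _] ->.
have xn := ln x xl; exists (inord x); last by rewrite /= inordK.
by rewrite mem_filter inE /= inordK // xl mem_enum.
Qed.

(** Failure to find an odd set means that all minimal minimizers for pairs from X with value below Q
    are even, which is the hypothesis of [local_even]. A set that is found has value below Q and odd
    capacity, so it is a violated constraint by [odd_viol]. *)
Lemma find_ok v s0 : v < n -> stat s0 -> ar s0 aEY = y -> clean y s0 -> rg s0 fv = v ->
 run FIND s0 (fun s1 => [/\ stat s1, clean y s1, clk s1 <= clk s0 + cFIND &
  (rg s1 fnd = 0 /\ cert f wcap Q (inord v)) \/ (rg s1 fnd = 1 /\ found s1)]).
Proof.
move=> vn S0 ey0 C0 ev0; have vN : v <= n by exact: ltnW.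
have gn := g_n gr; have gM := g_M gr.
do 3 (apply: run_sq; apply: run_asg => //=; rewrite ?ev0 ?(s_n S0); try nlia).
apply: run_sq.
set s1 := setr vT n _.
have S1 : stat s1 by do 3 (apply: stat_setr => //).
have C1 : clean y s1 by case: C0.
apply: (run_call (flow_ok es gr yb deg DM QM Q0 nM QL (ltac:(nlia) : Q + 2 <= Lm) vN (leqnn n) S1 ey0 C1 erefl erefl)).
move=> s2 /(fpost_set vN (leqnn n))[d2 k2 H2] fr2.
have {}k2 : clk s2 <= (clk s0).+3 + 10 + Q.+1 * cF Q D := k2.
have f2 : rg s2 fnd = 0 by rewrite (fr_r fr2).
apply: run_sq; apply: run_asg => //=.
pose X2 s3 := [/\ dirty n s3, rg s3 fnd = 0, clk s3 <= (clk s0).+3 + 10 + Q.+1 * cF Q D + 4 * (Q + 2) + 20, rg s3 kx <= Q + 2 &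
 (rg s3 kx = 0 /\ forall A : {set W}, inord v \in A -> inord n \notin A -> Q <= f A) \/
 (exists l, [/\ l = [seq ar s3 aXL i | i <- iota 0 (rg s3 kx)], uniq l, f (setof l) < Q,
   (forall x, x \in l -> x <= n) & ismin f (inord v) (Some (inord n)) (setof l)])].
apply: run_sq.
have post3 : run (IF vQ <=: fF THEN skip
  ELSE ((FOR ip TO cn DO aXL ~[ip] <~ aQUE`[ip]) ;; kx <~ cn)) (setr kx 0 s2) X2.
 have d2' : dirty n (setr kx 0 s2) by apply: (dirty_eq d2) => //; apply: stat_setr => //; case: d2.
 have cn2 := d_c d2; have SS := d_st d2.
 apply: run_ite => //=; rewrite (s_Q SS) => hF.
  apply: run_asg => //=; split=> //=.
  - apply: (dirty_eq d2') => //; apply: stat_setr => //; apply: stat_tick; exact: (d_st d2').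
  - by nlia.
  - by left; split=> //; case: H2 => [[]//|[h]]; nlia.
 apply: run_sq.
 apply: (@run_for _ _ _ (fun k s3 => [/\ dirty n s3, rg s3 fnd = 0, rg s3 cn = rg s2 cn, ar s3 aQUE = ar s2 aQUE &
   (forall i, i < k -> ar s3 aXL i = ar s2 aQUE i) /\ clk s3 <= clk s2 + 5 + 3 * k]) (rg s2 cn)) => //.
 - by nlia.
 - by move=> k s3 [_ _ e _ _] _ /=.
 - split=> //=; last by split=> //; nlia.
  by apply: (dirty_eq d2') => //; do ?[apply: stat_setr => //|apply: stat_tick]; exact: (d_st d2').
 - move=> k s3 kc [d3 f3 e3 q3 [x3 c3]] ek.
  have qk := d_q d3 (ltac:(rewrite e3; exact: kc) : k < rg s3 cn).
  apply: run_put => //=; rewrite ?ek; [by split=> //; nlia|nlia|nlia|].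
  split=> //=; last first.
   split; last by nlia.
   by move=> i; rewrite ltnS leq_eqVlt; case: eqP => [->|_ /= hi]; rewrite ?q3 // x3.
  by apply: (dirty_eq d3) => //; do ?[apply: stat_setr => //|apply: stat_seta => //|apply: stat_tick]; exact: (d_st d3).
 move=> s3 [d3 f3 e3 q3 [x3 c3]] ek; apply: run_asg => //=; first by rewrite e3; nlia.
 split=> //=; [|by nlia|by rewrite e3; nlia|right].
  by apply: (dirty_eq d3) => //; do ?[apply: stat_setr => //|apply: stat_seta => //|apply: stat_tick]; exact: (d_st d3).
 exists (quel s2); case: H2 => [[h]|[_ [u2 l2 m2]]]; first by nlia.
 split=> //.
  rewrite /quel e3; apply/eq_in_map => i; rewrite mem_iota => /andP[_ hi]; rewrite x3 //.
 by move=> x /mapP[i]; rewrite mem_iota => /andP[_ hi] ->; apply: (d_q d2).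
apply: (run_call post3) => s3 [d3 f3 k3 x3 H3] fr3.
apply: run_sq; apply: (run_call (clean_dirty (leqnn n) d3)) => s4 [C4 k4] fr4.
have S4 : stat s4 by apply: stat_frame fr4 _ _ (d_st d3).
have kx4 : rg s4 kx = rg s3 kx by rewrite (fr_r fr4).
have xl4 : ar s4 aXL = ar s3 aXL by rewrite (fr_a fr4).
have y4 : ar s4 aEY = y by rewrite (fr_a fr4) // (d_y d3).
apply: run_sq; apply: run_put => //=; rewrite ?kx4 ?(s_n S4); [nlia|nlia|].
set kX := rg s3 kx.
pose XL := updf (ar s4 aXL) kX n.
have XLn i : i <= kX -> (i < kX -> ar s3 aXL i <= n) -> XL i <= n.
 by move=> hi h; rewrite /XL /=; case: eqP => // ne; rewrite xl4; apply: h; rewrite ltn_neqAle hi andbT; exact/eqP.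
have kX2 : kX <= Q + 2 := x3.
have Xn i : i <= kX -> XL i <= n.
 move=> hi; apply: XLn => // hi'; case: H3 => [[e _]|[l [el _ _ ln _]]]; first by rewrite /kX e in hi'.
 by apply: ln; rewrite el; apply/mapP; exists i => //; rewrite mem_iota.
pose Pev a t := forall M, ismin f (inord a) (Some (inord t)) M -> f M < Q -> ~~ par M.
pose J s5 := [/\ stat s5, ar s5 aEY = y, clean y s5, rg s5 kx = kX & ar s5 aXL = XL].
have cEQ : 0 < cCL by rewrite /cCL; nlia.
apply: (@run_for _ _ _ (fun a s5 => [/\ J s5, clk s5 <= clk s4 + 5 + a * ((Q + 3) * (cCL + 10) + 10) &
  (rg s5 fnd = 0 /\ forall i j, i < a -> j <= kX -> Pev (XL i) (XL j)) \/ (rg s5 fnd = 1 /\ found s5)]) kX) => //.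
- by nlia.
- by move=> k s5 [[_ _ _ e _] _ _] _ /=.
- split=> /=; [|by nlia|by left; rewrite (fr_r fr4)].
 have J1 : stat (setr 52 0 (seta 18 kX n s4)) by do ?[apply: stat_setr => //|apply: stat_seta => //|apply: stat_tick].
 by split=> //=; case: C4.
- move=> a s5 ak [J5 k5 H5] ea.
 apply: (@run_for _ _ _ (fun b s6 => [/\ J s6, rg s6 ia = a, clk s6 <= clk s5 + 5 + b * (cCL + 5) &
  (rg s6 fnd = 0 /\ (forall i j, i < a -> j <= kX -> Pev (XL i) (XL j)) /\ forall j, j < b -> Pev (XL a) (XL j)) \/ (rg s6 fnd = 1 /\ found s6)]) kX.+1) => //.
 + by nlia.
 + by move=> k s6 [[_ _ _ e _] _ _ _] _ /=; rewrite e addn1.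
 + case: J5 => a1 a2 a3 a4 a5; split=> //=; [|by nlia|].
   by split=> //=; do ?[apply: stat_setr => //|apply: stat_tick].
  by case: H5 => [[h1 h2]|h]; [left|right].
 + move=> b s6 bk [[S6 y6 C6 x6 l6] ia6 k6 H6] eb.
  have [hb bK] : b <= kX /\ b < Lm by split=> //; nlia.
  have [ha aK] : a <= kX /\ a < Lm by split; nlia.
  apply: run_ite => //= f6; last first.
   apply: run_asg => //=; split=> //=; [|by nlia|].
    by split=> //=; do ?[apply: stat_setr => //|apply: stat_tick].
   by case: H6 => [[h _]|h]; [nlia|right].
  have {H6}[_ [P6 P6']] : rg s6 fnd = 0 /\ (forall i j, i < a -> j <= kX -> Pev (XL i) (XL j)) /\ forall j, j < b -> Pev (XL a) (XL j).
   by case: H6 => // -[h]; nlia.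
  apply: run_sq; apply: run_asg => //=; rewrite ?ia6 ?l6; [by split=> //; nlia|by have := Xn a ha; nlia|].
  apply: run_sq; apply: run_asg => //=; rewrite ?eb ?l6; [by split=> //; nlia|by have := Xn b hb; nlia|].
  apply: run_sq; set s7 := setr vT _ _.
  have S7 : stat s7 by do ?[apply: stat_setr => //|apply: stat_tick].
  have C7 : clean y s7 by case: C6.
  apply: (run_call (flow_ok es gr yb deg DM QM Q0 nM QL (ltac:(nlia) : Q + 2 <= Lm) (Xn a ha) (Xn b hb) S7 y6 C7 erefl erefl)).
  move=> s8 /(fpost_set (Xn a ha) (Xn b hb))[d8 k8 H8] fr8.
  have {}k8 : clk s8 <= clk s6 + 14 + Q.+1 * cF Q D by move: k8; rewrite /s7 /=; nlia.
  have S8 := d_st d8; have cn8 := d_c d8.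
  pose Post s9 := [/\ dirty (XL b) s9, [/\ rg s9 ia = a, rg s9 ib = b, rg s9 kx = kX & ar s9 aXL = XL], clk s9 <= clk s8 + 7 * (Q + 2) + 30 &
    (rg s9 fnd = 0 /\ Pev (XL a) (XL b)) \/ (rg s9 fnd = 1 /\ found s9)].
  have keep8 : [/\ rg s8 ia = a, rg s8 ib = b, rg s8 kx = kX & ar s8 aXL = XL].
   by split; rewrite ?(fr_r fr8) ?(fr_a fr8).
  have fn8 : rg s8 fnd = 0 by rewrite (fr_r fr8) //=; nlia.
  apply: run_sq.
  have post9 : run (IF vQ <=: fF THEN skip ELSE (
      vpar <~ #0 ;;
      (FOR ip TO cn DO vpar <~ vpar + aCAP`[aQUE`[ip]]) ;;
      WHEN #1 <=: (odd_ vpar) DO (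
       fnd <~ #1 ;; ku <~ cn ;;
       FOR ip TO cn DO aUL ~[ip] <~ aQUE`[ip]))) s8 Post.
   case: keep8 => i8 j8 x8 l8.
   apply: run_ite => //=; rewrite (s_Q S8) => hF.
    apply: run_asg => //=; split=> //=; [|by nlia|left; split=> //].
     by apply: (dirty_eq d8) => //; do ?[apply: stat_setr => //|apply: stat_tick].
    move=> M [/andP[/= m1 m2] _] fM; case: H8 => [[_ h]|[h _]]; last by nlia.
    by have := h M m1 m2; nlia.
   case: H8 => [[h _]|[_ [u8 l8' m8]]]; first by nlia.
   apply: run_sq; apply: run_asg => //=; apply: run_sq.
   have dd8 s9 : rg s9 vT = rg s8 vT -> rg s9 cn = rg s8 cn -> rg s9 tl = rg s8 tl -> stat s9 ->
     ar s9 aEY = ar s8 aEY -> ar s9 aQUE = ar s8 aQUE -> ar s9 aVIS = ar s8 aVIS ->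
     ar s9 aTL = ar s8 aTL -> ar s9 aT = ar s8 aT -> ar s9 aRC = ar s8 aRC -> dirty (XL b) s9.
    by move=> *; apply: (dirty_eq d8).
   (* A reached vertex has capacity at most its sink capacity, hence at most the cut value, which is
      below Q. This keeps the capacity sum whose parity is tested within a word. *)
   have capq i : i < rg s8 cn -> cap (ar s8 aQUE i) <= Q * E.
    move=> hi; have qn : ar s8 aQUE i <= n by apply: (d_q d8).
    have xin : inord (ar s8 aQUE i) \in setof (quel s8).
     by rewrite inE /= inordK //; apply/mapP; exists i => //; rewrite mem_iota.
    have : T0 y (ar s8 aQUE i) <= f (setof (quel s8)).
     rewrite /f /ycut /cut (bigD1 (inord (ar s8 aQUE i))) //= inordK //.
     by rewrite -!addnA leq_addr.
    have := T0_ge deg DM QM Q0 nM QL (ltac:(nlia) : Q + 2 <= Lm) qn; have : Q <= Q * E by rewrite leq_pmulr.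
    by nlia.
   apply: (@run_for _ _ _ (fun k s9 => [/\ dirty (XL b) s9, [/\ rg s9 ia = a, rg s9 ib = b, rg s9 kx = kX & ar s9 aXL = XL],
     rg s9 cn = rg s8 cn /\ rg s9 fnd = 0, ar s9 aQUE = ar s8 aQUE &
     rg s9 vpar = \sum_(x <- [seq ar s8 aQUE i | i <- iota 0 k]) cap x /\ clk s9 <= clk s8 + 5 + 3 * k]) (rg s8 cn)) => //.
   * by nlia.
   * by move=> k s9 [_ _ [e _] _ _] _ /=.
   * split=> //=; [|by split=> //; rewrite ?big_nil; nlia].
    by apply: dd8 => //; do ?[apply: stat_setr => //|apply: stat_tick].
   * move=> k s9 kc [d9 kp9 [e9 f9] q9 [p9 c9]] ek9.
    have qk : ar s8 aQUE k <= n by apply: (d_q d8).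
    have S9 := d_st d9.
    have ib : \sum_(x <- [seq ar s8 aQUE i | i <- iota 0 k]) cap x <= (Q + 2) * (Q * E).
     rewrite big_map; apply: leq_trans (_ : \sum_(i <- iota 0 k) Q * E <= _).
      by rewrite big_seq [X in _ <= X]big_seq; apply: leq_sum => i; rewrite mem_iota => hi; apply: capq; lia.
     by rewrite big_const_seq count_predT size_iota iter_addn_0 mulnC leq_mul2r; apply/orP; right; nlia.
    have := capq k kc => ck.
    apply: run_asg => //=; rewrite ?ek9 ?q9 ?p9 ?(s_cap S9); [by split=> //; split=> //; nlia|nlia|].
    split=> //=; [|split; last by nlia].
     by apply: (dirty_eq d9) => //; do ?[apply: stat_setr => //|apply: stat_tick].
    rewrite -[ar s8 16 0 :: _]/([seq ar s8 16 i | i <- iota 0 k.+1]).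
    by rewrite -[k.+1]addn1 iotaD map_cat big_cat /= big_cons big_nil addn0.
   move=> s9 [d9 kp9 [e9 f9] q9 [p9 c9]] ek9.
   have S9 := d_st d9.
   have ln8 x : x \in quel s8 -> x <= n.
    by move=> /mapP[i]; rewrite mem_iota => /andP[_ hi] ->; apply: (d_q d8).
   have pq : par (setof (quel s8)) = odd (rg s9 vpar) by rewrite par_list // p9.
   apply: run_ite => //=; rewrite ev_odd => od; last first.
    apply: run_asg => //=; split=> //=; [|by nlia|left; split=> //].
     by apply: (dirty_eq d9) => //; do ?[apply: stat_setr => //|apply: stat_tick].
    by move=> M mM _; rewrite (ismin_uniq mM m8) pq; case: odd od.
   apply: run_sq; apply: run_asg => //=; first by nlia.
   apply: run_sq; apply: run_asg => //=; first by rewrite e9; nlia.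
   rewrite e9.
   apply: (@run_for _ _ _ (fun k s3 => [/\ dirty (XL b) s3, [/\ rg s3 ia = a, rg s3 ib = b, rg s3 kx = kX & ar s3 aXL = XL],
    [/\ rg s3 cn = rg s8 cn, rg s3 fnd = 1 & rg s3 ku = rg s8 cn], ar s3 aQUE = ar s8 aQUE &
    (forall i, i < k -> ar s3 aUL i = ar s8 aQUE i) /\ clk s3 <= clk s9 + 10 + 3 * k]) (rg s8 cn)) => //.
   * by nlia.
   * by move=> k s3' [_ _ [e _ _] _ _] _ /=.
   * split=> //=; last by split=> //; nlia.
    by apply: (dirty_eq d9) => //; do ?[apply: stat_setr => //|apply: stat_tick].
   * move=> k s3' kc [d3' kp3 [e3 f3' u3] q3 [x3' c3]] ek.
    have qk : ar s8 aQUE k <= n by apply: (d_q d8).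
    apply: run_put => //=; rewrite ?ek ?q3; [by split=> //; nlia|nlia|nlia|].
    split=> //=; last first.
     split; last by nlia.
     by move=> i; rewrite ltnS leq_eqVlt; case: eqP => [->|_ /= hi] //; rewrite x3'.
    by apply: (dirty_eq d3') => //; do ?[apply: stat_setr => //|apply: stat_seta => //|apply: stat_tick]; exact: (d_st d3').
   move=> s3' [d3' kp3 [e3 f3' u3] q3 [x3' c3]] ek; split=> //=; [|by nlia|right; split=> //].
    by apply: (dirty_eq d3') => //; do ?[apply: stat_setr => //|apply: stat_tick]; exact: (d_st d3').
   rewrite /found /= u3.
   have -> : [seq ar s3' aUL i | i <- iota 0 (rg s8 cn)] = quel s8.
    by apply/eq_in_map => i; rewrite mem_iota => /andP[_ hi]; rewrite x3'.
   by split=> //; rewrite pq; case: odd od.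
  apply: (run_call post9) => s9 [d9 [i9 j9 x9 l9] k9 H9] fr9.
  apply: (run_call (clean_dirty (Xn b hb) d9)) => sA [CA kA] frA.
  have SA : stat sA by apply: stat_frame frA _ _ (d_st d9).
  split=> //=; first split=> //=; rewrite ?(fr_a frA) ?(fr_r frA) //.
  * by apply: stat_setr.
  * exact: (d_y d9).
  * by move: k8 k9 kA k6; rewrite /= mulSn /cCL; nlia.
  * case: H9 => [[h1 h2]|[h1 h2]]; [left; split=> //; split=> //|right].
    by move=> j; rewrite ltnS leq_eqVlt => /orP[/eqP->|]; [|exact: P6'].
   by split=> //; move: h2; rewrite /found /= !(fr_a frA) // !(fr_r frA).
 move=> s6 [J6 ia6 k6 H6] _; split=> /=.
 + case: J6 => a1 a2 a3 a4 a5; split=> //=; do ?[apply: stat_setr => //|apply: stat_tick] => //.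
 + have : kX.+1 * (cCL + 5) <= (Q + 3) * (cCL + 5) by rewrite leq_mul2r; apply/orP; right; nlia.
  by rewrite mulSn; move: k5 k6 => /=; nlia.
 + case: H6 => [[h1 [h2 h3]]|h]; [left; split=> // i j|by right].
  by rewrite ltnS leq_eqVlt => /orP[/eqP->|]; [move=> hj; exact: h3|exact: h2].
move=> s5 [[S5 y5 C5 x5 l5] k5 H5] _; split=> //=; first exact: stat_tick.
 have : kX * ((Q + 3) * (cCL + 10) + 10) <= (Q + 3) * ((Q + 3) * (cCL + 10) + 10) by rewrite leq_mul2r; apply/orP; right; nlia.
 rewrite /cFIND; set G := _ * (_ * _ + 10) => hG.
 have eC : cCL = (10 + Q.+1 * cF Q D) + (4 * (Q + 2) + Q * (Q + 2) * (10 * D + 20) + 10 * D + 30) + 20 * (Q + 2) + 40 by [].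
 by move: k3 k4 k5; nlia.
case: H5 => [[h1 h2]|h]; [left; split=> //|by right].
case: H3 => [[_ h]|[l [el ul fl ln ml]]].
 left=> A vA; rewrite -f_dummy; apply: h; rewrite !inE ?eqxx // vA andbT.
 by rewrite -val_eqE /= !inordK //; nlia.
right; exists (setof l); have ml' := proj1 (ismin_dummy _ vn) ml; split=> //.
have nl : n \notin l.
 by have [/andP[_ h] _] := ml; move: h; rewrite /= inE /= inordK.
have inl a : a \in setof l -> exists i, [/\ i < kX, XL i = a & (a : nat) < n].
 rewrite inE => al; have := al; rewrite {1}el => /mapP[i]; rewrite mem_iota add0n => /andP[_ hi] e.
 exists i; split=> //; first by rewrite /XL /= xl4; case: eqP => // ei; rewrite ei in hi; move: hi; rewrite /kX; nlia.
 have := ln _ al; rewrite leq_eqVlt => /orP[/eqP e'|//]; by rewrite -e' al in nl.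
(* The forbidden vertex is either a point of X or [None]; the latter is the pair whose second end is
   the dummy at index kX. *)
apply: (local_even fsub fpos _ ml') => a r M /inl[i [ik ei an]] hr mM fM.
case: r hr mM => [d|_] mM'.
 have [j [jk ej _]] := inl d mM' => mM; have := h2 i j ik (ltnW jk); rewrite ei ej /Pev !inord_val; exact.
have := h2 i kX ik (leqnn _); rewrite ei /XL /= eqxx /Pev inord_val => H; apply: (H M _ fM).
by have := proj2 (@ismin_dummy (val a) M an); rewrite inord_val; apply.
Qed.

End FixY.
End Find.

End FindTh.

(** * Lowering the loads of a violated constraint *)

Module BumpTh.
Import Defs MachineTh HoareTh CutsTh InnerCodeTh ResetTh SearchTh PushTh FlowTh FindTh.
Section Bump.
Variables (Lm M0 : nat) (es : seq (nat * nat * nat)).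
Variables (n E Q D Fy Y0 RM me : nat) (hd sl dg cap er : nat -> nat).
Notation run := (run Lm M0 es).
Notation outs := (outs me hd).
Notation stat := (stat n E Q D Fy Y0 RM me hd sl dg cap er).
Notation graph := (graph Lm M0 n E Q D me hd sl dg cap).
Notation T0 := (T0 Q Fy me hd cap).
Notation yq := (yq Q Fy).
Notation clean := (clean n Q Fy me hd cap).
Notation W := 'I_n.+1.
Notation etl := (etl n hd). Notation ehd := (ehd n hd).
Notation ycut := (ycut n Q Fy me hd cap).
Notation wcap := (wcap cap).
Notation par := (par wcap).
Notation found := (found n Q Fy me hd cap).
Hypothesis gr : graph.

(** Mostly room in words and arrays. The condition [me * Y0 <= Fy] has content: all loads below Y0
    together amount to at most one unit of capacity. *)
Record pars : Prop := Pars {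
 p_DM : D * (Q * E) <= M0; p_QM : Q * E + Q * E <= M0; p_Q0 : 0 < Q; p_nM : n.+2 <= M0;
 p_QL : Q * (Q + 2) <= Lm; p_Q2L : Q + 3 <= Lm; p_cM : (Q + 2) * (Q * E) + Q * E <= M0;
 p_E0 : 1 < E; p_er : forall e, e < me -> 0 < er e <= RM;
 p_Fy : 0 < Fy; p_Y0 : 0 < Y0; p_meF : me * Y0 <= Fy;
 p_RM : (2 * E * Fy) * (RM + Q + D + 1) + E * RM <= M0; p_DL : (Q + 2) * D <= Lm;
 p_capF : forall x, x <= n -> cap x * Fy + 1 <= M0 }.
Hypothesis pp : pars.

Definition bstep (l : seq nat) (y y' : nat -> nat) : Prop := exists a,
 [/\ forall e, e \in l -> Y0 <= y e -> a <= er e,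
   a = RM \/ (exists e, [/\ e \in l, Y0 <= y e & a = er e]) &
   forall e, y' e = if (e \in l) && (Y0 <= y e)
            then y e - (y e * a + E * er e - 1) %/ (E * er e) else y e].

Definition load (y : nat -> nat) x := \sum_(a <- outs x) y a./2.

Definition constr (l : seq nat) (k : nat) : Prop :=
 [/\ uniq l, forall e, e \in l -> e < me &
  (exists2 v, v < n & k = cap v /\ forall e, e < me -> (e \in l) = (hd e.*2 == v) || (hd e.*2.+1 == v)) \/
  (exists2 A : {set W}, par A & k = (\sum_(x in A) wcap x)./2 /\
   forall e, e < me -> (e \in l) = (inord (hd e.*2) \in A) && (inord (hd e.*2.+1) \in A))].

Definition viol (l : seq nat) (y : nat -> nat) := exists2 k, constr l k & k * Fy < \sum_(e <- l) y e.

Inductive bumps (y : nat -> nat) : nat -> (nat -> nat) -> Prop :=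
| bumps0 : bumps y 0 y
| bumpsS k l y1 y2 of bumps y k y1 & viol l y1 & bstep l y1 y2 : bumps y k.+1 y2.

Lemma bumps_trans y1 k y2 k' y3 : bumps y1 k y2 -> bumps y2 k' y3 -> bumps y1 (k + k') y3.
Proof.
move=> h; elim=> [|k1 l y4 y5 _ IH v b]; first by rewrite addn0.
by rewrite addnS; apply: bumpsS v b.
Qed.

Lemma bstep_le l y y' e : bstep l y y' -> y' e <= y e.
Proof. by case=> a [_ _ ->]; case: ifP => // _; exact: leq_subr. Qed.

Lemma bumps_le y k y' e : bumps y k y' -> y' e <= y e.
Proof. by elim=> // k1 l y1 y2 _ IH _ b; exact: leq_trans (bstep_le e b) IH. Qed.

(** Both ends of an edge in l have capacity at least 1. A star through it has k at least 1, and an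
    odd set containing it has total capacity at least 2, so its half is at least 1. *)
Lemma constr_pos l k y : constr l k -> 0 < \sum_(e <- l) y e -> 0 < k.
Proof.
case=> ul lm H s0.
have [e el] : exists e, e \in l by case: l s0 {ul lm H} => [|e l]; [rewrite big_nil|exists e; rewrite inE eqxx].
have em := lm e el.
have e2 : e.*2 < me.*2 by lia. have e3 : e.*2.+1 < me.*2 by lia.
case: H => [[v vn [-> h]]|[A pA [-> h]]].
 by move: el; rewrite h // => /orP[] /eqP <-; [have := g_cap gr e2|have := g_cap gr e3] => /andP[].
have /andP[a1 a2] : (inord (hd e.*2) \in A) && (inord (hd e.*2.+1) \in A) by rewrite -h.
have h1 := g_hd gr e2; have h2 := g_hd gr e3.
have ne : inord (hd e.*2) != inord (hd e.*2.+1) :> W.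
 have := g_nl gr e2; rewrite /rva odd_double => ne.
 rewrite -val_eqE /= !inordK; [by rewrite eq_sym|nlia|nlia].
rewrite (bigD1 (inord (hd e.*2))) //= (bigD1 (inord (hd e.*2.+1))) /=; last by rewrite a2 eq_sym.
have c1 := g_cap gr e2; have c2 := g_cap gr e3.
by rewrite /FindTh.wcap !inordK; nlia.
Qed.

(** Loads below Y0 sum to at most me Y0, hence to at most Fy, which does not exceed a positive
    capacity k Fy. *)
Lemma viol_big l y : viol l y -> exists2 e, e \in l & Y0 <= y e.
Proof.
case=> k c h; have k0 := constr_pos c (leq_ltn_trans (leq0n _) h).
case: c => ul lm _.
case/boolP: (has (fun e => Y0 <= y e) l) => [/hasP[e el h1]|/hasPn hn]; first by exists e.
have : \sum_(e <- l) y e <= size l * Y0.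
 rewrite -sum1_size big_distrl /= big_seq [X in _ <= X]big_seq; apply: leq_sum => e /hn.
 by rewrite mul1n -ltnNge => /ltnW.
have : size l <= me.
 have := uniq_leq_size ul (_ : {subset l <= iota 0 me}); rewrite size_iota; apply.
 by move=> e /lm; rewrite mem_iota.
move=> h1 h2; have : size l * Y0 <= me * Y0 by rewrite leq_mul2r h1 orbT.
have := p_meF pp; have : Fy <= k * Fy by rewrite leq_pmull.
by nlia.
Qed.

(** Variant of both repair loops: rounding up makes every lowered load drop by at least one. *)
Lemma bump_sum l y y' : (forall e, e \in l -> e < me) -> (exists2 e, e \in l & Y0 <= y e) ->
 bstep l y y' -> \sum_(e < me) y' e < \sum_(e < me) y e.
Proof.
move=> lm [e el ye] b; have [a [h1 h2 h3]] := b.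
have em := lm e el.
rewrite (bigD1 (Ordinal em)) //= [X in _ < X](bigD1 (Ordinal em)) //=.
rewrite -addSn; apply: leq_add; last by apply: leq_sum => i _; exact: bstep_le b.
have /andP[r0 rM] := p_er pp em; have p1 := p_E0 pp; have p2 := p_Y0 pp.
rewrite h3 el ye /=.
have Er : 0 < E * er e by rewrite muln_gt0 r0; nlia.
have a0 : 0 < a.
 case: h2 => [->|[e' [el' _ ->]]]; first by nlia.
 by have /andP[] := p_er pp (lm _ el').
have : 0 < (y e * a + E * er e - 1) %/ (E * er e).
 by rewrite divn_gt0 //; have : 0 < y e * a by [rewrite muln_gt0; nlia]; nlia.
nlia.
Qed.

Lemma bump_ok s l y : stat s -> ar s aEY = y -> [seq ar s aBL i | i <- iota 0 (rg s kb)] = l ->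
 uniq l -> (forall e, e \in l -> e < me) -> rg s kb <= Lm -> rg s vRM = RM ->
 (forall e, e < me -> y e <= 2 * E * Fy) ->
 run BUMP s (fun s' => bstep l y (ar s' aEY) /\ clk s' <= clk s + 12 * rg s kb + 20).
Proof.
move=> S0 ey el ul lm kL eR yM.
have gn := g_n gr; have gM := g_M gr; have gm := g_m gr; have pR := p_RM pp.
have nl i : i < rg s kb -> ar s aBL i \in l.
 by move=> h; rewrite -el; apply/mapP; exists i => //; rewrite mem_iota.
have nle i : i < rg s kb -> ar s aBL i < me by move=> /nl /lm.
have yR e : e < me -> y e * RM + E * RM + y e <= M0.
 move=> /yM h; have : y e * RM <= (2 * E * Fy) * RM by rewrite leq_mul2r h orbT.
 have : (2 * E * Fy) * (RM + Q + D + 1) = (2 * E * Fy) * RM + (2 * E * Fy) * (Q + D) + 2 * E * Fy by lia.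
 by nlia.
have RMM : RM <= M0 by have := p_E0 pp; have : RM <= E * RM by [rewrite leq_pmull; have := p_E0 pp; nlia]; nlia.
apply: run_sq; apply: run_asg => //=; first by rewrite eR.
apply: run_sq.
apply: (@run_for _ _ _ (fun k s1 => [/\ stat s1, ar s1 aEY = y, ar s1 aBL = ar s aBL /\ rg s1 kb = rg s kb,
  (forall i, i < k -> Y0 <= y (ar s aBL i) -> rg s1 am <= er (ar s aBL i)) /\
  (rg s1 am = RM \/ exists i, [/\ i < k, Y0 <= y (ar s aBL i) & rg s1 am = er (ar s aBL i)]) &
  clk s1 <= clk s + 5 + 6 * k]) (rg s kb)) => //.
- by nlia.
- by move=> k s1 [_ _ [_ e] _ _] _ /=.
- split=> //=; [by do ?[apply: stat_setr => //|apply: stat_tick]|by split=> //; left|by nlia].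
- move=> k s1 kc [S1 y1 [b1 e1] [m1 m2] c1] ek.
 have hl := nle k kc; have hM := yR _ hl; have hr := p_er pp hl.
 apply: run_sq; apply: run_asg => //=; rewrite ?ek ?b1; [by split=> //; nlia|nlia|].
 apply: run_ite => //=; rewrite ?y1 ?(s_Y0 S1); [by split=> //; nlia| |].
  move=> hy; apply: run_ite => //=; rewrite ?(s_er S1); [by split=> //; nlia| |].
   move=> ha; apply: run_asg => //=; rewrite ?(s_er S1); [by split=> //; nlia|nlia|].
   split=> //=; [by do ?[apply: stat_setr => //|apply: stat_tick]| |by nlia].
   split; last by right; exists k; split=> //; nlia.
   move=> i; rewrite ltnS leq_eqVlt => /orP[/eqP->//|h] h'; exact: leq_trans ha (m1 i h h').
  move=> ha; apply: run_asg => //=.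
  split=> //=; [by do ?[apply: stat_setr => //|apply: stat_tick]| |by nlia].
  split; last by case: m2 => [|[i [i1 i2 i3]]]; [left|right; exists i; split=> //; nlia].
  move=> i; rewrite ltnS leq_eqVlt => /orP[/eqP-> _|h] ; [by nlia|exact: m1].
 move=> hy; apply: run_asg => //=.
 split=> //=; [by do ?[apply: stat_setr => //|apply: stat_tick]| |by nlia].
 split; last by case: m2 => [|[i [i1 i2 i3]]]; [left|right; exists i; split=> //; nlia].
 move=> i; rewrite ltnS leq_eqVlt => /orP[/eqP->|h] ; [by nlia|exact: m1].
move=> s1 [S1 y1 [b1 e1] [m1 m2] c1] _.
set a := rg s1 am in m1 m2.
have aR : a <= RM by case: m2 => [->|[i [i1 _ ->]]] //; have /andP[] := p_er pp (nle _ i1).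
pose nw e := y e - (y e * a + E * er e - 1) %/ (E * er e).
apply: (@run_for _ _ _ (fun k s2 => [/\ stat s2, rg s2 am = a, ar s2 aBL = ar s aBL /\ rg s2 kb = rg s kb,
  forall e, ar s2 aEY e = if (e \in take k l) && (Y0 <= y e) then nw e else y e &
  clk s2 <= clk s1 + 5 + 6 * k]) (rg s kb)) => //.
- by nlia.
- by move=> k s2 [_ _ [_ e] _ _] _ /=.
- split=> //=; [by do ?[apply: stat_setr => //|apply: stat_tick]| |by nlia].
 by move=> e; rewrite take0 y1.
- move=> k s2 kc [S2 a2 [b2 e2] y2 c2] ek.
 have sz : size l = rg s kb by rewrite -el size_map size_iota.
 have hl := nle k kc; have hM := yR _ hl; have hr := p_er pp hl.
 have [e ee] : exists e, e = ar s aBL k by eexists.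
 rewrite -ee in hl hM hr.
 have nk : nth 0 l k = e by rewrite -el (nth_map 0) ?size_iota // nth_iota //= -ee.
 have tk : take k.+1 l = rcons (take k l) e by rewrite (take_nth 0) ?sz // nk.
 have ne : e \notin take k l.
  have : uniq (take k.+1 l) by exact: take_uniq.
  by rewrite tk rcons_uniq => /andP[].
 have ye : ar s2 aEY e = y e by rewrite y2 (negbTE ne).
 have yE : y e * a + E * er e <= M0.
  have : y e * a <= y e * RM by rewrite leq_mul2l aR orbT.
  have : E * er e <= E * RM by rewrite leq_mul2l; apply/orP; right; nlia.
  by nlia.
 apply: run_sq; apply: run_asg => //=; rewrite ?ek ?b2 -?ee; [by split=> //; nlia|nlia|].
 apply: run_ite => //=; rewrite ?ye ?(s_Y0 S2); [by split=> //; nlia| |].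
  move=> hy; apply: run_put => //=; rewrite ?ye ?(s_E S2) ?(s_er S2) ?a2; [by do !split=> //; nlia|nlia|by apply: leq_trans (leq_subr _ _) _; nlia|].
  split=> //=; [by do ?[apply: stat_setr => //|apply: stat_seta => //|apply: stat_tick]| |by nlia].
  move=> e'; case: eqP => [->|/eqP ne'].
   by rewrite tk mem_rcons inE eqxx hy.
  by rewrite y2 tk mem_rcons inE (negbTE ne').
 move=> hy; apply: run_asg => //=.
 split=> //=; [by do ?[apply: stat_setr => //|apply: stat_seta => //|apply: stat_tick]| |by nlia].
 move=> e'; rewrite y2 tk mem_rcons inE; case: eqP => [->|//] /=.
 by rewrite (negbTE ne) /= leqNgt hy.
move=> s2 [S2 a2 [b2 e2] y2 c2] _; split; last by move: c1 c2 => /=; nlia.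
have sz : size l = rg s kb by rewrite -el size_map size_iota.
exists a; split.
- move=> e; rewrite -el => /mapP[i]; rewrite mem_iota => /andP[_ hi] ->; exact: m1.
- case: m2 => [->|[i [i1 i2 i3]]]; [by left|right].
 by exists (ar s aBL i); split=> //; exact: nl.
- by move=> e; rewrite /= y2 -sz take_size.
Qed.

End Bump.

End BumpTh.

(** * Odd set constraints as odd cuts of value below Q *)

Module BumpSetTh.
Import Defs MachineTh HoareTh CutsTh InnerCodeTh ResetTh SearchTh PushTh FlowTh FindTh BumpTh.
Section Inner.
Variables (Lm M0 : nat) (es : seq (nat * nat * nat)).
Variables (n E Q D Fy Y0 RM me : nat) (hd sl dg cap er : nat -> nat).
Notation run := (run Lm M0 es).
Notation outs := (outs me hd).
Notation stat := (stat n E Q D Fy Y0 RM me hd sl dg cap er).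
Notation graph := (graph Lm M0 n E Q D me hd sl dg cap).
Notation T0 := (T0 Q Fy me hd cap).
Notation yq := (yq Q Fy).
Notation clean := (clean n Q Fy me hd cap).
Notation W := 'I_n.+1.
Notation etl := (etl n hd). Notation ehd := (ehd n hd).
Notation ycut := (@ycut n Q Fy me hd cap).
Notation wcap := (wcap cap).
Notation par := (par wcap).
Notation found := (found n Q Fy me hd cap).
Notation pars := (pars Lm M0 n E Q D Fy Y0 RM me cap er).
Notation bstep := (bstep E Y0 RM er).
Notation load := (load me hd).
Notation constr := (constr n me hd cap).
Notation viol := (viol n Fy me hd cap).
Notation bumps := (bumps n E Fy Y0 RM me hd cap er).
Hypothesis gr : graph.
Hypothesis pp : pars.

Definition stars y := forall x, x <= n -> load y x <= cap x * Fy.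
Definition small y := forall e, e < me -> y e <= 2 * E * Fy.
Definition inside (A : {set W}) (e : 'I_me) := (etl e \in A) && (ehd e \in A).

Lemma le_load y a : a < me.*2 -> y a./2 <= load y (hd a).
Proof.
move=> al; have h := rva_lt al.
rewrite /BumpTh.load big_filter -[X in iota 0 X]subn0 big_mkord (bigD1 (Ordinal h)) /= ?rvaK //.
by rewrite rva_half leq_addr.
Qed.

Lemma stars_y y e : stars y -> e < me -> y e <= E * Fy.
Proof.
move=> st em; have h : e.*2 < me.*2 by lia.
have := le_load y h; rewrite doubleK => h1; apply: (leq_trans h1).
apply: (leq_trans (st _ (hd_le gr h))); rewrite leq_mul2r.
by have /andP[_ ->] := g_cap gr h; rewrite orbT.
Qed.

Lemma stars_small y : stars y -> small y.
Proof.
move=> st e em; apply: (leq_trans (stars_y st em)).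
by rewrite -mulnA leq_pmull.
Qed.

Lemma yq_le y e B : y e <= B * Fy -> yq y e <= Q * B.
Proof.
move=> h; have F0 := p_Fy pp.
apply: (@leq_trans (B * Fy * Q %/ Fy)); first by apply: leq_div2r; rewrite leq_mul2r h orbT.
by rewrite -mulnA (mulnC Fy) mulnA mulnK // mulnC.
Qed.

Lemma stars_yb y : stars y -> forall e, e < me -> yq y e <= Q * E.
Proof. by move=> st e em; apply: yq_le; exact: stars_y. Qed.

Lemma stars_deg y : stars y -> forall x, x <= n -> \sum_(a <- outs x) yq y a./2 <= Q * cap x.
Proof.
move=> st x xn; have F0 := p_Fy pp.
rewrite -(leq_pmul2r F0) big_distrl /=.
apply: (@leq_trans (load y x * Q)).
 rewrite /BumpTh.load big_distrl /=; apply: leq_sum => a _; exact: leq_trunc_div.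
by rewrite (mulnC Q) mulnAC leq_mul2r (st x xn) orbT.
Qed.

Lemma stars_le y y' : (forall e, y' e <= y e) -> stars y -> stars y'.
Proof. by move=> h st x /st; apply: leq_trans; apply: leq_sum. Qed.

Lemma small_le y y' : (forall e, y' e <= y e) -> small y -> small y'.
Proof. by move=> h st x /st; apply: leq_trans. Qed.

Lemma sum_outs (A : {set W}) (g : nat -> nat) :
 \sum_(x in A) \sum_(a <- outs x) g a./2 = \sum_(e < me) ((etl e \in A) + (ehd e \in A)) * g e.
Proof.
have -> : \sum_(x in A) \sum_(a <- outs x) g a./2 =
  \sum_(x in A) \sum_(a < me.*2) (hd (rva a) == x) * g a./2.
 apply: eq_bigr => x _; rewrite big_filter.
 rewrite -[X in iota 0 X]subn0 big_mkord big_mkcond; apply: eq_bigr => i _.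
 by case: eqP; rewrite ?mul1n.
rewrite exchange_big /=.
have -> : \sum_(a < me.*2) \sum_(x in A) (hd (rva a) == x) * g a./2 =
  \sum_(a < me.*2) (inord (hd (rva a)) \in A) * g a./2.
 apply: eq_bigr => a _; have hl := hd_le gr (rva_lt (ltn_ord a)).
 case/boolP: (inord (hd (rva a)) \in A) => hA.
  rewrite (bigD1 (inord (hd (rva a)))) //= inordK // eqxx big1 ?addn0 // => x /andP[_ /eqP ne].
  by case: eqP => // e; case: ne; apply: val_inj; rewrite /= inordK // e.
 rewrite big1 // => x xA; case: eqP => // e; case/negP: hA; rewrite e inord_val //.
rewrite (sum_double me (fun a => (inord (hd (rva a)) \in A) * g a./2)); apply: eq_bigr => e _.
have h2 : (e.*2.+1)./2 = e by lia.
by rewrite rva_double rva_doubleS doubleK h2 -mulnDl.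
Qed.

(** Summing degrees over A counts inner edges twice and crossing edges once. For a total capacity
    2k+1 the cut is below Q exactly when the rounded load inside A exceeds (Q+1) k, that is, when it
    violates the odd set constraint relaxed by the factor 1 + 1/Q. *)
Lemma ycut_in y (A : {set W}) : stars y ->
 ycut y A + 2 * \sum_(e < me | inside A e) yq y e = (Q + 1) * \sum_(x in A) wcap x.
Proof.
move=> st; rewrite /FindTh.ycut /cut.
have h1 : \sum_(x in A) T0 y x + \sum_(x in A) \sum_(a <- outs x) yq y a./2 = (Q + 1) * \sum_(x in A) wcap x.
 rewrite -big_split big_distrr /=; apply: eq_bigr => x _; rewrite /ResetTh.T0 subnK //.
 have xn : x <= n by rewrite -ltnS ltn_ord.
 by have := stars_deg st xn; rewrite /FindTh.wcap mulnDl; nlia.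
rewrite -h1 -addnA; congr (_ + _); rewrite sum_outs [X in _ + 2 * X]big_mkcond /=.
rewrite big_distrr -big_split /=; apply: eq_bigr => e _; rewrite /inside.
by case: (_ \in A) => /=; case: (_ \in A) => /=; lia.
Qed.

Lemma sum_inside l (A : {set W}) (g : nat -> nat) : uniq l -> (forall e, e \in l -> e < me) ->
 (forall e, e < me -> (e \in l) = (inord (hd e.*2) \in A) && (inord (hd e.*2.+1) \in A)) ->
 \sum_(e <- l) g e = \sum_(e < me | inside A e) g e.
Proof.
move=> ul lm h.
have -> : \sum_(e < me | inside A e) g e = \sum_(e <- [seq e <- iota 0 me | e \in l]) g e.
 rewrite big_filter -[X in iota 0 X]subn0 big_mkord; apply: eq_bigl => e.
 by rewrite h // /inside andbC.
apply: perm_big; apply: uniq_perm => //; first by rewrite filter_uniq ?iota_uniq.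
by move=> e; rewrite mem_filter mem_iota; case/boolP: (e \in l) => // /lm ->.
Qed.

(** Loads are rounded down in the network, so an excess seen there is an excess of the true
    loads. *)
Lemma odd_viol y l (A : {set W}) : stars y -> uniq l -> (forall e, e \in l -> e < me) ->
 (forall e, e < me -> (e \in l) = (inord (hd e.*2) \in A) && (inord (hd e.*2.+1) \in A)) ->
 par A -> ycut y A < Q -> viol l y.
Proof.
move=> st ul lm h pA fA; exists (\sum_(x in A) wcap x)./2; first by split=> //; right; exists A.
have F0 := p_Fy pp; have Q0 := p_Q0 pp.
have := ycut_in A st; move: pA; rewrite /CutsTh.par => od.
rewrite -{1}(odd_double_half (\sum_(x in A) wcap x)) od; set k := _./2 => eS.
rewrite (sum_inside _ ul lm h).
have s1 : k * Q < \sum_(e < me | inside A e) yq y e.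
 move: eS; set S := \sum_(_ < _ | _) _; rewrite mulnDr mulnDl -(mul2n k) mulnCA mulnDl; nlia.
have s2 : (\sum_(e < me | inside A e) yq y e) * Fy <= (\sum_(e < me | inside A e) y e) * Q.
 by rewrite !big_distrl; apply: leq_sum => e _; exact: leq_trunc_div.
rewrite -(ltn_pmul2r Q0) mulnAC; apply: leq_trans s2; by rewrite ltn_pmul2r.
Qed.

(** What the certificates guarantee: the odd set capacity relaxed by 1 + 1/Q, plus one rounding unit
    Fy/Q for each inner edge. With Q = E^3 both relaxations are far below eps for the small odd sets
    that need this bound. *)
Definition goody y := stars y /\ forall A : {set W}, par A ->
 Q * \sum_(e < me | inside A e) y e <=
  Fy * ((Q + 1) * (\sum_(x in A) wcap x)./2 + \sum_(e < me | inside A e) 1).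

Lemma certs_goody y : stars y -> (forall v : W, cert (ycut y) wcap Q v) -> goody y.
Proof.
move=> st ce; split=> // A pA.
have hA : Q <= ycut y A.
 rewrite leqNgt; apply/negP => h; have := cert_even (@fsub n Q Fy me hd cap y) (@fpos n Q Fy me hd cap y) ce h.
 by rewrite pA.
have F0 := p_Fy pp; have := ycut_in A st; move: (pA); rewrite /CutsTh.par => od.
rewrite -{1}(odd_double_half (\sum_(x in A) wcap x)) od; set k := _./2 => eS.
have s1 : \sum_(e < me | inside A e) yq y e <= (Q + 1) * k.
 move: eS; set S := \sum_(_ < _ | _) _; rewrite mulnDr mulnDl -(mul2n k) mulnCA mulnDl; nlia.
apply: (@leq_trans (\sum_(e < me | inside A e) Fy * (yq y e + 1))).
 rewrite big_distrr /=; apply: leq_sum => e _; rewrite mulnC mulnDr muln1 mulnC /ResetTh.yq.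
 by have := ltn_ceil (y e * Q) F0; rewrite (mulnC Q) (mulnC Fy) mulSn; move: (_ %/ _) => q; nlia.
rewrite -big_distrr /= leq_mul2l big_split /= leq_add2r s1 orbT //.
Qed.

Definition cBS := (Q + 2) * (40 * D + 80) + 80.

(** Keeping only even arcs lists every inner edge once. *)
Definition eins (u : seq nat) (x : nat) := [seq a <- outs x | (hd a \in u) && ~~ odd a].

Lemma eins_uniq u v : uniq v -> uniq [seq a./2 | a <- flatten [seq eins u x | x <- v]].
Proof.
move=> uv; rewrite map_inj_in_uniq; last first.
 move=> a b /flattenP[sa /mapP[x _ ->]] ha /flattenP[sb /mapP[x' _ ->]] hb.
 move: ha hb; rewrite !mem_filter => /andP[/andP[_ oa] _] /andP[/andP[_ ob] _].
 by move=> e; rewrite -(odd_double_half a) -(odd_double_half b) e (negbTE oa) (negbTE ob).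
elim: v uv => //= x v IH /andP[xv uv]; rewrite cat_uniq IH // andbT !filter_uniq ?iota_uniq //=.
apply/hasPn => a /flattenP[s /mapP[x' x'v ->]]; rewrite /eins !mem_filter => /and3P[_ /eqP ea _].
by apply/negP => /and3P[_ /eqP e2 _]; move: xv; rewrite -e2 ea x'v.
Qed.

Lemma eins_mem u v e : (forall x, x \in v -> x \in u) -> e < me ->
 (e \in [seq a./2 | a <- flatten [seq eins u x | x <- v]]) = (hd e.*2 \in u) && (hd e.*2.+1 \in v).
Proof.
move=> vu em; apply/mapP/andP => [[a /flattenP[s /mapP[x xv ->]]]|[h1 h2]].
 rewrite /eins !mem_filter => /and3P[/andP[h1 h2] /eqP h3 _] ->.
 have ea : a./2.*2 = a by rewrite -{2}(odd_double_half a) (negbTE h2).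
 by rewrite ea; split=> //; move: h3; rewrite /rva (negbTE h2) => ->.
exists e.*2; rewrite ?doubleK //; apply/flattenP; exists (eins u (hd e.*2.+1)); first exact: map_f.
by rewrite !mem_filter h1 odd_double rva_double eqxx mem_iota /=; lia.
Qed.

(** A lowered load has both ends in the set, so resetting the vertices of the set makes the whole
    network agree with the new loads. [aVIS] is borrowed as a membership mark and zeroed again. *)
Lemma bumpset_ok s y : stat s -> ar s aEY = y -> stars y -> clean y s -> found y s ->
 run BUMPSET s (fun s' => [/\ stat s', exists2 l, viol l y & bstep l y (ar s' aEY),
  clean (ar s' aEY) s' & clk s' <= clk s + cBS]).
Proof.
move=> S0 ey st [CT CR CV] [kQ ul ln fl pl].
have gn := g_n gr; have gM := g_M gr; have gm := g_m gr; have DL := p_DL pp; have q2 := p_Q2L pp; have nM := p_nM pp.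
set u := [seq _ | i <- _] in ul ln fl pl.
have usz : size u = rg s ku by rewrite size_map size_iota.
have unt i : i < rg s ku -> ar s aUL i = nth 0 u i by move=> h; rewrite (nth_map 0) ?size_iota // nth_iota.
have uin i : i < rg s ku -> nth 0 u i \in u by move=> h; rewrite mem_nth // usz.
have uln i : i < rg s ku -> nth 0 u i <= n by move=> /uin /ln.
have [kL kM] : rg s ku <= Lm /\ rg s ku <= M0 by split; nlia.
move: usz unt uin uln kQ kL kM; have [c ec] : exists c, c = rg s ku by eexists.
rewrite -ec => usz unt uin uln kQ kL kM.
apply: run_sq.
apply: (@run_for _ _ _ (fun k s1 => [/\ stat s1, ar s1 aEY = y, rg s1 ku = c /\ ar s1 aUL = ar s aUL,
  [/\ ar s1 aT = ar s aT, ar s1 aRC = ar s aRC &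
  forall x, x <= n -> ar s1 aVIS x = (x \in take k u)] & clk s1 <= clk s + 5 + 3 * k]) c) => //.
- by move=> k s1 [_ _ [e _] _ _] _ /=.
- split=> //=; [by do ?[apply: stat_setr => //|apply: stat_tick]| |by nlia].
 by split=> // x xn; rewrite take0 CV.
- move=> k s1 kc [S1 y1 [k1 u1] [t1 r1 v1] c1] ek.
 have hn := uln k kc.
 apply: run_put => //=; rewrite ?ek ?u1 ?unt //; [by split=> //; nlia|nlia|nlia|].
 split=> //=; [by do ?[apply: stat_setr => //|apply: stat_seta => //|apply: stat_tick]| |by nlia].
 split=> // x xn; rewrite (take_nth 0) ?usz // mem_rcons inE.
 by case: eqP => //= _; rewrite v1.
move=> s1 [S1 y1 [k1 u1] [t1 r1 v1] c1] _.
rewrite -usz take_size in v1.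
apply: run_sq; apply: run_asg => //=.
pose lst k := [seq a./2 | a <- flatten [seq eins u x | x <- take k u]].
have lsz k : size (lst k) <= k * D.
 rewrite /lst size_map; elim: k => [|k IH]; first by rewrite take0.
 case: (ltnP k (size u)) => hk; last first.
  have -> : take k.+1 u = take k u by rewrite !take_oversize // leqW.
  by apply: (leq_trans IH); rewrite leq_mul2r leqnSn orbT.
 rewrite (take_nth 0) // map_rcons flatten_rcons size_cat mulSnr leq_add //.
 have xn : nth 0 u k <= n by apply: ln; rewrite mem_nth.
 by rewrite /eins size_filter (leq_trans (count_size _ _)) // (size_outs gr) // (g_dg gr).
have lmax : size (lst c) <= Lm.
 apply: leq_trans (lsz _) (leq_trans _ DL); by rewrite leq_mul2r kQ orbT.
apply: run_sq.
apply: (@run_for _ _ _ (fun k s2 => [/\ stat s2, ar s2 aEY = y, rg s2 ku = c /\ ar s2 aUL = ar s aUL,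
  [/\ ar s2 aT = ar s aT, ar s2 aRC = ar s aRC, ar s2 aVIS = ar s1 aVIS, rg s2 kb = size (lst k) &
   forall i, i < size (lst k) -> ar s2 aBL i = nth 0 (lst k) i] & clk s2 <= clk s1 + 8 + k * (8 * D + 12)]) c) => //.
- by move=> k s2 [_ _ [e _] _ _] _ /=.
- have l0 : lst 0 = [::] by rewrite /lst take0.
 split=> //=; [by do ?[apply: stat_setr => //|apply: stat_tick]| |by nlia].
 by split=> //; rewrite l0.
- move=> k s2 kc [S2 y2 [k2 u2] [t2 r2 v2 b2 l2] c2] ek.
 have hn := uln k kc; have dgD := g_dg gr hn.
 have [x ex] : exists x, x = nth 0 u k by eexists.
 rewrite -ex in hn dgD.
 apply: run_sq; apply: run_asg => //=; rewrite ?ek ?u2 ?unt // -?ex; [by split=> //; nlia|nlia|].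
 pose ls j := lst k ++ [seq a./2 | a <- [seq a <- take j (outs x) | (hd a \in u) && ~~ odd a]].
 have lsk : lst k.+1 = ls (dg x).
  by rewrite /ls -(size_outs gr hn) take_size /lst (take_nth 0) ?usz // map_rcons flatten_rcons map_cat -ex.
 have lspre j : j <= dg x -> size (ls j) <= size (lst k.+1).
  move=> jd; rewrite lsk /ls !size_cat !size_map leq_add2l !size_filter.
  by rewrite -(size_outs gr hn) take_size -[X in _ <= count _ X](cat_take_drop j) count_cat leq_addr.
 have lk1 : size (lst k.+1) <= Lm.
  apply: leq_trans (lsz _) (leq_trans _ DL); rewrite leq_mul2r; apply/orP; right; nlia.
 apply: (@run_for _ _ _ (fun j s3 => [/\ stat s3, ar s3 aEY = y, [/\ rg s3 ku = c, ar s3 aUL = ar s aUL & rg s3 rx = x],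
  [/\ ar s3 aT = ar s aT, ar s3 aRC = ar s aRC, ar s3 aVIS = ar s1 aVIS, rg s3 kb = size (ls j) &
   forall i, i < size (ls j) -> ar s3 aBL i = nth 0 (ls j) i] & clk s3 <= clk s2 + 5 + 7 * j]) (dg x)) => //.
 + by have := slot_lt gr hn; have := g_D gr; nlia.
 + move=> j s3 [S3 _ [_ _ e] _ _] _ /=; rewrite e (s_dg S3); split=> //; split=> //; nlia.
 + have l0 : ls 0 = lst k by rewrite /ls take0 cats0.
  split=> //=; [by do ?[apply: stat_setr => //|apply: stat_tick]| |by nlia].
  by split=> //; rewrite l0.
 + move=> j s3 jd [S3 y3 [k3 u3 x3] [t3 r3 v3 b3 l3] c3] ej.
  have sL := slot_lt gr hn jd; have sin := slot_in gr hn jd.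
  have [a ea] : exists a, a = sl (x * D + j) by eexists.
  rewrite -ea in sin; have al := outs_lt sin; have hn' := hd_le gr al.
  have eS : ls j.+1 = if (hd a \in u) && ~~ odd a then rcons (ls j) a./2 else ls j.
   rewrite /ls (take_nth 0) ?(size_outs gr) // -(slot gr) // -ea filter_rcons.
   by case: ifP => _; rewrite ?map_rcons -?rcons_cat.
  have szj := lspre j.+1 jd.
  apply: run_sq; apply: run_asg => //=; rewrite ?x3 ?ej ?(s_D S3) ?(s_sl S3) -?ea; [by split=> //; nlia|nlia|].
  have vv : ar s3 aVIS (hd a) = (hd a \in u) by rewrite v3 v1.
  apply: run_ite => //=; rewrite ?(s_hd S3) ?vv; [by do !split=> //; nlia| |].
   move=> h1; apply: run_ite => //=; rewrite ev_odd => h2.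
    have hh : (hd a \in u) && ~~ odd a by move: h1 h2; case: (_ \in u) => //; case: odd.
    rewrite hh in eS; rewrite eS size_rcons in szj.
    apply: run_sq; apply: run_put => //=; rewrite ?b3; [nlia|by rewrite divn2; nlia|].
    apply: run_asg => //=; rewrite ?b3; first by nlia.
    split=> //=; [by do ?[apply: stat_setr => //|apply: stat_seta => //|apply: stat_tick]| |by nlia].
    split=> //; rewrite eS size_rcons; first by rewrite addn1.
    move=> i; rewrite ltnS leq_eqVlt nth_rcons => /orP[/eqP->|h]; first by rewrite eqxx ltnn divn2.
    by rewrite h l3 //; case: eqP => // e; rewrite e ltnn in h.
   have hh : (hd a \in u) && ~~ odd a = false by move: h2; case: odd; rewrite ?andbF.
   rewrite hh in eS; apply: run_asg => //=.
   split=> //=; [by do ?[apply: stat_setr => //|apply: stat_seta => //|apply: stat_tick]| |by nlia].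
   by split=> //; rewrite eS.
  move=> h1; have hh : (hd a \in u) && ~~ odd a = false by move: h1; case: (_ \in u).
  rewrite hh in eS; apply: run_asg => //=.
  split=> //=; [by do ?[apply: stat_setr => //|apply: stat_seta => //|apply: stat_tick]| |by nlia].
  by split=> //; rewrite eS.
 move=> s3 [S3 y3 [k3 u3 x3] [t3 r3 v3 b3 l3] c3] _; split=> //=.
 + by do ?[apply: stat_setr => //|apply: stat_tick].
 + by split=> //; rewrite lsk.
 + by move: c3; rewrite mulSn; nlia.
move=> s2 [S2 y2 [k2 u2] [t2 r2 v2 b2 l2] c2] _.
have lc : lst c = [seq a./2 | a <- flatten [seq eins u x | x <- u]] by rewrite /lst -usz take_size.
have ulst : uniq (lst c) by rewrite lc eins_uniq.
have lme e : e \in lst c -> e < me.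
 by rewrite lc => /mapP[a /flattenP[s' /mapP[x _ ->]]]; rewrite mem_filter => /andP[_ /outs_lt h] ->; lia.
have lmem e : e < me -> (e \in lst c) = (hd e.*2 \in u) && (hd e.*2.+1 \in u) by move=> em; rewrite lc eins_mem.
apply: run_sq.
have S2' : stat (tick s2) by exact: stat_tick.
apply: (run_call (bump_ok es gr pp (s := tick s2) (l := lst c) S2' y2 _ ulst lme _ _ (stars_small st))) => //=.
- apply: (@eq_from_nth _ 0); first by rewrite size_map size_iota b2.
 by move=> i; rewrite size_map size_iota => hi; rewrite (nth_map 0) ?size_iota // nth_iota // l2 // -b2.
- by rewrite b2.
- exact: (s_RM S2).
move=> s3 [B3 c3] fr3.
have S3 : stat s3 by apply: stat_frame fr3 _ _ S2'.
have y'le e : ar s3 aEY e <= y e by apply: bstep_le B3.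
have st' : stars (ar s3 aEY) by apply: stars_le st.
have y'out e : e < me -> ~~ ((hd e.*2 \in u) && (hd e.*2.+1 \in u)) -> ar s3 aEY e = y e.
 by move=> em h; case: B3 => a [_ _ ->]; rewrite lmem // (negbTE h).
have [k3 u3 t3 r3 v3] : [/\ rg s3 ku = c, ar s3 aUL = ar s aUL, ar s3 aT = ar s aT, ar s3 aRC = ar s aRC & ar s3 aVIS = ar s1 aVIS].
 by rewrite !(fr_r fr3) ?(fr_a fr3).
have c3' : clk s3 <= clk s2 + 12 * (c * D) + 21.
 by move: c3; rewrite /= b2; have := lsz c; nlia.
set y' := ar s3 aEY in y'le st' y'out B3 *.
apply: run_sq.
apply: (@run_for _ _ _ (fun k s4 => [/\ stat s4, ar s4 aEY = y', rg s4 ku = c /\ ar s4 aUL = ar s aUL,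
  [/\ ar s4 aT = ar s aT, ar s4 aRC = ar s aRC &
  forall x, x <= n -> ar s4 aVIS x = (x \in u) && (x \notin take k u)] & clk s4 <= clk s3 + 5 + 3 * k]) c) => //.
- by move=> k s4 [_ _ [e _] _ _] _ /=.
- split=> //=; [by do ?[apply: stat_setr => //|apply: stat_tick]| |by nlia].
 by split=> // x xn; rewrite take0 v3 v1 // andbT.
- move=> k s4 kc [S4 y4 [k4 u4] [t4 r4 v4] c4] ek.
 have hn := uln k kc.
 apply: run_put => //=; rewrite ?ek ?u4 ?unt //; [by split=> //; nlia|nlia|].
 split=> //=; [by do ?[apply: stat_setr => //|apply: stat_seta => //|apply: stat_tick]| |by nlia].
 split=> // x xn; rewrite (take_nth 0) ?usz // mem_rcons inE negb_or.
 by case: eqP => //= [->|_]; rewrite ?andbF // v4.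
move=> s4 [S4 y4 [k4 u4] [t4 r4 v4] c4] _.
apply: (@run_for _ _ _ (fun k s5 => [/\ stat s5, ar s5 aEY = y', rg s5 ku = c /\ ar s5 aUL = ar s aUL,
  [/\ forall x, x <= n -> ar s5 aT x = if x \in take k u then T0 y' x else T0 y x,
    forall a, a < me.*2 -> ar s5 aRC a = if (hd a \in take k u) || (hd (rva a) \in take k u) then yq y' a./2 else yq y a./2 &
    forall x, x <= n -> ar s5 aVIS x = 0] & clk s5 <= clk s4 + 5 + k * (10 * D + 15)]) c) => //.
- by move=> k s5 [_ _ [e _] _ _] _ /=.
- split=> //=; [by do ?[apply: stat_setr => //|apply: stat_tick]| |by nlia].
 split; [by move=> x xn; rewrite take0 t4 CT|by move=> a al; rewrite take0 r4 CR|].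
 by move=> x xn; rewrite v4 // -usz take_size andbN.
- move=> k s5 kc [S5 y5 [k5 u5] [t5 r5 v5] c5] ek.
 have hn := uln k kc.
 apply: run_sq; apply: run_asg => //=; rewrite ?ek ?u5 ?unt //; [by split=> //; nlia|nlia|].
 have S6 : stat (setr ru (nth 0 u k) (tick s5)) by do ?[apply: stat_setr => //|apply: stat_tick].
 have p1 := p_QM pp.
 apply: (run_call (reset_ok es gr (y := y') S6 hn y5 (stars_yb st') (p_DM pp) _)); first by nlia.
 move=> s6 [t6 r6 c6] fr6; have {}c6 : clk s6 <= (clk s5).+2 + (10 * D + 10) := c6.
 split=> //=.
 + by apply: stat_setr => //; apply: stat_frame fr6 _ _ S6.
 + by rewrite (fr_a fr6).
 + by rewrite (fr_a fr6) // (fr_r fr6).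
 + have v6 : ar s6 aVIS = ar s5 aVIS by rewrite (fr_a fr6).
  rewrite v6; split=> //.
   move=> x xn; rewrite t6 /= (take_nth 0) ?usz // mem_rcons inE.
   by case: eqP => //= _; rewrite t5.
  move=> a al; rewrite r6 //= (take_nth 0) ?usz // !mem_rcons !inE r5 //.
  by case: (hd a == _) => //=; case: (hd (rva a) == _); rewrite ?orbT.
 + by move: c6; rewrite mulSn; nlia.
move=> s5 [S5 y5 [k5 u5] [t5 r5 v5] c5] _.
rewrite -usz take_size in t5 r5; rewrite /= y5.
have eqy a : a < me.*2 -> ~~ ((hd a \in u) && (hd (rva a) \in u)) -> y' a./2 = y a./2.
 move=> al h; apply: y'out; first by lia.
 have [b eb] : exists b, a = b.*2 \/ a = b.*2.+1 by exists a./2; have := odd_double_half a; case: (odd a) => /=; lia.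
 case: eb h => -> /=; rewrite ?rva_double ?rva_doubleS ?doubleK ?uphalf_double //.
 by rewrite andbC.
split=> //=; first exact: stat_tick.
- exists (lst c) => //; apply: (odd_viol (A := setof n u) st) => // e em.
 have e2 : e.*2 < me.*2 by lia. have e3 : e.*2.+1 < me.*2 by lia.
 rewrite lmem // !inE /= !inordK //; exact: (hd_le gr).
- split=> //.
 + move=> x xn; rewrite /= t5 //; case: ifP => // xu; rewrite /ResetTh.T0; congr (_ - _).
  rewrite big_seq [RHS]big_seq; apply: eq_bigr => a ain.
  rewrite /ResetTh.yq eqy //; first exact: (outs_lt ain).
  by rewrite (outs_tl ain) xu andbF.
 + move=> a al; rewrite /= r5 //; case: ifP => // h; rewrite /ResetTh.yq eqy //.
  by move: h; case: (hd a \in u).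
- rewrite /cBS.
 have h1 : c * D <= (Q + 2) * D by rewrite leq_mul2r kQ orbT.
 have h2 : c * (8 * D + 12) <= (Q + 2) * (8 * D + 12) by rewrite leq_mul2r kQ orbT.
 have h3 : c * (10 * D + 15) <= (Q + 2) * (10 * D + 15) by rewrite leq_mul2r kQ orbT.
 have -> : (Q + 2) * (40 * D + 80) = (Q + 2) * (8 * D + 12) + (Q + 2) * (10 * D + 15) + 12 * ((Q + 2) * D) + (Q + 2) * (10 * D + 53) by lia.
 have : Q + 2 <= (Q + 2) * (10 * D + 53) by rewrite leq_pmulr // addnS.
 have : (Q + 2) * 53 <= (Q + 2) * (10 * D + 53) by rewrite leq_mul2l leq_addl orbT.
 by move: c1 c2 c3' c4 c5; nlia.
Qed.

End Inner.

End BumpSetTh.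

(** * The levels of the inner packing loop *)

Module LevelsTh.
Import Defs MachineTh HoareTh CutsTh InnerCodeTh ResetTh SearchTh PushTh FlowTh FindTh BumpTh BumpSetTh.
Section Levels.
Variables (Lm M0 : nat) (es : seq (nat * nat * nat)).
Variables (n E Q D Fy Y0 RM me : nat) (hd sl dg cap er : nat -> nat).
Notation run := (run Lm M0 es).
Notation outs := (outs me hd).
Notation stat := (stat n E Q D Fy Y0 RM me hd sl dg cap er).
Notation graph := (graph Lm M0 n E Q D me hd sl dg cap).
Notation T0 := (T0 Q Fy me hd cap).
Notation yq := (yq Q Fy).
Notation clean := (clean n Q Fy me hd cap).
Notation W := 'I_n.+1.
Notation etl := (etl n hd). Notation ehd := (ehd n hd).
Notation ycut := (@ycut n Q Fy me hd cap).
Notation wcap := (wcap cap).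
Notation par := (par wcap).
Notation found := (found n Q Fy me hd cap).
Notation pars := (pars Lm M0 n E Q D Fy Y0 RM me cap er).
Notation bstep := (bstep E Y0 RM er).
Notation load := (load me hd).
Notation constr := (constr n me hd cap).
Notation viol := (viol n Fy me hd cap).
Notation bumps := (bumps n E Fy Y0 RM me hd cap er).
Hypothesis gr : graph.
Hypothesis pp : pars.

Notation stars := (stars n Fy me hd cap).
Notation small := (small E Fy me).
Notation inside := (@inside n me hd).
Notation goody := (goody n Q Fy me hd cap).
Notation cBS := (cBS Q D).
Notation cFIND := (cFIND Q D).

(** No search starts from the dummy, yet [cert_even] wants a certificate for every vertex: its
    singleton costs 0, is therefore the minimal minimizer, and is even. *)
Lemma cert_dummy y : stars y -> cert (ycut y) wcap Q (inord n).
Proof.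
move=> st; right; exists [set inord n].
have fd B : ycut y (B :\ inord n) = ycut y B.
 exact: (f_dummy Fy gr y (p_DM pp) (p_QM pp) (p_Q0 pp) (p_nM pp) (p_QL pp) (p_Q2L pp) (p_cM pp) (ltnW (p_E0 pp))).
have f0 : ycut y [set inord n] = 0.
 rewrite -fd setDv /FindTh.ycut /cut big_set0 add0n big1 // => e _; by rewrite !inE.
split.
 split=> [|A /andP[nA _]]; first by rewrite /sep inE eqxx.
 by rewrite f0; split=> // _; rewrite sub1set.
move=> A An _; rewrite /CutsTh.par.
have -> : \sum_(x in A) wcap x = 0; last by [].
rewrite big1 // => x /(subsetP An); rewrite inE => /eqP ->.
by rewrite /FindTh.wcap inordK // (g_cap0 gr).
Qed.

(** By [ycut_in], lowering the loads adds to the cut twice the rounded load lost inside A, which is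
    monotone in A. One scan over the vertices therefore suffices although later vertices still cause
    repairs. *)
Lemma cert_le y y' v : stars y -> (forall e, y' e <= y e) -> cert (ycut y) wcap Q v -> cert (ycut y') wcap Q v.
Proof.
move=> st le; have st' : stars y' by exact: (stars_le le).
pose g (A : {set W}) := 2 * \sum_(e < me | inside A e) (yq y e - yq y' e).
have yl e : yq y' e <= yq y e by apply: leq_div2r; rewrite leq_mul2r le orbT.
apply: (cert_mono (g := g) (@fsub n Q Fy me hd cap y) (@fsub n Q Fy me hd cap y')).
 move=> A; have h1 := ycut_in gr pp A st; have h2 := ycut_in gr pp A st'.
 rewrite -h1 in h2; rewrite /g.
 have e1 : \sum_(e < me | inside A e) (yq y e - yq y' e) + \sum_(e < me | inside A e) yq y' e = \sum_(e < me | inside A e) yq y e.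
  by rewrite -big_split /=; apply: eq_bigr => e _; rewrite subnK.
 by nlia.
move=> A B AB; rewrite leq_mul2l /= [X in X <= _]big_mkcond [X in _ <= X]big_mkcond; apply: leq_sum => e _.
case: ifP => // /andP[h1 h2]; by rewrite /BumpSetTh.inside (subsetP AB _ h1) (subsetP AB _ h2).
Qed.

(** All searches except the last are followed by a bump, so k bumps cost k+1 searches. The time of a
    level is thus charged to its vertices and to its bumps. *)
Lemma findbump_ok s y v : stat s -> ar s aEY = y -> stars y -> clean y s -> rg s fv = v -> v < n ->
 run FINDBUMP s (fun s' => exists k, [/\ stat s', bumps y k (ar s' aEY), clean (ar s' aEY) s',
  cert (ycut (ar s' aEY)) wcap Q (inord v) & clk s' <= clk s + 5 + k.+1 * (cFIND + cBS + 5)]).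
Proof.
move=> S0 ey st C0 ev vn.
apply: run_sq; apply: run_asg => //=; first by have := p_nM pp; nlia.
apply: (@run_whl _ _ _ (fun s1 => exists k, [/\ stat s1, bumps y k (ar s1 aEY), clean (ar s1 aEY) s1,
  rg s1 fv = v & (rg s1 go3 = 1 /\ clk s1 <= clk s + 1 + k * (cFIND + cBS + 5)) \/
   (rg s1 go3 = 0 /\ cert (ycut (ar s1 aEY)) wcap Q (inord v) /\ clk s1 <= clk s + 1 + k.+1 * (cFIND + cBS + 5))])
  (fun s1 => (\sum_(e < me) ar s1 aEY e).*2 + rg s1 go3)).
 exists 0; split=> //=; [by apply: stat_setr|by rewrite ey; exact: bumps0|by rewrite ey; case: C0|by left; split=> //; nlia].
move=> s1 [k [S1 B1 C1 v1 H1]]; split=> //=; last first.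
 case: H1 => [[h _]|[h [ce c1]]]; first by nlia.
 move=> _; exists k; split=> //=; [exact: stat_tick|by nlia].
case: H1 => [[g1 c1]|[g1 _]] h1; last by nlia.
have st1 : stars (ar s1 aEY) by apply: (stars_le _ st) => e; exact: (bumps_le e B1).
have S1' : stat (tick s1) by exact: stat_tick.
apply: run_sq.
apply: (run_call (find_ok es gr (stars_yb gr pp st1) (stars_deg pp st1) (p_DM pp) (p_QM pp) (p_Q0 pp) (p_nM pp) (p_QL pp) (p_Q2L pp) (p_cM pp)
  (ltnW (p_E0 pp)) vn S1' erefl _ v1)); first by case: C1.
move=> s2 [S2 C2 c2 H2] fr2; have {}c2 : clk s2 <= (clk s1).+1 + cFIND := c2.
have y2 : ar s2 aEY = ar s1 aEY by rewrite (fr_a fr2).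
have g2 : rg s2 go3 = 1 by rewrite (fr_r fr2).
have v2 : rg s2 fv = v by rewrite (fr_r fr2).
apply: run_ite => //= h2.
 apply: run_asg => //=; split; last by rewrite y2 g1; nlia.
 case: H2 => [[f2 ce]|[f2 _]]; last by nlia.
 exists k; split=> //=; [by do ?[apply: stat_setr => //|apply: stat_tick]|by rewrite y2|by rewrite y2; case: C2|right].
 by split=> //; rewrite y2; split=> //; rewrite mulSn; nlia.
case: H2 => [[f2 _]|[f2 F2]]; first by nlia.
have S2' : stat (tick s2) by exact: stat_tick.
have y2' : ar (tick s2) aEY = ar s1 aEY by [].
apply: (run_call (bumpset_ok es gr pp S2' y2' st1 _ F2)); first by case: C2.
move=> s3 [S3 [l vl bl] C3 c3] fr3; have {}c3 : clk s3 <= (clk s2).+1 + cBS := c3.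
have g3 : rg s3 go3 = 1 by rewrite (fr_r fr3).
split.
 exists k.+1; split=> //; [exact: (bumpsS B1 vl bl)|by rewrite (fr_r fr3)|left; split=> //].
 by rewrite mulSn; nlia.
have lm e : e \in l -> e < me by case: vl => kk [_ h _] _; exact: h.
by have h := bump_sum pp lm (viol_big gr pp vl) bl; rewrite g3 g1 !addn1 ltnS ltn_double.
Qed.

Lemma load_ok s y : stat s -> ar s aEY = y -> small y -> rg s sv <= n ->
 run LOAD s (fun s' => rg s' sL = load y (rg s sv) /\ clk s' <= clk s + 10 + 4 * D).
Proof.
move=> S0 ey sm; have [v ev] : exists v, v = rg s sv by eexists.
rewrite -ev => vn.
have gn := g_n gr; have gM := g_M gr; have gm := g_m gr; have pR := p_RM pp; have nM := p_nM pp.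
have dgD := g_dg gr vn; have dL := g_D gr.
apply: run_sq; apply: run_asg => //=.
have DL : D <= Lm by apply: leq_trans dL; rewrite leq_pmull.
apply: (@run_for _ _ _ (fun k s1 => [/\ stat s1, ar s1 aEY = y, rg s1 sv = v,
  rg s1 sL = \sum_(a <- take k (outs v)) y a./2 & clk s1 <= clk s + 8 + 3 * k]) (dg v)) => //.
- by nlia.
- by move=> k s1 [S1 _ e _ _] _ /=; rewrite e (s_dg S1); split=> //; split=> //; nlia.
- by split=> //=; [do ?[apply: stat_setr => //|apply: stat_tick]|rewrite take0 big_nil|nlia].
- move=> k s1 kd [S1 y1 v1 l1 c1] ek.
 have sL' := slot_lt gr vn kd; have sin := slot_in gr vn kd.
 have [a ea] : exists a, a = sl (v * D + k) by eexists.
 rewrite -ea in sin; have al := outs_lt sin.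
 have tk : take k.+1 (outs v) = rcons (take k (outs v)) a by rewrite (take_nth 0) ?(size_outs gr) // -(slot gr) // ea.
 have sb : \sum_(b <- take k.+1 (outs v)) y b./2 <= D * (2 * E * Fy).
  apply: leq_trans (_ : \sum_(b <- take k.+1 (outs v)) 2 * E * Fy <= _).
   rewrite big_seq [X in _ <= X]big_seq; apply: leq_sum => b /mem_take /outs_lt bl; apply: sm; lia.
  rewrite big_const_seq count_predT iter_addn_0 mulnC leq_mul2r size_take (size_outs gr) //; apply/orP; right; case: ifP; nlia.
 have sM : D * (2 * E * Fy) <= M0.
  have : (2 * E * Fy) * (RM + Q + D + 1) = (2 * E * Fy) * (RM + Q + 1) + D * (2 * E * Fy) by lia.
  by nlia.
 rewrite tk big_rcons /= in sb.
 apply: run_asg => //=; rewrite ?v1 ?ek ?(s_D S1) ?(s_sl S1) ?y1 ?divn2 -?ea ?l1; [|by nlia|].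
  by do !split=> //; lia.
 split=> //=; [by do ?[apply: stat_setr => //|apply: stat_tick]|by rewrite tk big_rcons|by nlia].
move=> s1 [S1 y1 v1 l1 c1] _ /=.
by rewrite l1 -(size_outs gr vn) take_size; split=> //; nlia.
Qed.

Definition cST := 30 * D + 60.

Lemma star_constr v : v < n -> constr [seq a./2 | a <- outs v] (cap v).
Proof.
move=> vn; split.
- rewrite map_inj_in_uniq ?filter_uniq ?iota_uniq // => a b ha hb eq.
 have al := outs_lt ha; have bl := outs_lt hb; have t1 := outs_tl ha; have t2 := outs_tl hb.
 have [//|ne] := eqVneq a b.
 have e : b = rva a.
  move: (odd_double_half a) (odd_double_half b); rewrite -eq /rva; move/eqP: ne.
  by case: (odd a); case: (odd b) => /=; lia.
 by have := g_nl gr al; rewrite t1 -t2 e rvaK eqxx.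
- by move=> e /mapP[a /outs_lt h ->]; lia.
- left; exists v => //; split=> // e em; apply/mapP/orP => [[a]|[]/eqP h].
 + rewrite mem_filter => /andP[/eqP <- _] ->; have := odd_double_half a; rewrite /rva; case: (odd a) => /= <-.
   by left; rewrite add1n /= uphalf_double.
  by right; rewrite add0n doubleK.
 + exists e.*2.+1; rewrite /= ?uphalf_double // mem_filter rva_doubleS h eqxx mem_iota /=; lia.
 + exists e.*2; rewrite ?doubleK // mem_filter rva_double h eqxx mem_iota /=; lia.
Qed.

Lemma star_ok s y v : stat s -> ar s aEY = y -> small y -> rg s sv = v -> v < n ->
 run STAR s (fun s' => exists k, [/\ stat s', bumps y k (ar s' aEY),
  load (ar s' aEY) v <= cap v * Fy & clk s' <= clk s + k.+1 * cST]).
Proof.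
move=> S0 ey sm ev vn.
have vN : v <= n by exact: ltnW.
have gn := g_n gr; have gM := g_M gr; have gm := g_m gr; have nM := p_nM pp.
have dgD := g_dg gr vN; have dL := g_D gr; have cF := p_capF pp vN.
have DL : D <= Lm by apply: leq_trans dL; rewrite leq_pmull.
apply: run_sq.
apply: (run_call (load_ok S0 ey sm _)); first by rewrite ev.
move=> s1 [l1 c1] fr1; rewrite ev in l1.
have S1 : stat s1 by apply: stat_frame fr1 _ _ S0.
apply: (@run_whl _ _ _ (fun s2 => exists k, [/\ stat s2, bumps y k (ar s2 aEY), rg s2 sv = v,
  rg s2 sL = load (ar s2 aEY) v & clk s2 <= clk s + 10 + 4 * D + k * cST])
  (fun s2 => \sum_(e < me) ar s2 aEY e)).
 exists 0; split=> //; [|by rewrite (fr_r fr1)|by rewrite l1 (fr_a fr1) // ey|by nlia].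
 by rewrite (fr_a fr1) // ey; exact: bumps0.
move=> s2 [k [S2 B2 v2 L2 c2]]; rewrite /= v2 (s_cap S2) (s_Fy S2) L2; split=> //; [by split=> //; split=> //; nlia| |].
 move=> viol1.
 have sm2 : small (ar s2 aEY) by apply: (small_le _ sm) => e; exact: (bumps_le e B2).
 apply: run_sq.
 apply: (@run_for _ _ _ (fun j s3 => [/\ stat s3, rg s3 sv = v, ar s3 aEY = ar s2 aEY,
   (forall i, i < j -> ar s3 aBL i = nth 0 [seq a./2 | a <- outs v] i) & clk s3 <= clk s2 + 8 + 3 * j]) (dg v)) => //.
 - by nlia.
 - by move=> j s3 [S3 e _ _ _] _ /=; rewrite e (s_dg S3); split=> //; split=> //; nlia.
 - by split=> //=; [do ?[apply: stat_setr => //|apply: stat_tick]|nlia].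
 - move=> j s3 jd [S3 v3 y3 b3 c3] ej.
  have sL' := slot_lt gr vN jd; have al := outs_lt (slot_in gr vN jd).
  apply: run_put => //=; rewrite ?v3 ?ej ?(s_D S3) ?(s_sl S3) ?divn2; [by do !split=> //; nlia|nlia|by lia|].
  split=> //=; [by do ?[apply: stat_setr => //|apply: stat_seta => //|apply: stat_tick]| |by nlia].
  move=> i; rewrite ltnS leq_eqVlt; case: eqP => [-> _|_ /= h]; last exact: b3.
  by rewrite (nth_map 0) ?(size_outs gr) // -(slot gr).
 move=> s3 [S3 v3 y3 b3 c3] _.
 apply: run_sq; apply: run_asg => //=; rewrite ?v3 ?(s_dg S3); [by split=> //; nlia|nlia|].
 apply: run_sq; set s4 := setr kb _ _.
 have S4 : stat s4 by do ?[apply: stat_setr => //|apply: stat_tick].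
 have cs := star_constr vn; have [ul lm _] := cs.
 apply: (run_call (bump_ok es gr pp (l := [seq a./2 | a <- outs v]) S4 y3 _ ul lm _ _ sm2)) => //=.
 - apply: (@eq_from_nth _ 0); first by rewrite !size_map size_iota (size_outs gr).
  by move=> i; rewrite size_map size_iota => hi; rewrite (nth_map 0) ?size_iota // nth_iota // b3.
 - by nlia.
 - exact: (s_RM S3).
 move=> s5 [B5 c5] fr5.
 have S5 : stat s5 by apply: stat_frame fr5 _ _ S4.
 have v5 : rg s5 sv = v by rewrite (fr_r fr5).
 have vl : viol [seq a./2 | a <- outs v] (ar s2 aEY).
  by exists (cap v) => //; rewrite big_map; move: viol1; rewrite addn1.
 have B5' : bumps y k.+1 (ar s5 aEY) by exact: (bumpsS B2 vl B5).
 have sm5 : small (ar s5 aEY) by apply: (small_le _ sm) => e; exact: (bumps_le e B5').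
 apply: (run_call (load_ok S5 erefl sm5 _)); first by rewrite v5.
 move=> s6 [l6 c6] fr6.
 have y6 : ar s6 aEY = ar s5 aEY by rewrite (fr_a fr6).
 split.
  exists k.+1; split=> //; [by apply: stat_frame fr6 _ _ S5|by rewrite y6|by rewrite (fr_r fr6)|by rewrite l6 v5 y6|].
  have eC : cST = 30 * D + 60 by [].
  by move: c3 c5 c6 => /=; rewrite [k.+1 * _]mulSn; nlia.
 by rewrite y6; exact: (bump_sum pp lm (viol_big gr pp vl) B5).
move=> h; exists k; split=> //=; [exact: stat_tick|by nlia|].
have eC : cST = 30 * D + 60 by [].
by rewrite [k.+1 * _]mulSn; nlia.
Qed.

(** Trace of the loop on which its value is analysed: number of levels, total number of bumps,
    current loads and loads accumulated over the levels. Loads outside the me edges are left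
    unspecified. *)
Inductive levels : nat -> nat -> (nat -> nat) -> (nat -> nat) -> Prop :=
| lev0 y eb of (forall e, e < me -> y e = Y0) & (forall e, e < me -> eb e = 0) : levels 0 0 y eb
| levS l k y eb y1 k' y2 eb' of levels l k y eb & (forall e, e < me -> y1 e = y e + y e %/ E) &
  bumps y1 k' y2 & goody y2 & (forall e, e < me -> eb' e = eb e + y2 e) : levels l.+1 (k + k') y2 eb'.

Definition cLEV := 10 * me + n * (cST + 10) + (n + 1) * (10 * D + 20) + n * (cFIND + cBS + 20) + 50.

Lemma inner_ok s N : stat s -> rg s vN = N -> N <= M0 -> (forall x, x <= n -> ar s aVIS x = 0) ->
 (forall e, e < me -> ar s aEY e = Y0) -> (forall e, e < me -> ar s aEB e = 0) -> Y0 <= E * Fy ->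
 N * (E * Fy) <= M0 ->
 run INNER s (fun s' => exists k, [/\ stat s', levels N k (ar s' aEY) (ar s' aEB), forall x, x <= n -> ar s' aVIS x = 0 &
  clk s' <= clk s + 5 + N * cLEV + k * (cST + cFIND + cBS + 5)]).
Proof.
move=> S0 eN NM V0 y0 eb0 YE NE; have [E0 F0] : 0 < E /\ 0 < Fy by have := p_E0 pp; have := p_Fy pp; nlia.
have gn := g_n gr; have gM := g_M gr; have gm := g_m gr; have nM := p_nM pp; have pR := p_RM pp.
have EFM : 2 * E * Fy <= M0.
 have : 2 * E * Fy <= (2 * E * Fy) * (RM + Q + D + 1) by rewrite leq_pmulr // addn1.
 by nlia.
pose cX := cST + cFIND + cBS + 5.
apply: (@run_for _ _ _ (fun l s1 => exists k, [/\ stat s1, rg s1 vN = N, levels l k (ar s1 aEY) (ar s1 aEB),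
  (forall x, x <= n -> ar s1 aVIS x = 0) /\
   ((forall e, e < me -> ar s1 aEY e <= E * Fy) /\ (forall e, e < me -> ar s1 aEB e <= l * (E * Fy))) &
  clk s1 <= clk s + 4 + l * cLEV + k * cX]) N) => //.
- by move=> l s1 [k [_ e _ _ _]] _.
- exists 0; split=> //=; [by do ?[apply: stat_setr => //|apply: stat_tick]|exact: lev0| |by nlia].
 by split=> //; split=> e em; [rewrite y0|rewrite eb0].
- move=> l s1 lN [k [S1 n1 L1 [V1 [yb1 eb1]] c1]] el.
 set y := ar s1 aEY in L1 yb1; set eb := ar s1 aEB in L1 eb1.
 apply: run_sq.
 apply: (@run_for _ _ _ (fun j s2 => [/\ stat s2, [/\ rg s2 vN = N & rg s2 lv = l], ar s2 aEB = eb,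
   [/\ (forall x, x <= n -> ar s2 aVIS x = 0), (forall e, e < j -> ar s2 aEY e = y e + y e %/ E) &
   (forall e, j <= e -> ar s2 aEY e = y e)] & clk s2 <= clk s1 + 6 + 3 * j]) me) => //.
 + by nlia.
 + by move=> j s2 [S2 _ _ _ _] _ /=; rewrite (s_me S2).
 + by split=> //=; [do ?[apply: stat_setr => //|apply: stat_tick]|nlia].
 + move=> j s2 jm [S2 [n2 l2] e2 [V2 y2 y2'] c2] ej.
  have hy := yb1 j jm; have hd' : y j %/ E <= y j by exact: leq_div.
  apply: run_put => //=; rewrite ?ej ?(s_E S2) ?(y2' j (leqnn j)); [by do !split=> //; nlia|nlia|nlia|].
  split=> //=; [by do ?[apply: stat_setr => //|apply: stat_seta => //|apply: stat_tick]| |by nlia].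
  split=> // e; first by rewrite ltnS leq_eqVlt; case: eqP => [->|_ /= h] //; exact: y2.
  move=> h; case: eqP => [ee|_]; [by rewrite ee ltnn in h|by apply: y2'; nlia].
 move=> s2 [S2 [n2 l2] e2 [V2 y2 _] c2] _.
 set y1 := ar s2 aEY in y2.
 have sm1 : small y1.
  move=> e em; rewrite y2 //; have := yb1 e em; have : y e %/ E <= y e by exact: leq_div.
  by rewrite -mulnA; nlia.
 apply: run_sq.
 apply: (@run_for _ _ _ (fun v s3 => exists k1, [/\ stat s3, [/\ rg s3 vN = N & rg s3 lv = l], ar s3 aEB = eb /\ (forall x, x <= n -> ar s3 aVIS x = 0),
   bumps y1 k1 (ar s3 aEY) /\ (forall x, x < v -> load (ar s3 aEY) x <= cap x * Fy) & clk s3 <= clk s2 + 6 + v * (cST + 4) + k1 * cST]) n) => //.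
 + by nlia.
 + by move=> v s3 [k1 [S3 _ _ _ _]] _ /=; rewrite (s_n S3).
 + exists 0; split=> //=; [by do ?[apply: stat_setr => //|apply: stat_tick]|by split=> //; exact: bumps0|by nlia].
 + move=> v s3 vn [k1 [S3 [n3 l3] [e3 V3] [B3 st3] c3]] ev.
  have sm3 : small (ar s3 aEY) by apply: (small_le _ sm1) => e; exact: (bumps_le e B3).
  apply: run_sq; apply: run_asg => //=; rewrite ?ev; first by nlia.
  have S4 : stat (setr sv v (tick s3)) by do ?[apply: stat_setr => //|apply: stat_tick].
  apply: (run_call (star_ok S4 erefl sm3 erefl vn)) => s5 [k2 [S5 B5 ld c5]] fr5.
  have {}c5 : clk s5 <= (clk s3).+2 + k2.+1 * cST := c5.
  have B5' : bumps (ar s3 aEY) k2 (ar s5 aEY) := B5.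
  exists (k1 + k2); split=> /=.
  * by apply: stat_setr.
  * by rewrite !(fr_r fr5).
  * by rewrite !(fr_a fr5).
  * split; first exact: bumps_trans B3 B5'.
   move=> x; rewrite ltnS leq_eqVlt => /orP[/eqP->//|xv].
   apply: leq_trans (st3 x xv); apply: leq_sum => a _; exact: (bumps_le _ B5').
  * by move: c5; rewrite [k2.+1 * _]mulSn [v.+1 * _]mulSn [(k1 + k2) * _]mulnDl; nlia.
 move=> s3 [k1 [S3 [n3 l3] [e3 V3] [B3 st3] c3]] _.
 set y3 := ar s3 aEY in B3 st3.
 have on : outs n = [::] by exact: (outs_n gr (p_DM pp) (p_QM pp) (p_Q0 pp) (p_nM pp) (p_QL pp) (p_Q2L pp) (p_cM pp) E0).
 have st : stars y3.
  by move=> x; rewrite leq_eqVlt => /orP[/eqP->|]; [rewrite /BumpTh.load on big_nil|exact: st3].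
 apply: run_sq.
 apply: (@run_for _ _ _ (fun v s4 => [/\ stat s4, [/\ rg s4 vN = N & rg s4 lv = l], ar s4 aEB = eb /\ (forall x, x <= n -> ar s4 aVIS x = 0),
   [/\ ar s4 aEY = y3, (forall x, x < v -> ar s4 aT x = T0 y3 x) & (forall a, a < me.*2 -> hd a < v -> ar s4 aRC a = yq y3 a./2)] &
   clk s4 <= clk s3 + 6 + v * (10 * D + 15)]) n.+1) => //.
 + by nlia.
 + by move=> v s4 [S4 _ _ _ _] _ /=; rewrite (s_n S4) addn1.
 + by split=> //=; [do ?[apply: stat_setr => //|apply: stat_tick]|nlia].
 + move=> v s4 vn [S4 [n4 l4] [e4 V4] [y4 t4 r4] c4] ev.
  apply: run_sq; apply: run_asg => //=; rewrite ?ev; first by nlia.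
  have S5 : stat (setr ru v (tick s4)) by do ?[apply: stat_setr => //|apply: stat_tick].
  have p1 := p_QM pp.
  apply: (run_call (reset_ok es gr (y := y3) S5 _ y4 (stars_yb gr pp st) (p_DM pp) _)); [by []|by nlia|].
  move=> s6 [t6 r6 c6] fr6; have {}c6 : clk s6 <= (clk s4).+2 + (10 * D + 10) := c6.
  split=> /=.
  * by apply: stat_setr => //; apply: stat_frame fr6 _ _ S5.
  * by rewrite !(fr_r fr6).
  * by rewrite !(fr_a fr6).
  * split; first by rewrite (fr_a fr6).
    by move=> x; rewrite t6 /= ltnS leq_eqVlt; case: eqP => //= _; exact: t4.
   by move=> a al; rewrite r6 //= ltnS leq_eqVlt; case: eqP => //= _ h; rewrite r4 //; case: ifP.
  * by move: c6; rewrite [v.+1 * _]mulSn; nlia.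
 move=> s4 [S4 [n4 l4] [e4 V4] [y4 t4 r4] c4] _.
 have C4 : clean y3 s4 by split=> // a al; apply: r4 => //; rewrite ltnS; exact: (hd_le gr al).
 apply: run_sq.
 apply: (@run_for _ _ _ (fun v s5 => exists k2, [/\ stat s5, [/\ rg s5 vN = N & rg s5 lv = l], ar s5 aEB = eb,
   [/\ bumps y3 k2 (ar s5 aEY), clean (ar s5 aEY) s5 & (forall x, x < v -> cert (ycut (ar s5 aEY)) wcap Q (inord x))] &
   clk s5 <= clk s4 + 6 + v * (cFIND + cBS + 15) + k2 * (cFIND + cBS + 5)]) n) => //.
 + by nlia.
 + by move=> v s5 [k2 [S5 _ _ _ _]] _ /=; rewrite (s_n S5).
 + exists 0; split=> //=; [by do ?[apply: stat_setr => //|apply: stat_tick]| |by nlia].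
  by rewrite y4; split=> //; first [exact: bumps0 | case: C4].
 + move=> v s5 vn [k2 [S5 [n5 l5] e5 [B5 C5 ce5] c5]] ev.
  have st5 : stars (ar s5 aEY) by apply: (stars_le _ st) => e; exact: (bumps_le e B5).
  apply: run_sq; apply: run_asg => //=; rewrite ?ev; first by nlia.
  have S6 : stat (setr fv v (tick s5)) by do ?[apply: stat_setr => //|apply: stat_tick].
  have C6 : clean (ar s5 aEY) (setr fv v (tick s5)) by case: C5.
  apply: (run_call (findbump_ok S6 erefl st5 C6 erefl vn)) => s7 [k3 [S7 B7 C7 ce7 c7]] fr7.
  have {}c7 : clk s7 <= (clk s5).+2 + 5 + k3.+1 * (cFIND + cBS + 5) := c7.
  have B7' : bumps (ar s5 aEY) k3 (ar s7 aEY) := B7.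
  exists (k2 + k3); split=> /=.
  * by apply: stat_setr.
  * by rewrite !(fr_r fr7).
  * by rewrite !(fr_a fr7).
  * split; [exact: bumps_trans B5 B7'|by case: C7|].
   move=> x; rewrite ltnS leq_eqVlt => /orP[/eqP->//|xv].
   by apply: (cert_le st5 _ (ce5 x xv)) => e; exact: (bumps_le e B7').
  * by move: c7; rewrite [k3.+1 * _]mulSn [v.+1 * _]mulSn [(k2 + k3) * _]mulnDl; nlia.
 move=> s5 [k2 [S5 [n5 l5] e5 [B5 C5 ce5] c5]] _.
 set y5 := ar s5 aEY in B5 C5 ce5.
 have st5 : stars y5 by apply: (stars_le _ st) => e; exact: (bumps_le e B5).
 have gy : goody y5.
  apply: (certs_goody gr pp st5) => v; have := ltn_ord v; rewrite ltnS leq_eqVlt => /orP[/eqP e|h].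
   have <- : inord n = v by apply: val_inj; rewrite /= inordK.
   exact: cert_dummy.
  by have := ce5 v h; rewrite inord_val.
 have yb5 e : e < me -> y5 e <= E * Fy by exact: (stars_y gr st5).
 apply: (@run_for _ _ _ (fun j s6 => [/\ stat s6, [/\ rg s6 vN = N & rg s6 lv = l], ar s6 aEY = y5 /\ (forall x, x <= n -> ar s6 aVIS x = 0),
   (forall e, e < j -> ar s6 aEB e = eb e + y5 e) /\ (forall e, j <= e -> ar s6 aEB e = eb e) & clk s6 <= clk s5 + 6 + 3 * j]) me) => //.
 + by nlia.
 + by move=> j s6 [S6 _ _ _ _] _ /=; rewrite (s_me S6).
 + split=> //=; [by do ?[apply: stat_setr => //|apply: stat_tick]|by case: C5|by split=> // e _; rewrite e5|by nlia].
 + move=> j s6 jm [S6 [n6 l6] [y6 V6] [b6 b6'] c6] ej.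
  have h1 := yb5 j jm; have h2 := eb1 j jm.
  have h3 : l.+1 * (E * Fy) <= N * (E * Fy) by rewrite leq_mul2r lN orbT.
  rewrite mulSn in h3.
  apply: run_put => //=; rewrite ?ej ?y6 ?(b6' j (leqnn j)); [by do !split=> //; nlia|nlia|nlia|].
  split=> //=; [by do ?[apply: stat_setr => //|apply: stat_seta => //|apply: stat_tick]| |by nlia].
  split=> e; first by rewrite ltnS leq_eqVlt; case: eqP => [->|_ /= h] //; exact: b6.
  move=> h; case: eqP => [ee|_]; [by rewrite ee ltnn in h|by apply: b6'; nlia].
 move=> s6 [S6 [n6 l6] [y6 V6] [b6 _] c6] _.
 have B : bumps y1 (k1 + k2) y5 by exact: bumps_trans B3 B5.
 exists (k + (k1 + k2)); split=> //=.
 + by do ?[apply: stat_setr => //|apply: stat_tick].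
 + by rewrite y6; apply: (levS L1 y2 B gy).
 + split=> //; rewrite y6; split=> // e em; rewrite b6 // mulSn; have := yb5 e em; have := eb1 e em; nlia.
 + have k1X : k1 * cX = k1 * cST + k1 * (cFIND + cBS + 5) by rewrite -mulnDr /cX !addnA.
  have k2X : k2 * cX = k2 * cST + k2 * (cFIND + cBS + 5) by rewrite -mulnDr /cX !addnA.
  have eL : cLEV = 10 * me + n * (cST + 10) + (n + 1) * (10 * D + 20) + n * (cFIND + cBS + 20) + 50 by [].
  have n1' : n * (cST + 4) <= n * (cST + 10) by rewrite leq_mul2l leq_add2l orbT.
  have n2' : n.+1 * (10 * D + 15) <= (n + 1) * (10 * D + 20) by rewrite addn1 leq_mul2l leq_add2l orbT.
  have n3' : n * (cFIND + cBS + 15) <= n * (cFIND + cBS + 20) by rewrite leq_mul2l leq_add2l orbT.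
  rewrite [(k + _) * _]mulnDl [(k1 + k2) * _]mulnDl [l.+1 * _]mulSn k1X k2X; nlia.
move=> s1 [k [S1 n1 L1 [V1 _] c1]] _; exists k; split=> //; first exact: stat_tick.
by move: c1; rewrite /cX /=; nlia.
Qed.

End Levels.

End LevelsTh.

(** * Value of the inner packing loop and number of its bumps *)

Module WeightsTh.
Import Defs MachineTh HoareTh CutsTh InnerCodeTh ResetTh SearchTh PushTh FlowTh FindTh BumpTh BumpSetTh LevelsTh.
Import Order.TTheory GRing.Theory Num.Theory.

Section LnFacts.
Variable R : realType.
Local Open Scope ring_scope.
Implicit Types x y t : R.

Lemma ln_le_sub1 x : 0 < x -> ln x <= x - 1.
Proof. by move=> h; have := @le_ln1Dx R (x - 1); rewrite addrCA subrr addr0; apply; lra. Qed.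

Lemma ln_ge_frac t : t < 1 -> - (t / (1 - t)) <= ln (1 - t).
Proof.
move=> h; have p : 0 < 1 - t by lra.
have := @ln_le_sub1 (1 - t)^-1; rewrite invr_gt0 p => /(_ isT); rewrite lnV ?posrE // => h2.
have -> : - (t / (1 - t)) = - ((1 - t)^-1 - 1) by field; lra.
by lra.
Qed.

Lemma eqle x y : x = y -> x <= y.
Proof. by move=> ->. Qed.

Lemma ln_mono x y : 0 < x -> x <= y -> ln x <= ln y.
Proof. by move=> h1 h2; rewrite ler_ln ?posrE //; lra. Qed.

End LnFacts.

Section InnerValue.
Local Open Scope ring_scope.
Variables (R : realType) (n E Q Fy Y0 RM me : nat) (hd cap er : nat -> nat).
Notation bstep := (bstep E Y0 RM er).
Notation load := (load me hd).
Notation constr := (constr n me hd cap).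
Notation viol := (viol n Fy me hd cap).
Notation bumps := (bumps n E Fy Y0 RM me hd cap er).
Notation goody := (goody n Q Fy me hd cap).
Notation levels := (levels n E Q Fy Y0 RM me hd cap er).
Hypothesis E5 : (5 <= E)%N.
Hypothesis er0 : forall e, (e < me)%N -> (0 < er e <= RM)%N.
Hypothesis RM0 : (0 < RM)%N.
Hypothesis YE : (2 * (E * E * RM) <= Y0)%N.
Hypothesis meE : (me * Y0 * E <= Fy)%N.
Hypothesis F0 : (0 < Fy)%N.
Hypothesis cpos : forall l k y, constr l k -> (0 < \sum_(e <- l) y e)%N -> (0 < k)%N.

Let eps : R := E%:R^-1.
Lemma epsE : eps * E%:R = 1. Proof. by rewrite mulVf // pnatr_eq0; lia. Qed.
Lemma eps0 : 0 < eps. Proof. by rewrite invr_gt0 ltr0n; lia. Qed.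
Lemma eps5 : eps <= 5^-1. Proof. by rewrite lef_pV2 ?posrE ?ltr0n ?ler_nat //; lia. Qed.

Lemma Y0_pos : (0 < Y0)%N.
Proof. by apply: leq_trans YE; rewrite !muln_gt0 RM0 andbT /=; lia. Qed.

Lemma bump_bounds (y a r : nat) : (Y0 <= y)%N -> (0 < a)%N -> (a <= r)%N -> (r <= RM)%N ->
 let y' := (y - (y * a + E * r - 1) %/ (E * r))%N in
 let x : R := a%:R / r%:R * eps in
 [/\ y%:R * x <= y%:R - y'%:R, y%:R * (1 - x * (1 + eps)) <= y'%:R :> R, 0 < x & x <= eps].
Proof.
move=> Yy a0 ar rR y' x; have r0 : (0 < r)%N by exact: leq_trans ar.
have Er : (0 < E * r)%N by rewrite muln_gt0 r0 andbT; lia.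
pose d := ((y * a + E * r - 1) %/ (E * r))%N.
have d1 : (y * a <= d * (E * r))%N.
 have := ltn_ceil (y * a + E * r - 1) Er; rewrite -/d mulSn; clearbody d; lia.
have d2 : (d * (E * r) <= y * a + E * r - 1)%N by exact: leq_trunc_div.
have dy : (d <= y)%N.
 rewrite -(leq_pmul2r Er); apply: (leq_trans d2).
 have h1 : (y * a <= y * r)%N by rewrite leq_mul2l ar orbT.
 have h2 : (E * r + y * r <= y * (E * r))%N.
  have : (E * r <= y * r)%N.
   rewrite leq_mul2r; apply/orP; right; apply: leq_trans Yy; apply: leq_trans YE.
   by rewrite -!mulnA; apply: (@leq_trans (E * 1)%N); [rewrite muln1|nia].
  have : (2 * (y * r) <= y * (E * r))%N by rewrite mulnCA leq_mul2l leq_mul2r; apply/orP; right; apply/orP; right; lia.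
  lia.
 lia.
have yd : y'%:R = y%:R - d%:R :> R by rewrite natrB.
have rR0 : (0 : R) < r%:R by rewrite ltr0n.
have E0R : (0 : R) < E%:R by rewrite ltr0n; lia.
have xd : x * (E%:R * r%:R) = a%:R.
 by rewrite /x /eps; field; rewrite !gt_eqF.
have Er0 : (0 : R) < E%:R * r%:R by rewrite mulr_gt0.
have x0 : 0 < x by rewrite /x !mulr_gt0 ?invr_gt0 ?ltr0n //; lia.
have d1' : y%:R * x <= d%:R.
 by rewrite -(ler_pM2r Er0) -mulrA xd -!natrM ler_nat.
have d2' : d%:R <= y%:R * x + 1.
 rewrite -(ler_pM2r Er0) mulrDl -mulrA xd mul1r -!natrM -natrD ler_nat; lia.
(* This is what Y0 is chosen for: x is at least 1/(E RM) and y at least 2 E^2 RM, so the one unit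
   lost by rounding up is at most the fraction eps of the intended decrease. *)
have key : 1 <= y%:R * (x * eps).
 have e1 : y%:R * (x * eps) = (y * a)%:R / (E * E * r)%:R.
  by rewrite /x /eps !natrM; field; rewrite !gt_eqF.
 rewrite e1 ler_pdivlMr ?mul1r ?ler_nat ?ltr0n ?muln_gt0 ?r0 ?andbT; last by lia.
 apply: (@leq_trans Y0); last by apply: (leq_trans Yy); rewrite leq_pmulr.
 apply: leq_trans YE; apply: (@leq_trans (E * E * RM)%N); first by rewrite leq_mul2l rR orbT.
 by rewrite leq_pmull.
split=> //.
- by rewrite yd; lra.
- rewrite yd mulrBr mulr1 mulrDr mulr1 mulrDr; lra.
- rewrite /x -[X in _ <= X]mul1r ler_pM2r ?eps0 // ler_pdivrMr // mul1r ler_nat //.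
Qed.

(** On the logarithmic scale a bump moves a load by -x up to a relative error of order eps. The last
    conclusion keeps all loads above Y0/2: only loads of at least Y0 are lowered, and never below
    half. *)
Lemma bump_ln (y a r : nat) : (Y0 <= y)%N -> (0 < a)%N -> (a <= r)%N -> (r <= RM)%N ->
 let y' := (y - (y * a + E * r - 1) %/ (E * r))%N in
 let x : R := a%:R / r%:R * eps in
 [/\ ln y%:R - x * (1 + 3 * eps) <= ln y'%:R, ln y'%:R <= ln y%:R - x & (Y0 <= 2 * y')%N].
Proof.
move=> Yy a0 ar rR y' x; have [h1 h2 x0 xe] := bump_bounds Yy a0 ar rR.
rewrite -/y' -/x in h1 h2 x0 xe.
have e0 := eps0; have e5 := eps5.
have y0 : (0 : R) < y%:R by rewrite ltr0n; exact: leq_trans Y0_pos Yy.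
pose t := x * (1 + eps).
have t1 : t <= 3^-1.
 have : t <= eps * (1 + eps) by rewrite ler_pM2r //; lra.
 have : eps * (1 + eps) <= 5^-1 * (1 + 5^-1) by apply: ler_pM; lra.
 lra.
have t0 : 0 < t by rewrite mulr_gt0 //; lra.
have y'0 : (0 : R) < y'%:R.
 apply: lt_le_trans h2; rewrite mulr_gt0 // -/t; lra.
split.
- apply: (@le_trans _ _ (ln (y%:R * (1 - t)))); last by apply: ln_mono => //; rewrite mulr_gt0 //; lra.
 rewrite lnM ?posrE //; last by lra.
 have := @ln_ge_frac R t (ltac:(lra)) => hl.
 have : t / (1 - t) <= x * (1 + 3 * eps); last by lra.
 rewrite ler_pdivrMr; last by lra.
 rewrite -[x * _ * _]mulrA -[t]/(x * (1 + eps)) ler_pM2l //.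
 have xt : x * (1 + eps) <= eps * (1 + eps) by rewrite ler_pM2r //; lra.
 have : (1 + 3 * eps) * (1 - eps * (1 + eps)) <= (1 + 3 * eps) * (1 - x * (1 + eps)) by rewrite ler_pM2l; lra.
 have : eps * eps <= 5^-1 * eps by rewrite ler_pM2r.
 have : eps * (eps * eps) <= 5^-1 * (5^-1 * eps) by apply: ler_pM => //; [lra|nra|nra].
 nra.
- have p : 0 < 1 - x by lra.
 apply: (@le_trans _ _ (ln (y%:R * (1 - x)))); first by apply: ln_mono => //; lra.
 rewrite lnM ?posrE //; have := ln_le_sub1 p; lra.
- rewrite -(ler_nat R) natrM.
 have : y%:R * (1 - t) <= y'%:R by [].
 have : Y0%:R <= y%:R :> R by rewrite ler_nat.
 have : y%:R * t <= y%:R * 3^-1 by rewrite ler_pM2l.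
 lra.
Qed.

(** Rounding down loses at most one unit, and one unit is at most eps^2 y because y is at least
    E^2. *)
Lemma grow_ln (y : nat) : (Y0 <= 2 * y)%N ->
 let y1 := (y + y %/ E)%N in
 [/\ ln y%:R + eps * (1 - 2 * eps) <= ln y1%:R :> R, ln y1%:R <= ln y%:R + eps :> R & y1%:R <= y%:R * (1 + eps) :> R].
Proof.
move=> Yy y1; have e0 := eps0; have e5 := eps5.
have EY : (E * E <= y)%N by have : (E * E <= E * E * RM)%N by [rewrite leq_pmulr]; lia.
have y0 : (0 : R) < y%:R by rewrite ltr0n; apply: leq_trans EY; rewrite muln_gt0; lia.
have E0R : (0 : R) < E%:R by rewrite ltr0n; lia.
have q1 : (y %/ E)%:R <= y%:R * eps :> R.
 rewrite /eps ler_pdivlMr // -natrM ler_nat; exact: leq_trunc_div.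
have q2 : y%:R * eps - 1 <= (y %/ E)%:R :> R.
 rewrite lerBlDr /eps ler_pdivrMr // -[1]/(1%:R) -natrD -natrM ler_nat ltnW // addn1 ltn_ceil //; lia.
have EY' : 1 <= y%:R * (eps * eps).
 have -> : y%:R * (eps * eps) = y%:R / (E * E)%:R by rewrite /eps natrM; field; rewrite gt_eqF.
 by rewrite ler_pdivlMr ?mul1r ?ler_nat // ltr0n muln_gt0; lia.
pose u := eps - eps * eps.
have u0 : 0 < u by rewrite /u; nra.
have ue : u <= eps by rewrite /u; nra.
have l1 : y%:R * (1 + u) <= y1%:R by rewrite /y1 natrD /u; lra.
split; last by rewrite /y1 natrD; lra.
- apply: (@le_trans _ _ (ln (y%:R * (1 + u)))); last by apply: ln_mono => //; rewrite mulr_gt0 //; lra.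
 rewrite lnM ?posrE //; last by lra.
 have := @ln_ge_frac R (- u) (ltac:(lra)); rewrite opprK.
 have -> : - (- u / (1 + u)) = u / (1 + u) by field; lra.
 have : eps * (1 - 2 * eps) <= u / (1 + u); last by lra.
 rewrite ler_pdivlMr; last by lra.
 rewrite /u; nra.
- apply: (@le_trans _ _ (ln (y%:R * (1 + eps)))); first by apply: ln_mono; rewrite /y1 natrD; [have := ler0n R (y %/ E); lra|lra].
 rewrite lnM ?posrE //; last by lra.
 have : ln (1 + eps) <= eps; last by lra.
 by have := @ln_le_sub1 R (1 + eps) (ltac:(lra)); lra.
Qed.

Variable h : nat -> R.
Hypothesis h0 : forall e, (e < me)%N -> 0 <= h e.
Hypothesis hc : forall l k, constr l k -> \sum_(e <- l) h e <= k%:R.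

(** Logarithmic potential relative to a fixed competitor h. A level raises it by about eps [Hr]
    whatever the loads are; repairs lower it, and feasibility of h limits by how much. *)
Definition Psi (y : nat -> nat) : R := \sum_(e < me) (er e)%:R * h e * ln (y e)%:R.
Definition Sr (y : nat -> nat) : R := \sum_(e < me) (er e)%:R * (y e)%:R.
Definition Hr : R := \sum_(e < me) (er e)%:R * h e.
Definition Ls (y : nat -> nat) : R := \sum_(e < me) ln (y e)%:R.
Definition low (y : nat -> nat) := forall e, (e < me)%N -> (Y0 <= 2 * y e)%N.

Lemma sum_sub (l : seq nat) (g : nat -> R) : uniq l -> (forall e, e \in l -> (e < me)%N) ->
 \sum_(e < me) (if (e : nat) \in l then g e else 0) = \sum_(e <- l) g e.
Proof.
move=> ul lm; rewrite -big_mkcond /=.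
have -> : \sum_(e < me | (e : nat) \in l) g e = \sum_(e <- iota 0 me | e \in l) g e.
 by rewrite -[X in iota 0 X]subn0 big_mkord.
rewrite -[LHS]big_filter; apply: perm_big; apply: uniq_perm => //; first by rewrite filter_uniq ?iota_uniq.
by move=> e; rewrite mem_filter mem_iota /=; case/boolP: (e \in l) => // /lm ->.
Qed.

(** The reduced weights cancel in the decrease x_e = eps a / er_e. The loss of [Psi] is about eps a
    times the sum of h over the constraint, at most eps a k, while the loss of [Sr] is about eps a
    times the violating load, at least eps a k Fy (1 - eps). Moreover the edge attaining the minimum
    a loses the fraction eps, so the sum of the logarithms drops by at least eps at each bump. *)
Lemma bstep_val l y y' : low y -> viol l y -> bstep l y y' ->
 [/\ Psi y - Psi y' <= (1 + 5 * eps) / Fy%:R * (Sr y - Sr y'),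
   1 + E%:R * Ls y' <= E%:R * Ls y & low y'].
Proof.
move=> lo [k ck sk] [a [am aM ye]]; have k0 := cpos ck (leq_ltn_trans (leq0n _) sk).
have e0 := eps0; have e5 := eps5.
have [ul lm _] := ck.
have a0 : (0 < a)%N.
 by case: aM => [->//|[e [el _ ->]]]; have /andP[] := er0 (lm _ el).
pose B e := (e \in l) && (Y0 <= y e)%N.
have Ba e : B e -> [/\ (Y0 <= y e)%N, (0 < a)%N, (a <= er e)%N, (er e <= RM)%N & (e < me)%N].
 by move=> /andP[el ey]; split=> //; [exact: am|have /andP[] := er0 (lm _ el)|exact: lm].
have yB e : B e -> y' e = (y e - (y e * a + E * er e - 1) %/ (E * er e))%N by rewrite ye -/(B e) => ->.
have yN e : ~~ B e -> y' e = y e by rewrite ye -/(B e) => /negbTE ->.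
have E0R : (0 : R) < E%:R by rewrite ltr0n; lia.
have F0R : (0 : R) < Fy%:R by rewrite ltr0n.
have erR e : B e -> (0 : R) < (er e)%:R by move=> /Ba[_ _ _ _ em]; rewrite ltr0n; have /andP[] := er0 em.
have lsum (P : pred nat) : \sum_(e <- l | P e) h e <= k%:R.
 apply: le_trans (hc ck); rewrite [X in _ <= X](bigID P) /= lerDl big_seq_cond sumr_ge0 // => e /andP[el _].
 by apply: h0; exact: lm.
(* The loads below Y0 amount to at most me Y0, hence to at most eps Fy, so the large loads alone
   carry nearly the whole violating load. *)
have bigY : k%:R * Fy%:R * (1 - eps) <= \sum_(e <- l | (Y0 <= y e)%N) (y e)%:R :> R.
 have s1 : k%:R * Fy%:R <= \sum_(e <- l) (y e)%:R :> R by rewrite -natrM -natr_sum ler_nat ltnW.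
 rewrite (bigID (fun e => (Y0 <= y e)%N)) /= in s1.
 have s2 : \sum_(e <- l | ~~ (Y0 <= y e)%N) (y e)%:R <= (me * Y0)%:R :> R.
  rewrite -natr_sum ler_nat; apply: (@leq_trans (\sum_(e <- l) Y0)).
   by rewrite [X in (X <= _)%N]big_mkcond; apply: leq_sum => e _; case: ifP => //; rewrite -ltnNge => /ltnW.
  rewrite big_const_seq count_predT iter_addn_0 mulnC leq_mul2r.
  have := uniq_leq_size ul (_ : {subset l <= iota 0 me}); rewrite size_iota => -> //; first by rewrite orbT.
  by move=> e /lm; rewrite mem_iota.
 have s3 : (me * Y0)%:R <= Fy%:R * eps :> R.
  by rewrite /eps ler_pdivlMr // -natrM ler_nat.
 have : 1 * (Fy%:R * eps) <= k%:R * (Fy%:R * eps) :> R by rewrite ler_pM2r ?mulr_gt0 // ler1n.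
 lra.
have Pd : Psi y - Psi y' <= a%:R * eps * (1 + 3 * eps) * k%:R.
 rewrite /Psi -sumrB.
 apply: (@le_trans _ _ (\sum_(e < me) (if (e : nat) \in l then (if (Y0 <= y e)%N then a%:R * eps * (1 + 3 * eps) * h e else 0) else 0))).
  apply: ler_sum => e _; rewrite -mulrBr.
  case/boolP: (B e) => hB; last first.
   rewrite (yN _ hB) subrr mulr0; move: hB; rewrite /B; case: (_ \in l) => //=; case: (_ <= _)%N => //.
  have [b1 b2 b3 b4 b5] := Ba _ hB; have [c1 _ _] := bump_ln b1 b2 b3 b4.
  rewrite -(yB _ hB) in c1; move: hB (erR _ hB); rewrite /B => /andP[-> ->] er'.
  have hh := h0 b5.
  apply: (@le_trans _ _ ((er e)%:R * h e * (a%:R / (er e)%:R * eps * (1 + 3 * eps)))).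
   by apply: ler_wpM2l; [rewrite mulr_ge0 // ler0n|lra].
  apply: eqle; rewrite /eps; field; rewrite !gt_eqF //.
 rewrite (sum_sub (fun e => if (Y0 <= y e)%N then a%:R * eps * (1 + 3 * eps) * h e else 0)) // -big_mkcond -mulr_sumr.
 by apply: ler_wpM2l; [rewrite !mulr_ge0 ?ler0n //; lra|exact: lsum].
have Sd : a%:R * eps * (k%:R * Fy%:R * (1 - eps)) <= Sr y - Sr y'.
 apply: (@le_trans _ _ (a%:R * eps * \sum_(e <- l | (Y0 <= y e)%N) (y e)%:R)).
  by apply: ler_wpM2l => //; rewrite mulr_ge0 ?ler0n //; lra.
 rewrite /Sr -sumrB mulr_sumr big_mkcond -(sum_sub _ ul lm).
 apply: ler_sum => e _; rewrite -mulrBr.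
 case/boolP: (B e) => hB; last first.
  rewrite (yN _ hB) subrr mulr0; move: hB; rewrite /B; case: (_ \in l) => //=; case: (_ <= _)%N => //.
 have [b1 b2 b3 b4 b5] := Ba _ hB; have [c1 _ _ _] := bump_bounds b1 b2 b3 b4.
 rewrite -(yB _ hB) in c1; move: hB (erR _ hB); rewrite /B => /andP[-> ->] er'.
 apply: (@le_trans _ _ ((er e)%:R * ((y e)%:R * (a%:R / (er e)%:R * eps)))).
  by apply: eqle; rewrite /eps; field; rewrite !gt_eqF.
 by rewrite ler_pM2l.
split.
- apply: (le_trans Pd).
 apply: (@le_trans _ _ ((1 + 5 * eps) / Fy%:R * (a%:R * eps * (k%:R * Fy%:R * (1 - eps))))); last first.
  by apply: ler_wpM2l => //; rewrite mulr_ge0 ?invr_ge0 ?ler0n //; lra.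
 have -> : (1 + 5 * eps) / Fy%:R * (a%:R * eps * (k%:R * Fy%:R * (1 - eps))) =
      a%:R * eps * k%:R * ((1 + 5 * eps) * (1 - eps)) by field; rewrite gt_eqF.
 have -> : a%:R * eps * (1 + 3 * eps) * k%:R = a%:R * eps * k%:R * (1 + 3 * eps) by ring.
 by apply: ler_wpM2l; [rewrite !mulr_ge0 ?ler0n //; lra|nra].
- have [e eB ea] : exists2 e, B e & a = er e.
  have [e el ey] : exists2 e, e \in l & (Y0 <= y e)%N.
   case/boolP: (has (fun e => Y0 <= y e)%N l) => [/hasP[e el h1]|/hasPn hn]; first by exists e.
   have p1 : 0 < k%:R * Fy%:R * (1 - eps) by rewrite !mulr_gt0 ?ltr0n //; lra.
   move: (lt_le_trans p1 bigY); rewrite big_seq_cond big1 ?ltxx // => e /andP[el ye'].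
   by have := hn e el; rewrite ye'.
  case: aM => [aR|[e' [e1 e2 e3]]]; last by exists e'; rewrite // /B e1 e2.
  exists e; first by rewrite /B el ey.
  by apply/eqP; rewrite eqn_leq am // aR; have /andP[] := er0 (lm _ el).
 have [b1 b2 b3 b4 b5] := Ba _ eB.
 have le1 i : (i < me)%N -> ln (y' i)%:R <= ln (y i)%:R :> R.
  move=> im; case/boolP: (B i) => hB; last by rewrite yN.
  have [d1 d2 d3 d4 d5] := Ba _ hB; have [_ c2 _] := bump_ln d1 d2 d3 d4.
  have [_ _ x0 _] := bump_bounds d1 d2 d3 d4; rewrite yB //; lra.
 have : Ls y' + eps <= Ls y.
  rewrite /Ls (bigD1 (Ordinal b5)) //= [X in _ <= X](bigD1 (Ordinal b5)) //= addrAC.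
  apply: lerD; last by apply: ler_sum => i _; exact: le1.
  have [_ c2 _] := bump_ln b1 b2 b3 b4; rewrite yB // ea in c2 *.
  move: c2; rewrite -ea divff ?mul1r; last by rewrite pnatr_eq0 -lt0n.
  lra.
 rewrite -(ler_pM2l E0R) mulrDr (mulrC _ eps) epsE; lra.
- move=> e em; case/boolP: (B e) => hB; last by rewrite yN // lo.
 have [d1 d2 d3 d4 d5] := Ba _ hB; have [_ _ c3] := bump_ln d1 d2 d3 d4; by rewrite yB.
Qed.

Let C : R := (1 + 5 * eps) / Fy%:R.

Lemma bumps_val y k y' : bumps y k y' -> low y ->
 [/\ Psi y - Psi y' <= C * (Sr y - Sr y'), k%:R + E%:R * Ls y' <= E%:R * Ls y & low y'].
Proof.
move=> b lo; elim: b => [|k1 l y1 y2 _ [a1 a2 a3] v bs]; first by rewrite !subrr mulr0 add0r.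
have [c1 c2 c3] := bstep_val a3 v bs; split=> //.
 by rewrite -/C in c1; rewrite !mulrBr in a1 c1 *; lra.
by rewrite -natr1; lra.
Qed.

Definition S0 : R := Sr (fun=> Y0).

(** Telescoping over the levels. All decreases of [Sr] together equal the initial value plus the
    growth minus the final value. The growth of a level is at most eps times the value at its start,
    and the starting values sum to [S0 + Sr eb - Sr y] because [eb] collects the values at the ends.
    In the third clause each level adds at most me to E [Ls] and each bump takes away at least 1. *)
Lemma levels_val l k y eb : levels l k y eb ->
 [/\ low y,
  l%:R * eps * (1 - 2 * eps) * Hr - (Psi y - Hr * ln Y0%:R) <= C * (S0 + eps * (Sr eb - Sr y + S0) - Sr y),
  k%:R + E%:R * Ls y <= l%:R * me%:R + E%:R * (me%:R * ln Y0%:R) &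
  (0 < l)%N -> goody y].
Proof.
have e0 := eps0; have e5 := eps5; have Yp := Y0_pos.
have C0 : 0 <= C by rewrite mulr_ge0 ?invr_ge0 ?ler0n //; lra.
elim=> {l k y eb} [y eb yY eb0|l k y eb y1 k' y2 eb' L [lo i1 i2 _] g b gd ebE].
 have eP : Psi y = Hr * ln Y0%:R.
  by rewrite /Psi /Hr mulr_suml; apply: eq_bigr => e _; rewrite yY.
 have eS : Sr y = S0 by rewrite /S0 /Sr; apply: eq_bigr => e _; rewrite yY.
 have eE : Sr eb = 0 by rewrite /Sr big1 // => e _; rewrite eb0 // mulr0.
 have eL : Ls y = me%:R * ln Y0%:R.
  rewrite /Ls (eq_bigr (fun=> ln Y0%:R)) ?sumr_const ?card_ord ?mulr_natl // => e _; by rewrite yY.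
 split=> //; first by move=> e em; rewrite yY // mul2n -addnn leq_addr.
  by rewrite eP eS eE; lra.
 by rewrite eL; lra.
have gl e : (e < me)%N -> [/\ ln (y e)%:R + eps * (1 - 2 * eps) <= ln (y1 e)%:R, ln (y1 e)%:R <= ln (y e)%:R + eps & (y1 e)%:R <= (y e)%:R * (1 + eps)].
 by move=> em; rewrite g //; apply: grow_ln; exact: lo.
have lo1 : low y1.
 by move=> e em; rewrite g //; have := lo e em; have := leq0n (y e %/ E); lia.
have [c1 c2 c3] := bumps_val b lo1.
have p1 : Psi y + eps * (1 - 2 * eps) * Hr <= Psi y1.
 rewrite /Psi /Hr mulr_sumr -big_split; apply: ler_sum => e _ /=.
 have [d1 _ _] := gl e (ltn_ord e).
 have : (er e)%:R * h e * (ln (y e)%:R + eps * (1 - 2 * eps)) <= (er e)%:R * h e * ln (y1 e)%:R.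
  by apply: ler_wpM2l => //; rewrite mulr_ge0 ?ler0n // h0.
 by rewrite mulrDr [eps * (1 - 2 * eps) * _]mulrC.
have p2 : Sr y1 <= Sr y * (1 + eps).
 rewrite /Sr mulr_suml; apply: ler_sum => e _; rewrite -mulrA.
 by apply: ler_wpM2l; [exact: ler0n|have [] := gl e (ltn_ord e)].
have p3 : Ls y1 <= Ls y + me%:R * eps.
 have -> : me%:R * eps = \sum_(e < me) eps by rewrite sumr_const card_ord mulr_natl.
 by rewrite /Ls -big_split; apply: ler_sum => e _; have [] := gl e (ltn_ord e).
have p4 : Sr eb' = Sr eb + Sr y2.
 by rewrite /Sr -big_split; apply: eq_bigr => e _; rewrite ebE // natrD mulrDr.
split=> //.
- have h1 : C * Sr y1 <= C * (Sr y * (1 + eps)) by apply: ler_wpM2l.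
 rewrite p4 -natr1 !mulrDl mul1r; rewrite !mulrBr in c1.
 have -> : C * (S0 + eps * (Sr eb + Sr y2 - Sr y2 + S0) - Sr y2) =
  C * (S0 + eps * (Sr eb - Sr y + S0) - Sr y) + C * (Sr y * (1 + eps)) - C * Sr y2 by ring.
 lra.
- have h1 : E%:R * Ls y1 <= E%:R * (Ls y + me%:R * eps) by apply: ler_wpM2l => //; exact: ler0n.
 rewrite mulrDr in h1.
 have h2 : E%:R * (me%:R * eps) = me%:R by rewrite mulrCA [_ * eps]mulrC epsE mulr1.
 rewrite natrD -natr1 [(l%:R + 1) * _]mulrDl; lra.
Qed.

Lemma levels_sums l k y eb : levels l k y eb ->
 (forall x, (x <= n)%N -> (load eb x <= l * (cap x * Fy))%N) /\
 (forall A : {set 'I_n.+1}, par (wcap cap) A ->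
   (Q * \sum_(e < me | @inside n me hd A e) eb e <=
   l * (Fy * ((Q + 1) * (\sum_(x in A) wcap cap x)./2 + \sum_(e < me | @inside n me hd A e) 1)))%N).
Proof.
have out_lt x a : a \in outs me hd x -> (a./2 < me)%N.
 by rewrite mem_filter mem_iota => /andP[_ /andP[_]]; lia.
elim=> {l k y eb} [y eb yY eb0|l k y eb y1 k' y2 eb' L [i1 i2] g b [st gd] ebE].
 split=> [x xn|A pA].
  by rewrite /BumpTh.load big_seq big1 // => a /out_lt; exact: eb0.
 by rewrite big1 ?muln0 // => e _; exact: eb0.
split=> [x xn|A pA].
 rewrite mulSn; have -> : load eb' x = (load y2 x + load eb x)%N.
  rewrite /BumpTh.load -big_split /= big_seq [RHS]big_seq; apply: eq_bigr => a /out_lt am; rewrite ebE //; lia.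
 by apply: leq_add; [exact: st|exact: i1].
rewrite mulSn.
have -> : (\sum_(e < me | @inside n me hd A e) eb' e = \sum_(e < me | @inside n me hd A e) y2 e + \sum_(e < me | @inside n me hd A e) eb e)%N.
 by rewrite -big_split; apply: eq_bigr => e _; rewrite ebE //= addnC.
by rewrite mulnDr; apply: leq_add; [exact: gd|exact: i2].
Qed.

Hypothesis gE : forall y, goody y -> forall e, (e < me)%N -> (y e <= E * Fy)%N.

(** Vertex constraints keep the final loads below E Fy, so [Psi] has risen by at most [Hr] times
    ln(E Fy) - ln Y0. By the choice of N this is an eps fraction of the N eps [Hr] gained by the
    levels; the remainder was paid by the decrease of [Sr]. *)
Lemma inner_val N k y eb : levels N k y eb -> (0 < N)%N ->
 ln (E%:R * Fy%:R) - ln Y0%:R <= N%:R * (eps * eps) ->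
 (1 - 3 * eps) * Hr <= (1 + 5 * eps) / (N%:R * Fy%:R) * (Sr eb + 2 * E%:R * S0).
Proof.
move=> L N0 hN; have [lo i1 _ gd] := levels_val L; have {}gd := gE (gd N0).
have e0 := eps0; have e5 := eps5; have Yp := Y0_pos.
have F0R : (0 : R) < Fy%:R by rewrite ltr0n.
have N0R : (0 : R) < N%:R by rewrite ltr0n.
have C0 : 0 < C by rewrite mulr_gt0 ?invr_gt0 //; lra.
have H0 : 0 <= Hr by rewrite sumr_ge0 // => e _; rewrite mulr_ge0 ?ler0n // h0.
have S00 : 0 <= S0 by rewrite sumr_ge0 // => e _; rewrite mulr_ge0 ?ler0n.
have Sy0 : 0 <= Sr y by rewrite sumr_ge0 // => e _; rewrite mulr_ge0 ?ler0n.
have y0 e : (e < me)%N -> (0 : R) < (y e)%:R by move=> /lo; rewrite ltr0n; lia.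
have P1 : Psi y <= Hr * ln (E%:R * Fy%:R).
 rewrite /Psi /Hr mulr_suml; apply: ler_sum => e _; apply: ler_wpM2l; first by rewrite mulr_ge0 ?ler0n // h0.
 by apply: ln_mono; [exact: y0|rewrite -natrM ler_nat gd].
have P2 : Hr * (ln (E%:R * Fy%:R) - ln Y0%:R) <= Hr * (N%:R * (eps * eps)) by apply: ler_wpM2l.
have P3 : N%:R * eps * (1 - 3 * eps) * Hr <= C * (2 * S0 + eps * Sr eb).
 have : C * (S0 + eps * (Sr eb - Sr y + S0) - Sr y) <= C * (2 * S0 + eps * Sr eb).
  rewrite ler_pM2l //; nra.
 rewrite mulrBr in P2; nra.
have Ne : 0 < N%:R * eps by rewrite mulr_gt0.
rewrite -(ler_pM2l Ne) mulrA; apply: (le_trans P3); apply: eqle.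
rewrite /C /eps; field; rewrite !gt_eqF // ltr0n; first [exact: N0|exact: F0|by apply: leq_trans E5].
Qed.

(** Each load ends above Y0/2, so [Ls] ends at least at me (ln Y0 - 1), which limits the decreases
    available to the bumps. *)
Lemma inner_cnt N k y eb : levels N k y eb -> (k <= N * me + E * me)%N.
Proof.
move=> L; have [lo _ i2 _] := levels_val L; have Yp := Y0_pos.
have : me%:R * (ln Y0%:R - 1) <= Ls y.
 have -> : me%:R * (ln Y0%:R - 1) = \sum_(e < me) (ln Y0%:R - 1) :> R by rewrite sumr_const card_ord mulr_natl.
 apply: ler_sum => e _; have h1 := lo e (ltn_ord e).
 have h2 : ln Y0%:R <= ln (2%:R * (y e)%:R) :> R by apply: ln_mono; rewrite -?natrM ?ltr0n ?ler_nat.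
 rewrite lnM ?posrE ?ltr0n // in h2; last by lia.
 have : ln 2 <= 2 - 1 :> R by apply: ln_le_sub1.
 lra.
have E0R : (0 : R) < E%:R by rewrite ltr0n; lia.
rewrite -(ler_pM2l E0R) => h1.
rewrite -(ler_nat R) natrD !natrM; rewrite mulrBr mulr1 mulrBr in h1; lra.
Qed.

End InnerValue.

End WeightsTh.

(** * Analysis of the outer multiplicative weights *)

Module OuterTh.
Import Defs WeightsTh.
Import Order.TTheory GRing.Theory Num.Theory.

Section Outer.
Local Open Scope ring_scope.
Variables (R : realType) (n m E N F Fy Q Wm Bm : nat) (I J W b : nat -> nat).

Definition inc (i t : nat) := (I t == i) || (J t == i).
Definition sm (t : nat) := (0 < b (I t) <= E)%N && (0 < b (J t) <= E)%N.
(** In units of 1/E. A large edge receives min(b_i, b_j) at once, which saturates one end and bounds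
    the number of touches. A small edge receives only 1/E, so that the touches inside a small odd
    set remain negligible; its proper load comes from the inner loop. *)
Definition dl (t : nat) : nat := if sm t then 1%N else (E * minn (b (I t)) (b (J t)))%N.
Definition inH (X U : nat -> nat) (t : nat) := [&& sm t, (0 < U t)%N & (X (I t) + X (J t) < W t * F)%N].
Definition rr (X : nat -> nat) (t : nat) : nat := (W t * F - (X (I t) + X (J t)))%N.
Definition cdiv (x y : nat) := ((x + y - 1) %/ y)%N.

(** (LP1) with edges named by their stream positions and vertices by natural numbers. *)
Definition feas (h : nat -> R) : Prop :=
 [/\ forall t, (t < m)%N -> 0 <= h t,
   forall i, (i < n)%N -> \sum_(t < m | inc i t) h t <= (b i)%:R &
   forall A : pred nat, odd (\sum_(i < n | A i) b i) ->
    \sum_(t < m | A (I t) && A (J t)) h t <= ((\sum_(i < n | A i) b i)./2)%:R].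

Let eps : R := E%:R^-1.

(** Interface to the inner loop: [eb] divided by N Fy lives on the stored uncovered edges, satisfies
    the vertex constraints, nearly satisfies the odd set constraints, and nearly maximizes the sum
    of the deficits [rr] over all feasible vectors. *)
Record inner_res (X U eb : nat -> nat) : Prop := InnerRes {
 ir0 : forall t, (t < m)%N -> ~~ inH X U t -> eb t = 0%N;
 ir1 : forall i, (i < n)%N -> (\sum_(t < m | inc i t) eb t <= N * (b i * Fy))%N;
 ir2 : forall A : pred nat, odd (\sum_(i < n | A i) b i) ->
  (Q * \sum_(t < m | A (I t) && A (J t)) eb t <=
   N * (Fy * ((Q + 1) * (\sum_(i < n | A i) b i)./2 + \sum_(t < m | [&& A (I t), A (J t) & sm t]) 1)))%N;
 ir3 : forall h, feas h -> (1 - 3 * eps) * \sum_(t < m | inH X U t) (rr X t)%:R * h t <=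
  (1 + 5 * eps) * (\sum_(t < m) (rr X t)%:R * ((eb t)%:R / (N%:R * Fy%:R)) + 1) }.

Definition settled (X U : nat -> nat) := forall t, (t < m)%N -> (0 < b (I t))%N -> (0 < b (J t))%N ->
 sm t && (0 < U t)%N \/ (W t * F <= X (I t) + X (J t))%N.

(** Multiplication by 1 + eps load / b_i, rounded up, for the load dl/E; [growX] is the same for the
    load ldg/(N Fy). Rounding up makes every touch progress, at the price of an additive error at
    most 1 per step. *)
Definition touchX (X : nat -> nat) t i := if inc i t then (X i + cdiv (X i * dl t) (E * b i * E))%N else X i.
Definition touchU (U : nat -> nat) t t' := if t' == t then (U t + dl t)%N else U t'.
Definition ldg (eb : nat -> nat) i : nat := (\sum_(t < m | inc i t) eb t)%N.
Definition growX (X eb : nat -> nat) i := (X i + cdiv (X i * ldg eb i) (N * Fy * b i * E))%N.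
Definition decay (X : nat -> nat) i := (X i - X i %/ E)%N.

(** Trace of the outer loop: p finished rounds, c touches, potentials X, touch loads U in units of
    1/E and inner loads Hh in units of 1/(N Fy). A round is closed by [rchP] only in a settled
    state. *)
Inductive reach : nat -> nat -> (nat -> nat) -> (nat -> nat) -> (nat -> nat) -> Prop :=
| rch0 X U Hh of (forall i, (i < n)%N -> X i = 1%N) & (forall t, (t < m)%N -> U t = 0%N) &
  (forall t, (t < m)%N -> Hh t = 0%N) : reach 0 0 X U Hh
| rchT p c X U Hh t X' U' of reach p c X U Hh & (t < m)%N & (0 < b (I t))%N & (0 < b (J t))%N &
  (X (I t) + X (J t) < W t * F)%N & (sm t -> U t = 0%N) &
  (forall i, (i < n)%N -> X' i = touchX X t i) & (forall t', (t' < m)%N -> U' t' = touchU U t t') :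
  reach p c.+1 X' U' Hh
| rchP p c X U Hh eb X' Hh' of reach p c X U Hh & settled X U & inner_res X U eb &
  (forall i, (i < n)%N -> X' i = decay (growX X eb) i) &
  (forall t, (t < m)%N -> Hh' t = (Hh t + eb t)%N) : reach p.+1 c X' U Hh'.

Hypothesis E8 : (8 <= E)%N.
Hypothesis N0 : (0 < N)%N.
Hypothesis Fy0 : (0 < Fy)%N.
Hypothesis Q0 : (0 < Q)%N.
Hypothesis Il : forall t, (t < m)%N -> (I t < n)%N.
Hypothesis Jl : forall t, (t < m)%N -> (J t < n)%N.
Hypothesis IJ : forall t, (t < m)%N -> I t != J t.
Hypothesis WmP : forall t, (t < m)%N -> (W t <= Wm)%N.
Hypothesis BmP : forall i, (i < n)%N -> (b i <= Bm)%N.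

Lemma oepsE : eps * E%:R = 1. Proof. by rewrite mulVf // pnatr_eq0; lia. Qed.
Lemma oeps0 : 0 < eps. Proof. by rewrite invr_gt0 ltr0n; lia. Qed.
Lemma oeps8 : eps <= 8^-1. Proof. by rewrite lef_pV2 ?posrE ?ltr0n ?ler_nat //; lia. Qed.

Lemma cdiv_ge x y : (0 < y)%N -> x%:R / y%:R <= (cdiv x y)%:R :> R.
Proof.
move=> y0; rewrite ler_pdivrMr ?ltr0n // -natrM ler_nat.
have := ltn_ceil (x + y - 1) y0; rewrite -/(cdiv x y) mulSn; move: (cdiv x y * y)%N => z; lia.
Qed.

Lemma cdiv_le x y : (0 < y)%N -> (cdiv x y)%:R <= x%:R / y%:R + 1 :> R.
Proof.
move=> y0; rewrite -lerBlDr ler_pdivlMr ?ltr0n // mulrBl mul1r lerBlDr -natrM -natrD ler_nat.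
have := leq_trunc_div (x + y - 1) y; rewrite -/(cdiv x y); lia.
Qed.

Lemma cdiv0 y : cdiv 0 y = 0%N.
Proof. by rewrite /cdiv add0n; case: y => [|y]; rewrite ?divn0 // subn1 divn_small. Qed.

Lemma dl_le t i : inc i t -> (0 < b (I t))%N -> (0 < b (J t))%N -> (0 < dl t <= E * b i)%N.
Proof.
move=> h b1 b2; have E0 : (0 < E)%N by lia.
have bi : (minn (b (I t)) (b (J t)) <= b i)%N /\ (0 < b i)%N.
 by case/orP: h => /eqP <-; split=> //; [exact: geq_minl|exact: geq_minr].
rewrite /dl; case: ifP => _; first by rewrite muln_gt0 E0; case: bi.
case: bi => bl _; rewrite muln_gt0 E0 leq_pmul2l // bl andbT /= /minn; by case: ifP.
Qed.

Lemma reach_pos p c X U Hh i : reach p c X U Hh -> (i < n)%N -> (0 < X i)%N.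
Proof.
move=> r; elim: r i => {p c X U Hh} [X U Hh x0 _ _ i il|p c X U Hh t X' U' _ IH _ _ _ _ _ hX _ i il|p c X U Hh eb X' Hh' _ IH _ _ hX _ i il].
- by rewrite x0.
- by rewrite hX // /touchX; have := IH i il; case: ifP; lia.
- rewrite hX // /decay; have : (0 < growX X eb i)%N by rewrite /growX; have := IH i il; lia.
 by move=> h; rewrite subn_gt0 ltn_Pdiv //; lia.
Qed.

Lemma frac_le1 (x y z : nat) : (0 < y)%N -> (x <= y * z)%N -> x%:R / (y%:R * E%:R) <= z%:R * eps :> R.
Proof.
move=> y0 h; have E0 : (0 : R) < E%:R by rewrite ltr0n; lia.
have yR : (0 : R) < y%:R by rewrite ltr0n.
rewrite ler_pdivrMr ?mulr_gt0 //.
have -> : z%:R * eps * (y%:R * E%:R) = (y * z)%:R by rewrite /eps natrM; field; rewrite gt_eqF.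
by rewrite ler_nat.
Qed.

(** X_i grows only because of an edge with X_i + X_j < W F, and the load then added is at most b_i,
    so the growth is at most the rounded-up X_i / E, hence at most X_i: a potential can at most
    double from below W F. *)
Lemma reach_le p c X U Hh i : reach p c X U Hh -> (i < n)%N -> (X i <= 2 * (Wm * F) + 2)%N.
Proof.
have cd x y : (x <= y)%N -> (cdiv x y <= 1)%N.
 case: y => [|y] h; first by move: h; rewrite leqn0 => /eqP ->; rewrite cdiv0.
 by rewrite /cdiv -ltnS ltn_divLR //; lia.
have cm x y z : (0 < y)%N -> (cdiv (x * y) (y * z) <= cdiv x z)%N.
 move=> y0; case: z => [|z]; first by rewrite muln0 /cdiv !divn0.
 rewrite -ltnS /cdiv ltn_divLR ?muln_gt0 ?y0 //.
 have := ltn_ceil (x + z.+1 - 1) (isT : (0 < z.+1)%N); set q := (_ %/ _)%N => h.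
 have : (x <= q * z.+1)%N by move: h; rewrite mulSn; lia.
 move=> hx; have h3 : (x * y <= q * z.+1 * y)%N by rewrite leq_mul2r hx orbT.
 have e : (q * (y * z.+1) = q * z.+1 * y)%N by rewrite -mulnA [(z.+1 * y)%N]mulnC.
 rewrite mulSn e; have : (0 < y * z.+1)%N by rewrite muln_gt0 y0.
 lia.
have cE x : (cdiv x E <= x)%N.
 case: x => [|x]; first by rewrite cdiv0.
 by rewrite -ltnS /cdiv ltn_divLR; nia.
have cmono x y z : (x <= y)%N -> (cdiv x z <= cdiv y z)%N by move=> h; apply: leq_div2r; lia.
move=> r; elim: r i => {p c X U Hh} [X U Hh x0 _ _ i il|p c X U Hh t X' U' r IH tm b1 b2 lt _ hX _ i il|p c X U Hh eb X' Hh' r IH _ ir hX _ i il].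
- by rewrite x0 //; lia.
- rewrite hX // /touchX; case: ifP => h; last exact: IH.
 have /andP[d0 d1] := dl_le h b1 b2.
 have b0 : (0 < E * b i)%N by exact: leq_trans d1.
 have : (cdiv (X i * dl t) (E * b i * E) <= X i)%N.
  apply: leq_trans (cE (X i)); apply: leq_trans (cm (X i) _ _ b0).
  by apply: cmono; rewrite leq_mul2l d1 orbT.
 have h2 : (W t * F <= Wm * F)%N by rewrite leq_mul2r WmP ?orbT.
 have : (X i < W t * F)%N by move: h => /orP[] /eqP <-; lia.
 lia.
- rewrite hX // /decay; have : (growX X eb i <= 2 * (Wm * F) + 2)%N; last by have := leq_subr (growX X eb i %/ E) (growX X eb i); lia.
 rewrite /growX; case: (posnP (ldg eb i)) => [->|l0]; first by rewrite muln0 cdiv0 addn0; exact: IH.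
 have h1 := ir1 ir il; rewrite -/(ldg eb i) in h1.
 have b0 : (0 < N * Fy * b i)%N by move: (leq_trans l0 h1); rewrite mulnA mulnAC.
 have : (cdiv (X i * ldg eb i) (N * Fy * b i * E) <= X i)%N.
  apply: leq_trans (cE (X i)); apply: leq_trans (cm (X i) _ _ b0).
  by apply: cmono; rewrite leq_mul2l -mulnA [(Fy * _)%N]mulnC h1 orbT.
 have [t ht et] : exists2 t : 'I_m, inc i t & (0 < eb t)%N.
  case: (pickP (fun t : 'I_m => inc i t && (0 < eb t)%N)) => [t /andP[]|hn]; first by exists t.
  move: l0; rewrite /ldg big1 // => t it; have := hn t; rewrite it /= lt0n; by case: eqP.
 have hH : inH X U t by apply/negPn/negP => hH; have := ir0 ir (ltn_ord t) hH => e; rewrite e in et.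
 have h2 : (W t * F <= Wm * F)%N by rewrite leq_mul2r WmP ?orbT.
 have : (X i < W t * F)%N by case/and3P: hH => _ _; move: ht => /orP[] /eqP <-; lia.
 lia.
Qed.

Definition ld (U Hh : nat -> nat) (i : nat) : R :=
 \sum_(t < m | inc i t) ((U t)%:R / E%:R + (Hh t)%:R / (N%:R * Fy%:R)).

Lemma ln_grow (x a y : nat) : (0 < x)%N -> (0 < y)%N -> (a <= y)%N ->
 ln x%:R + (1 - eps) * (a%:R / (y%:R * E%:R)) <= ln (x + cdiv (x * a) (y * E))%:R :> R.
Proof.
move=> x0 y0 ay; have e0 := oeps0; have e8 := oeps8.
have E0 : (0 : R) < E%:R by rewrite ltr0n; lia.
have yR : (0 : R) < y%:R by rewrite ltr0n. have xR : (0 : R) < x%:R by rewrite ltr0n.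
set u := a%:R / _.
have u0 : 0 <= u by rewrite mulr_ge0 ?invr_ge0 ?mulr_ge0 ?ler0n.
have ue : u <= eps by have := @frac_le1 a y 1 y0; rewrite muln1 mul1r; apply.
apply: (@le_trans _ _ (ln (x%:R * (1 + u)))); last first.
 apply: ln_mono; first by rewrite mulr_gt0 //; lra.
 have := @cdiv_ge (x * a) (y * E); rewrite muln_gt0 y0 => /(_ (ltac:(lia) : true && (0 < E)%N)).
 have -> : (x * a)%:R / (y * E)%:R = x%:R * u by rewrite /u !natrM mulrA.
 by rewrite natrD; lra.
rewrite lnM ?posrE //; last by lra.
have := @ln_ge_frac R (- u) (ltac:(lra)); rewrite opprK.
have -> : - (- u / (1 + u)) = u / (1 + u) by field; lra.
have : (1 - eps) * u <= u / (1 + u); last by lra.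
rewrite ler_pdivlMr; last by lra.
have : u * (u * (1 - eps)) <= u * eps by apply: ler_wpM2l => //; nra.
nra.
Qed.

Lemma ld_touch U Hh U' t i : (t < m)%N -> (forall t', (t' < m)%N -> U' t' = touchU U t t') ->
 ld U' Hh i = ld U Hh i + (inc i t)%:R * ((dl t)%:R / E%:R).
Proof.
move=> tm hU; rewrite /ld.
transitivity (\sum_(t0 < m | inc i t0) ((U t0)%:R / E%:R + (Hh t0)%:R / (N%:R * Fy%:R) + ((t0 : nat) == t)%:R * ((dl t)%:R / E%:R) : R)).
 apply: eq_bigr => t0 _; rewrite hU // /touchU; case: eqP => [->|_]; last by rewrite mul0r addr0.
 by rewrite natrD mulrDl mul1r addrAC.
rewrite big_split /=; congr (_ + _); rewrite -mulr_suml; congr (_ * _).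
case/boolP: (inc i t) => h; last first.
 by rewrite big1 // => t0 h0; case: eqP => // e; rewrite -e h0 in h.
rewrite (bigD1 (Ordinal tm)) //= eqxx big1 ?addr0 // => t0 /andP[_ /eqP ne].
by case: eqP => // e; case: ne; apply: val_inj.
Qed.

Lemma ld_inner U Hh eb Hh' i : (forall t, (t < m)%N -> Hh' t = (Hh t + eb t)%N) ->
 ld U Hh' i = ld U Hh i + (ldg eb i)%:R / (N%:R * Fy%:R).
Proof.
move=> h; rewrite /ld /ldg natr_sum mulr_suml -big_split /=; apply: eq_bigr => t _.
by rewrite h // natrD; lra.
Qed.

(** Relative load u raises ln X_i by nearly eps u, and each decay lowers it by about eps. So the
    relative load is at most about ln X_i / eps plus the number of rounds. *)
Lemma reach_ln p c X U Hh i : reach p c X U Hh -> (i < n)%N -> (0 < b i)%N ->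
 (1 - eps) * (ld U Hh i / ((b i)%:R * E%:R)) <= ln (X i)%:R + p%:R * (eps * (1 + 2 * eps)).
Proof.
move=> r; have e0 := oeps0; have e8 := oeps8.
have E0 : (0 : R) < E%:R by rewrite ltr0n; lia.
have NF : (0 : R) < N%:R * Fy%:R by rewrite mulr_gt0 ?ltr0n.
elim: r i => {p c X U Hh} [X U Hh x0 u0 hh0 i il b0|p c X U Hh t X' U' r IH tm b1 b2 lt _ hX hU i il b0|p c X U Hh eb X' Hh' r IH _ ir hX hH i il b0].
- rewrite x0 // ln1 mul0r addr0 /ld big1 ?mul0r ?mulr0 // => t _.
 by rewrite u0 // hh0 // !mul0r addr0.
- have bR : (0 : R) < (b i)%:R by rewrite ltr0n.
 have xp := reach_pos r il.
 rewrite (ld_touch Hh i tm hU) hX // /touchX; case: ifP => h; last first.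
  by rewrite mul0r addr0; exact: IH.
 have /andP[d0 d1] := dl_le h b1 b2.
 have := IH i il b0; have := @ln_grow (X i) (dl t) (E * b i) xp _ d1; rewrite muln_gt0 b0 andbT => /(_ (ltac:(lia) : (0 < E)%N)).
 rewrite mul1r [(ld U Hh i + _) / _]mulrDl [(1 - eps) * (_ + _)]mulrDr.
 have -> : (dl t)%:R / E%:R / ((b i)%:R * E%:R) = (dl t)%:R / ((E * b i)%:R * E%:R) :> R.
  by rewrite natrM; field; rewrite !gt_eqF.
 lra.
- have bR : (0 : R) < (b i)%:R by rewrite ltr0n.
 have xp := reach_pos r il.
 rewrite (ld_inner U i hH) hX // [(ld U Hh i + _) / _]mulrDl [(1 - eps) * (_ + _)]mulrDr -natr1 [(p%:R + 1) * _]mulrDl mul1r.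
 have h1 := ir1 ir il; rewrite -/(ldg eb i) in h1.
 have b0' : (0 < N * Fy * b i)%N by rewrite !muln_gt0 N0 Fy0.
 have h2 : (ldg eb i <= N * Fy * b i)%N by rewrite -mulnA [(Fy * _)%N]mulnC.
 have := IH i il b0; have := ln_grow xp b0' h2; rewrite -/(growX X eb i).
 have -> : (ldg eb i)%:R / (N%:R * Fy%:R) / ((b i)%:R * E%:R) = (ldg eb i)%:R / ((N * Fy * b i)%:R * E%:R) :> R.
  by rewrite !natrM; field; rewrite !gt_eqF // ltr0n.
 set g := growX X eb i.
 have g0 : (0 < g)%N by rewrite /g /growX; lia.
 have gR : (0 : R) < g%:R by rewrite ltr0n.
 have : ln g%:R - eps * (1 + 2 * eps) <= ln (decay (growX X eb) i)%:R :> R.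
  have q1 : (g %/ E)%:R <= g%:R * eps :> R by rewrite /eps ler_pdivlMr // -natrM ler_nat; exact: leq_trunc_div.
  apply: (@le_trans _ _ (ln (g%:R * (1 - eps)))); last first.
   apply: ln_mono; first by rewrite mulr_gt0 //; lra.
   by rewrite /decay -/g natrB ?leq_div //; lra.
  rewrite lnM ?posrE //; last by lra.
  have := @ln_ge_frac R eps (ltac:(lra)).
  have : eps / (1 - eps) <= eps * (1 + 2 * eps); last by lra.
  rewrite ler_pdivrMr; last by lra.
  nra.
 lra.
Qed.

Hypothesis lnX : ln (2 * (Wm * F) + 2)%:R <= N%:R * (eps * eps) :> R.

(** By [lnX] the logarithm contributes at most an eps fraction of N, so over N rounds the load of i
    stays within N b_i up to 1 + 5 eps. Dividing by N satisfies the vertex constraints up to that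
    factor. *)
Lemma reach_load p c X U Hh i : reach p c X U Hh -> (p <= N)%N -> (i < n)%N ->
 ld U Hh i <= (b i)%:R * (N%:R * (1 + 5 * eps)).
Proof.
move=> r pN il; have e0 := oeps0; have e8 := oeps8.
have E0 : (0 : R) < E%:R by rewrite ltr0n; lia.
have NR : (0 : R) < N%:R by rewrite ltr0n.
case: (posnP (b i)) => [bz|b0].
 rewrite bz mul0r; have -> : ld U Hh i = 0; last by [].
 (* At a vertex of capacity 0 the logarithmic bound is void; there no incident edge is ever touched
    or stored, so the load is 0. *)
 have z : forall t : 'I_m, inc i t -> U t = 0%N /\ Hh t = 0%N.
  elim: r {pN} => {p c X U Hh} [X U Hh _ u0 hh0 t _|p c X U Hh t X' U' _ IH tm b1 b2 _ _ _ hU t' h|p c X U Hh eb X' Hh' _ IH _ ir _ hH t h].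
  - by rewrite u0 ?hh0.
  - have [u h'] := IH t' h; split=> //; rewrite hU // /touchU; case: eqP => // e.
   by move: h b1 b2; rewrite e => /orP[] /eqP ->; rewrite bz.
  - have [u h'] := IH t h; split=> //; rewrite hH // h' add0n (ir0 ir) //.
   by rewrite /inH /sm; move: h => /orP[] /eqP ->; rewrite bz /= ?andbF.
 by rewrite /ld big1 // => t h; have [-> ->] := z t h; rewrite !mul0r addr0.
have bR : (0 : R) < (b i)%:R by rewrite ltr0n.
have h1 := reach_ln r il b0.
have h2 : ln (X i)%:R <= N%:R * (eps * eps).
 apply: le_trans lnX; apply: ln_mono; first by rewrite ltr0n (reach_pos r).
 by rewrite ler_nat (reach_le r).
have h3 : p%:R * (eps * (1 + 2 * eps)) <= N%:R * (eps * (1 + 2 * eps)).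
 by rewrite ler_pM2r ?ler_nat // mulr_gt0 //; lra.
have h4 : (1 - eps) * (ld U Hh i / ((b i)%:R * E%:R)) <= N%:R * (eps * (1 + 3 * eps)) by lra.
have h5 : (1 - eps) * ld U Hh i <= N%:R * (1 + 3 * eps) * (b i)%:R.
 have p1 : 0 < (b i)%:R * E%:R :> R by rewrite mulr_gt0.
 move: h4; rewrite [X in X <= _]mulrA ler_pdivrMr // => /le_trans; apply; apply: eqle.
 by rewrite /eps; field; rewrite gt_eqF.
have h6 : 1 - eps > 0 by lra.
rewrite -(ler_pM2l h6); apply: (le_trans h5).
have -> : (1 - eps) * ((b i)%:R * (N%:R * (1 + 5 * eps))) = N%:R * (b i)%:R * ((1 - eps) * (1 + 5 * eps)) by ring.
rewrite mulrAC; apply: ler_wpM2l; first by rewrite mulr_ge0 ?ler0n.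
nra.
Qed.

(* Every touch uses a noticeable part of the load allowed to one of its ends. *)
Lemma reach_cnt p c X U Hh : reach p c X U Hh ->
 c%:R <= (E * E)%:R * \sum_(i < n) ld U Hh i / (b i)%:R.
Proof.
move=> r; have E0 : (0 : R) < E%:R by rewrite ltr0n; lia.
have NF : (0 : R) < N%:R * Fy%:R by rewrite mulr_gt0 ?ltr0n.
elim: r => {p c X U Hh} [X U Hh _ _ _|p c X U Hh t X' U' _ IH tm b1 b2 _ _ _ hU|p c X U Hh eb X' Hh' _ IH _ _ _ hH].
- rewrite mulr_ge0 ?ler0n // sumr_ge0 // => i _; rewrite mulr_ge0 ?invr_ge0 ?ler0n //.
 by rewrite sumr_ge0 // => t _; rewrite addr_ge0 // mulr_ge0 ?invr_ge0 ?mulr_ge0 ?ler0n.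
- have [i [il h mi]] : exists i, [/\ (i < n)%N, inc i t & (E * b i <= dl t * (E * E))%N].
  have E1 : (0 < E)%N by lia.
  have [i [il h mi]] : exists i, [/\ (i < n)%N, inc i t & (b i = minn (b (I t)) (b (J t)))%N].
   case: (leqP (b (I t)) (b (J t))) => h.
    by exists (I t); rewrite Il // /inc eqxx.
   by exists (J t); rewrite Jl // /inc eqxx orbT.
  exists i; split=> //; rewrite /dl; case: ifP => hs.
   have : (b i <= E)%N by move: hs => /andP[/andP[_ h1] /andP[_ h2]]; case/orP: h => /eqP <-.
   by rewrite mul1n leq_pmul2l.
  by rewrite -mi leq_pmulr // muln_gt0 E1.
 have bi0 : (0 < b i)%N by case/orP: h => /eqP <-.
 have bR : (0 : R) < (b i)%:R by rewrite ltr0n.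
 have h1 : \sum_(i0 < n) ld U Hh i0 / (b i0)%:R + (dl t)%:R / E%:R / (b i)%:R <= \sum_(i0 < n) ld U' Hh i0 / (b i0)%:R.
  rewrite (bigD1 (Ordinal il)) //= [X in _ <= X](bigD1 (Ordinal il)) //= addrAC.
  apply: lerD; first by rewrite (ld_touch Hh i tm hU) h mul1r mulrDl.
  apply: ler_sum => j _; rewrite (ld_touch Hh j tm hU) mulrDl lerDl.
  by rewrite !mulr_ge0 ?invr_ge0 ?ler0n.
 have h2 : 1 <= (E * E)%:R * ((dl t)%:R / E%:R / (b i)%:R) :> R.
  have -> : (E * E)%:R * ((dl t)%:R / E%:R / (b i)%:R) = (dl t * (E * E))%:R / (E * b i)%:R :> R.
   by rewrite !natrM; field; rewrite !gt_eqF.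
  by rewrite ler_pdivlMr ?mul1r ?ler_nat // ltr0n muln_gt0 bi0 andbT; lia.
 have h3 : (E * E)%:R * (\sum_(i0 < n) ld U Hh i0 / (b i0)%:R + (dl t)%:R / E%:R / (b i)%:R) <=
    (E * E)%:R * \sum_(i0 < n) ld U' Hh i0 / (b i0)%:R by apply: ler_wpM2l; rewrite ?ler0n.
 rewrite mulrDr in h3; rewrite -natr1; lra.
- apply: (le_trans IH); apply: ler_wpM2l; first exact: ler0n.
 apply: ler_sum => i _; apply: ler_wpM2r; first by rewrite invr_ge0 ler0n.
 by rewrite (ld_inner U i hH) lerDl mulr_ge0 ?invr_ge0 ?mulr_ge0 ?ler0n.
Qed.

Lemma N15 : N%:R * (1 + 5 * eps) <= (2 * N)%:R :> R.
Proof.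
have e8 := oeps8; rewrite natrM [2%:R * _]mulrC; apply: ler_wpM2l; first exact: ler0n.
lra.
Qed.

(** Summing the load bound over the vertices: the number of touches, hence of stored edges, is
    linear in n and does not depend on m. *)
Lemma reach_cnt_le p c X U Hh : reach p c X U Hh -> (p <= N)%N -> (c <= n * (2 * N * (E * E)))%N.
Proof.
move=> r pN; rewrite -(ler_nat R); apply: (le_trans (reach_cnt r)).
apply: (@le_trans _ _ ((E * E)%:R * (n%:R * (2 * N)%:R))); last by rewrite -!natrM ler_nat mulnCA [(E * E * _)%N]mulnC.
apply: ler_wpM2l; first exact: ler0n.
have -> : n%:R * (2 * N)%:R = \sum_(i < n) (2 * N)%:R :> R by rewrite sumr_const card_ord mulr_natl.
apply: ler_sum => i _; case: (posnP (b i)) => [->|b0]; first by rewrite invr0 mulr0 ler0n.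
rewrite ler_pdivrMr ?ltr0n // mulrC; apply: le_trans (reach_load r pN (ltn_ord i)) _.
by apply: ler_wpM2l; [exact: ler0n|exact: N15].
Qed.

Lemma reach_U p c X U Hh t : reach p c X U Hh -> (p <= N)%N -> (t < m)%N -> (U t <= E * (2 * N) * Bm)%N.
Proof.
move=> r pN tm; have E0 : (0 : R) < E%:R by rewrite ltr0n; lia.
have il := Il tm; have h := reach_load r pN il.
have h1 : (U t)%:R / E%:R <= ld U Hh (I t).
 rewrite /ld (bigD1 (Ordinal tm)) /=; last by rewrite /inc eqxx.
 rewrite -addrA lerDl addr_ge0 ?sumr_ge0 // => *; rewrite ?addr_ge0 ?mulr_ge0 ?invr_ge0 ?mulr_ge0 ?ler0n //.
have h2 : (b (I t))%:R * (N%:R * (1 + 5 * eps)) <= Bm%:R * (2 * N)%:R.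
 apply: ler_pM; rewrite ?ler0n ?ler_nat ?BmP //; last exact: N15.
 by rewrite mulr_ge0 ?ler0n //; have := oeps0; lra.
have : (U t)%:R / E%:R <= (Bm * (2 * N))%:R :> R by rewrite natrM; lra.
by rewrite ler_pdivrMr // -natrM ler_nat; lia.
Qed.

(** A stored small edge uses a load of at least 1/E at a vertex of capacity at most E, whose total
    load is at most 2 N E. This is the degree bound D of the stored graph. *)
Lemma reach_deg p c X U Hh i : reach p c X U Hh -> (p <= N)%N -> (i < n)%N ->
 (\sum_(t < m | inc i t && (sm t && (0 < U t)%N)) 1 <= 2 * N * (E * E))%N.
Proof.
move=> r pN il; have E0 : (0 : R) < E%:R by rewrite ltr0n; lia.
case: (posnP (\sum_(t < m | inc i t && (sm t && (0 < U t)%N)) 1)%N) => [->//|s0].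
have bE : (b i <= E)%N.
 case: (pickP (fun t : 'I_m => inc i t && (sm t && (0 < U t)%N))) => [t /and3P[h hs _]|hn].
  by move: hs => /andP[/andP[_ h1] /andP[_ h2]]; case/orP: h => /eqP <-.
 by rewrite big_pred0 in s0.
have h := reach_load r pN il.
have h1 : (\sum_(t < m | inc i t && (sm t && (0 < U t)%N)) 1)%N%:R / E%:R <= ld U Hh i.
 rewrite natr_sum mulr_suml /ld big_mkcondr /=; apply: ler_sum => t _; case: ifP => [/andP[_ u0]|_].
  apply: (@le_trans _ _ ((U t)%:R / E%:R)).
   by apply: ler_wpM2r; rewrite ?invr_ge0 ?ler0n ?ler1n.
  by rewrite lerDl mulr_ge0 ?invr_ge0 ?mulr_ge0 ?ler0n.
 by rewrite addr_ge0 ?mulr_ge0 ?invr_ge0 ?mulr_ge0 ?ler0n.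
have h2 : (b i)%:R * (N%:R * (1 + 5 * eps)) <= E%:R * (2 * N)%:R.
 apply: ler_pM; rewrite ?ler0n ?ler_nat //; last exact: N15.
 by rewrite mulr_ge0 ?ler0n //; have := oeps0; lra.
have : (\sum_(t < m | inc i t && (sm t && (0 < U t)%N)) 1)%N%:R / E%:R <= (E * (2 * N))%:R :> R by rewrite natrM; lra.
by rewrite ler_pdivrMr // -natrM ler_nat; lia.
Qed.

Lemma reach_listed p c X U Hh : reach p c X U Hh -> (\sum_(t < m) (0 < U t) <= c)%N.
Proof.
elim=> {p c X U Hh} [X U Hh _ u0 _|p c X U Hh t X' U' _ IH tm _ _ _ _ _ hU|p c X U Hh eb X' Hh' _ IH _ _ _ _] //.
 by rewrite big1 // => t _; rewrite u0.
rewrite (bigD1 (Ordinal tm)) //= -[c.+1]add1n; apply: leq_add; first exact: leq_b1.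
apply: leq_trans IH; rewrite [X in (_ <= X)%N](bigD1 (Ordinal tm)) //=; apply: leq_trans (leq_addl _ _).
apply: leq_sum => t' ne; rewrite hU // /touchU; case: eqP => // e; case/eqP: ne; exact: val_inj.
Qed.

Lemma reach_small p c X U Hh t : reach p c X U Hh -> (t < m)%N -> sm t -> (U t <= 1)%N.
Proof.
move=> r tm st; elim: r => {p c X U Hh} [X U Hh _ u0 _|p c X U Hh t' X' U' _ IH _ _ _ _ us _ hU|p c X U Hh eb X' Hh' _ IH _ _ _ _] //.
 by rewrite u0.
rewrite hU // /touchU; case: eqP => // e; rewrite -e in us *.
by rewrite us // /dl st.
Qed.

Lemma reach_Hh p c X U Hh : reach p c X U Hh ->
 (forall t, (t < m)%N -> (Hh t <= p * (N * (Bm * Fy)))%N) /\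
 (forall A : pred nat, odd (\sum_(i < n | A i) b i) ->
  (Q * \sum_(t < m | A (I t) && A (J t)) Hh t <= p *
   (N * (Fy * ((Q + 1) * (\sum_(i < n | A i) b i)./2 + \sum_(t < m | [&& A (I t), A (J t) & sm t]) 1))))%N).
Proof.
elim=> {p c X U Hh} [X U Hh _ _ h0|//|p c X U Hh eb X' Hh' _ [i1 i2] _ ir _ hH].
 by split=> [t tm|A _]; rewrite ?h0 // big1 ?muln0 // => t _; exact: h0.
split=> [t tm|A oA].
 rewrite hH // mulSn addnC; apply: leq_add; last exact: i1.
 have := ir1 ir (Il tm); rewrite (bigD1 (Ordinal tm)) /=; last by rewrite /inc eqxx.
 move=> h; apply: leq_trans (_ : N * (b (I t) * Fy) <= _)%N; first by apply: leq_trans h; exact: leq_addr.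
 by rewrite leq_mul2l leq_mul2r BmP ?Il // !orbT.
rewrite mulSn; have -> : (\sum_(t < m | A (I t) && A (J t)) Hh' t = \sum_(t < m | A (I t) && A (J t)) eb t + \sum_(t < m | A (I t) && A (J t)) Hh t)%N.
 by rewrite -big_split; apply: eq_bigr => t _; rewrite hH //= addnC.
by rewrite mulnDr; apply: leq_add; [exact: (ir2 ir)|exact: i2].
Qed.

(** Dual objective of the potentials, seen as vertex covers for the weights scaled by F; [Val] is
    the value of the accumulated loads on the same scale. *)
Definition Phi (X : nat -> nat) : R := \sum_(i < n) (b i)%:R * (X i)%:R.
Definition Val (U Hh : nat -> nat) : R :=
 \sum_(t < m) (W t * F)%:R * ((U t)%:R / E%:R + (Hh t)%:R / (N%:R * Fy%:R)).
Definition SB : R := \sum_(i < n) (b i)%:R.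

(** Exchange of summation; every edge has exactly two distinct ends. *)
Lemma sum_inc (g : nat -> R) (x : nat -> R) :
 \sum_(i < n) x i * \sum_(t < m | inc i t) g t = \sum_(t < m) g t * (x (I t) + x (J t)).
Proof.
under eq_bigr => i _ do rewrite mulr_sumr.
rewrite (exchange_big_dep xpredT) //=; apply: eq_bigr => t _.
have il := Il (ltn_ord t); have jl := Jl (ltn_ord t).
rewrite (bigD1 (Ordinal il)) /=; last by rewrite /inc eqxx.
rewrite (bigD1 (Ordinal jl)) /=; last first.
 by rewrite /inc eqxx orbT /= -val_eqE /= eq_sym IJ.
rewrite big1 ?addr0; first by rewrite mulrDr !(mulrC (g t)).
move=> i /andP[/andP[h /eqP n1] /eqP n2]; case/orP: h => /eqP e; [case: n1|case: n2]; exact: val_inj.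
Qed.

Variable hs : nat -> R.
Hypothesis fs : feas hs.
Definition vs : R := \sum_(t < m) (W t)%:R * hs t.

(** Weak duality. In a settled state every edge is covered except the stored ones in [inH], which
    lack exactly [rr X t]; edges with an end of capacity 0 vanish in every feasible vector. *)
Lemma duality X U : settled X U ->
 F%:R * vs <= Phi X + \sum_(t < m | inH X U t) (rr X t)%:R * hs t.
Proof.
move=> st; have [h0 h1 _] := fs.
have P1 : \sum_(t < m) hs t * ((X (I t))%:R + (X (J t))%:R) <= Phi X.
 rewrite -(sum_inc hs (fun i => (X i)%:R)) /Phi; apply: ler_sum => i _.
 by rewrite mulrC; apply: ler_wpM2r; [exact: ler0n|exact: h1].
have P2 : F%:R * vs <= \sum_(t < m) hs t * ((X (I t))%:R + (X (J t))%:R) + \sum_(t < m | inH X U t) (rr X t)%:R * hs t.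
 rewrite /vs mulr_sumr [X in _ <= _ + X]big_mkcond -big_split /=; apply: ler_sum => t _.
 have tm := ltn_ord t; have ht := h0 t tm.
 have hb i : (i < n)%N -> inc i t -> (b i)%:R = 0 :> R -> hs t = 0.
  move=> il it bz; apply/eqP; rewrite eq_le ht andbT -bz; apply: le_trans (h1 i il).
  by rewrite (bigD1 t) //= lerDl sumr_ge0 // => t' _; exact: h0.
 case: (posnP (b (I t))) => [z|b1].
  rewrite (hb (I t)) ?Il ?/inc ?eqxx ?z //; by case: ifP; rewrite ?mulr0 ?mul0r ?addr0.
 case: (posnP (b (J t))) => [z|b2].
  rewrite (hb (J t)) ?Jl ?/inc ?eqxx ?orbT ?z //; by case: ifP; rewrite ?mulr0 ?mul0r ?addr0.
 rewrite mulrA -natrM [(F * W t)%N]mulnC -natrD.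
 case: ifP => hH.
  have lt : (X (I t) + X (J t) < W t * F)%N by case/and3P: hH.
  have -> : (W t * F = X (I t) + X (J t) + rr X t)%N by rewrite /rr subnKC // ltnW.
  by rewrite natrD mulrDl [hs t * _]mulrC.
 rewrite addr0 mulrC; apply: ler_wpM2l => //; rewrite ler_nat.
 case: (st t tm b1 b2) => [/andP[s1 s2]|//].
 by rewrite leqNgt; apply/negP => lt; move: hH; rewrite /inH s1 s2 lt.
lra.
Qed.

(** The dual objective stays below eps times collected value minus p times the optimum, plus
    rounding errors. A touch raises it by about eps (X_i + X_j) load, less than eps W F load, which
    is the rise of eps [Val]. In closing a round the decay takes away eps [Phi], while by duality
    the inner loads earn, beyond their own cost in [Phi], at least (1 - 8 eps) (F vs - Phi) - 1. *)
Lemma reach_phi p c X U Hh : reach p c X U Hh ->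
 Phi X <= SB + eps * Val U Hh - eps * (p%:R * ((1 - 8 * eps) * (F%:R * vs))) + c%:R * (2 * Bm)%:R + p%:R * (2 * SB + 1).
Proof.
move=> r; have e0 := oeps0; have e8 := oeps8.
have E0 : (0 : R) < E%:R by rewrite ltr0n; lia.
have NF : (0 : R) < N%:R * Fy%:R by rewrite mulr_gt0 ?ltr0n.
elim: r => {p c X U Hh} [X U Hh x0 u0 h0|p c X U Hh t X' U' r IH tm b1 b2 lt us hX hU|p c X U Hh eb X' Hh' r IH stl ir hX hH].
- have -> : Phi X = SB by rewrite /Phi /SB; apply: eq_bigr => i _; rewrite x0 // mulr1.
 have -> : Val U Hh = 0 by rewrite /Val big1 // => t _; rewrite u0 // h0 // !mul0r addr0 mulr0.
 lra.
- have p1 : Phi X' <= Phi X + \sum_(i < n | inc i t) ((X i)%:R * (eps * ((dl t)%:R / E%:R)) + (b i)%:R).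
  rewrite /Phi [X in _ <= _ + X]big_mkcond -big_split /=; apply: ler_sum => i _.
  rewrite hX // /touchX; case: ifP => h; last by rewrite addr0.
  have /andP[d0 d1] := dl_le h b1 b2.
  have bi0 : (0 < b i)%N by case/orP: h => /eqP <-.
  have bR : (0 : R) < (b i)%:R by rewrite ltr0n.
  have := @cdiv_le (X i * dl t) (E * b i * E); rewrite !muln_gt0 bi0 andbT => /(_ (ltac:(lia) : (0 < E)%N && (0 < E)%N)) => hc.
  rewrite natrD mulrDr lerD2l.
  apply: le_trans (_ : (b i)%:R * ((X i * dl t)%:R / (E * b i * E)%:R + 1) <= _); first by rewrite ler_pM2l.
  rewrite mulrDr mulr1 lerD2r; apply: eqle; rewrite /eps !natrM; field; rewrite !gt_eqF //.
 have p2 : \sum_(i < n | inc i t) ((X i)%:R * (eps * ((dl t)%:R / E%:R)) + (b i)%:R) <=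
   (W t * F)%:R * (eps * ((dl t)%:R / E%:R)) + (2 * Bm)%:R.
  have il := Il tm; have jl := Jl tm.
  rewrite (bigD1 (Ordinal il)) /=; last by rewrite /inc eqxx.
  rewrite (bigD1 (Ordinal jl)) /=; last by rewrite /inc eqxx orbT /= -val_eqE /= eq_sym IJ.
  rewrite big1 ?addr0; last first.
   move=> i /andP[/andP[h /eqP n1] /eqP n2]; case/orP: h => /eqP e; [case: n1|case: n2]; exact: val_inj.
  have q1 : (b (I t))%:R <= Bm%:R :> R by rewrite ler_nat BmP.
  have q2 : (b (J t))%:R <= Bm%:R :> R by rewrite ler_nat BmP.
  have q3 : (X (I t))%:R + (X (J t))%:R <= (W t * F)%:R :> R by rewrite -natrD ler_nat ltnW.
  have q4 : 0 <= eps * ((dl t)%:R / E%:R) by rewrite !mulr_ge0 ?invr_ge0 ?ler0n // ltW.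
  have := ler_wpM2r q4 q3; rewrite mulrDl natrM; lra.
 have p3 : Val U' Hh = Val U Hh + (W t * F)%:R * ((dl t)%:R / E%:R).
  rewrite /Val (bigD1 (Ordinal tm)) //= [X in _ = X + _](bigD1 (Ordinal tm)) //= hU // /touchU eqxx natrD.
  rewrite (eq_bigr (fun t0 : 'I_m => (W t0 * F)%:R * ((U t0)%:R / E%:R + (Hh t0)%:R / (N%:R * Fy%:R)))); first by ring.
  move=> t0 /eqP ne; rewrite hU // /touchU; case: eqP => // e; case: ne; exact: val_inj.
 have e : c.+1%:R * (2 * Bm)%:R = c%:R * (2 * Bm)%:R + (2 * Bm)%:R :> R by rewrite -natr1 mulrDl mul1r.
 by rewrite p3 e; lra.
- pose w t := (eb t)%:R / (N%:R * Fy%:R) : R.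
 have w0 t : 0 <= w t by rewrite mulr_ge0 ?invr_ge0 ?ler0n // ltW.
 have p1 : Phi (growX X eb) <= Phi X + eps * (\sum_(t < m) w t * ((X (I t))%:R + (X (J t))%:R)) + SB.
  rewrite -(sum_inc w (fun i => (X i)%:R)) /Phi /SB mulr_sumr -!big_split /=; apply: ler_sum => i _.
  rewrite /growX natrD mulrDr -addrA lerD2l.
  case: (posnP (b i)) => [->|bi0].
   rewrite !mul0r addr0 !mulr_ge0 ?ler0n ?sumr_ge0 // ltW //.
  have bR : (0 : R) < (b i)%:R by rewrite ltr0n.
  have := @cdiv_le (X i * ldg eb i) (N * Fy * b i * E); rewrite !muln_gt0 N0 Fy0 bi0 /= => /(_ (ltac:(lia) : (0 < E)%N)) => hc.
  apply: le_trans (_ : (b i)%:R * ((X i * ldg eb i)%:R / (N * Fy * b i * E)%:R + 1) <= _); first by rewrite ler_pM2l.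
  rewrite mulrDr mulr1 lerD2r; apply: eqle.
  have -> : \sum_(t < m | inc i t) w t = (ldg eb i)%:R / (N%:R * Fy%:R) by rewrite /ldg natr_sum mulr_suml.
  by rewrite /eps !natrM; field; rewrite !gt_eqF // ltr0n.
 have p2 : Phi X' <= (1 - eps) * Phi (growX X eb) + SB.
  rewrite /Phi /SB mulr_sumr -big_split /=; apply: ler_sum => i _.
  rewrite hX // /decay natrB ?leq_div // mulrBr.
  set g := growX X eb i.
  have q2 : g%:R * eps - 1 <= (g %/ E)%:R :> R.
   rewrite lerBlDr /eps ler_pdivrMr // -[1]/(1%:R) -natrD -natrM ler_nat ltnW // addn1 ltn_ceil //; lia.
  have := ler_wpM2l (ler0n R (b i)) q2; rewrite mulrBr mulr1; lra.
 have p3 : Val U Hh' = Val U Hh + \sum_(t < m) (W t * F)%:R * w t.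
  by rewrite /Val -big_split /=; apply: eq_bigr => t _; rewrite hH // natrD /w; ring.
 have p4 : \sum_(t < m) w t * ((X (I t))%:R + (X (J t))%:R) + \sum_(t < m) (rr X t)%:R * w t = \sum_(t < m) (W t * F)%:R * w t.
  rewrite -big_split /=; apply: eq_bigr => t _; rewrite [(rr X t)%:R * _]mulrC -mulrDr mulrC.
  case/boolP: (inH X U t) => hH'; last by rewrite /w (ir0 ir) // !mul0r !mulr0.
  have lt : (X (I t) + X (J t) < W t * F)%N by case/and3P: hH'.
  by rewrite -!natrD /rr subnKC // ltnW.
 have p5 := ir3 ir fs; have p6 := duality stl.
 set Sh := \sum_(t < m | inH X U t) _ in p5 p6; set Sw := \sum_(t < m) (rr X t)%:R * w t in p4.
 rewrite -/Sw in p5.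
 (* The 8 comes from (1 + 5 eps) (1 - 8 eps) <= 1 - 3 eps. *)
 have p7 : (1 - 8 * eps) * Sh <= Sw + 1.
  have Sh0 : 0 <= Sh by rewrite sumr_ge0 // => t _; rewrite mulr_ge0 ?ler0n //; case: fs => h0 _ _; exact: h0.
  have c1 : (0 : R) < 1 + 5 * eps by lra.
  rewrite -(ler_pM2l c1); apply: le_trans p5.
  have -> : (1 + 5 * eps) * ((1 - 8 * eps) * Sh) = ((1 + 5 * eps) * (1 - 8 * eps)) * Sh by ring.
  by apply: ler_wpM2r => //; nra.
 have p8 : (1 - 8 * eps) * (F%:R * vs - Phi X) <= Sw + 1.
  apply: le_trans p7; apply: ler_wpM2l; lra.
 have PX0 : 0 <= Phi X by rewrite sumr_ge0 // => i _; rewrite mulr_ge0 ?ler0n.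
 have Pg : Phi X <= Phi (growX X eb).
  by apply: ler_sum => i _; apply: ler_wpM2l; rewrite ?ler0n // ler_nat leq_addr.
 have q1 : eps * Phi X <= eps * Phi (growX X eb) by rewrite ler_pM2l.
 have q2 := ler_wpM2l (ltW e0) p8.
 have q3 : 0 <= eps * (8 * eps * Phi X) by rewrite !mulr_ge0 ?ler0n // ltW.
 rewrite p3 -natr1 [(p%:R + 1) * (2 * SB + 1)]mulrDl [(p%:R + 1) * ((1 - 8 * eps) * _)]mulrDl !mul1r -p4.
 lra.
Qed.

End Outer.

End OuterTh.

(** * One pass over the edge stream *)

Module PassTh.
Import Defs MachineTh HoareTh InnerCodeTh FindTh WeightsTh OuterTh.
Notation rp := 71 (only parsing). Notation go := 72 (only parsing).
Notation pi_ := 73 (only parsing). Notation pj := 74 (only parsing).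
Notation pw := 75 (only parsing). Notation idx := 76 (only parsing).
Notation pp_ := 77 (only parsing). Notation pk := 78 (only parsing).
Notation pu := 79 (only parsing). Notation ph := 80 (only parsing).
Notation pbi := 81 (only parsing). Notation pbj := 82 (only parsing).
Notation wf := 83 (only parsing). Notation ps_ := 84 (only parsing).
Notation pdl := 85 (only parsing). Notation pt := 86 (only parsing).

(** Stored edges are identified by their position in the stream, which is the same in all passes,
    and are kept in this order. Looking up the current edge is then a merge of two sorted lists,
    with [pp_] the next unread entry. *)
Definition RDL : cmd :=
 pu <~ #0 ;; ph <~ #0 ;;
 WHEN (pp_ + #1) <=: vcnt DO WHEN (aLT`[pp_]) <=: idx DO (
  pu <~ aLU`[pp_] ;; ph <~ aLH`[pp_] ;; pp_ <~ pp_ + #1).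

Definition CST : cmd :=
 pbi <~ aCAP`[pi_] ;; pbj <~ aCAP`[pj] ;; wf <~ pw * vF ;;
 ps_ <~ #0 ;; (WHEN pbi <=: vE DO WHEN pbj <=: vE DO ps_ <~ #1) ;;
 pdl <~ vE * pbi ;; (WHEN pbj <=: pbi DO pdl <~ vE * pbj) ;;
 WHEN #1 <=: ps_ DO pdl <~ #1.

(** The product [ps_ * pu * wf] encodes the rule for small edges: once such an edge carries a touch
    load, the left side exceeds [wf] and the loop is closed to it for good. *)
Definition TOUCH : cmd :=
 WHILE (aX`[pi_] + aX`[pj] + #1 + ps_ * pu * wf) <=: wf DO (
  aX~[pi_] <~ aX`[pi_] + (aX`[pi_] * pdl + vE * pbi * vE - #1) %/ (vE * pbi * vE) ;;
  aX~[pj] <~ aX`[pj] + (aX`[pj] * pdl + vE * pbj * vE - #1) %/ (vE * pbj * vE) ;;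
  pu <~ pu + pdl).

(** The new list is written to separate arrays, because a newly touched edge may belong in the
    middle of the list that is being read. *)
Definition APP : cmd :=
 WHEN #1 <=: pu DO (
  bLT~[pk] <~ idx ;; bLI~[pk] <~ pi_ ;; bLJ~[pk] <~ pj ;; bLW~[pk] <~ pw ;;
  bLU~[pk] <~ pu ;; bLH~[pk] <~ ph ;; pk <~ pk + #1).

Definition STEP : cmd :=
 RDL ;; CST ;; (WHEN #1 <=: pbi DO WHEN #1 <=: pbj DO TOUCH) ;; APP ;; idx <~ idx + #1.

Definition PASS : cmd :=
 Rew ;; idx <~ #0 ;; pp_ <~ #0 ;; pk <~ #0 ;; go <~ #1 ;;
 WHILE #1 <=: go DO (Nxt go pi_ pj pw ;; WHEN #1 <=: go DO STEP).

Definition COPY : cmd :=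
 (FOR pt TO pk DO (
  aLT~[pt] <~ bLT`[pt] ;; aLI~[pt] <~ bLI`[pt] ;; aLJ~[pt] <~ bLJ`[pt] ;;
  aLW~[pt] <~ bLW`[pt] ;; aLU~[pt] <~ bLU`[pt] ;; aLH~[pt] <~ bLH`[pt])) ;;
 vcnt <~ pk.

Section Pass.
Variables (R : realType) (Lm M0 : nat) (es : seq (nat * nat * nat)).
Variables (n E Q D N F Fy Y0 RM Wm Bm : nat) (cap : nat -> nat).
Notation run := (run Lm M0 es).
Notation m := (size es).
Definition I_ t := (nth (0, 0, 0) es t).1.1.
Definition J_ t := (nth (0, 0, 0) es t).1.2.
Definition W_ t := (nth (0, 0, 0) es t).2.
Notation reach := (@reach R n m E N F Fy Q I_ J_ W_ cap).
Notation settled := (settled m E F I_ J_ W_ cap).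
Notation sm := (sm E I_ J_ cap).
Notation dl := (dl E I_ J_ cap).

Record cfg (s : st) : Prop := Cfg {
 f_n : rg s 1 = n; f_E : rg s 2 = E; f_N : rg s 3 = N; f_Q : rg s 4 = Q; f_D : rg s 5 = D;
 f_F : rg s 6 = F; f_Fy : rg s 7 = Fy; f_Y0 : rg s 8 = Y0; f_RM : rg s 10 = RM;
 f_cap : ar s aCAP = cap; f_vis : forall x, x <= n -> ar s aVIS x = 0;
 f_ld : forall x, x < n -> ar s aLD x = 0 }.

Lemma cfg_frame c s s' : frame c s s' ->
 all (fun r => r \notin modr c) [:: 1; 2; 3; 4; 5; 6; 7; 8; 10] ->
 all (fun k => k \notin moda c) [:: 3; 14; 20] -> cfg s -> cfg s'.
Proof.
move=> fr /= /and5P[a1 a2 a3 a4 /and5P[a5 a6 a7 a8 /andP[a9 _]]] /and4P[b1 b2 b3 _].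
by case=> *; split; rewrite ?(fr_r fr) ?(fr_a fr).
Qed.
Lemma cfg_tick s : cfg s -> cfg (tick s). Proof. by case=> *; split. Qed.
Lemma cfg_setr r v s : r \notin [:: 1; 2; 3; 4; 5; 6; 7; 8; 10] -> cfg s -> cfg (setr r v s).
Proof.
by move=> h [*]; split=> //=; case: eqP => // e; move: h; rewrite -e.
Qed.
Lemma cfg_seta k i v s : k \notin [:: 3; 14; 20] -> cfg s -> cfg (seta k i v s).
Proof.
by move=> h [*]; split=> //=; case: eqP => // e; move: h; rewrite -e.
Qed.

Definition lstp (U : nat -> nat) t := [seq x <- iota 0 t | 0 < U x].
Definition lst U := lstp U m.

Record listed (s : st) (U Hh : nat -> nat) : Prop := Listed {
 l_c : rg s vcnt = size (lst U);
 l_T : forall k, k < size (lst U) -> ar s aLT k = nth 0 (lst U) k;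
 l_I : forall k, k < size (lst U) -> ar s aLI k = I_ (nth 0 (lst U) k);
 l_J : forall k, k < size (lst U) -> ar s aLJ k = J_ (nth 0 (lst U) k);
 l_W : forall k, k < size (lst U) -> ar s aLW k = W_ (nth 0 (lst U) k);
 l_U : forall k, k < size (lst U) -> ar s aLU k = U (nth 0 (lst U) k);
 l_H : forall k, k < size (lst U) -> ar s aLH k = Hh (nth 0 (lst U) k) }.

Lemma listed_eq s s' U Hh : listed s U Hh -> rg s' vcnt = rg s vcnt ->
 (forall k, 21 <= k <= 26 -> ar s' k = ar s k) -> listed s' U Hh.
Proof. by case=> a b c d e f g h1 h2; split=> *; rewrite ?h1 ?h2 //; auto. Qed.

Record buf (s : st) (U Hh : nat -> nat) t : Prop := Buf {
 bf_c : rg s pk = size (lstp U t);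
 bf_T : forall k, k < size (lstp U t) -> ar s bLT k = nth 0 (lstp U t) k;
 bf_I : forall k, k < size (lstp U t) -> ar s bLI k = I_ (nth 0 (lstp U t) k);
 bf_J : forall k, k < size (lstp U t) -> ar s bLJ k = J_ (nth 0 (lstp U t) k);
 bf_W : forall k, k < size (lstp U t) -> ar s bLW k = W_ (nth 0 (lstp U t) k);
 bf_U : forall k, k < size (lstp U t) -> ar s bLU k = U (nth 0 (lstp U t) k);
 bf_H : forall k, k < size (lstp U t) -> ar s bLH k = Hh (nth 0 (lstp U t) k) }.

Lemma lstpS U t : lstp U t.+1 = if 0 < U t then rcons (lstp U t) t else lstp U t.
Proof. by rewrite /lstp -[t.+1]addn1 iotaD filter_cat /= add0n; case: ifP; rewrite ?cats0 ?cats1. Qed.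

Lemma lst_cat U t : t <= m -> lst U = lstp U t ++ [seq x <- iota t (m - t) | 0 < U x].
Proof. by move=> h; rewrite /lst /lstp -{1}(subnKC h) iotaD filter_cat. Qed.

Lemma lst_hit U t : t < m -> 0 < U t ->
 nth 0 (lst U) (size (lstp U t)) = t /\ size (lstp U t) < size (lst U).
Proof.
move=> h u; rewrite (lst_cat U h) lstpS u nth_cat size_cat size_rcons nth_rcons ltnn eqxx leqnn.
by split=> //; rewrite ltnS leq_addr.
Qed.

Lemma lst_miss U t : t < m -> U t = 0 -> size (lstp U t) < size (lst U) ->
 t < nth 0 (lst U) (size (lstp U t)).
Proof.
move=> h u; have e : lstp U t.+1 = lstp U t by rewrite lstpS u.
rewrite (lst_cat U h) e size_cat => hs; rewrite nth_cat ltnn subnn.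
have : nth 0 [seq x <- iota t.+1 (m - t.+1) | 0 < U x] 0 \in [seq x <- iota t.+1 (m - t.+1) | 0 < U x].
 by apply: mem_nth; move: hs; rewrite -{1}[size (lstp U t)]addn0 ltn_add2l.
by rewrite mem_filter mem_iota => /andP[_ /andP[]].
Qed.

Lemma lstp_ext U U' t : (forall x, x < t -> U x = U' x) -> lstp U t = lstp U' t.
Proof. by move=> h; apply: eq_in_filter => x; rewrite mem_iota => /andP[_ hx]; rewrite h. Qed.

Lemma lstp_le U t : t <= m -> size (lstp U t) <= size (lst U).
Proof. by move=> h; rewrite (lst_cat U h) size_cat leq_addr. Qed.

Lemma size_lst U : size (lst U) = \sum_(t < m) (0 < U t).
Proof.
by rewrite /lst /lstp size_filter -sum1_count -[X in iota 0 X]subn0 big_mkord big_mkcond; apply: eq_bigr => i _; case: (0 < _).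
Qed.

Lemma mem_lst U k : k < size (lst U) -> nth 0 (lst U) k < m /\ 0 < U (nth 0 (lst U) k).
Proof. by move=> /(mem_nth 0); rewrite mem_filter mem_iota => /andP[-> /andP[_ ->]]. Qed.

Hypothesis E8 : 8 <= E.
Hypothesis N0 : 0 < N.
Hypothesis Fy0 : 0 < Fy.
Hypothesis Q0 : 0 < Q.
Hypothesis Il : forall t, t < m -> I_ t < n.
Hypothesis Jl : forall t, t < m -> J_ t < n.
Hypothesis IJ : forall t, t < m -> I_ t != J_ t.
Hypothesis WmP : forall t, t < m -> W_ t <= Wm.
Hypothesis BmP : forall i, i < n -> cap i <= Bm.
Hypothesis lnX : (ln (2 * (Wm * F) + 2)%:R <= N%:R * (E%:R^-1 * E%:R^-1) :> R)%R.
Hypothesis nL : n < Lm.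
Hypothesis lL : n * (2 * N * (E * E)) < Lm.
Hypothesis LM : Lm <= M0.
Hypothesis mM : m < M0.
Hypothesis XM : 2 * (Wm * F) + 2 + Wm <= M0.
Hypothesis UM : E * (2 * N) * Bm <= M0.
Hypothesis bM : E * Bm + E + Bm <= M0.

(** The inner loop loads stored edges only, and an edge is stored from its first touch on. *)
Lemma reach_H0 p c X U Hh t : reach p c X U Hh -> t < m -> U t = 0 -> Hh t = 0.
Proof.
move=> r tm; elim: r => {p c X U Hh} [X U Hh _ _ h0 _|p c X U Hh t' X' U' _ IH _ b1 b2 _ _ _ hU|p c X U Hh eb X' Hh' _ IH _ ir _ hH u].
- exact: h0.
- rewrite hU // /touchU; case: eqP => [e|_]; last exact: IH.
 have E0 : 0 < E by lia.
 have : 0 < dl t'.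
  rewrite /OuterTh.dl; case: ifP => // _; rewrite muln_gt0 E0 /=.
  by rewrite /minn; case: ifP.
 by lia.
- by rewrite hH // IH // (ir0 ir) // /inH u andbF.
Qed.

Lemma reach_size p c X U Hh : reach p c X U Hh -> p <= N -> size (lst U) < Lm.
Proof.
move=> r pN; rewrite size_lst.
have h1 := reach_listed r; have h2 : c <= n * (2 * N * (E * E)) by exact: (reach_cnt_le E8 N0 Fy0 Q0 Il Jl WmP lnX r pN).
by apply: leq_ltn_trans lL; apply: leq_trans h2.
Qed.

Lemma rdl_ok s U Hh t : cfg s -> listed s U Hh -> t < m -> rg s idx = t -> rg s pp_ = size (lstp U t) ->
 (U t = 0 -> Hh t = 0) -> size (lst U) < Lm -> (forall x, x < m -> U x <= M0 /\ Hh x <= M0) ->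
 run RDL s (fun s' => [/\ rg s' pu = U t, rg s' ph = Hh t, rg s' pp_ = size (lstp U t.+1) & clk s' <= clk s + 10]).
Proof.
move=> C0 L0 tm ei ep H0 sL UHM.
apply: run_sq; apply: run_asg => //=; apply: run_sq; apply: run_asg => //=.
apply: run_ite => //=; rewrite ep (l_c L0) addn1 => h1; last first.
 have u0 : U t = 0 by apply/eqP; rewrite -leqn0 leqNgt; apply/negP => u; have [_] := lst_hit tm u; lia.
 apply: run_asg => //=; rewrite ep lstpS u0 H0 //; split=> //; lia.
apply: run_ite => //=; rewrite ep ?(l_T L0) // ?ei; [by split=> //; lia| |].
 move=> h2; have u0 : 0 < U t by rewrite lt0n; apply/eqP => u; have := lst_miss tm u h1; lia.
 have [e1 _] := lst_hit tm u0; have [uM hM] := UHM t tm.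
 apply: run_sq; apply: run_asg => //=; rewrite ep ?(l_U L0) // ?e1 //; first by split=> //; lia.
 apply: run_sq; apply: run_asg => //=; rewrite ep ?(l_H L0) // ?e1 //; first by split=> //; lia.
 apply: run_asg => //=; rewrite ep; first by lia.
 by split=> //; [rewrite lstpS u0 size_rcons addn1|lia].
move=> h2; have u0 : U t = 0.
 by apply/eqP; rewrite -leqn0 leqNgt; apply/negP => u; have [e1 _] := lst_hit tm u; lia.
by apply: run_asg => //=; rewrite ep lstpS u0 H0 //; split=> //; lia.
Qed.

Lemma cst_ok s t : cfg s -> t < m -> rg s pi_ = I_ t -> rg s pj = J_ t -> rg s pw = W_ t ->
 run CST s (fun s' => [/\ rg s' pbi = cap (I_ t), rg s' pbj = cap (J_ t), rg s' wf = W_ t * F,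
  (0 < cap (I_ t) -> 0 < cap (J_ t) -> rg s' ps_ = sm t /\ rg s' pdl = dl t) & clk s' <= clk s + 20]).
Proof.
move=> C0 tm ei ej ew; have il := Il tm; have jl := Jl tm; have wl := WmP tm; have b1 := BmP il; have b2 := BmP jl.
have hw : W_ t * F <= Wm * F by rewrite leq_mul2r wl orbT.
have m1 : E * cap (I_ t) <= E * Bm by rewrite leq_mul2l b1 orbT.
have m2 : E * cap (J_ t) <= E * Bm by rewrite leq_mul2l b2 orbT.
apply: run_sq; apply: run_asg => //=; rewrite ?ei ?(f_cap C0); [by split=> //; lia|lia|].
apply: run_sq; apply: run_asg => //=; rewrite ?ej ?(f_cap C0); [by split=> //; lia|lia|].
apply: run_sq; apply: run_asg => //=; rewrite ?ew ?(f_F C0); first lia.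
apply: run_sq; apply: run_asg => //=.
apply: run_sq.
set s1 := setr ps_ 0 _.
pose P s2 := [/\ rg s2 ps_ = (cap (I_ t) <= E) && (cap (J_ t) <= E), rg s2 pbi = cap (I_ t), rg s2 pbj = cap (J_ t), rg s2 wf = W_ t * F /\ rg s2 vE = E & clk s2 <= clk s + 7].
have h1 : run (WHEN pbi <=: vE DO WHEN pbj <=: vE DO ps_ <~ #1) s1 P.
 apply: run_ite => //=; rewrite (f_E C0) => c1.
  apply: run_ite => //=; rewrite (f_E C0) => c2; apply: run_asg => //=; try lia; split=> //=; rewrite ?c1 ?c2 ?(f_E C0) //; try lia; try by rewrite leqNgt c2.
 apply: run_asg => //=; try lia; split=> //=; rewrite ?(f_E C0) //; try lia; try by rewrite leqNgt c1.
apply: (run_call h1) => s2 [q1 q2 q3 [q4 qE] q5] _.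
apply: run_sq; apply: run_asg => //=; rewrite ?qE ?q2; first lia.
apply: run_sq.
set s3 := setr pdl _ s2.
pose P' s4 := [/\ rg s4 pdl = E * minn (cap (I_ t)) (cap (J_ t)), rg s4 ps_ = (cap (I_ t) <= E) && (cap (J_ t) <= E),
  [/\ rg s4 pbi = cap (I_ t), rg s4 pbj = cap (J_ t) & rg s4 wf = W_ t * F] & clk s4 <= clk s + 10].
have h2 : run (WHEN pbj <=: pbi DO pdl <~ (vE * pbj)%al) s3 P'.
 apply: run_ite => //=; rewrite q2 q3 => c1; apply: run_asg => //=; rewrite ?qE ?q3; try lia; split=> //=; try lia.
 apply: (run_call h2) => s4 [z1 z2 [z3 z4 z5] z6] _.
apply: run_ite => //=; rewrite z2 => c1; apply: run_asg => //=; try lia; split=> //=; try lia.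
 by move=> p1 p2; rewrite z2 /OuterTh.dl /OuterTh.sm p1 p2 /=; move: c1; case: ((_ <= E) && _) => //.
by move=> p1 p2; rewrite z2 z1 /OuterTh.dl /OuterTh.sm p1 p2 /=; move: c1; case: ((_ <= E) && _) => //.
Qed.

Lemma touch_ok s p c U Hh t : cfg s -> p <= N -> t < m -> reach p c (ar s aX) U Hh ->
 rg s pi_ = I_ t -> rg s pj = J_ t -> rg s pbi = cap (I_ t) -> rg s pbj = cap (J_ t) -> rg s wf = W_ t * F ->
 0 < cap (I_ t) -> 0 < cap (J_ t) -> rg s ps_ = sm t -> rg s pdl = dl t -> rg s pu = U t ->
 run TOUCH s (fun s' => exists c' U', [/\ reach p c' (ar s' aX) U' Hh, rg s' pu = U' t,
  forall x, x <> t -> U' x = U x,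
  (sm t && (0 < U' t) \/ W_ t * F <= ar s' aX (I_ t) + ar s' aX (J_ t)) /\ (forall i, i < n -> ar s aX i <= ar s' aX i) &
  c <= c' /\ clk s' <= clk s + 2 + 5 * (c' - c)]).
Proof.
move=> C0 pN tm r0 ei ej ebi ebj ew b1 b2 es' ed eu.
have il := Il tm; have jl := Jl tm.
have Wl : W_ t * F <= Wm * F by rewrite leq_mul2r WmP ?orbT.
apply: (@run_whl _ _ _ (fun s1 => exists c1 U1, [/\ cfg s1, reach p c1 (ar s1 aX) U1 Hh,
  [/\ rg s1 pi_ = I_ t, rg s1 pj = J_ t, rg s1 pbi = cap (I_ t) & rg s1 pbj = cap (J_ t)],
  [/\ rg s1 wf = W_ t * F, rg s1 ps_ = sm t, rg s1 pdl = dl t & rg s1 pu = U1 t] &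
  [/\ forall x, x <> t -> U1 x = U x, forall i, i < n -> ar s aX i <= ar s1 aX i, c <= c1 & clk s1 <= clk s + 1 + 5 * (c1 - c)]])
 (fun s1 => W_ t * F - (ar s1 aX (I_ t) + ar s1 aX (J_ t)))).
 by exists c, U; split=> //; split=> //; lia.
move=> s1 [c1 [U1 [C1 r1 [i1 j1 bi1 bj1] [w1 s1' d1 u1] [x1 y1 cc k1]]]] /=.
rewrite i1 j1 w1 s1' u1; split=> //; [by do !split=> //; lia| |].
 move=> h.
 have su : sm t -> U1 t = 0.
  move=> st; rewrite st mul1n in h; case: (posnP (U1 t)) => // u0.
  have : W_ t * F <= U1 t * (W_ t * F) by rewrite leq_pmull.
  lia.
 have lt : ar s1 aX (I_ t) + ar s1 aX (J_ t) < W_ t * F by lia.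
 pose X' i := touchX E I_ J_ cap (ar s1 aX) t i.
 pose U' := touchU E I_ J_ cap U1 t.
 have r2 : reach p c1.+1 X' U' Hh by apply: (rchT r1 tm b1 b2 lt su).
 have xi := reach_le E8 N0 Fy0 Q0 WmP r2 il.
 have xj := reach_le E8 N0 Fy0 Q0 WmP r2 jl.
 have ux : U' t <= E * (2 * N) * Bm by exact: (reach_U E8 N0 Fy0 Q0 Il WmP BmP lnX r2 pN tm).
 have iI : inc I_ J_ (I_ t) t by rewrite /inc eqxx.
 have iJ : inc I_ J_ (J_ t) t by rewrite /inc eqxx orbT.
 rewrite /X' /touchX iI in xi; rewrite /X' /touchX iJ in xj.
 have nij : (J_ t == I_ t) = false by apply/negbTE; rewrite eq_sym IJ.
 rewrite /U' /touchU eqxx in ux.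
 apply: run_sq; apply: run_put => //=; rewrite ?i1 ?bi1 ?d1 ?(f_E C1); [by do !split=> //; lia|lia|by rewrite -/(cdiv _ _); lia|].
 apply: run_sq; apply: run_put => //=; rewrite ?j1 ?bj1 ?d1 ?(f_E C1) ?nij; [by do !split=> //; lia|lia|by rewrite -/(cdiv _ _); lia|].
 apply: run_asg => //=; rewrite ?u1 ?d1; first lia.
 set A := updf _ _ _.
 have eA i : A i = X' i.
  rewrite /A /X' /touchX /inc /= (eq_sym (I_ t)) (eq_sym (J_ t)); case: eqP => [->|_]; first by rewrite orbT.
  by case: eqP => [->|_].
 have xI := eA (I_ t); have xJ := eA (J_ t).
 split; last first.
  rewrite -[X in _ - X < _]/(A (I_ t) + A (J_ t)) xI xJ /X' /touchX iI iJ.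
  (* Rounding up guarantees progress: each turn raises the potential by at least 1. *)
  have p1 : 0 < cdiv (ar s1 aX (I_ t) * dl t) (E * cap (I_ t) * E).
   have x0 := reach_pos E8 N0 Fy0 Q0 r1 il.
    have /andP[d0 _] : 0 < dl t <= E * cap (I_ t) by exact: (dl_le E8 N0 Fy0 Q0 iI b1 b2).
   rewrite /cdiv divn_gt0 ?muln_gt0 ?b1 ?andbT //=; last by lia.
   have : 0 < ar s1 aX (I_ t) * dl t by rewrite muln_gt0 x0. lia.
  lia.
 exists c1.+1, U'; split=> //=.
 - by do ?[apply: cfg_setr => //|apply: cfg_seta => //|apply: cfg_tick].
 - by rewrite (_ : A = X') //; apply/boolp.funext.
 - by rewrite w1 s1' /U' /touchU eqxx.
 - have q1 x : x <> t -> U' x = U x by move=> nx; rewrite /U' /touchU; case: eqP => // _; exact: x1.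
  have q2 i : i < n -> ar s aX i <= A i.
   by move=> hi; rewrite eA /X' /touchX; have := y1 i hi; case: ifP => _; lia.
  by split=> //; lia.
move=> h; exists c1, U1; split=> //; last by split=> //=; lia.
split; last exact: y1.
case: (leqP (W_ t * F) (ar s1 aX (I_ t) + ar s1 aX (J_ t))) => hx; [by right|left].
move: h; case: (sm t) => /=; last by rewrite !mul0n; lia.
by case: (U1 t) => // h; move: h; rewrite muln0 mul0n; lia.
Qed.

Lemma app_ok s U Hh t : cfg s -> t < m -> rg s idx = t -> rg s pi_ = I_ t -> rg s pj = J_ t -> rg s pw = W_ t ->
 rg s pu = U t -> rg s ph = Hh t -> buf s U Hh t -> size (lst U) < Lm -> U t <= M0 -> Hh t <= M0 ->
 run APP s (fun s' => buf s' U Hh t.+1 /\ clk s' <= clk s + 10).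
Proof.
move=> C0 tm e1 e2 e3 e4 e5 e6 B0 sL uM hM; have il := Il tm; have jl := Jl tm; have wl := WmP tm.
have sl := lstp_le U (ltnW tm).
apply: run_ite => //=; rewrite e5 => hu; last first.
 have e : lstp U t.+1 = lstp U t by rewrite lstpS; case: (U t) hu.
 apply: run_asg => //=; split; last lia.
 by case: B0 => *; split; rewrite ?e.
have e : lstp U t.+1 = rcons (lstp U t) t by rewrite lstpS hu.
have kc := bf_c B0.
apply: run_sq; apply: run_put => //=; rewrite ?kc ?e1; [lia|lia|].
apply: run_sq; apply: run_put => //=; rewrite ?kc ?e2; [lia|lia|].
apply: run_sq; apply: run_put => //=; rewrite ?kc ?e3; [lia|lia|].
apply: run_sq; apply: run_put => //=; rewrite ?kc ?e4; [lia|lia|].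
apply: run_sq; apply: run_put => //=; rewrite ?kc ?e5; [lia|lia|].
apply: run_sq; apply: run_put => //=; rewrite ?kc ?e6; [lia|lia|].
apply: run_asg => //=; rewrite ?kc; first lia.
split; last by rewrite /=; lia.
have hn (A : nat -> nat) (g : nat -> nat) v : (forall k, k < size (lstp U t) -> A k = g (nth 0 (lstp U t) k)) -> v = g t ->
 forall k, k < size (rcons (lstp U t) t) -> updf A (size (lstp U t)) v k = g (nth 0 (rcons (lstp U t) t) k).
 move=> hA -> k; rewrite size_rcons ltnS leq_eqVlt nth_rcons /=; case: eqP => [->|_ /= h]; first by rewrite ltnn.
 by rewrite h hA.
case: B0 => _ b1 b2 b3 b4 b5 b6.
split; rewrite e /=; try (by rewrite size_rcons addn1).
- exact: (hn _ id).
- exact: (hn _ I_).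
- exact: (hn _ J_).
- exact: (hn _ W_).
- exact: (hn _ U).
- exact: (hn _ Hh).
Qed.

(** [v_U] says that the touch loads of unread edges are still the old ones. [v_s] is [settled]
    restricted to the edges already read; it persists because potentials never decrease within a
    pass, and this is why one traversal per round is enough. *)
Record pinv (p : nat) (U0 Hh : nat -> nat) (t c : nat) (U : nat -> nat) (s : st) : Prop := Pinv {
 v_cfg : cfg s; v_l : listed s U0 Hh; v_i : rg s idx = t; v_p : rg s pp_ = size (lstp U0 t);
 v_b : buf s U Hh t; v_U : forall x, t <= x -> U x = U0 x; v_r : reach p c (ar s aX) U Hh;
 v_s : forall x, x < t -> 0 < cap (I_ x) -> 0 < cap (J_ x) ->
  sm x && (0 < U x) \/ W_ x * F <= ar s aX (I_ x) + ar s aX (J_ x) }.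

Hypothesis HM : N * (N * (Bm * Fy)) <= M0.

Lemma reach_UH p c X U Hh x : reach p c X U Hh -> p <= N -> x < m -> U x <= M0 /\ Hh x <= M0.
Proof.
move=> r pN xm; split.
 by apply: leq_trans UM; exact: (reach_U E8 N0 Fy0 Q0 Il WmP BmP lnX r pN xm).
have [h _] := reach_Hh Il BmP r.
by apply: leq_trans (h x xm) _; apply: leq_trans HM; rewrite leq_mul2r pN orbT.
Qed.

Lemma touch_r c X U Hh p : reach p c X U Hh -> p <= N ->
 size (lst U) < Lm /\ (forall x, x < m -> U x <= M0 /\ Hh x <= M0).
Proof. by move=> r pN; split; [exact: (reach_size r)|move=> x; exact: (reach_UH r)]. Qed.

Lemma step_ok s p U0 Hh t c U c0 X0 : pinv p U0 Hh t c U s -> p <= N -> t < m -> reach p c0 X0 U0 Hh ->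
 rg s pi_ = I_ t -> rg s pj = J_ t -> rg s pw = W_ t ->
 run STEP s (fun s' => exists c' U', [/\ pinv p U0 Hh t.+1 c' U' s', c <= c',
   (forall i, i < n -> ar s aX i <= ar s' aX i) & clk s' <= clk s + 55 + 5 * (c' - c)]).
Proof.
move=> [C0 L0 ei ep B0 uU r v_s] pN tm r0 e1 e2 e3.
have [sL0 M00] := touch_r r0 pN.
apply: run_sq; apply: (run_call (rdl_ok C0 L0 tm ei ep _ sL0 M00)); first by move=> u; exact: (reach_H0 r0 tm u).
move=> s1 [u1 h1 p1 k1] fr1.
have C1 : cfg s1 by apply: cfg_frame fr1 _ _ C0.
have uT : U t = U0 t by apply: uU.
apply: run_sq; apply: (run_call (cst_ok C1 tm _ _ _)); rewrite ?(fr_r fr1) //.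
move=> s2 [b1 b2 w2 sd k2] fr2.
have C2 : cfg s2 by apply: cfg_frame fr2 _ _ C1.
have X2 : ar s2 aX = ar s aX by rewrite (fr_a fr2) // (fr_a fr1).
have r2 : reach p c (ar s2 aX) U Hh by rewrite X2.
have [i2 j2 W2 u2] : [/\ rg s2 pi_ = I_ t, rg s2 pj = J_ t, rg s2 pw = W_ t & rg s2 pu = U t].
 by rewrite uT !(fr_r fr2) // u1 !(fr_r fr1).
have [h2 id2 p2 k2'] : [/\ rg s2 ph = Hh t, rg s2 idx = t, rg s2 pp_ = size (lstp U0 t.+1) & rg s2 pk = rg s pk].
 by rewrite !(fr_r fr2) // h1 p1 !(fr_r fr1).
apply: run_sq.
pose P s3 := exists c' U', [/\ reach p c' (ar s3 aX) U' Hh, rg s3 pu = U' t, forall x, x <> t -> U' x = U x,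
  (0 < cap (I_ t) -> 0 < cap (J_ t) -> sm t && (0 < U' t) \/ W_ t * F <= ar s3 aX (I_ t) + ar s3 aX (J_ t)) /\
  (forall i, i < n -> ar s aX i <= ar s3 aX i) & c <= c' /\ clk s3 <= clk s2 + 5 + 5 * (c' - c)].
have h3 : run (WHEN #1 <=: pbi DO WHEN #1 <=: pbj DO TOUCH) s2 P.
 apply: run_ite => //=; rewrite b1 => q1.
  apply: run_ite => //=; rewrite b2 => q2.
   have [sd1 sd2] := sd q1 q2.
   have Ct : cfg (tick (tick s2)) by do 2 apply: cfg_tick.
   apply: (run_call (touch_ok Ct pN tm r2 i2 j2 b1 b2 w2 q1 q2 sd1 sd2 u2)) => s3 [c' [U' [z1 z2 z3 [z4 z4'] [z5 z6]]]] _.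
   exists c', U'; split=> //; first by split=> // i hi; rewrite -X2; exact: z4'.
   by split=> //; move: z6 => /=; lia.
  apply: run_asg => //=; exists c, U; split=> //=; first by split=> [|i _]; rewrite ?X2 //; move=> _; lia.
  by split=> //; lia.
 apply: run_asg => //=; exists c, U; split=> //=; first by split=> [|i _]; rewrite ?X2 //; lia.
 by split=> //; lia.
apply: (run_call h3) => s3 [c' [U' [z1 z2 z3 [z4 z4'] [z5 z6]]]] fr3.
have C3 : cfg s3 by apply: cfg_frame fr3 _ _ C2.
have [sL3 M3] := touch_r z1 pN; have [M31 M32] := M3 t tm.
have lU : lstp U' t = lstp U t by apply: lstp_ext => x xt; apply: z3; lia.
have B3 : buf s3 U' Hh t.
 case: B0 => d1 d2 d3 d4 d5 d6 d7.
 split; rewrite lU ?(fr_r fr3) ?k2' //; move=> k kc; rewrite (fr_a fr3) // (fr_a fr2) // (fr_a fr1) //; auto.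
 rewrite d6 // z3 // => e.
 by have := mem_nth 0 kc; rewrite e mem_filter mem_iota add0n ltnn !andbF.
apply: run_sq; apply: (run_call (app_ok C3 tm _ _ _ _ z2 _ B3 sL3 M31 M32)); rewrite ?(fr_r fr3) //.
move=> s4 [B4 k4] fr4.
have C4 : cfg s4 by apply: cfg_frame fr4 _ _ C3.
apply: run_asg => //=; first by rewrite (fr_r fr4) // (fr_r fr3) // id2; lia.
have X4 : ar s4 aX = ar s3 aX by rewrite (fr_a fr4).
exists c', U'; split=> //=; last 2 first.
- by move=> i hi; rewrite X4; exact: z4'.
- by lia.
split=> /=.
- exact: cfg_setr.
- apply: (listed_eq L0) => /=; first by rewrite (fr_r fr4) // (fr_r fr3) // (fr_r fr2) // (fr_r fr1).
 move=> k hk; rewrite (fr_a fr4) ?(fr_a fr3) ?(fr_a fr2) ?(fr_a fr1) //=; by rewrite ?inE; lia.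
- by rewrite (fr_r fr4) // (fr_r fr3) // id2 addn1.
- by rewrite (fr_r fr4) // (fr_r fr3).
- by case: B4 => *; split.
- by move=> x hx; rewrite z3; [apply: uU; lia|lia].
- by rewrite X4.
- move=> x; rewrite ltnS leq_eqVlt X4 => /orP[/eqP->|xt] q1 q2; first exact: z4.
 rewrite z3; last by lia.
 have xm : x < m by exact: ltn_trans tm.
 case: (v_s x xt q1 q2); [by left|move=> h; right].
 have := z4' _ (Il xm); have := z4' _ (Jl xm); lia.
Qed.

Lemma pass_ok s p c U0 Hh : cfg s -> listed s U0 Hh -> p <= N -> reach p c (ar s aX) U0 Hh ->
 (forall t, t < m -> I_ t <= M0 /\ J_ t <= M0) ->
 run PASS s (fun s' => exists c' U', [/\ pinv p U0 Hh m c' U' s', c <= c', ps s' = (ps s).+1, ot s' = ot s &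
  clk s' <= clk s + 15 + m * 60 + 5 * (c' - c)]).
Proof.
move=> C0 L0 pN r0 bIJ.
have WMle t : t < m -> W_ t <= M0 by move=> /WmP; lia.
apply: run_sq; exists (rewi es s); first exact: XRew.
do 3 (apply: run_sq; apply: run_asg => //=).
apply: run_sq; apply: run_asg => //=; first by lia.
apply: (@run_whl _ _ _ (fun s1 => exists t c1 U1, [/\ pinv p U0 Hh t c1 U1 s1, t <= m /\ rs s1 = drop t es,
  ps s1 = (ps s).+1 /\ ot s1 = ot s, (rg s1 go = 1 \/ (rg s1 go = 0 /\ t = m)) &
  c <= c1 /\ clk s1 <= clk s + 6 + t * 58 + 5 * (c1 - c) + 5 * (1 - rg s1 go)])
 (fun s1 => size (rs s1) + rg s1 go)).
- exists 0, c, U0; split=> //=; [|by rewrite drop0|by left|by lia].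
 split=> //=; [by do ?[apply: cfg_setr => //]; case: C0 => *; split|by case: L0 => *; split].
move=> s1 [t [c1 [U1 [V1 [tm ers] [ps1 ot1] g1 [cc k1]]]]]; split=> //=; last first.
 move=> g0; case: g1 => [g1|[g1 et]]; first by rewrite g1 in g0.
 rewrite et in V1 k1; exists c1, U1; split=> //=; last by rewrite g1 in k1; lia.
 by case: V1 => d1 d2 d3 d4 d5 d6 d7 d8; split=> //=; [exact: cfg_tick|case: d2 => *; split|case: d5 => *; split].
move=> g; have {}g1 : rg s1 go = 1 by case: g1 => // -[g1 _]; rewrite g1 in g.
rewrite g1 in k1.
case: (ltnP t m) => tm'; last first.
 have et : t = m by apply/eqP; rewrite eqn_leq tm.
 apply: run_sq; exists (nxt0 go (tick s1)); first by apply: XNxt0; rewrite /= ers et drop_size.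
 apply: run_ite => //= h0; try (by rewrite ltnn in h0).
 apply: run_asg => //=; split; last by rewrite g1; lia.
 exists t, c1, U1; split=> //=; [|by right|by split=> //; lia].
 case: V1 => d1 d2 d3 d4 d5 d6 d7 d8; split=> //=; [|by case: d2 => *; split|by case: d5 => *; split].
 by case: d1 => *; split.
have ex := drop_nth (0, 0, 0) tm'.
have en : nth (0, 0, 0) es t = (I_ t, J_ t, W_ t) by rewrite /I_ /J_ /W_; case: (nth _ _ _) => -[].
have [bI bJ] := bIJ t tm'.
apply: run_sq; exists (nxt1 go pi_ pj pw (I_ t) (J_ t) (W_ t) (drop t.+1 es) (tick s1)).
 by apply: XNxt1 => //=; rewrite ?ers ?ex ?en //; auto.
apply: run_ite => //= _.
set s2 := tick (nxt1 _ _ _ _ _ _ _ _ _).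
have V2 : pinv p U0 Hh t c1 U1 s2.
 case: V1 => d1 d2 d3 d4 d5 d6 d7 d8; split=> //=; [|by case: d2 => *; split|by case: d5 => *; split].
 by case: d1 => *; split.
apply: (run_call (step_ok V2 pN tm' r0 erefl erefl erefl)) => s3 [c3 [U3 [V3 q1 q2 q3]]] fr3.
have {}q3 : clk s3 <= (clk s1).+3 + 55 + 5 * (c3 - c1) := q3.
have [rs3 ps3 ot3] := fr_s fr3 isT.
have g3 : rg s3 go = 1 by rewrite (fr_r fr3).
split; last by rewrite rs3 g3 /= ers ex g1 /=; lia.
exists t.+1, c3, U3; split=> //; [by rewrite ps3 ot3|by left|].
by split; [lia|rewrite g3 mulSn; lia].
Qed.

Lemma copy_ok s U Hh : cfg s -> buf s U Hh m -> size (lst U) < Lm -> (forall x, x < m -> U x <= M0 /\ Hh x <= M0) ->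
 run COPY s (fun s' => [/\ cfg s', listed s' U Hh & clk s' <= clk s + 10 + 8 * size (lst U)]).
Proof.
move=> C0 B0 sL UM'; have c0 := bf_c B0.
apply: run_sq.
apply: (@run_for _ _ _ (fun k s1 => [/\ cfg s1, rg s1 pk = size (lst U), forall j, 27 <= j -> ar s1 j = ar s j,
  (forall x, x < k -> [/\ ar s1 aLT x = nth 0 (lst U) x, ar s1 aLI x = I_ (nth 0 (lst U) x) & ar s1 aLJ x = J_ (nth 0 (lst U) x)]) /\
  (forall x, x < k -> [/\ ar s1 aLW x = W_ (nth 0 (lst U) x), ar s1 aLU x = U (nth 0 (lst U) x) & ar s1 aLH x = Hh (nth 0 (lst U) x)]) &
  clk s1 <= clk s + 5 + 8 * k]) (size (lst U))) => //.
- by lia.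
- by move=> k s1 [_ e _ _ _] _ /=.
- by split=> //=; [apply: cfg_setr|lia].
- move=> k s1 kc [C1 p1 b1 [x1 y1] k1] ek.
 have [xm ux] := mem_lst kc; have [uM hM] := UM' _ xm; have wl := WmP xm; have il := Il xm; have jl := Jl xm.
 have [e1 e2 e3] : [/\ ar s1 bLT k = nth 0 (lst U) k, ar s1 bLI k = I_ (nth 0 (lst U) k) & ar s1 bLJ k = J_ (nth 0 (lst U) k)].
  by rewrite !b1 //; split; [exact: (bf_T B0)|exact: (bf_I B0)|exact: (bf_J B0)].
 have [e4 e5 e6] : [/\ ar s1 bLW k = W_ (nth 0 (lst U) k), ar s1 bLU k = U (nth 0 (lst U) k) & ar s1 bLH k = Hh (nth 0 (lst U) k)].
  by rewrite !b1 //; split; [exact: (bf_W B0)|exact: (bf_U B0)|exact: (bf_H B0)].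
 do 5 (apply: run_sq; apply: run_put => //=; rewrite ?ek ?e1 ?e2 ?e3 ?e4 ?e5; [by split=> //; lia|lia|lia|]).
 apply: run_put => //=; rewrite ?ek ?e6; [by split=> //; lia|lia|lia|].
 split=> //=.
 + by do ?[apply: cfg_setr => //|apply: cfg_seta => //|apply: cfg_tick].
 + by move=> j hj; do 6 (case: eqP => [e|_]; [lia|]); exact: b1.
 + by split=> x; rewrite ltnS leq_eqVlt; case: eqP => [->|_ /= h]; auto.
 + by lia.
move=> s1 [C1 p1 b1 [x1 y1] k1] _.
apply: run_asg => //=; first by rewrite p1; lia.
split=> //=; [by do ?[apply: cfg_setr => //|apply: cfg_tick]| |lia].
split=> //= k kc; by [case: (x1 k kc)|case: (y1 k kc)].
Qed.

End Pass.

End PassTh.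

(** * Building the stored graph for the inner loop *)

Module BuildTh.
Import Defs MachineTh HoareTh CutsTh InnerCodeTh ResetTh FindTh BumpTh BumpSetTh LevelsTh WeightsTh OuterTh PassTh.
Definition ADD1 : cmd :=
 aHD~[#2 * vme] <~ pj ;; aHD~[#2 * vme + #1] <~ pi_ ;;
 aER~[vme] <~ wf - (aX`[pi_] + aX`[pj]).
Definition ADD2 : cmd :=
 aEP~[vme] <~ pt ;; aEY~[vme] <~ vY0 ;; aEB~[vme] <~ #0.
Definition ADD3 : cmd :=
 aSL~[pi_ * vD + aDG`[pi_]] <~ #2 * vme ;; aDG~[pi_] <~ aDG`[pi_] + #1.
Definition ADD4 : cmd :=
 aSL~[pj * vD + aDG`[pj]] <~ #2 * vme + #1 ;; aDG~[pj] <~ aDG`[pj] + #1.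
Definition ADD : cmd := ADD1 ;; ADD2 ;; ADD3 ;; ADD4 ;; vme <~ vme + #1.

Definition BUILD : cmd :=
 vme <~ #0 ;; (FOR pt TO (vn + #1) DO aDG~[pt] <~ #0) ;;
 FOR pt TO vcnt DO (
  pi_ <~ aLI`[pt] ;; pj <~ aLJ`[pt] ;; wf <~ aLW`[pt] * vF ;;
  WHEN (aCAP`[pi_]) <=: vE DO WHEN (aCAP`[pj]) <=: vE DO
   WHEN (aX`[pi_] + aX`[pj] + #1) <=: wf DO ADD).

Section Build.
Variables (R : realType) (Lm M0 : nat) (es : seq (nat * nat * nat)).
Variables (n E Q D N F Fy Y0 RM Wm Bm : nat) (cap : nat -> nat).
Notation run := (run Lm M0 es).
Notation m := (size es).
Notation I_ := (I_ es). Notation J_ := (J_ es). Notation W_ := (W_ es).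
Notation reach := (@reach R n m E N F Fy Q I_ J_ W_ cap).
Notation sm := (sm E I_ J_ cap).
Notation cfg := (cfg n E Q D N F Fy Y0 RM cap).
Notation lst := (lst es).
Notation listed := (listed es).
Notation inH := (inH E F I_ J_ W_ cap).
Notation rr := (rr F I_ J_ W_).
Notation inc := (inc I_ J_).
Hypothesis E8 : 8 <= E.
Hypothesis N0 : 0 < N.
Hypothesis Fy0 : 0 < Fy.
Hypothesis Q0 : 0 < Q.
Hypothesis eD : D = 2 * N * (E * E).
Hypothesis Il : forall t, t < m -> I_ t < n.
Hypothesis Jl : forall t, t < m -> J_ t < n.
Hypothesis IJ : forall t, t < m -> I_ t != J_ t.
Hypothesis simple : forall t t', t < m -> t' < m -> inc (I_ t) t' -> inc (J_ t) t' -> t = t'.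
Hypothesis WmP : forall t, t < m -> W_ t <= Wm.
Hypothesis BmP : forall i, i < n -> cap i <= Bm.
Hypothesis capn : cap n = 0.
Hypothesis lnX : (ln (2 * (Wm * F) + 2)%:R <= N%:R * (E%:R^-1 * E%:R^-1) :> R)%R.
Hypothesis nL : n < Lm.
Hypothesis lL : n * (2 * N * (E * E)) < Lm.
Hypothesis DL : n.+1 * D <= Lm.
Hypothesis LM : 2 * Lm <= M0.
Hypothesis mL : forall p c X U Hh, reach p c X U Hh -> p <= N -> 2 * size (lst U) < Lm.
Hypothesis XM : 2 * (Wm * F) + 2 + Wm <= M0.
Hypothesis YM : Y0 <= M0.

Lemma reach_b p c X U Hh t : reach p c X U Hh -> t < m -> 0 < U t -> 0 < cap (I_ t) /\ 0 < cap (J_ t).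
Proof.
move=> r tm; elim: r => {p c X U Hh} [X U Hh _ u0 _|p c X U Hh t' X' U' _ IH _ b1 b2 _ _ _ hU|p c X U Hh eb X' Hh' _ IH _ _ _ _] //.
 by rewrite u0.
by rewrite hU // /touchU; case: eqP => [->|].
Qed.

(** The uncovered small edges among the first k list entries. The e-th of them becomes edge e of the
    stored graph. *)
Definition Hk X U k := [seq t <- take k (lst U) | inH X U t].
Definition Hl X U := Hk X U (size (lst U)).

Lemma Hl_uniq X U : uniq (Hl X U).
Proof. by rewrite /Hl /Hk take_size filter_uniq // filter_uniq // iota_uniq. Qed.
Lemma mem_Hl X U t : (t \in Hl X U) = (t < m) && inH X U t.
Proof.
rewrite /Hl /Hk take_size !mem_filter mem_iota /= add0n.
by case h: (inH X U t); rewrite ?andbF //= andbT; case/and3P: h => _ -> _.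
Qed.
Lemma Hk_sub X U k : {subset Hk X U k <= Hl X U}.
Proof. by move=> t; rewrite /Hl /Hk take_size !mem_filter => /andP[h /mem_take]; rewrite mem_filter => /andP[-> ->]; rewrite h. Qed.
Lemma size_Hk X U k : size (Hk X U k) <= size (Hl X U).
Proof.
rewrite /Hl /Hk take_size !size_filter -{2}(cat_take_drop k (lst U)) count_cat; exact: leq_addr.
Qed.
Lemma size_Hl X U : size (Hl X U) <= size (lst U).
Proof. by rewrite /Hl /Hk take_size size_filter count_size. Qed.

Lemma Hk_deg p c X U Hh k x : reach p c X U Hh -> p <= N -> x < n -> count (inc x) (Hk X U k) <= D.
Proof.
move=> r pN xn; rewrite eD; apply: leq_trans (reach_deg E8 N0 Fy0 Q0 WmP lnX r pN xn).
rewrite /Hk count_filter.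
apply: (@leq_trans (count (predI (inc x) (inH X U)) (lst U))).
 by rewrite -{2}(cat_take_drop k (lst U)) count_cat leq_addr.
rewrite /PassTh.lst /lstp count_filter -sum1_count -[X in iota 0 X]subn0 big_mkord.
rewrite [X in X <= _]big_mkcond [X in _ <= X]big_mkcond; apply: leq_sum => t _ /=.
case: (inc x t) => //=; case h: (inH X U t) => //=.
by move: h; rewrite /OuterTh.inH => /and3P[-> -> _].
Qed.

Lemma outsS (hd : nat -> nat) e x : outs e.+1 hd x = outs e hd x ++
 (if hd e.*2.+1 == x then [:: e.*2] else [::]) ++ (if hd e.*2 == x then [:: e.*2.+1] else [::]).
Proof.
rewrite /outs -[in LHS](_ : e.*2 + 2 = e.+1.*2); last by lia.
rewrite iotaD filter_cat /= add0n rva_double rva_doubleS.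
by case: ifP; case: ifP.
Qed.

Lemma outs_ext (hd hd' : nat -> nat) e x : (forall a, a < e.*2 -> hd a = hd' a) -> outs e hd x = outs e hd' x.
Proof. by move=> h; apply: eq_in_filter => a; rewrite mem_iota add0n => /andP[_ al]; rewrite h // rva_lt. Qed.

Record bld (X U : nat -> nat) (k : nat) (s : st) : Prop := Bld {
 b_me : rg s vme = size (Hk X U k);
 b_h0 : forall e, e < size (Hk X U k) -> ar s aHD e.*2 = J_ (nth 0 (Hk X U k) e);
 b_h1 : forall e, e < size (Hk X U k) -> ar s aHD e.*2.+1 = I_ (nth 0 (Hk X U k) e);
 b_er : forall e, e < size (Hk X U k) -> ar s aER e = rr X (nth 0 (Hk X U k) e);
 b_ep : forall e, e < size (Hk X U k) -> ar s aEP e < size (lst U) /\ nth 0 (lst U) (ar s aEP e) = nth 0 (Hk X U k) e;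
 b_y : forall e, e < size (Hk X U k) -> ar s aEY e = Y0 /\ ar s aEB e = 0;
 b_dg : forall x, x <= n -> ar s aDG x = size (outs (size (Hk X U k)) (ar s aHD) x);
 b_sl : forall x j, x <= n -> j < ar s aDG x -> ar s aSL (x * D + j) = nth 0 (outs (size (Hk X U k)) (ar s aHD) x) j }.

Lemma outs_cnt X U k (hd : nat -> nat) x :
 (forall e, e < size (Hk X U k) -> hd e.*2 = J_ (nth 0 (Hk X U k) e)) ->
 (forall e, e < size (Hk X U k) -> hd e.*2.+1 = I_ (nth 0 (Hk X U k) e)) ->
 size (outs (size (Hk X U k)) hd x) = count (inc x) (Hk X U k).
Proof.
move=> h0 h1; have Hm t : t \in Hk X U k -> t < m by move=> /Hk_sub; rewrite mem_Hl => /andP[].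
set l := Hk X U k in h0 h1 Hm *.
have {Hm} : forall j, j <= size l -> size (outs j hd x) = count (inc x) (take j l).
 elim=> [|j IH] jl; first by rewrite take0.
 rewrite outsS !size_cat IH ?(ltnW jl) // (take_nth 0) // -cats1 count_cat /= addn0 h0 // h1 //.
 have ne := IJ (Hm _ (mem_nth 0 jl)); congr (_ + _); rewrite /OuterTh.inc.
 case: eqP => [e1|_] /=; last by case: eqP.
 by rewrite -e1 eq_sym (negbTE ne).
by move=> /(_ _ (leqnn _)); rewrite take_size.
Qed.

Lemma slot_inj x j x' j' : j < D -> j' < D -> x * D + j = x' * D + j' -> x = x' /\ j = j'.
Proof.
move=> h h' e; have D0 : 0 < D by lia.
have e1 : x = x'.
 by have := congr1 (fun z => z %/ D) e; rewrite !divnMDl // !divn_small // !addn0.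
by split=> //; move: e; rewrite e1 => /addnI.
Qed.

(** Edge e puts arc 2e into the next slot of I and arc 2e+1 into the next slot of J. Slots of
    different vertices do not collide because degrees stay below D. *)
Lemma bld_add s s' p c U Hh k t e X : reach p c X U Hh -> p <= N ->
 k < size (lst U) -> bld X U k s -> inH X U t -> t = nth 0 (lst U) k -> e = size (Hk X U k) ->
 ar s aDG (I_ t) < D -> ar s aDG (J_ t) < D ->
 rg s' vme = e + 1 ->
 (forall a, ar s' aHD a = if a == 2 * e + 1 then I_ t else if a == 2 * e then J_ t else ar s aHD a) ->
 (forall a, ar s' aER a = if a == e then rr X t else ar s aER a) ->
 (forall a, ar s' aEP a = if a == e then k else ar s aEP a) ->
 (forall a, ar s' aEY a = if a == e then Y0 else ar s aEY a) ->
 (forall a, ar s' aEB a = if a == e then 0 else ar s aEB a) ->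
 (forall x, ar s' aDG x = if x == J_ t then ar s aDG (J_ t) + 1 else if x == I_ t then ar s aDG (I_ t) + 1 else ar s aDG x) ->
 (forall z, ar s' aSL z = if z == J_ t * D + ar s aDG (J_ t) then 2 * e + 1 else
   if z == I_ t * D + ar s aDG (I_ t) then 2 * e else ar s aSL z) -> bld X U k.+1 s'.
Proof.
move=> r pN kl B hH et' ee dgI dgJ MEe HDe ERe EPe EYe EBe DGe SLe.
have [tm _] := mem_lst kl; rewrite -et' in tm.
have il := Il tm; have jl := Jl tm; have ne := IJ tm.
have eS : Hk X U k.+1 = rcons (Hk X U k) t by rewrite /Hk (take_nth 0) // filter_rcons -et' hH.
case: B => b1 b2 b3 b4 b5 b6 b7 b8.
rewrite -ee in b1 b2 b3 b4 b5 b6 b7 b8.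
have nij : (J_ t == I_ t) = false by apply/negbTE; rewrite eq_sym.
have nij' : (I_ t == J_ t) = false by apply/negbTE.
have H1 a : a < e.*2 -> ar s' aHD a = ar s aHD a by move=> h; rewrite HDe; do 2 (case: eqP => [?|_]; [lia|]).
have H2 : ar s' aHD e.*2 = J_ t by rewrite HDe -mul2n; case: eqP => [?|_]; [lia|rewrite eqxx].
have H3 : ar s' aHD e.*2.+1 = I_ t by rewrite HDe -mul2n addn1 eqxx.
have oe x : outs e.+1 (ar s' aHD) x = outs e (ar s aHD) x ++ (if I_ t == x then [:: e.*2] else [::]) ++ (if J_ t == x then [:: e.*2.+1] else [::]).
 by rewrite outsS H2 H3 (outs_ext x H1).
split; rewrite eS ?size_rcons -?ee.
- by rewrite MEe addn1.
- move=> e0; rewrite ltnS leq_eqVlt nth_rcons -ee => /orP[/eqP ->|h]; first by rewrite ltnn eqxx.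
 by rewrite h H1 ?b2 // ltn_double.
- move=> e0; rewrite ltnS leq_eqVlt nth_rcons -ee => /orP[/eqP ->|h]; first by rewrite ltnn eqxx.
 by rewrite h H1 ?b3 //; lia.
- move=> e0; rewrite ltnS leq_eqVlt nth_rcons -ee => /orP[/eqP ->|h]; first by rewrite ltnn eqxx ERe eqxx.
 by rewrite h ERe; case: eqP => [?|_]; [lia|exact: b4].
- move=> e0; rewrite ltnS leq_eqVlt nth_rcons -ee => /orP[/eqP ->|h]; first by rewrite ltnn eqxx EPe eqxx -et'.
 by rewrite h EPe; case: eqP => [?|_]; [lia|exact: b5].
- move=> e0; rewrite ltnS leq_eqVlt => /orP[/eqP ->|h]; first by rewrite EYe EBe eqxx.
 by rewrite EYe EBe; case: eqP => [?|_]; [lia|exact: b6].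
- move=> x xn; rewrite DGe oe !size_cat -b7 // (eq_sym x) (eq_sym x).
 case: eqP => [e1|_]; first by rewrite -e1 nij' /= addn1.
 by case: eqP => [e1|_] /=; rewrite ?e1 ?addn0 ?addn1.
- move=> x j xn; rewrite DGe SLe oe nth_cat -b7 //.
 case: (eqVneq x (J_ t)) => [->|nJ].
  rewrite addn1 ltnS leq_eqVlt nij' /= => /orP[/eqP ->|h]; first by rewrite eqxx ltnn subnn /= -mul2n addn1.
  rewrite h; case: eqP => [/addnI|_]; first by move=> ?; lia.
  case: eqP => [e1|_]; last by apply: b8 => //; exact: ltnW.
  have [e3 _] := slot_inj (ltn_trans h dgJ) dgI e1; by rewrite e3 eqxx in nij.
 case: (eqVneq x (I_ t)) => [->|nI].
  rewrite addn1 ltnS leq_eqVlt /= => /orP[/eqP ->|h].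
   rewrite ltnn subnn /= eqxx; case: eqP => [e1|_]; last by rewrite mul2n.
   have [e3 _] := slot_inj dgI dgJ e1; by rewrite e3 eqxx in ne.
  rewrite h; case: eqP => [e1|_].
   have [e3 _] := slot_inj (ltn_trans h dgI) dgJ e1; by rewrite e3 eqxx in ne.
  by case: eqP => [/addnI|_]; [move=> ?; lia|apply: b8 => //; exact: ltnW].
 move=> h; rewrite h.
 have hD : j < D.
  apply: leq_trans h _; move: xn; rewrite leq_eqVlt => /orP[/eqP ->|xn].
   rewrite b7 // ee outs_cnt -?ee //; apply: leq_trans (_ : 0 <= _) => //.
   rewrite leqNgt -has_count; apply/hasPn => t0 /Hk_sub; rewrite mem_Hl => /andP[t0m _].
   by have := Il t0m; have := Jl t0m; rewrite /OuterTh.inc; case: eqP => [?|_]; case: eqP => [?|_] //=; lia.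
  by rewrite b7 ?(ltnW xn) // ee outs_cnt -?ee //; exact: (Hk_deg k r pN xn).
 case: eqP => [e1|_]; first by have [e3 _] := slot_inj hD dgJ e1; rewrite e3 eqxx in nJ.
 by case: eqP => [e1|_]; [have [e3 _] := slot_inj hD dgI e1; rewrite e3 eqxx in nI|exact: b8].
Qed.

Lemma add_ok s p c U Hh k : cfg s -> reach p c (ar s aX) U Hh -> p <= N -> size (lst U) < Lm ->
 k < size (lst U) -> bld (ar s aX) U k s -> inH (ar s aX) U (nth 0 (lst U) k) ->
 rg s pi_ = I_ (nth 0 (lst U) k) -> rg s pj = J_ (nth 0 (lst U) k) -> rg s wf = W_ (nth 0 (lst U) k) * F -> rg s pt = k ->
 run ADD s (fun s' => bld (ar s aX) U k.+1 s' /\ clk s' <= clk s + 15).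
Proof.
move=> C0 r pN sL kl B hH ei ej ew et; set X := ar s aX in B hH *.
have [t et'] : exists t, t = nth 0 (lst U) k by eexists.
rewrite -et' in hH ei ej ew; have [tm _] := mem_lst kl; rewrite -et' in tm.
have il := Il tm; have jl := Jl tm; have ne := IJ tm.
have Wl : W_ t * F <= Wm * F by rewrite leq_mul2r WmP ?orbT.
have eS : Hk X U k.+1 = rcons (Hk X U k) t by rewrite /Hk (take_nth 0) // filter_rcons -et' hH.
have B0 := B; case: B => b1 b2 b3 b4 b5 b6 b7 b8.
have [e ee] : exists e, e = size (Hk X U k) by eexists.
rewrite -ee in b1 b2 b3 b4 b5 b6 b7 b8.
have mH : e < size (lst U).
 by apply: leq_trans (size_Hl X U); rewrite ee; apply: leq_trans (size_Hk X U k.+1); rewrite eS size_rcons.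
have e2 := mL r pN.
have dgI : ar s aDG (I_ t) < D.
 rewrite b7 ?(ltnW il) // ee outs_cnt -?ee //; apply: leq_trans (Hk_deg k.+1 r pN il).
 by rewrite -/X eS -cats1 count_cat /= /OuterTh.inc eqxx /= addn1.
have dgJ : ar s aDG (J_ t) < D.
 rewrite b7 ?(ltnW jl) // ee outs_cnt -?ee //; apply: leq_trans (Hk_deg k.+1 r pN jl).
 by rewrite -/X eS -cats1 count_cat /= /OuterTh.inc eqxx orbT /= addn1.
have dM : D <= Lm by apply: leq_trans DL; rewrite leq_pmull.
have sI : I_ t * D + ar s aDG (I_ t) < Lm.
 apply: leq_trans DL; rewrite mulSn; have : I_ t * D <= n * D by [rewrite leq_mul2r ltnW ?orbT]; lia.
have sJ : J_ t * D + ar s aDG (J_ t) < Lm.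
 apply: leq_trans DL; rewrite mulSn; have : J_ t * D <= n * D by [rewrite leq_mul2r ltnW ?orbT]; lia.
have nij : (J_ t == I_ t) = false by apply/negbTE; rewrite eq_sym.
have nij' : (I_ t == J_ t) = false by apply/negbTE.
have h1 : run ADD1 s (fun s1 => [/\ forall a, ar s1 aHD a = if a == 2 * e + 1 then I_ t else if a == 2 * e then J_ t else ar s aHD a,
  forall a, ar s1 aER a = if a == e then rr X t else ar s aER a & clk s1 <= clk s + 3]).
 do 2 (apply: run_sq; apply: run_put => //=; rewrite ?b1 ?ei ?ej; [lia|lia|]).
 apply: run_put => //=; rewrite ?b1 ?ei ?ej ?ew -/X; [by do !split=> //; lia|lia|lia|].
 by split=> //=; lia.
apply: run_sq; apply: (run_call h1) => s1 [HD1 ER1 k1] fr1.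
have C1 : cfg s1 by apply: cfg_frame fr1 _ _ C0.
have [m1 t1 i1 j1] : [/\ rg s1 vme = e, rg s1 pt = k, rg s1 pi_ = I_ t & rg s1 pj = J_ t] by rewrite !(fr_r fr1).
have h2 : run ADD2 s1 (fun s2 => [/\ forall a, ar s2 aEP a = if a == e then k else ar s1 aEP a,
  forall a, ar s2 aEY a = if a == e then Y0 else ar s1 aEY a,
  forall a, ar s2 aEB a = if a == e then 0 else ar s1 aEB a & clk s2 <= clk s1 + 3]).
 do 2 (apply: run_sq; apply: run_put => //=; rewrite ?m1 ?t1 ?(f_Y0 C1); [lia|lia|]).
 apply: run_put => //=; rewrite ?m1; first lia.
 by split=> //=; lia.
apply: run_sq; apply: (run_call h2) => s2 [EP2 EY2 EB2 k2] fr2.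
have C2 : cfg s2 by apply: cfg_frame fr2 _ _ C1.
have [m2 i2 j2] : [/\ rg s2 vme = e, rg s2 pi_ = I_ t & rg s2 pj = J_ t] by rewrite !(fr_r fr2).
have dg2 : ar s2 aDG = ar s aDG by rewrite (fr_a fr2) // (fr_a fr1).
have sl2 : ar s2 aSL = ar s aSL by rewrite (fr_a fr2) // (fr_a fr1).
have h3 : run ADD3 s2 (fun s3 => [/\ forall z, ar s3 aSL z = if z == I_ t * D + ar s aDG (I_ t) then 2 * e else ar s aSL z,
  forall x, ar s3 aDG x = if x == I_ t then ar s aDG (I_ t) + 1 else ar s aDG x & clk s3 <= clk s2 + 2]).
 apply: run_sq; apply: run_put => //=; rewrite ?m2 ?i2 ?(f_D C2) ?dg2; [by do !split=> //; lia|lia|lia|].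
 apply: run_put => //=; rewrite ?i2 ?dg2; [by do !split=> //; lia|lia|lia|].
 split=> //=; first [by move=> z; rewrite sl2|by move=> x; rewrite dg2|lia].
apply: run_sq; apply: (run_call h3) => s3 [SL3 DG3 k3] fr3.
have C3 : cfg s3 by apply: cfg_frame fr3 _ _ C2.
have [m3 j3] : [/\ rg s3 vme = e & rg s3 pj = J_ t] by rewrite !(fr_r fr3).
have dJ : ar s3 aDG (J_ t) = ar s aDG (J_ t) by rewrite DG3 nij.
have h4 : run ADD4 s3 (fun s4 => [/\ forall z, ar s4 aSL z = if z == J_ t * D + ar s aDG (J_ t) then 2 * e + 1 else ar s3 aSL z,
  forall x, ar s4 aDG x = if x == J_ t then ar s aDG (J_ t) + 1 else ar s3 aDG x & clk s4 <= clk s3 + 2]).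
 apply: run_sq; apply: run_put => //=; rewrite ?m3 ?j3 ?(f_D C3) ?dJ; [by do !split=> //; lia|lia|lia|].
 apply: run_put => //=; rewrite ?j3 ?dJ; [by do !split=> //; lia|lia|lia|].
 by split=> //=; lia.
apply: run_sq; apply: (run_call h4) => s4 [SL4 DG4 k4] fr4.
have m4 : rg s4 vme = e by rewrite !(fr_r fr4).
apply: run_asg => //=; first by rewrite m4; lia.
split; last by rewrite /=; lia.
apply: (bld_add r pN kl B0 hH et' ee dgI dgJ) => /=.
- by rewrite m4.
- by move=> a; rewrite (fr_a fr4) // (fr_a fr3) // (fr_a fr2).
- by move=> a; rewrite (fr_a fr4) // (fr_a fr3) // (fr_a fr2).
- by move=> a; rewrite (fr_a fr4) // (fr_a fr3) // EP2 (fr_a fr1).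
- by move=> a; rewrite (fr_a fr4) // (fr_a fr3) // EY2 (fr_a fr1).
- by move=> a; rewrite (fr_a fr4) // (fr_a fr3) // EB2 (fr_a fr1).
- by move=> x; rewrite DG4 DG3.
- by move=> z; rewrite SL4 SL3.
Qed.

Lemma build_ok s p c U Hh : cfg s -> reach p c (ar s aX) U Hh -> p <= N -> size (lst U) < Lm -> listed s U Hh ->
 run BUILD s (fun s' => bld (ar s aX) U (size (lst U)) s' /\ clk s' <= clk s + 30 * (n + size (lst U)) + 30).
Proof.
move=> C0 r pN sL L0; set X := ar s aX in r *.
apply: run_sq; apply: run_asg => //=.
apply: run_sq.
apply: (@run_for _ _ _ (fun k s1 => [/\ cfg s1, listed s1 U Hh, ar s1 aX = X /\ rg s1 vme = 0, forall x, x < k -> ar s1 aDG x = 0 &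
  clk s1 <= clk s + 6 + 3 * k]) n.+1) => //.
- by lia.
- by move=> k s1 [C1 _ _ _ _] _ /=; rewrite (f_n C1) addn1.
- by split=> //=; [do ?[apply: cfg_setr => //|apply: cfg_tick]|case: L0 => *; split|lia].
- move=> k s1 kn [C1 L1 [x1 m1] d1 k1] ek.
 apply: run_put => //=; rewrite ?ek; first lia.
 split=> //=; [by do ?[apply: cfg_setr => //|apply: cfg_seta => //|apply: cfg_tick]|by case: L1 => *; split| |lia].
 by move=> x; rewrite ltnS leq_eqVlt; case: eqP => // _ /= h; exact: d1.
move=> s1 [C1 L1 [x1 m1] d1 k1] _.
apply: (@run_for _ _ _ (fun k s2 => [/\ cfg s2, listed s2 U Hh, ar s2 aX = X, bld X U k s2 & clk s2 <= clk s1 + 6 + 26 * k]) (size (lst U))) => //.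
- by lia.
- by move=> k s2 [_ L2 _ _ _] _ /=; rewrite (l_c L2).
- have e0 : Hk X U 0 = [::] by rewrite /Hk take0.
 split=> //=; [by do ?[apply: cfg_setr => //|apply: cfg_tick]|by case: L1 => *; split| |lia].
 split; rewrite e0 //=; first [by move=> x xn; rewrite d1|by move=> x j xn; rewrite d1].
- move=> k s2 kl [C2 L2 x2 B2 k2] ek.
 have [t et] : exists t, t = nth 0 (lst U) k by eexists.
 have [tm tu] := mem_lst kl; rewrite -et in tm tu.
 have il := Il tm; have jl := Jl tm.
 have [bI bJ] := reach_b r tm tu.
 have Wl : W_ t * F <= Wm * F by rewrite leq_mul2r WmP ?orbT.
 have wl := WmP tm.
 have hHi : inH X U t = (cap (I_ t) <= E) && (cap (J_ t) <= E) && (X (I_ t) + X (J_ t) + 1 <= W_ t * F).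
  by rewrite /OuterTh.inH /OuterTh.sm bI bJ tu addn1.
 have skip_ok s3 : cfg s3 -> listed s3 U Hh -> ar s3 aX = X -> bld X U k s3 -> inH X U t = false -> clk s3 <= clk s2 + 20 ->
   [/\ cfg (setr 86 k.+1 (setr 99 0 s3)), listed (setr 86 k.+1 (setr 99 0 s3)) U Hh, ar s3 aX = X, bld X U k.+1 (setr 86 k.+1 (setr 99 0 s3)) &
    clk (setr 86 k.+1 (setr 99 0 s3)) <= clk s1 + 6 + 26 * k.+1].
  move=> C3 L3 x3 B3 nH k3; have eS : Hk X U k.+1 = Hk X U k by rewrite /Hk (take_nth 0) // filter_rcons -et nH.
  split=> //=; [by do ?[apply: cfg_setr => //|apply: cfg_tick]|by case: L3 => *; split| |lia].
  by case: B3 => *; split; rewrite ?eS.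
 apply: run_sq; apply: run_asg => //=; rewrite ?ek ?(l_I L2) // -?et; [by split=> //; lia|lia|].
 apply: run_sq; apply: run_asg => //=; rewrite ?ek ?(l_J L2) // -?et; [by split=> //; lia|lia|].
 apply: run_sq; apply: run_asg => //=; rewrite ?ek ?(l_W L2) ?(f_F C2) // -?et; [by split=> //; lia|lia|].
 set s3 := setr wf _ _.
 have C3 : cfg s3 by do ?[apply: cfg_setr => //|apply: cfg_tick].
 have L3 : listed s3 U Hh by case: L2 => *; split.
 have B3 : bld X U k s3 by case: B2 => *; split.
 apply: run_ite => //=; rewrite ?(f_cap C2) ?(f_E C2) ; [by split=> //; lia|move=> h1|move=> h1]; last first.
  apply: run_asg => //=; apply: (skip_ok (tick s3)) => //=; first [lia|exact: cfg_tick|by case: L3 => *; split|by case: B3 => *; split|by rewrite hHi leqNgt h1].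
 apply: run_ite => //=; rewrite ?(f_cap C2) ?(f_E C2) ; [by split=> //; lia|move=> h2|move=> h2]; last first.
  apply: run_asg => //=; apply: (skip_ok (tick (tick s3))) => //=; first [lia|by do 2 apply: cfg_tick|by case: L3 => *; split|by case: B3 => *; split|by rewrite hHi [cap (J_ t) <= E]leqNgt h2 andbF].
 apply: run_ite => //=; rewrite ?x2 ; [by do !split=> //; lia|move=> h3|move=> h3]; last first.
  apply: run_asg => //=; apply: (skip_ok (tick (tick (tick s3)))) => //=; first [lia|by do 3 apply: cfg_tick|by case: L3 => *; split|by case: B3 => *; split|by rewrite hHi [_ + 1 <= _]leqNgt h3 andbF].
 have hH : inH X U t by rewrite hHi h1 h2.
 set s4 := tick (tick (tick s3)).
 have C4 : cfg s4 by do 3 apply: cfg_tick.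
 have r4 : reach p c (ar s4 aX) U Hh by rewrite /= x2.
 have B4 : bld (ar s4 aX) U k s4 by rewrite /= x2; case: B3 => *; split.
 apply: (run_call (add_ok C4 r4 pN sL kl B4 _ _ _ _ _)); rewrite -?et //=; first by rewrite x2.
 move=> s5 [B5 k5] fr5; rewrite /= x2 in B5.
 split=> //=.
 + apply: cfg_setr => //; apply: cfg_frame fr5 _ _ C4 => //.
 + apply: (listed_eq L3) => /=; first by rewrite (fr_r fr5).
  by move=> j hj; rewrite (fr_a fr5) // !inE; lia.
 + by rewrite (fr_a fr5).
 + by case: B5 => *; split.
 + by move: k5; rewrite /s4 /s3 /=; lia.
move=> s2 [C2 L2 x2 B2 k2] _; split; first by case: B2 => *; split.
by rewrite /=; lia.
Qed.

End Build.

End BuildTh.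

(** * One round: pass, inner loop and update of the potentials *)

Module PhaseTh.
Import Defs MachineTh HoareTh CutsTh InnerCodeTh ResetTh FindTh BumpTh BumpSetTh LevelsTh WeightsTh OuterTh PassTh BuildTh.
Definition UPD1 : cmd :=
 FOR pt TO vme DO (
  pk <~ aEP`[pt] ;; aLH~[pk] <~ aLH`[pk] + aEB`[pt] ;;
  pi_ <~ aHD`[#2 * pt] ;; aLD~[pi_] <~ aLD`[pi_] + aEB`[pt] ;;
  pj <~ aHD`[#2 * pt + #1] ;; aLD~[pj] <~ aLD`[pj] + aEB`[pt]).
Definition UPD2 : cmd :=
 FOR pt TO vn DO (
  aX~[pt] <~ aX`[pt] + (aX`[pt] * aLD`[pt] + vN * vFy * aCAP`[pt] * vE - #1) %/ (vN * vFy * aCAP`[pt] * vE) ;;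
  aLD~[pt] <~ #0 ;;
  aX~[pt] <~ aX`[pt] - aX`[pt] %/ vE).
Definition PHASE : cmd := PASS ;; COPY ;; BUILD ;; INNER ;; UPD1 ;; UPD2.

Import Order.TTheory GRing.Theory Num.Theory.

Section Phase.
Variables (R : realType) (Lm M0 : nat) (es : seq (nat * nat * nat)).
Variables (n E Q D N F Fy Y0 RM Wm Bm : nat) (cap : nat -> nat).
Notation run := (run Lm M0 es).
Notation m := (size es).
Notation I_ := (I_ es). Notation J_ := (J_ es). Notation W_ := (W_ es).
Notation reach := (@reach R n m E N F Fy Q I_ J_ W_ cap).
Notation inner_res := (@inner_res R n m E N F Fy Q I_ J_ W_ cap).
Notation feas := (@feas R n m I_ J_ cap).
Notation settled := (settled m E F I_ J_ W_ cap).
Notation sm := (sm E I_ J_ cap).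
Notation cfg := (cfg n E Q D N F Fy Y0 RM cap).
Notation lst := (lst es).
Notation listed := (listed es).
Notation inH := (inH E F I_ J_ W_ cap).
Notation rr := (rr F I_ J_ W_).
Notation inc := (inc I_ J_).
Notation Hl := (Hl es E F cap).
Notation bld := (bld es n E D F Y0 cap).
Hypothesis E8 : (8 <= E)%N.
Hypothesis N0 : (0 < N)%N.
Hypothesis Fy0 : (0 < Fy)%N.
Hypothesis Q0 : (0 < Q)%N.
Hypothesis eD : D = (2 * N * (E * E))%N.
Hypothesis Il : forall t, (t < m)%N -> (I_ t < n)%N.
Hypothesis Jl : forall t, (t < m)%N -> (J_ t < n)%N.
Hypothesis IJ : forall t, (t < m)%N -> I_ t != J_ t.
Hypothesis simple : forall t t', (t < m)%N -> (t' < m)%N -> inc (I_ t) t' -> inc (J_ t) t' -> t = t'.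
Hypothesis WmP : forall t, (t < m)%N -> (W_ t <= Wm)%N.
Hypothesis BmP : forall i, (i < n)%N -> (cap i <= Bm)%N.
Hypothesis capn : cap n = 0%N.
Hypothesis lnX : (ln (2 * (Wm * F) + 2)%:R <= N%:R * (E%:R^-1 * E%:R^-1) :> R)%R.
Hypothesis lnY : (ln (E%:R * Fy%:R) - ln Y0%:R <= N%:R * (E%:R^-1 * E%:R^-1) :> R)%R.
Hypothesis nL : (n < Lm)%N.
Hypothesis lL : (n * (2 * N * (E * E)) < Lm)%N.
Hypothesis DL : (n.+1 * D <= Lm)%N.
Hypothesis LM : (2 * Lm <= M0)%N.
Hypothesis mL : forall p c X U Hh, reach p c X U Hh -> (p <= N)%N -> (2 * size (lst U) < Lm)%N.
Hypothesis UM : (E * (2 * N) * Bm <= M0)%N.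
Hypothesis bM : (E * Bm + E + Bm <= M0)%N.
Hypothesis mM : (m < M0)%N.
Hypothesis XM2 : (4 * (Wm * F) + 4 <= M0)%N.
Hypothesis YFy : (Y0 <= E * Fy)%N.
Hypothesis XM : (2 * (Wm * F) + 2 + Wm <= M0)%N.
Hypothesis YM : (Y0 <= M0)%N.
Hypothesis RMW : (0 < RM)%N /\ (Wm * F <= RM)%N.
Hypothesis YE : (2 * (E * E * RM) <= Y0)%N.
Hypothesis meE : forall U, (size (lst U) < Lm -> size (lst U) * Y0 * E <= Fy)%N.
Hypothesis meS : forall U, (size (lst U) < Lm -> 2 * E * size (lst U) * RM * Y0 <= N * Fy)%N.
Hypothesis pDM : (D * (Q * E) <= M0)%N.
Hypothesis pcM : ((Q + 2) * (Q * E) + Q * E <= M0)%N.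
Hypothesis pQL : (Q * (Q + 2) <= Lm)%N.
Hypothesis pQ2L : (Q + 3 <= Lm)%N.
Hypothesis pRM : ((2 * E * Fy) * (RM + Q + D + 1) + E * RM <= M0)%N.
Hypothesis pDL : ((Q + 2) * D <= Lm)%N.
Hypothesis pcF : (Bm * Fy + 1 + ((Q + 1) * Bm + Q) <= M0)%N.
Hypothesis NM : (N * (E * Fy) <= M0)%N.
Hypothesis HM : (N * (N * (Bm * Fy)) <= M0)%N.

Section Built.
Variables (s : st) (X U Hh : nat -> nat) (p c : nat).
Hypothesis Cs : cfg s.
Hypothesis r : reach p c X U Hh.
Hypothesis pN : (p < N)%N.
Hypothesis B : bld X U (size (lst U)) s.
Hypothesis sL : (size (lst U) < Lm)%N.
Notation H := (Hl X U).
Notation me := (size H).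
Notation hd := (ar s aHD). Notation sl := (ar s aSL). Notation dg := (ar s aDG). Notation er := (ar s aER).
Notation he := (nth 0%N H).

Lemma he_in e : (e < me)%N -> [/\ (he e < m)%N, inH X U (he e) & he e \in H].
Proof.
move=> h; have hh : he e \in H by apply: mem_nth.
have h3 : (he e < m) && inH X U (he e) by rewrite -(mem_Hl es E F cap X U).
by case/andP: h3.
Qed.

Lemma hdE e : (e < me)%N -> hd e.*2 = J_ (he e) /\ hd e.*2.+1 = I_ (he e).
Proof. by move=> h; rewrite (b_h0 B) ?(b_h1 B). Qed.

Lemma hd_arc a : (a < me.*2)%N -> [/\ (a./2 < me)%N, (hd a < n)%N, hd (rva a) != hd a,
 inc (hd a) (he a./2) & (0 < cap (hd a) <= E)%N].
Proof.
move=> al; have h : (a./2 < me)%N by lia.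
have [hm hH hin] := he_in h; have [h0 h1] := hdE h.
have sv : sm (he a./2) by case/and3P: hH.
have /andP[s1 s2] := sv; have ne := IJ hm.
have [e|e] : a = (a./2).*2 \/ a = (a./2).*2.+1 by have := odd_double_half a; case: (odd a) => /=; lia.
 split=> //; rewrite e ?rva_double ?h0 ?h1 //; [exact: Jl|by rewrite doubleK /OuterTh.inc eqxx orbT].
split=> //; rewrite e ?rva_doubleS ?h0 ?h1 //; [exact: Il|by rewrite eq_sym|].
have -> : (a./2.*2.+1)./2 = a./2 by lia.
by rewrite /OuterTh.inc eqxx.
Qed.

Lemma built_graph : graph Lm M0 n E Q D me hd sl dg cap.
Proof.
have nM : (n <= M0)%N by lia.
split.
- by move=> a /hd_arc[].
- move=> x xn; apply: (@eq_from_nth _ 0%N); first by rewrite size_map size_iota (b_dg B).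
 by move=> j; rewrite size_map size_iota => hj; rewrite (nth_map 0%N) ?size_iota // nth_iota // add0n (b_sl B).
- move=> x; rewrite leq_eqVlt => /orP[/eqP ->|xn].
  rewrite (b_dg B) // (outs_cnt E8 N0 Fy0 Q0 eD IJ capn lnX nL lL DL LM XM YM _ (b_h0 B) (b_h1 B)).
  apply: (@leq_trans 0) => //; rewrite leqNgt -has_count; apply/hasPn => t0; rewrite mem_Hl => /andP[t0m _].
  by have := Il t0m; have := Jl t0m; rewrite /OuterTh.inc; case: eqP => [?|_]; case: eqP => [?|_] //=; lia.
 rewrite (b_dg B) ?(ltnW xn) // (outs_cnt E8 N0 Fy0 Q0 eD IJ capn lnX nL lL DL LM XM YM _ (b_h0 B) (b_h1 B)).
 exact: (Hk_deg E8 N0 Fy0 Q0 eD WmP lnX _ r (ltnW pN) xn).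
- by move=> a /hd_arc[].
- move=> a a' al al' e1 e2.
 have [h1 _ n1 i1 _] := hd_arc al; have [h2 _ n2 i2 _] := hd_arc al'.
 have [m1 _ _] := he_in h1; have [m2 _ _] := he_in h2.
 have [_ _ _ j1 _] := hd_arc (rva_lt al); have [_ _ _ j2 _] := hd_arc (rva_lt al').
 rewrite rva_half in j1; rewrite rva_half in j2.
 have et : he a./2 = he a'./2.
  have c1 : inc (hd a) (he a'./2) by rewrite e1.
  have c2 : inc (hd (rva a)) (he a'./2) by rewrite e2.
  move: i1 j1 n1 c1 c2; rewrite /OuterTh.inc => i1 j1 n1 c1 c2.
  apply: simple => //; rewrite /OuterTh.inc.
   by case/orP: i1 => /eqP i1; [rewrite i1|case/orP: j1 => /eqP j1; [rewrite j1|move: n1; rewrite -i1 -j1 eqxx]].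
  by case/orP: i1 => /eqP i1; [case/orP: j1 => /eqP j1; [move: n1; rewrite -i1 -j1 eqxx|rewrite j1]|rewrite i1].
 have eh : a./2 = a'./2 by apply/eqP; rewrite -(nth_uniq 0%N h1 h2 (Hl_uniq _ _ _ _ _ _)) et.
 have [//|na] := eqVneq a a'.
 have ea : a' = rva a.
  move: (odd_double_half a) (odd_double_half a'); rewrite -eh /rva; move/eqP: na.
  by clear; case: (odd a); case: (odd a') => /=; lia.
 by move: n1; rewrite -ea -e1 eqxx.
- by move=> a /hd_arc[_ _ _ _ /andP[-> ->]].
- exact: capn.
- move=> x; rewrite leq_eqVlt => /orP[/eqP ->|xn]; first by rewrite capn muln0; lia.
 have : ((Q + 1) * cap x <= (Q + 1) * Bm)%N by rewrite leq_mul2l BmP ?orbT.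
 lia.
- exact: DL.
- exact: nL.
- by have := mL r (ltnW pN); have := size_Hl es E F cap X U; rewrite mul2n; lia.
- lia.
Qed.

Lemma erE e : (e < me)%N -> er e = rr X (he e) /\ (0 < er e <= RM)%N.
Proof.
move=> h; have e1 : er e = rr X (he e) := b_er B h.
rewrite e1; split=> //.
have [hm hH _] := he_in h; case/and3P: hH => _ _ lt.
have : (W_ (he e) * F <= Wm * F)%N by rewrite leq_mul2r WmP ?orbT.
by case: RMW => _ rw; rewrite /OuterTh.rr; lia.
Qed.

Lemma built_pars : pars Lm M0 n E Q D Fy Y0 RM me cap er.
Proof.
have sH := size_Hl es E F cap X U; case: RMW => R0 _.
have Yp : (0 < Y0)%N by apply: leq_trans YE; rewrite !muln_gt0 R0 andbT /=; lia.
split=> //; try lia.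
- by move=> e /erE[].
- have h := meE sL; apply: leq_trans (_ : size (lst U) * Y0 * E <= _)%N => //.
 apply: leq_trans (_ : size (lst U) * Y0 <= _)%N; first by rewrite leq_mul2r sH orbT.
 by rewrite leq_pmulr //; lia.
- move=> x; rewrite leq_eqVlt => /orP[/eqP ->|xn]; first by rewrite capn mul0n; lia.
 have : (cap x * Fy <= Bm * Fy)%N by rewrite leq_mul2r BmP ?orbT.
 by lia.
Qed.

Local Open Scope ring_scope.

Lemma sumH (V : nmodType) (g : nat -> V) (P : pred nat) :
 \sum_(t < m | P t && inH X U t) g t = \sum_(e < me | P (he e)) g (he e).
Proof.
have -> : \sum_(e < me | P (he e)) g (he e) = \sum_(t <- H | P t) g t by rewrite (big_nth 0%N) big_mkord.
have -> : \sum_(t < m | P t && inH X U t) g t = \sum_(t <- iota 0 m | P t && inH X U t) g t.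
 by rewrite -[X in iota 0 X]subn0 big_mkord.
rewrite -big_filter -[RHS]big_filter; apply: perm_big; apply: uniq_perm.
- by rewrite filter_uniq ?iota_uniq.
- by rewrite filter_uniq // Hl_uniq.
- by move=> t; rewrite mem_filter mem_filter mem_Hl mem_iota /= add0n; case: (P t); case: (inH X U t); rewrite /= ?andbT ?andbF.
Qed.

Variables (k : nat) (y eb : nat -> nat).
Notation levels := (levels n E Q Fy Y0 RM me hd cap er).
Hypothesis L : levels N k y eb.

(** Inner loads carried back from edge numbers of the stored graph to stream positions. *)
Definition ebt t := if t \in H then eb (index t H) else 0%N.

Lemma ebtE e : (e < me)%N -> ebt (he e) = eb e.
Proof. by move=> h; rewrite /ebt mem_nth // index_uniq // Hl_uniq. Qed.

Lemma sumHn (g : nat -> nat) (P : pred nat) :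
 (\sum_(t < m | P t && inH X U t) g t = \sum_(e < me | P (he e)) g (he e))%N.
Proof. exact: (@sumH nat g P). Qed.

Lemma sum_ebt (P : pred nat) : (\sum_(t < m | P t) ebt t = \sum_(e < me | P (he e)) eb e)%N.
Proof.
rewrite (bigID (fun t : 'I_m => inH X U t)) /= [X in (_ + X)%N]big1 ?addn0.
 by rewrite sumHn; apply: eq_bigr => e _; rewrite ebtE.
by move=> t /andP[_ /negbTE h]; rewrite /ebt mem_Hl h andbF.
Qed.

Lemma sum_constr (V : nmodType) (v : nat) (g : nat -> V) : (v < n)%N ->
 \sum_(a <- outs me hd v) g a./2 = \sum_(e < me | inc v (he e)) g e.
Proof.
move=> vn; have [ul lm H'] := star_constr built_graph vn.
have -> : \sum_(a <- outs me hd v) g a./2 = \sum_(e <- [seq a./2 | a <- outs me hd v]) g e by rewrite big_map.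
have -> : \sum_(e < me | inc v (he e)) g e = \sum_(e <- iota 0 me | inc v (he e)) g e.
 by rewrite -[X in iota 0 X]subn0 big_mkord.
rewrite -[RHS]big_filter; apply: perm_big; apply: uniq_perm => //; first by rewrite filter_uniq ?iota_uniq.
move=> e; rewrite mem_filter mem_iota /= add0n.
apply/idP/andP => [h|[h1 h2]].
 have em := lm e h; split=> //; have [h0 h1] := hdE em.
 move: h => /mapP[a ha ->]; have al := outs_lt ha; have [_ _ _ _ _] := hd_arc al.
 have [_ _ _ j _] := hd_arc (rva_lt al); rewrite rva_half in j.
 by rewrite -(outs_tl ha).
have [h0 h1'] := hdE h2; case/orP: h1 => /eqP ev.
 apply/mapP; exists e.*2; rewrite ?doubleK // mem_filter rva_double h1' ev eqxx mem_iota /=; lia.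
apply/mapP; exists e.*2.+1; last by rewrite /= uphalf_double.
by rewrite mem_filter rva_doubleS h0 ev eqxx mem_iota /=; lia.
Qed.

Lemma sum_cap (A : {set 'I_n.+1}) :
 (\sum_(x in A) wcap cap x = \sum_(i < n | inord i \in A) cap i)%N.
Proof.
rewrite big_mkcond big_ord_recr /= -/(ord_max).
have -> : wcap cap (ord_max : 'I_n.+1) = 0%N by exact: capn.
rewrite if_same addn0 [RHS]big_mkcond; apply: eq_bigr => i _.
have -> : widen_ord (leqnSn n) i = inord i by apply: val_inj; rewrite /= inordK // ltnS ltnW.
by rewrite /wcap inordK // ltnS ltnW.
Qed.

(** Every constraint of the stored graph is a constraint of (LP1) restricted to its edges, so the
    restriction of a feasible vector is an admissible competitor for [inner_val]. The dummy lies
    outside the index range of (LP1) and contributes no capacity. *)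
Lemma inner_ir : inner_res X U ebt.
Proof.
have E5 : (5 <= E)%N by lia.
case: RMW => R0 RW.
have meE' : (me * Y0 * E <= Fy)%N.
 by apply: leq_trans (meE sL); rewrite leq_mul2r leq_mul2r size_Hl !orbT.
have [q1 q2] := levels_sums E5 R0 YE meE' Fy0 L.
split.
- by move=> t tm /negbTE h; rewrite /ebt mem_Hl h andbF.
- move=> i il; rewrite sum_ebt; have := q1 i (ltnW il); rewrite /load.
 by rewrite (sum_constr (V := nat) eb il).
- move=> A oA; pose A' : {set 'I_n.+1} := [set x : 'I_n.+1 | A (val x) && (val x < n)%N].
 have inA i : (i < n)%N -> (inord i \in A') = A i by move=> h; rewrite inE /= inordK ?h ?andbT // ltnS ltnW.
 have sA : (\sum_(x in A') wcap cap x = \sum_(i < n | A i) cap i)%N.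
  by rewrite sum_cap; apply: eq_bigl => i; rewrite inA.
 have pA : par (wcap cap) A' by rewrite /par sA.
 have := q2 A' pA; rewrite sA.
 have eI (e : 'I_me) : @inside n me hd A' e = A (I_ (he e)) && A (J_ (he e)).
  have [hm _ _] := he_in (ltn_ord e); have [h0 h1] := hdE (ltn_ord e).
  by rewrite /inside /etl /ehd h0 h1 !inA ?Il ?Jl.
 rewrite (eq_bigl _ _ eI) (eq_bigl _ _ eI) -(sum_ebt (fun t => A (I_ t) && A (J_ t))) => h.
 apply: (leq_trans h); rewrite leq_mul2l leq_mul2l leq_add2l.
 have -> : (\sum_(e < me | A (I_ (he e)) && A (J_ (he e))) 1 = \sum_(t < m | (A (I_ t) && A (J_ t)) && inH X U t) 1)%N.
  exact: esym (sumHn (fun=> 1%N) (fun t => A (I_ t) && A (J_ t))).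
 rewrite [X in (X <= _)%N]big_mkcond [X in (_ <= X)%N]big_mkcond /= leq_sum ?orbT // => t _.
 by case: (A (I_ t)); case: (A (J_ t)) => //=; case hh: (inH X U t) => //; case/and3P: hh => -> _ _.
- move=> hs [f0 f1 f2].
 have er0 e : (e < me)%N -> (0 < er e <= RM)%N by move=> /erE[].
 have cpos l kk yy : constr n me hd cap l kk -> (0 < \sum_(e <- l) yy e)%N -> (0 < kk)%N by move=> h; exact: (constr_pos built_graph h).
 pose h e := hs (he e).
 have h0 e : (e < me)%N -> 0 <= h e by move=> em; apply: f0; case: (he_in em).
 have subl l (P : pred nat) : uniq l -> (forall e, e \in l -> (e < me)%N) ->
   (forall e, (e < me)%N -> (e \in l) = P (he e)) -> \sum_(e <- l) h e <= \sum_(t < m | P t) hs t.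
  move=> ul lm hP.
  have -> : \sum_(e <- l) h e = \sum_(e < me | P (he e)) h e.
   have -> : \sum_(e < me | P (he e)) h e = \sum_(e <- iota 0 me | P (he e)) h e.
    by rewrite -[X in iota 0 X]subn0 big_mkord.
   rewrite -[RHS]big_filter; apply: perm_big; apply: uniq_perm => //; first by rewrite filter_uniq ?iota_uniq.
   move=> e; rewrite mem_filter mem_iota /= add0n; apply/idP/andP => [el|[p1 em]]; last by rewrite hP.
   by have em := lm e el; rewrite -hP.
  rewrite -(sumH hs P) [X in _ <= X](bigID (fun t : 'I_m => inH X U t)) /= lerDl sumr_ge0 // => t _; exact: f0.
 have hc l kk : constr n me hd cap l kk -> \sum_(e <- l) h e <= kk%:R.
  case=> ul lm [[v vn [-> hv]]|[A pA [-> hA]]].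
   apply: le_trans (f1 v vn); apply: subl => // e em; have [g0 g1] := hdE em.
   by rewrite hv // g0 g1 /OuterTh.inc orbC.
  have oA : odd (\sum_(i < n | inord i \in A) cap i) by rewrite -sum_cap.
  rewrite sum_cap; have f2' := f2 (fun i => inord i \in A) oA; apply: (le_trans _ f2'); apply: (subl l (fun t => (inord (I_ t) \in A) && (inord (J_ t) \in A))) => // e em; have [g0 g1] := hdE em.
  by rewrite hA // g0 g1 andbC.
 have gE yy : goody n Q Fy me hd cap yy -> forall e, (e < me)%N -> (yy e <= E * Fy)%N.
  by case=> st _ e em; exact: (stars_y built_graph st em).
 have := @inner_val R n E Q Fy Y0 RM me hd cap er E5 er0 R0 YE meE' Fy0 cpos h h0 hc gE N k y eb L N0 lnY.
 have -> : \sum_(t < m | inH X U t) (rr X t)%:R * hs t = Hr me er h.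
  have := sumH (fun t => (rr X t)%:R * hs t) xpredT; rewrite /= => ->.
  by rewrite /Hr; apply: eq_bigr => e _; have [-> _] := erE (ltn_ord e).
 have NF : (0 : R) < N%:R * Fy%:R by rewrite mulr_gt0 ?ltr0n.
 have -> : \sum_(t < m) (rr X t)%:R * ((ebt t)%:R / (N%:R * Fy%:R)) = Sr R me er eb / (N%:R * Fy%:R).
  rewrite /Sr mulr_suml (bigID (fun t : 'I_m => inH X U t)) /= [X in _ + X]big1 ?addr0.
   have := sumH (fun t => (rr X t)%:R * ((ebt t)%:R / (N%:R * Fy%:R))) xpredT; rewrite /= => ->.
   by apply: eq_bigr => e _; rewrite ebtE // mulrA; have [-> _] := erE (ltn_ord e).
  by move=> t /negbTE hh; rewrite /ebt mem_Hl hh andbF mul0r mulr0.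
 (* The initial loads Y0 are so small against Fy that their contribution 2 E [S0] is at most N Fy;
    this is the additive 1 in [ir3]. *)
 have S0le : 2 * E%:R * S0 R Y0 me er <= N%:R * Fy%:R.
  have : S0 R Y0 me er <= (me * RM * Y0)%:R.
   apply: (@le_trans _ _ (\sum_(e < me) (RM * Y0)%:R)).
    by apply: ler_sum => e _; rewrite -natrM ler_nat leq_mul2r; have [_ /andP[_ ->]] := erE (ltn_ord e); rewrite orbT.
   by rewrite sumr_const card_ord -mulrnA ler_nat [X in (X <= _)%N]mulnC mulnA.
  move=> h1; apply: (@le_trans _ _ (2 * E%:R * (me * RM * Y0)%:R)).
   by apply: ler_wpM2l => //; rewrite mulr_ge0 ?ler0n.
  rewrite -!natrM ler_nat; apply: leq_trans (meS sL).
  by rewrite -!mulnA leq_mul2l leq_mul2l; apply/orP; right; apply/orP; right; rewrite leq_mul2r size_Hl orbT.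
 move=> h1; apply: (le_trans h1); rewrite -mulrA; apply: ler_wpM2l.
  by rewrite addr_ge0 ?mulr_ge0 ?invr_ge0 ?ler0n.
 rewrite mulrC mulrDl lerD2l ler_pdivrMr // mul1r //.
Qed.

(** The count of bumps concerns the loads alone, so it is obtained with the zero competitor. *)
Lemma inner_k : (k <= N * me + E * me)%N.
Proof.
have E5 : (5 <= E)%N by lia.
case: RMW => R0 RW.
have meE' : (me * Y0 * E <= Fy)%N.
 by apply: leq_trans (meE sL); rewrite leq_mul2r leq_mul2r size_Hl !orbT.
have er0 e : (e < me)%N -> (0 < er e <= RM)%N by move=> /erE[].
have cpos l kk yy : constr n me hd cap l kk -> (0 < \sum_(e <- l) yy e)%N -> (0 < kk)%N by move=> h; exact: (constr_pos built_graph h).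
have h0 e : (e < me)%N -> (0 : R) <= (fun=> 0) e by [].
have hc l kk : constr n me hd cap l kk -> \sum_(e <- l) (fun=> 0) e <= kk%:R :> R by rewrite big1.
exact: (@inner_cnt R n E Q Fy Y0 RM me hd cap er E5 er0 R0 YE meE' Fy0 cpos (fun=> 0) h0 hc N k y eb L).
Qed.

Local Close Scope ring_scope.

Notation growX := (growX m E N Fy I_ J_ cap).
Notation decay := (decay E).
Notation ldg := (ldg m I_ J_).

Lemma take_ldg j x : \sum_(t <- take j H | inc x t) ebt t <= ldg ebt x.
Proof.
rewrite /OuterTh.ldg (sum_ebt (inc x)).
have -> : \sum_(e < me | inc x (he e)) eb e = \sum_(t <- H | inc x t) ebt t.
 by rewrite (big_nth 0) big_mkord; apply: eq_bigr => e _; rewrite ebtE.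
by rewrite -{2}(cat_take_drop j H) big_cat leq_addr.
Qed.

Lemma take_ldgE x : \sum_(t <- take me H | inc x t) ebt t = ldg ebt x.
Proof.
rewrite take_size /OuterTh.ldg (sum_ebt (inc x)) (big_nth 0) big_mkord.
by apply: eq_bigr => e _; rewrite ebtE.
Qed.

Lemma growX_le x : (x < n)%N -> growX X ebt x <= M0.
Proof.
move=> xn; have xl := reach_le E8 N0 Fy0 Q0 WmP r xn; have il := ir1 inner_ir xn.
have: cdiv (X x * ldg ebt x) (N * Fy * cap x * E) <= X x.
 rewrite /cdiv; set yy := N * Fy * cap x * E.
 case: (posnP yy) => [->|y0]; first by rewrite divn0.
 rewrite -ltnS ltn_divLR // mulSn.
 have : X x * ldg ebt x <= X x * yy.
  rewrite leq_mul2l; apply/orP; right; apply: leq_trans il _.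
  have -> : N * (cap x * Fy) = N * Fy * cap x by rewrite [cap x * Fy]mulnC mulnA.
  by rewrite /yy leq_pmulr //; lia.
 lia.
by rewrite /OuterTh.growX; lia.
Qed.

Lemma ebt_ub t : settled X U -> t < m -> Hh t + ebt t <= M0.
Proof.
move=> stl tm.
have r1 : reach p.+1 c (fun x => decay (growX X ebt) x) U (fun t => Hh t + ebt t).
 by apply: (rchP r stl inner_ir).
by have [_] := reach_UH E8 N0 Fy0 Q0 Il WmP BmP lnX UM HM r1 pN tm.
Qed.

Lemma upd1_ok s1 : cfg s1 -> listed s1 U Hh -> rg s1 vme = me -> ar s1 aHD = hd ->
 ar s1 aEP = ar s aEP -> ar s1 aEB = eb -> settled X U ->
 run UPD1 s1 (fun s2 => [/\ forall i, i < size (lst U) -> ar s2 aLH i = Hh (nth 0 (lst U) i) + ebt (nth 0 (lst U) i),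
  forall x, x < n -> ar s2 aLD x = ldg ebt x & clk s2 <= clk s1 + 5 + 10 * me]).
Proof.
move=> C1 L1 em eh ep ee stl.
have ub t : t < m -> Hh t + ebt t <= M0 by exact: ebt_ub.
have lb x : x < n -> ldg ebt x <= M0.
 move=> xn; apply: leq_trans (ir1 inner_ir xn) _; apply: leq_trans HM.
 apply: leq_trans (_ : N * (Bm * Fy) <= _); last by rewrite leq_pmull.
 by rewrite leq_mul2l leq_mul2r BmP ?orbT.
have ml : 2 * me < Lm by have := mL r (ltnW pN); have := size_Hl es E F cap X U; lia.
have sM : size (lst U) <= M0 by lia.
apply: (@run_for _ _ _ (fun j s2 => [/\ [/\ rg s2 vme = me, ar s2 aEP = ar s aEP, ar s2 aEB = eb & ar s2 aHD = hd],
  forall i, i < size (lst U) -> ar s2 aLH i = Hh (nth 0 (lst U) i) + (if nth 0 (lst U) i \in take j H then ebt (nth 0 (lst U) i) else 0),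
  forall x, x < n -> ar s2 aLD x = \sum_(t <- take j H | inc x t) ebt t & clk s2 <= clk s1 + 4 + 10 * j]) me) => //.
- by lia.
- by move=> j s2 [[e1 _ _ _] _ _ _] _; split=> //=.
- split=> //=; first by move=> i il; rewrite (l_H L1) // take0 addn0.
  by move=> x xn; rewrite take0 big_nil (f_ld C1).
 by lia.
- move=> j s2 jm [[q1 q2 q3 q4] q5 q6 q7] ej.
 have [pl pe] := b_ep B jm; have [hm hH hin] := he_in jm; have [h0 h1] := hdE jm.
 have il := Il hm; have jl := Jl hm; have nij := IJ hm.
 have tj : take j.+1 H = rcons (take j H) (he j) by rewrite (take_nth 0).
 have nin : he j \notin take j H.
  have := Hl_uniq es E F cap X U; rewrite -{1}(cat_take_drop j.+1 H) tj cat_uniq rcons_uniq.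
  by case/andP => /andP[].
 have ubj := ub _ hm; have eje := ebtE jm.
 have tS x : \sum_(t <- take j.+1 H | inc x t) ebt t = \sum_(t <- take j H | inc x t) ebt t + (if inc x (he j) then eb j else 0).
  by rewrite tj -cats1 big_cat /= big_cons big_nil eje; case: ifP; rewrite ?addn0.
 have lI := leq_trans (take_ldg j.+1 (I_ (he j))) (lb _ il).
 have lJ := leq_trans (take_ldg j.+1 (J_ (he j))) (lb _ jl).
 have iI : inc (I_ (he j)) (he j) by rewrite /OuterTh.inc eqxx.
 have iJ : inc (J_ (he j)) (he j) by rewrite /OuterTh.inc eqxx orbT.
 rewrite tS iI in lI; rewrite tS iJ in lJ.
 have v5 := q5 _ pl; rewrite pe (negbTE nin) addn0 in v5.
 have vI := q6 _ il; have vJ := q6 _ jl.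
 have e2 : 2 * j = j.*2 by rewrite mul2n.
 have nJ : (I_ (he j) == J_ (he j)) = false by apply/negbTE.
 apply: run_sq; apply: run_asg => //=; rewrite ?ej ?q2; [by split=> //; lia|lia|].
 apply: run_sq; apply: run_put => //=; rewrite ?ej ?q3 ?v5; [by do !split=> //; lia|lia|by rewrite -eje|].
 apply: run_sq; apply: run_asg => //=; rewrite ?ej ?q4 ?e2 ?h0; [by do !split=> //; lia|lia|].
 apply: run_sq; apply: run_put => //=; rewrite ?ej ?q3 ?vJ; [by do !split=> //; lia|lia|exact: lJ|].
 apply: run_sq; apply: run_asg => //=; rewrite ?ej ?q4 ?e2 ?addn1 ?h1; [by do !split=> //; lia|lia|].
 apply: run_put => //=; rewrite ?ej ?q3 ?nJ ?vI; [by do !split=> //; lia|lia|exact: lI|].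
 split=> //=.
 + move=> i il'; rewrite tj mem_rcons inE; case: (i =P ar s aEP j) => [->|ni].
   by rewrite pe eqxx /= eje.
  rewrite q5 //; case: eqP => [e|//]; case: ni; apply/eqP.
  by rewrite -(nth_uniq 0 il' pl) ?e ?pe // filter_uniq ?iota_uniq.
 + move=> x xn; rewrite tS.
  case: (x =P I_ (he j)) => [->|n1] /=; first by rewrite iI.
  case: (x =P J_ (he j)) => [->|n2] /=; first by rewrite iJ.
  by rewrite q6 // /OuterTh.inc; case: eqP => [e|_]; [case: n1|case: eqP => [e|_]; [case: n2|rewrite addn0]].
 + by lia.
move=> s2 [[q1 q2 q3 q4] q5 q6 q7] _; split=> /=.
- by move=> i il; rewrite q5 // take_size /ebt; case: (_ \in _).
- by move=> x xn; rewrite q6 // take_ldgE.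
- by lia.
Qed.

Lemma upd2_ok s1 :
 [/\ rg s1 vn = n, rg s1 vE = E, rg s1 vN = N & rg s1 vFy = Fy] -> ar s1 aCAP = cap -> ar s1 aX = X ->
 (forall x, x < n -> ar s1 aLD x = ldg ebt x) ->
 run UPD2 s1 (fun s2 => [/\ forall x, x < n -> ar s2 aX x = decay (growX X ebt) x,
  forall x, x < n -> ar s2 aLD x = 0 & clk s2 <= clk s1 + 5 + 10 * n]).
Proof.
move=> [en eE eN eF] ec eX eL; have nM : n <= M0 by lia.
apply: (@run_for _ _ _ (fun j s2 => [/\ [/\ rg s2 vn = n, rg s2 vE = E, rg s2 vN = N & rg s2 vFy = Fy], ar s2 aCAP = cap,
  forall x, x < n -> ar s2 aX x = if x < j then decay (growX X ebt) x else X x,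
  forall x, x < n -> ar s2 aLD x = if x < j then 0 else ldg ebt x & clk s2 <= clk s1 + 4 + 10 * j]) n) => //.
- by move=> j s2 [[e1 _ _ _] _ _ _] _; split=> //=.
- by split=> //=; [rewrite eX|lia].
- move=> j s2 jn [[q1 q2 q3 q4] q5 q6 q7 q8] ej.
 have vX := q6 _ jn; have vL := q7 _ jn; rewrite ltnn in vX vL.
 have gv : X j + (X j * ldg ebt j + N * Fy * cap j * E - 1) %/ (N * Fy * cap j * E) = growX X ebt j by [].
 have gl := growX_le jn.
 apply: run_sq; apply: run_put => //=; rewrite ?ej ?q2 ?q3 ?q4 ?q5 ?vX ?vL; [by do !split=> //; lia|lia|by rewrite gv|].
 apply: run_sq; apply: run_put => //=; rewrite ?ej; [lia|].
 apply: run_put => //=; rewrite ?ej ?q2; [by do !split=> //; lia|lia|by rewrite eqxx gv; apply: leq_trans (leq_subr _ _) gl|].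
 rewrite eqxx gv; split=> //=.
 + by move=> x xn; rewrite ltnS leq_eqVlt; case: eqP => [->|_] //=; rewrite q6.
 + by move=> x xn; rewrite ltnS leq_eqVlt; case: eqP => [->|_] //=; rewrite q7.
 + by lia.
move=> s2 [_ _ q6 q7 q8] _; split=> /=.
- by move=> x xn; rewrite q6 // xn.
- by move=> x xn; rewrite q7 // xn.
- by lia.
Qed.

End Built.

(** The bound of [reach_cnt_le] on the touches, here limiting the length of the list and the size of
    the stored graph. *)
Definition T1 := n * (2 * N * (E * E)).
Definition cPH := (15 + (10 + 8 * T1) + (30 * (n + T1) + 30) +
 (5 + N * cLEV n Q D T1 + (N * T1 + E * T1) * (cST D + cFIND Q D + cBS Q D + 5)) + (10 + 10 * T1 + 10 * n)).

Lemma phase_ok s p c U Hh : cfg s -> listed s U Hh -> p < N -> reach p c (ar s aX) U Hh ->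
 (forall t, t < m -> I_ t <= M0 /\ J_ t <= M0) ->
 run PHASE s (fun s' => exists c' U' Hh', [/\ cfg s', listed s' U' Hh', reach p.+1 c' (ar s' aX) U' Hh',
  c <= c' /\ ps s' = (ps s).+1 /\ ot s' = ot s & clk s' <= clk s + 60 * m + cPH + 5 * (c' - c)]).
Proof.
move=> C0 L0 pN r0 bIJ; have pN' := ltnW pN.
have lL' : n * (2 * N * (E * E)) < Lm by [].
have LM' : Lm <= M0 by lia.
apply: run_sq; apply: (run_call (pass_ok E8 N0 Fy0 Q0 Il Jl IJ WmP BmP lnX nL lL LM' mM XM UM bM HM C0 L0 pN' r0 bIJ)) => s1 [c1 [U1 [V1 cc ps1 ot1 k1]]] _.
have C1 := v_cfg V1; have r1 := v_r V1; set X := ar s1 aX in r1.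
have sT : size (lst U1) <= T1.
 rewrite size_lst; apply: leq_trans (reach_listed r1) _.
 exact: (reach_cnt_le E8 N0 Fy0 Q0 Il Jl WmP lnX r1 pN').
have sL : size (lst U1) < Lm by apply: leq_ltn_trans sT lL.
have stl : settled X U1 by move=> t tm b1 b2; exact: (v_s V1).
have ub x : x < m -> U1 x <= M0 /\ Hh x <= M0 by exact: (reach_UH E8 N0 Fy0 Q0 Il WmP BmP lnX UM HM r1 pN').
apply: run_sq; apply: (run_call (copy_ok E8 N0 Fy0 Q0 Il Jl WmP lnX nL lL LM' mM XM UM bM HM C1 (v_b V1) sL ub)) => s2 [C2 L2 k2] f2.
have X2 : ar s2 aX = X by rewrite (fr_a f2).
have r2 : reach p c1 (ar s2 aX) U1 Hh by rewrite X2.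
apply: run_sq; apply: (run_call (build_ok E8 N0 Fy0 Q0 eD Il Jl IJ WmP capn lnX nL lL DL LM mL XM YM C2 r2 pN' sL L2)) => s3 [B3 k3] f3.
rewrite X2 in B3.
have C3 : cfg s3 by apply: cfg_frame f3 _ _ C2.
have L3 : listed s3 U1 Hh.
 apply: (listed_eq L2); first by rewrite (fr_r f3).
 by move=> a ha; rewrite (fr_a f3) //; move: a ha; do 27 (case=> //).
have X3 : ar s3 aX = X by rewrite (fr_a f3).
have gr := built_graph r1 pN B3 sL.
have pp := built_pars pN B3 sL.
set H := Hl X U1 in gr pp; pose me := size H.
have mT : me <= T1 by apply: leq_trans (size_Hl _ _ _ _ _ _) sT.
have st3 : stat n E Q D Fy Y0 RM me (ar s3 aHD) (ar s3 aSL) (ar s3 aDG) cap (ar s3 aER) s3.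
 by case: C3 => *; split=> //; exact: (b_me B3).
have NM' : N <= M0 by apply: leq_trans NM; rewrite leq_pmulr // muln_gt0 Fy0 andbT; lia.
have y3 e : e < me -> ar s3 aEY e = Y0 by move=> h; case: (b_y B3 h).
have b3 e : e < me -> ar s3 aEB e = 0 by move=> h; case: (b_y B3 h).
apply: run_sq; apply: (run_call (inner_ok es gr pp st3 (f_N C3) NM' (f_vis C3) y3 b3 YFy NM)) => s4 [k [st4 L vis4 k4]] f4.
have kk := inner_k r1 pN B3 sL L.
have C4 : cfg s4.
 case: (C3) => *; case: (st4) => *; split=> //; rewrite ?(fr_r f4) ?(fr_a f4) //.
have L4 : listed s4 U1 Hh.
 apply: (listed_eq L3); first by rewrite (fr_r f4).
 by move=> a ha; rewrite (fr_a f4) //; move: a ha; do 27 (case=> //).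
have X4 : ar s4 aX = X by rewrite (fr_a f4).
have ep4 : ar s4 aEP = ar s3 aEP by rewrite (fr_a f4).
apply: run_sq. have u1 := upd1_ok r1 pN B3 sL L C4 L4 (s_me st4) (s_hd st4) ep4 erefl stl.
apply: (run_call u1) => s5 [lh5 ld5 k5] f5.
have X5 : ar s5 aX = X by rewrite (fr_a f5).
have c5 : ar s5 aCAP = cap by rewrite (fr_a f5) // (f_cap C4).
have r5 : [/\ rg s5 vn = n, rg s5 vE = E, rg s5 vN = N & rg s5 vFy = Fy].
 by split; rewrite (fr_r f5) //; case: C4.
have u2 := upd2_ok r1 pN B3 sL L r5 c5 X5 ld5.
apply: (run_call u2) => s6 [x6 ld6 k6] f6.
have ir := inner_ir r1 pN B3 sL L.
exists c1, U1, (fun t => Hh t + ebt X U1 (ar s4 aEB) t); split.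
- case: C4 => g1 g2 g3 g4 g5 g6 g7 g8 g9 g10 g11 g12; split; try (by rewrite (fr_r f6) // (fr_r f5)).
 + by rewrite (fr_a f6) // (fr_a f5).
 + by move=> x xn; rewrite (fr_a f6) // (fr_a f5) //; exact: g11.
 + exact: ld6.
- case: L4 => g1 g2 g3 g4 g5 g6 g7; split; first by rewrite (fr_r f6) // (fr_r f5).
 + by move=> i il; rewrite (fr_a f6) // (fr_a f5) // g2.
 + by move=> i il; rewrite (fr_a f6) // (fr_a f5) // g3.
 + by move=> i il; rewrite (fr_a f6) // (fr_a f5) // g4.
 + by move=> i il; rewrite (fr_a f6) // (fr_a f5) // g5.
 + by move=> i il; rewrite (fr_a f6) // (fr_a f5) // g6.
 + by move=> i il; rewrite (fr_a f6) // lh5.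
- by apply: (rchP r1 stl ir).
- have [_ p2 o2] := fr_s f2 isT; have [_ p3 o3] := fr_s f3 isT; have [_ p4 o4] := fr_s f4 isT.
 have [_ p5 o5] := fr_s f5 isT; have [_ p6 o6] := fr_s f6 isT.
 by split=> //; split; congruence.
have g1 : cLEV n Q D me <= cLEV n Q D T1.
 by rewrite /cLEV; do ! apply: leq_add => //; rewrite leq_mul2l mT orbT.
have g2 : N * cLEV n Q D me <= N * cLEV n Q D T1 by rewrite leq_mul2l g1 orbT.
have g3 : k * (cST D + cFIND Q D + cBS Q D + 5) <= (N * T1 + E * T1) * (cST D + cFIND Q D + cBS Q D + 5).
 rewrite leq_mul2r; apply/orP; right; apply: leq_trans kk _.
 by apply: leq_add; rewrite leq_mul2l mT orbT.
rewrite /cPH; move: g2 g3 k1 k2 k3 k4 k5 k6; rewrite -/me.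
move: (N * cLEV n Q D me) (N * cLEV n Q D T1) (k * _) ((N * T1 + E * T1) * _); lia.
Qed.

End Phase.

End PhaseTh.

(** * The program, its parameters and its correctness *)

Module MainTh.
Import Defs MachineTh HoareTh CutsTh InnerCodeTh ResetTh FindTh BumpTh BumpSetTh LevelsTh WeightsTh OuterTh PassTh BuildTh PhaseTh.
Fixpoint pow_ex (r k : nat) : ex := if k is j.+1 then (pow_ex r j * r)%al else (#1)%al.
Lemma ev_pow r k s : ev (pow_ex r k) s = rg s r ^ k.
Proof. by elim: k => //= k ->; rewrite expnSr. Qed.
Lemma ok_pow Lm r k s : ok Lm (pow_ex r k) s.
Proof. by elim: k => //= k. Qed.

Arguments pow_ex : simpl never.

Definition SET1 : cmd :=
 1 <~ Raw #0 ;; 87 <~ Raw #1 ;; 88 <~ Raw #2 ;; 2 <~ #100 * (88 %/ 87 + #1).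
(** The capacity array overlaps the input: b_i is read at address i + 3 and written to address NA i
    + 3. Copying from the last index downwards never destroys an entry that is still to be read. *)
Definition SET2 : cmd :=
 FOR 90 TO 1 DO (91 <~ 1 - #1 - 90 ;; aCAP~[91] <~ Raw (91 + #3)%al).
(** The arrays share their memory with the input and may contain parts of it, so those assumed to
    have definite contents are initialised. Entry n of the capacities belongs to the dummy
    vertex. *)
Definition SET3 : cmd :=
 aCAP~[1] <~ #0 ;; FOR 90 TO (1 + #1) DO (aVIS~[90] <~ #0 ;; aLD~[90] <~ #0 ;; aX~[90] <~ #1).
Definition SET4 : cmd :=
 89 <~ #0 ;; FOR 90 TO 1 DO (WHEN 89 <=: aCAP`[90] DO 89 <~ aCAP`[90]).
(** One preliminary pass finds the largest weight, from which the scales are computed; hence N + 1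
    passes in total. *)
Definition SET5 : cmd :=
 Rew ;; 93 <~ #0 ;; go <~ #1 ;;
 WHILE #1 <=: go DO (Nxt go pi_ pj pw ;; WHEN #1 <=: go DO WHEN 93 <=: pw DO 93 <~ pw).
Definition SET6 : cmd :=
 94 <~ 1 + 93 + 89 + 2 ;; 95 <~ #0 ;; 96 <~ #1 ;;
 WHILE 96 <=: 94 DO (96 <~ 96 * #2 ;; 95 <~ 95 + #1).
Definition SET7 : cmd :=
 3 <~ #100 * 2 * 2 * 95 ;; 4 <~ 2 * 2 * 2 ;; 5 <~ #2 * 3 * (2 * 2) ;;
 6 <~ pow_ex 94 20 ;; 10 <~ 6 * 94 ;; 8 <~ 10 * 94 * 94 * 94 ;; 7 <~ 6 * 6 * 6 ;; 12 <~ #0.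
Definition SETUP : cmd := SET1 ;; SET2 ;; SET3 ;; SET4 ;; SET5 ;; SET6 ;; SET7.
(** The load U/E + Hh/(N Fy), scaled by E/(N (E+20)), written over a denominator common to all
    edges. *)
Definition OUTPUT : cmd :=
 96 <~ vE * vN * vFy * vN * (vE + #20) ;;
 FOR pt TO vcnt DO (
  pi_ <~ aLI`[pt] ;; pj <~ aLJ`[pt] ;;
  97 <~ (aLU`[pt] * vN * vFy + aLH`[pt] * vE) * vE ;; Emt pi_ pj 97 96).
Definition MAIN : cmd :=
 SETUP ;; (FOR rp TO vN DO PHASE) ;; OUTPUT.

Lemma MAIN_wf : wfc MAIN && wcc MAIN. Proof. by vm_compute. Qed.

(** This and the following lemmas bound an expression by a power of G along its syntax. The exponent
    is found by unification, so overflow conditions reduce to a comparison of numerals. *)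
Lemma pbM G (G2 : 100 <= G) x y a b : x <= G ^ a -> y <= G ^ b -> x * y <= G ^ (a + b).
Proof. by move=> h1 h2; rewrite expnD leq_mul. Qed.
Lemma pbD G (G2 : 100 <= G) x y a b : x <= G ^ a -> y <= G ^ b -> x + y <= G ^ (a + b + 1).
Proof.
move=> h1 h2; have ga : 0 < G ^ a by rewrite expn_gt0; lia.
have gb : 0 < G ^ b by rewrite expn_gt0; lia.
apply: leq_trans (leq_add h1 h2) _; rewrite expnD expn1 expnD.
apply: leq_trans (_ : G ^ a * G ^ b + G ^ a * G ^ b <= _); first by rewrite leq_add ?leq_pmulr ?leq_pmull.
by rewrite addnn -muln2 leq_mul2l; apply/orP; right; lia.
Qed.
Lemma pbmx G (G2 : 100 <= G) x y a b : x <= G ^ a -> y <= G ^ b -> x + y <= G ^ ((maxn a b).+1).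
Proof.
move=> h1 h2; have h3 : x <= G ^ maxn a b by apply: leq_trans h1 _; rewrite leq_pexp2l ?leq_maxl //; lia.
have h4 : y <= G ^ maxn a b by apply: leq_trans h2 _; rewrite leq_pexp2l ?leq_maxr //; lia.
by rewrite expnS; have : 2 * G ^ maxn a b <= G * G ^ maxn a b by [rewrite leq_mul2r; apply/orP; right; lia]; lia.
Qed.
Lemma pbS G (G2 : 100 <= G) x a : x <= G ^ a -> x.+1 <= G ^ (a.+1).
Proof. by move=> h; rewrite -[a]maxn0 -addn1; apply: (pbmx G2) => //. Qed.
Lemma pbX G (G2 : 100 <= G) x a k : x <= G ^ a -> x ^ k <= G ^ (a * k).
Proof. by move=> h; case: k => [|k]; rewrite ?muln0 // expnM leq_exp2r. Qed.
Lemma pbC G (G2 : 100 <= G) k : k <= 100 -> k <= G ^ 1.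
Proof. by rewrite expn1; lia. Qed.
Lemma pb1 G (G2 : 100 <= G) x : x <= G -> x <= G ^ 1.
Proof. by rewrite expn1. Qed.
Lemma pbU G (G2 : 100 <= G) x a b : x <= G ^ a -> a <= b -> x <= G ^ b.
Proof. by move=> h ab; apply: leq_trans h _; rewrite leq_pexp2l //; lia. Qed.
(** The same calculus for bounds of the form n G^a, for quantities that must remain linear in n. *)
Lemma nbMl G (G2 : 100 <= G) n (n0 : 0 < n) x y a b : x <= n * G ^ a -> y <= G ^ b -> x * y <= n * G ^ (a + b).
Proof. by move=> h1 h2; rewrite expnD mulnA leq_mul. Qed.
Lemma nbMr G (G2 : 100 <= G) n (n0 : 0 < n) x y a b : x <= G ^ a -> y <= n * G ^ b -> x * y <= n * G ^ (a + b).
Proof. by move=> h1 h2; rewrite mulnC [a + b]addnC; exact: (nbMl G2 n0). Qed.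
Lemma nbD G (G2 : 100 <= G) n (n0 : 0 < n) x y a b : x <= n * G ^ a -> y <= n * G ^ b -> x + y <= n * G ^ ((maxn a b).+1).
Proof.
move=> h1 h2; have h3 : x <= n * G ^ maxn a b by apply: leq_trans h1 _; rewrite leq_mul2l leq_pexp2l ?leq_maxl ?orbT //; lia.
have h4 : y <= n * G ^ maxn a b by apply: leq_trans h2 _; rewrite leq_mul2l leq_pexp2l ?leq_maxr ?orbT //; lia.
by rewrite expnS mulnCA; have : 2 * (n * G ^ maxn a b) <= G * (n * G ^ maxn a b) by [rewrite leq_mul2r; apply/orP; right; lia]; lia.
Qed.
Lemma nbW G (G2 : 100 <= G) n (n0 : 0 < n) x a : x <= G ^ a -> x <= n * G ^ a.
Proof. by move=> h; apply: leq_trans h _; rewrite leq_pmull. Qed.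
Lemma nbS G (G2 : 100 <= G) n (n0 : 0 < n) x a : x <= n * G ^ a -> x.+1 <= n * G ^ (a.+1).
Proof. by move=> h; rewrite -[a]maxn0 -addn1; apply: (nbD G2 n0) => //; rewrite expn0 muln1. Qed.
Lemma nb1 G (G2 : 100 <= G) n (n0 : 0 < n) : n <= n * G ^ 0.
Proof. by rewrite expn0 muln1. Qed.
Lemma nbU G (G2 : 100 <= G) n (n0 : 0 < n) x a b : x <= n * G ^ a -> a <= b -> x <= n * G ^ b.
Proof. by move=> h ab; apply: leq_trans h _; rewrite leq_mul2l leq_pexp2l ?orbT //; lia. Qed.

Import Order.TTheory GRing.Theory Num.Theory.

Section Setup.
Variables (R : realType) (n dn dd : nat) (es : seq (nat * nat * nat)) (ar0 : nat -> nat -> nat).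
Notation m := (size es).
Notation I_ := (I_ es). Notation J_ := (J_ es). Notation W_ := (W_ es).
(** Capacity i stands at input address i + 3, after n and the two parts of delta. *)
Definition cap0 i := ar0 ((i + 3) %% NA) ((i + 3) %/ NA).
(** 1/eps, between 100/delta and 200/delta for delta at most 1. *)
Definition pE := 100 * (dd %/ dn + 1).
Definition pB := \max_(i < n) cap0 i.
Definition pW := \max_(t < m) W_ t.
(** An upper bound of the input quantities and of E, with bit length [pL]. Since N/E^2 = 100 [pL]
    and ln G is at most [pL], the quantity N eps^2 exceeds the logarithm of every power of G up to
    100, as [lnX] and [lnY] require. *)
Definition pG := n + pW + pB + pE.
Definition pL := (trunc_log 2 pG).+1.
Definition pN := 100 * pE * pE * pL.
Definition pQ := pE * pE * pE.
Definition pD := 2 * pN * (pE * pE).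
(** Scale of the potentials. The power 20 exceeds the degree in G of all rounding errors accumulated
    by the potentials. The further scales form a chain: [pRM] bounds reduced weights, [pY0]
    dominates E^2 [pRM], and [pFy] = G^60 dominates [pY0] times the number of stored edges. *)
Definition pF := pG ^ 20.
Definition pRM := pF * pG.
Definition pY0 := pRM * pG * pG * pG.
Definition pFy := pF * pF * pF.
Definition pLm := (n + 2) * (10 * 100 * pE ^ 8 * pL).
Definition pP := pG ^ 100.
Variable pM : nat.
Hypothesis pGM : pP <= pM.
Notation run := (run pLm pM es).
Hypothesis n0 : 0 < n.
Hypothesis dn0 : 0 < dn.
Hypothesis a0 : ar0 0 0 = n.
Hypothesis a1 : ar0 1 0 = dn.
Hypothesis a2 : ar0 2 0 = dd.
Hypothesis arM : forall k i, k < NA -> i < pLm -> ar0 k i <= pM.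
Hypothesis mn : m <= n * n.

Lemma E100 : 100 <= pE. Proof. by rewrite /pE leq_pmulr // addn1. Qed.
Lemma G100 : 100 <= pG. Proof. by have := E100; rewrite /pG; lia. Qed.
Lemma nG : n <= pG. Proof. by rewrite /pG; lia. Qed.
Lemma WG : pW <= pG. Proof. by rewrite /pG; lia. Qed.
Lemma BG : pB <= pG. Proof. by rewrite /pG; lia. Qed.
Lemma EG : pE <= pG. Proof. by rewrite /pG; lia. Qed.
Lemma L0 : 0 < pL. Proof. by []. Qed.
Lemma pL_gt : pG < 2 ^ pL. Proof. by rewrite /pL; apply: trunc_log_ltn. Qed.
Lemma pL_le : 2 ^ pL.-1 <= pG. Proof. by rewrite /pL /=; apply: trunc_logP => //; have := G100; lia. Qed.
Lemma LG : pL <= pG.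
Proof. by have := pL_le; rewrite {2}/pL /=; have := ltn_expl (trunc_log 2 pG) (isT : 1 < 2); rewrite /pL; lia. Qed.
Lemma capB i : i < n -> cap0 i <= pB.
Proof.
move=> h; rewrite /pB; first [exact: (leq_bigmax (Ordinal h)) | exact: (leq_bigmax (fun i : 'I_n => cap0 i) (Ordinal h)) | exact: (@leq_bigmax _ (fun i : 'I_n => cap0 i) (Ordinal h))].
Qed.
Lemma wtW t : t < m -> W_ t <= pW.
Proof.
move=> h; rewrite /pW; first [exact: (leq_bigmax (Ordinal h)) | exact: (leq_bigmax (fun t : 'I_m => W_ t) (Ordinal h)) | exact: (@leq_bigmax _ (fun t : 'I_m => W_ t) (Ordinal h))].
Qed.

Ltac pbk := lazymatch goal with
 | |- is_true (leq (muln _ _) _) => eapply (pbM G100); [pbk|pbk]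
 | |- is_true (leq (addn _ _) _) => eapply (pbmx G100); [pbk|pbk]
 | |- is_true (leq (expn _ _) _) => first [exact: leqnn | eapply (pbX G100); pbk]
 | |- is_true (leq (S _) _) => first [apply: (pbC G100); reflexivity | eapply (pbS G100); pbk]
 | _ => first [apply: (pbC G100); reflexivity | apply: (pb1 G100); first [exact: nG|exact: WG|exact: BG|exact: EG|exact: LG|exact: leqnn]]
 end.
Ltac pbt := try apply: (leq_trans _ pGM); rewrite /pP /pY0 /pRM /pFy /pF /pD /pQ /pN /pLm; eapply (pbU G100); [pbk|by vm_compute].

Lemma LmM : 2 * pLm <= pM.
Proof. by pbt. Qed.
Lemma mM : m < pM.
Proof. by have h : n * n + 1 <= pM by [pbt]; lia. Qed.
Lemma XM : 2 * (pW * pF) + 2 + pW <= pM. Proof. by pbt. Qed.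
Lemma XM2 : 4 * (pW * pF) + 4 <= pM. Proof. by pbt. Qed.
Lemma YM : pY0 <= pM. Proof. by pbt. Qed.
Lemma NE_M : pN * (pE * pFy) <= pM. Proof. by pbt. Qed.
Lemma HM : pN * (pN * (pB * pFy)) <= pM. Proof. by pbt. Qed.
Lemma UM : pE * (2 * pN) * pB <= pM. Proof. by pbt. Qed.
Lemma bM : pE * pB + pE + pB <= pM. Proof. by pbt. Qed.
Lemma DM : pD * (pQ * pE) <= pM. Proof. by pbt. Qed.
Lemma cM : (pQ + 2) * (pQ * pE) + pQ * pE <= pM. Proof. by pbt. Qed.
Lemma RMM : (2 * pE * pFy) * (pRM + pQ + pD + 1) + pE * pRM <= pM. Proof. by pbt. Qed.
Lemma cFM : pB * pFy + 1 + ((pQ + 1) * pB + pQ) <= pM. Proof. by pbt. Qed.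
Lemma nM : n <= pM. Proof. by pbt. Qed.

Lemma nLm : n.+1 < pLm.
Proof.
rewrite /pLm; have : 0 < 10 * 100 * pE ^ 8 * pL by have E0 : 0 < pE by [have := E100; lia]; rewrite (muln_gt0 (10 * 100 * pE ^ 8) pL) (muln_gt0 (10 * 100) (pE ^ 8)) expn_gt0 E0.
by move=> h; apply: leq_trans (_ : (n + 2) * 1 <= _); [lia|by rewrite leq_mul2l h orbT].
Qed.

Lemma set1_ok s0 : ar s0 = ar0 -> run SET1 s0 (fun s => [/\ rg s 1 = n, rg s 2 = pE & clk s <= clk s0 + 4]).
Proof.
move=> e; have nl := nLm; have nm := nM; have EM : pE <= pM by pbt.
have L48 : 4 <= NA * pLm by rewrite /NA; lia.
have e0 : ar s0 (0 %% NA) (0 %/ NA) = n by rewrite e.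
have e1 : ar s0 (1 %% NA) (1 %/ NA) = dn by rewrite e.
have e2 : ar s0 (2 %% NA) (2 %/ NA) = dd by rewrite e.
have dnM : dn <= pM by rewrite -a1; apply: arM => //; lia.
have ddM : dd <= pM by rewrite -a2; apply: arM => //; lia.
apply: run_sq; apply: run_asg => //=; rewrite ?e0; [by split=> //; lia|lia|].
apply: run_sq; apply: run_asg => //=; rewrite ?e1; [by split=> //; lia|lia|].
apply: run_sq; apply: run_asg => //=; rewrite ?e2; [by split=> //; lia|lia|].
by apply: run_asg => //=; split=> //; lia.
Qed.

Lemma set2_ok s : ar s = ar0 -> rg s 1 = n ->
 run SET2 s (fun s' => (forall i, i < n -> ar s' aCAP i = cap0 i) /\ clk s' <= clk s + 5 + 6 * n).
Proof.
move=> e en; have nl := nLm; have nm := nM.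
apply: (@run_for _ _ _ (fun j s2 => [/\ rg s2 1 = n, forall k i, k <> 3 \/ i < n - j -> ar s2 k i = ar0 k i,
  forall i, n - j <= i -> i < n -> ar s2 aCAP i = cap0 i & clk s2 <= clk s + 4 + 6 * j]) n) => //.
- by move=> j s2 [e1 _ _ _] _; split=> //=.
- by split=> //=; [move=> k i _; rewrite e|move=> i h1 h2; lia|lia].
- move=> j s2 jn [q1 q2 q3 q4] ej.
 apply: run_sq; apply: run_asg => //=; rewrite ?q1 ?ej; first lia.
 set i := n - 1 - j; have hi : n - j = i.+1 by rewrite /i; lia.
 have v : ar s2 ((i + 3) %% NA) ((i + 3) %/ NA) = cap0 i.
  by apply: q2; right; rewrite hi /NA; lia.
 have vb : cap0 i <= pM by apply: arM; [rewrite ltn_mod|rewrite /NA; lia].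
 apply: run_put => //=; rewrite ?eqxx ?v //; [by split=> //; rewrite /NA; lia|lia|].
 split=> //=.
 + move=> k x h; case: eqP => [ek|nk]; last by apply: q2; left.
  rewrite /updf; case: eqP => [ex|nx]; first by case: h => [//|]; rewrite ex /i; lia.
  by subst k; apply: q2; right; lia.
 + move=> x h1 h2; case: eqP => [->//|nx]; apply: q3; lia.
 + by lia.
by move=> s2 [q1 q2 q3 q4] _; split=> /= [i il|]; [apply: q3; lia|lia].
Qed.

Lemma set3_ok s : rg s 1 = n -> (forall i, i < n -> ar s aCAP i = cap0 i) ->
 run SET3 s (fun s' => [/\ forall i, i < n -> ar s' aCAP i = cap0 i, ar s' aCAP n = 0,
  forall x, x <= n -> [/\ ar s' aVIS x = 0, ar s' aLD x = 0 & ar s' aX x = 1] & clk s' <= clk s + 20 + 10 * n]).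
Proof.
move=> en ec; have nl := nLm; have nm := nM.
apply: run_sq; apply: run_put => //=; rewrite ?en; first lia.
apply: (@run_for _ _ _ (fun j s2 => [/\ rg s2 1 = n, forall i, i < n -> ar s2 aCAP i = cap0 i, ar s2 aCAP n = 0,
  forall x, x < j -> [/\ ar s2 aVIS x = 0, ar s2 aLD x = 0 & ar s2 aX x = 1] & clk s2 <= clk s + 5 + 7 * j]) n.+1) => //.
- by have := LmM; lia.
- by move=> j s2 [e1 _ _ _ _] _; split=> //=; rewrite e1 addn1.
- split=> //=; [|by rewrite eqxx|by lia].
 by move=> i il; case: eqP => [e|_]; [lia|exact: ec].
- move=> j s2 jn [q1 q2 q3 q4 q5] ej.
 apply: run_sq; apply: run_put => //=; rewrite ?ej; first lia.
 apply: run_sq; apply: run_put => //=; rewrite ?ej; first lia.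
 apply: run_put => //=; rewrite ?ej; [lia|have := G100; have := nM; lia|].
 split=> //=; last by lia.
 move=> x; rewrite ltnS leq_eqVlt; case: eqP => [->|_] //= h; exact: q4.
by move=> s2 [q1 q2 q3 q4 q5] _; split=> //=; lia.
Qed.

Lemma set4_ok s : rg s 1 = n -> (forall i, i < n -> ar s aCAP i = cap0 i) ->
 run SET4 s (fun s' => rg s' 89 = pB /\ clk s' <= clk s + 10 + 10 * n).
Proof.
move=> en ec; have nl := nLm; have nm := nM; have BM : pB <= pM by pbt.
apply: run_sq; apply: run_asg => //=.
apply: (@run_for _ _ _ (fun j s2 => [/\ rg s2 1 = n, ar s2 = ar s, rg s2 89 = \max_(i < j) cap0 i & clk s2 <= clk s + 5 + 6 * j]) n) => //.
- by move=> j s2 [e1 _ _ _] _; split=> //=.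
- by split=> //=; [rewrite big_ord0|lia].
- move=> j s2 jn [q1 q2 q3 q4] ej.
 have cb := capB jn; have v : ar s2 aCAP j = cap0 j by rewrite q2 ec.
 apply: run_ite => //=; rewrite ?ej ?v ?q3; [by split=> //; lia| |] => h.
  apply: run_asg => //=; rewrite ?ej ?v; [by split=> //; lia|lia|].
  by split=> //=; [rewrite big_ord_recr /= ; apply/esym/maxn_idPr|lia].
 apply: run_asg => //=; split=> //=; last by lia.
 by rewrite big_ord_recr /= q3; apply/esym/maxn_idPl; exact: ltnW h.
by move=> s2 [q1 q2 q3 q4] _; split=> //=; lia.
Qed.

Lemma set5_ok s : run SET5 s (fun s' => [/\ rg s' 93 = pW, ps s' = (ps s).+1, ot s' = ot s & clk s' <= clk s + 10 + 10 * m]).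
Proof.
have WM : pW <= pM by pbt.
apply: run_sq; exists (rewi es s); first exact: XRew.
do 2 (apply: run_sq; apply: run_asg => //=).
 by have := nM; lia.
apply: (@run_whl _ _ _ (fun s2 => exists t, [/\ t <= m, rs s2 = drop t es /\ rg s2 93 = \max_(i < t) W_ i,
  ps s2 = (ps s).+1 /\ ot s2 = ot s, rg s2 72 = 1 \/ rg s2 72 = 0 /\ t = m & clk s2 + 4 * rg s2 72 <= clk s + 9 + 8 * t])
  (fun s2 => size (rs s2) + rg s2 72)).
 by exists 0; split=> //=; [rewrite drop0 big_ord0|left|lia].
move=> s2 [t [tm [q1 q2] [q3 q4] q5 q6]]; split=> //=.
 move=> h; have q5' : rg s2 72 = 1 by case: q5 => [//|[]]; lia.
 apply: run_sq; case: (ltnP t m) => ht.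
  move: (drop_nth (0, 0, 0) ht) => ed.
  case ew: (nth (0, 0, 0) es t) ed => [[wi wj] ww] ed.
  have eW : W_ t = ww by rewrite /W_ /PassTh.W_ ew.
  have wl := wtW ht.
  exists (nxt1 72 73 74 75 wi wj ww (drop t.+1 es) (tick s2)); first by apply: XNxt1; rewrite /= q1 ed.
  apply: run_ite => //= _; apply: run_ite => //=; rewrite ?q2 => hh.
   apply: run_asg => //=; first by rewrite -eW; lia.
   split=> /=; last by rewrite q1 !size_drop; lia.
   exists t.+1; split=> //=; [split=> //|by left|by lia].
   by rewrite big_ord_recr /= eW; apply/esym/maxn_idPr.
  apply: run_asg => //=; split=> /=; last by rewrite q1 !size_drop; lia.
  exists t.+1; split=> //=; [split=> //|by left|by lia].
  by rewrite big_ord_recr /= eW q2; apply/esym/maxn_idPl; exact: ltnW hh.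
 have et : t = m by lia.
 eexists; first by apply: XNxt0; rewrite /= q1 drop_oversize //; lia.
 apply: run_ite => //= _; apply: run_asg => //=; split=> /=; last by lia.
 by exists t; split=> //=; [right|lia].
by move=> h; case: q5 => [|[q5 et]]; [lia|split=> //=; [rewrite q2 et|lia]].
Qed.

Lemma set6_ok s : rg s 1 = n -> rg s 93 = pW -> rg s 89 = pB -> rg s 2 = pE ->
 run SET6 s (fun s' => [/\ rg s' 94 = pG, rg s' 95 = pL & clk s' <= clk s + 10 + 5 * pL]).
Proof.
move=> e1 e2 e3 e4; have GM : pG <= pM by pbt.
have G2M : pG * 2 <= pM by pbt.
have LM : pL + 1 <= pM by pbt.
apply: run_sq; apply: run_asg => //=; rewrite ?e1 ?e2 ?e3 ?e4; first exact: GM.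
do 2 (apply: run_sq; apply: run_asg => //=).
 by have := nM; lia.
apply: (@run_whl _ _ _ (fun s2 => exists l, [/\ rg s2 94 = pG, rg s2 95 = l, rg s2 96 = 2 ^ l, l = 0 \/ 2 ^ l.-1 <= pG & clk s2 <= clk s + 4 + 4 * l])
  (fun s2 => pG.*2.+1 - rg s2 96)).
 by exists 0; split=> //=; [left|lia].
move=> s2 [l [q1 q2 q3 q4 q5]]; split=> //=; rewrite q1 q3 => h.
 have lL : l < pL by rewrite /pL ltnS; apply: trunc_log_max.
 apply: run_sq; apply: run_asg => //=; rewrite ?q3; first by lia.
 apply: run_asg => //=; rewrite ?q2; first by lia.
 split=> /=; last by have : 0 < 2 ^ l by [rewrite expn_gt0]; lia.
 by exists l.+1; split=> //=; [lia|rewrite expnSr|right|lia].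
have el : l = pL.
 case: q4 => [l0|h2]; first by move: h; rewrite l0 expn0; have := G100; lia.
 case: l h h2 {q2 q3 q5} => [|l] h h2; first by move: h; rewrite expn0; have := G100; lia.
 by rewrite /pL; congr _.+1; apply/esym/trunc_log_eq => //=; rewrite h2.
by subst l; split=> //; lia.
Qed.

Lemma set7_ok s : rg s 2 = pE -> rg s 95 = pL -> rg s 94 = pG ->
 run SET7 s (fun s' => [/\ [/\ rg s' 3 = pN, rg s' 4 = pQ & rg s' 5 = pD],
  [/\ rg s' 6 = pF, rg s' 7 = pFy, rg s' 8 = pY0, rg s' 10 = pRM & rg s' 12 = 0] & clk s' <= clk s + 8]).
Proof.
move=> e1 e2 e3.
have x1 : pN <= pM by pbt. have x2 : pQ <= pM by pbt. have x3 : pD <= pM by pbt.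
have x4 : pF <= pM by pbt. have x5 : pRM <= pM by pbt. have x6 : pY0 <= pM by pbt. have x7 : pFy <= pM by pbt.
apply: run_sq; apply: run_asg => //=; rewrite ?e1 ?e2; first exact: x1.
apply: run_sq; apply: run_asg => //=; rewrite ?e1; first exact: x2.
apply: run_sq; apply: run_asg => //=; rewrite ?e1; first exact: x3.
apply: run_sq; apply: run_asg; [exact: ok_pow|by rewrite ev_pow /= e3; exact: x4|rewrite ev_pow /= e3 -/pF].
apply: run_sq; apply: run_asg => //=; rewrite ?e3; first exact: x5.
apply: run_sq; apply: run_asg => //=; rewrite ?e3; first exact: x6.
apply: run_sq; apply: run_asg => //=; try exact: x7.
by apply: run_asg => //=; split=> //=; lia.
Qed.

Lemma setup_ok s0 : ar s0 = ar0 ->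
 run SETUP s0 (fun s => [/\ cfg n pE pQ pD pN pF pFy pY0 pRM (ar s aCAP) s, (forall i, i < n -> ar s aCAP i = cap0 i) /\ ar s aCAP n = 0,
  rg s vcnt = 0 /\ forall x, x < n -> ar s aX x = 1, ps s = (ps s0).+1 /\ ot s = ot s0 &
  clk s <= clk s0 + 100 + 50 * n + 10 * m + 5 * pL]).
Proof.
move=> e0.
apply: run_sq; apply: (run_call (set1_ok e0)) => s1 [n1 E1 k1] f1.
have a_1 : ar s1 = ar0.
 rewrite -e0; apply: functional_extensionality_dep => k; exact: (fr_a f1).
apply: run_sq; apply: (run_call (set2_ok a_1 n1)) => s2 [c2 k2] f2.
have n2 : rg s2 1 = n by rewrite (fr_r f2).
apply: run_sq; apply: (run_call (set3_ok n2 c2)) => s3 [c3 z3 x3 k3] f3.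
have n3 : rg s3 1 = n by rewrite (fr_r f3).
apply: run_sq; apply: (run_call (set4_ok n3 c3)) => s4 [B4 k4] f4.
apply: run_sq; apply: (run_call (set5_ok s4)) => s5 [W5 p5 o5 k5] f5.
have n5 : rg s5 1 = n by rewrite (fr_r f5) // (fr_r f4).
have E5 : rg s5 2 = pE by rewrite (fr_r f5) // (fr_r f4) // (fr_r f3) // (fr_r f2).
have B5 : rg s5 89 = pB by rewrite (fr_r f5).
apply: run_sq; apply: (run_call (set6_ok n5 W5 B5 E5)) => s6 [G6 L6 k6] f6.
have E6 : rg s6 2 = pE by rewrite (fr_r f6).
apply: (run_call (set7_ok E6 L6 G6)) => s7 [[N7 Q7 D7] [F7 Fy7 Y7 R7 c7] k7] f7.
have a7 k : ar s7 k = ar s3 k by rewrite (fr_a f7) // (fr_a f6) // (fr_a f5) // (fr_a f4).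
have [_ p1 o1] := fr_s f1 isT; have [_ p2 o2] := fr_s f2 isT; have [_ p3 o3] := fr_s f3 isT.
have [_ p4 o4] := fr_s f4 isT; have [_ p6 o6] := fr_s f6 isT; have [_ p7 o7] := fr_s f7 isT.
split.
- split=> //; first by rewrite (fr_r f7) // (fr_r f6).
 + by rewrite (fr_r f7).
 + by move=> x xn; rewrite a7; case: (x3 x xn).
 + by move=> x xn; rewrite a7; case: (x3 x (ltnW xn)).
- by rewrite a7.
- by split=> // x xn; rewrite a7; case: (x3 x (ltnW xn)).
- by split; congruence.
- by lia.
Qed.

Lemma LmG : pLm <= pG ^ 15. Proof. by pbt. Qed.
Lemma pFyE : pFy = pG ^ 60. Proof. by rewrite /pFy /pF -!expnD. Qed.
Lemma meE_ok k : k < pLm -> k * pY0 * pE <= pFy.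
Proof.
move=> h; rewrite pFyE; apply: leq_trans (_ : pG ^ 15 * pY0 * pE <= _); last by pbt.
by rewrite leq_mul2r leq_mul2r (leq_trans (ltnW h) LmG) !orbT.
Qed.
Lemma NE2 : 2 * pE <= pN.
Proof.
have E1 := E100; have := L0; rewrite /pN -[100 * pE * pE * pL]mulnA mulnAC => l0.
by rewrite leq_mul2r; apply/orP; right; apply: leq_trans (_ : 100 * 1 <= _) => //; rewrite leq_mul2l muln_gt0; apply/orP; right; lia.
Qed.
Lemma meS_ok k : k < pLm -> 2 * pE * k * pRM * pY0 <= pN * pFy.
Proof.
move=> h; rewrite -[2 * pE * k * pRM * pY0]mulnA -[2 * pE * k * _]mulnA; apply: leq_mul; first exact: NE2.
rewrite pFyE; apply: leq_trans (_ : pG ^ 15 * (pRM * pY0) <= _); last by pbt.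
by rewrite leq_mul2r (leq_trans (ltnW h) LmG) orbT.
Qed.
Lemma RMW_ok : 0 < pRM /\ pW * pF <= pRM.
Proof.
have g := G100; split; first by rewrite /pRM /pF muln_gt0 expn_gt0; lia.
by rewrite /pRM mulnC leq_mul2l WG orbT.
Qed.
Lemma YE_ok : 2 * (pE * pE * pRM) <= pY0.
Proof.
have -> : pY0 = pG * (pG * pG * pRM) by rewrite /pY0; lia.
apply: leq_mul; first by have := G100; lia.
by rewrite leq_mul2r leq_mul ?orbT // EG.
Qed.
Lemma YFy_ok : pY0 <= pE * pFy.
Proof.
apply: leq_trans (_ : pFy <= _); first by rewrite pFyE; pbt.
by rewrite leq_pmull //; have := E100; lia.
Qed.

Lemma Lm_facts : [/\ 2 * (n * (2 * pN * (pE * pE))) < pLm, n.+1 * pD <= pLm, pQ * (pQ + 2) <= pLm, pQ + 3 <= pLm & (pQ + 2) * pD <= pLm].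
Proof.
have E1 := E100; have l0 := L0.
have [a ea] : exists a, a = pE * pE * (pE * pE) by eexists.
have [q eq_] : exists q, q = pE * pE * pE by eexists.
have [z ez] : exists z, z = a * pL by eexists.
have [w ew] : exists w, w = a * a * pL by eexists.
have e8 : pE ^ 8 = a * a by rewrite ea !expnS expn0; lia.
have eD : pD = 200 * z by rewrite /pD /pN ez ea; lia.
have eT : 2 * pN * (pE * pE) = 200 * z by rewrite -eD.
have eL : pLm = 1000 * ((n + 2) * w) by rewrite /pLm e8 ew; lia.
have eQ : pQ = q by rewrite eq_.
have g4 (e : nat) : 0 < e -> 0 < e * e * (e * e) by move=> h; rewrite !muln_gt0 h.
have g3 (e : nat) : 0 < e -> 0 < e * e * e by move=> h; rewrite !muln_gt0 h.
have ap : 0 < a by rewrite ea; apply: g4; lia.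
have q1 : 0 < q by rewrite eq_; apply: g3; lia.
have qa : q <= a by rewrite eq_ ea leq_mul // leq_pmulr //; lia.
have zw : z <= w by rewrite ez ew -mulnA leq_pmull.
have w1 : 0 < w by rewrite ew !muln_gt0 ap.
have qz : q * z <= w by rewrite ez ew mulnA leq_mul // leq_mul.
have qq : q * q <= w by apply: leq_trans (leq_mul qa qa) _; rewrite ew leq_pmulr.
have qw : q <= w by apply: leq_trans qq; rewrite leq_pmulr.
have nz : n * z <= n * w by rewrite leq_mul2l zw orbT.
rewrite eT eD eL eQ; clear -nz zw w1 qz qq qw.
by split; nia.
Qed.

(** G is below 2^pL and ln 2 is at most 1. *)
Lemma ln_pow (k x : nat) : 0 < x -> x <= pG ^ k -> (ln x%:R <= (k * pL)%:R :> R)%R.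
Proof.
move=> x0 xg; have g0 : 0 < pG by have := G100; lia.
have h1 : (ln x%:R <= ln (pG ^ k)%:R :> R)%R by rewrite ler_ln ?posrE ?ltr0n ?expn_gt0 ?g0 // ler_nat.
apply: (le_trans h1); rewrite natrX lnXn ?ltr0n // natrM -[(ln pG%:R *+ k)%R]mulr_natl.
apply: ler_wpM2l; first exact: ler0n.
have h2 : (ln pG%:R <= ln (2 ^ pL)%:R :> R)%R.
 by rewrite ler_ln ?posrE ?ltr0n ?expn_gt0 // ler_nat ltnW // pL_gt.
apply: (le_trans h2); rewrite natrX lnXn ?ltr0n // -[(ln 2%:R *+ pL)%R]mulr_natl.
rewrite -[X in (_ <= X)%R]mulr1; apply: ler_wpM2l; first exact: ler0n.
have := @ln_le_sub1 R 2%:R (ltr0n _ 2); lra.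
Qed.

Lemma NEE : (pN%:R * (pE%:R^-1 * pE%:R^-1) = (100 * pL)%:R :> R)%R.
Proof.
have E0 : (pE%:R != 0 :> R)%R by rewrite pnatr_eq0; have := E100; lia.
have -> : pN = pE * pE * (100 * pL) by rewrite /pN; lia.
by rewrite natrM natrM -invfM mulrC mulrA mulVf ?mul1r // mulf_neq0.
Qed.

Lemma lnX_ok : (ln (2 * (pW * pF) + 2)%:R <= pN%:R * (pE%:R^-1 * pE%:R^-1) :> R)%R.
Proof.
rewrite NEE; apply: (@le_trans _ _ (30 * pL)%:R%R); last by rewrite ler_nat leq_mul2r orbT.
by apply: ln_pow; [rewrite addn2|pbt].
Qed.

Lemma lnY_ok : (ln (pE%:R * pFy%:R) - ln pY0%:R <= pN%:R * (pE%:R^-1 * pE%:R^-1) :> R)%R.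
Proof.
have g0 : 0 < pG by have := G100; lia.
have l1 : (0 <= ln pY0%:R :> R)%R.
 rewrite ln_ge0 // ler1n; case: RMW_ok => R0 _; apply: leq_trans R0 _.
 have -> : pY0 = pRM * (pG * (pG * pG)) by rewrite /pY0 !mulnA.
 by apply: leq_pmulr; rewrite !muln_gt0 g0.
rewrite NEE -natrM; have h : (ln (pE * pFy)%:R <= (70 * pL)%:R :> R)%R.
 apply: ln_pow; last by pbt.
 by rewrite muln_gt0 pFyE expn_gt0 g0 andbT; have := E100; lia.
have : ((70 * pL)%:R <= (100 * pL)%:R :> R)%R by rewrite ler_nat leq_mul2r orbT.
lra.
Qed.

Hypothesis Il : forall t, t < m -> I_ t < n.
Hypothesis Jl : forall t, t < m -> J_ t < n.
Hypothesis IJ : forall t, t < m -> I_ t != J_ t.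
Hypothesis simple : forall t t', t < m -> t' < m -> inc I_ J_ (I_ t) t' -> inc I_ J_ (J_ t) t' -> t = t'.

Notation reach cap := (@reach R n m pE pN pF pFy pQ I_ J_ W_ cap).
Notation cfg := (cfg n pE pQ pD pN pF pFy pY0 pRM).

Lemma basics : [/\ 8 <= pE, 0 < pN, 0 < pFy & 0 < pQ].
Proof.
have e := E100; have g := G100; split; first by lia.
- by apply: leq_trans NE2; lia.
- by rewrite pFyE expn_gt0; lia.
- have g3 (x : nat) : 0 < x -> 0 < x * x * x by move=> h; rewrite !muln_gt0 h.
 by rewrite /pQ; apply: g3; lia.
Qed.

Definition pT := T1 n pE pN.
Definition pC := cPH n pE pQ pD pN.

Lemma size_T cap p c X U Hh : (forall i, i < n -> cap i <= pB) -> reach cap p c X U Hh -> p <= pN -> size (lst es U) <= pT /\ c <= pT.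
Proof.
move=> BmP r pN'; have [E8 N0 Fy0 Q0] := basics.
have h : c <= n * (2 * pN * (pE * pE)) by exact: (reach_cnt_le E8 N0 Fy0 Q0 Il Jl wtW lnX_ok r pN').
by split=> //; rewrite size_lst; apply: leq_trans (reach_listed r) _.
Qed.

Lemma phase_ok' cap s p c U Hh : cap n = 0 -> (forall i, i < n -> cap i <= pB) ->
 cfg cap s -> listed es s U Hh -> p < pN -> reach cap p c (ar s aX) U Hh ->
 run PHASE s (fun s' => exists c' U' Hh', [/\ cfg cap s', listed es s' U' Hh', reach cap p.+1 c' (ar s' aX) U' Hh',
  c <= c' /\ ps s' = (ps s).+1 /\ ot s' = ot s & clk s' <= clk s + 60 * m + pC + 5 * (c' - c)]).
Proof.
move=> capn BmP C0 L0' pN' r0; have [E8 N0 Fy0 Q0] := basics; have [f1 f2 f3 f4 f5] := Lm_facts.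
have nL : n < pLm by have := nLm; lia.
have lL : n * (2 * pN * (pE * pE)) < pLm by lia.
have mL p' c' X' U' Hh' : reach cap p' c' X' U' Hh' -> p' <= pN -> 2 * size (lst es U') < pLm.
 by move=> r' p'N; have [h _] := size_T BmP r' p'N; rewrite /pT /T1 in h; lia.
have meE' U' : size (lst es U') < pLm -> size (lst es U') * pY0 * pE <= pFy by exact: meE_ok.
have meS' U' : size (lst es U') < pLm -> 2 * pE * size (lst es U') * pRM * pY0 <= pN * pFy by exact: meS_ok.
have bIJ t : t < m -> I_ t <= pM /\ J_ t <= pM.
 by move=> tm; have := Il tm; have := Jl tm; have := nM; lia.
have W' := wtW; have x1 := lnX_ok; have x2 := lnY_ok; have x3 := LmM; have x4 := XM; have x5 := YM; have x6 := RMW_ok.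
have x7 := YE_ok; have x8 := DM; have x9 := cM; have x10 := RMM; have x11 := cFM; have x12 := NE_M; have x13 := HM.
have x14 := UM; have x15 := bM; have x16 := mM; have x17 := XM2; have x18 := YFy_ok.
have eD : pD = 2 * pN * (pE * pE) by [].
by eapply phase_ok; eassumption.
Qed.

Definition outrec (U Hh : nat -> nat) t :=
 (I_ t, J_ t, (U t * pN * pFy + Hh t * pE) * pE, pE * pN * pFy * pN * (pE + 20)).

Lemma main_ok s0 : ar s0 = ar0 -> ps s0 = 0 -> ot s0 = [::] -> clk s0 = 0 ->
 run MAIN s0 (fun s => exists cap c X U Hh, [/\ reach cap pN c X U Hh, forall i, i < n -> cap i = cap0 i,
  ps s = pN.+1, ot s = [seq outrec U Hh t | t <- lst es U] &
  clk s <= 200 + 50 * n + 10 * m + 5 * pL + pN * (60 * m + pC + 3) + 15 * pT]).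
Proof.
move=> ea ep eo ek; have [E8 N0 Fy0 Q0] := basics.
apply: run_sq; apply: (run_call (setup_ok ea)) => s1 [C1 [c1 cn1] [v1 x1] [p1 o1] k1] f1.
set cap := ar s1 aCAP in C1 c1 cn1.
have BmP i : i < n -> cap i <= pB by move=> il; rewrite c1 // capB.
have NM : pN <= pM by pbt.
have r1 : reach cap 0 0 (ar s1 aX) (fun=> 0) (fun=> 0) by apply: rch0.
have l1 : lst es (fun=> 0) = [::].
 by rewrite /lst /lstp; elim: (iota 0 m).
have L1 : listed es s1 (fun=> 0) (fun=> 0) by split; rewrite l1.
apply: run_sq.
pose P2 s2 := exists c U Hh, [/\ cfg cap s2, listed es s2 U Hh, reach cap pN c (ar s2 aX) U Hh,
 ps s2 = pN.+1 /\ ot s2 = [::] & clk s2 <= clk s1 + 3 + pN * (60 * m + pC + 3) + 5 * c].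
have h2 : run (FOR rp TO vN DO PHASE) s1 P2.
 apply: (@run_for _ _ _ (fun j s2 => exists c U Hh, [/\ cfg cap s2, listed es s2 U Hh, reach cap j c (ar s2 aX) U Hh,
  ps s2 = j.+1 /\ ot s2 = [::] & clk s2 <= clk s1 + 2 + j * (60 * m + pC + 3) + 5 * c]) pN) => //.
 - by move=> j s2 [c [U [Hh [C2 _ _ _ _]]]] _; split=> //=; exact: (f_N C2).
 - exists 0, (fun=> 0), (fun=> 0); split=> //=; [exact: cfg_setr|exact: (listed_eq L1)|by rewrite p1 ep o1 eo|by lia].
 - move=> j s2 jN [c [U [Hh [C2 L2 r2 [p2 o2] k2]]]] ej.
  have Ct := cfg_tick C2; have Lt : listed es (tick s2) U Hh by exact: (listed_eq L2).
  apply: (run_call (phase_ok' cn1 BmP Ct Lt jN r2)) => s3 [c' [U' [Hh' [C3 L3 r3 [cc [p3 o3]] k3]]]] _.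
  exists c', U', Hh'; split=> //=; [exact: cfg_setr|exact: (listed_eq L3)|by rewrite p3 o3 /= p2|].
  by rewrite mulSn; rewrite /= in k3; move: (j * _) k2 k3; lia.
 move=> s2 [c [U [Hh [C2 L2 r2 [p2 o2] k2]]]] _; exists c, U, Hh; split=> //=; [exact: cfg_tick|exact: (listed_eq L2)|].
 by move: (pN * _) k2; lia.
apply: (run_call h2) => s2 [c [U [Hh [C2 L2 r2 [p2 o2] k2]]]] _.
have [sT cT] := size_T BmP r2 (leqnn _).
have sL : size (lst es U) < pLm by have [f1' _ _ _ _] := Lm_facts; rewrite /pT /T1 in sT; lia.
have sM : size (lst es U) <= pM by have := LmM; lia.
have dM : pE * pN * pFy * pN * (pE + 20) <= pM by pbt.
apply: run_sq; apply: run_asg => //=; rewrite ?(f_E C2) ?(f_N C2) ?(f_Fy C2); first exact: dM.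
apply: (@run_for _ _ _ (fun j s3 => [/\ cfg cap s3, listed es s3 U Hh, rg s3 96 = pE * pN * pFy * pN * (pE + 20),
  ps s3 = pN.+1 /\ ot s3 = [seq outrec U Hh t | t <- take j (lst es U)] & clk s3 <= clk s2 + 2 + 6 * j]) (size (lst es U))) => //.
- by move=> j s3 [_ L3 _ _ _] _; split=> //=; exact: (l_c L3).
- split=> //=; [by apply: cfg_setr => //; apply: cfg_setr|exact: (listed_eq L2)|by rewrite take0|by lia].
- move=> j s3 jl [C3 L3 d3 [p3 o3] k3] ej.
 have [tm u0] := mem_lst jl; set t := nth 0 (lst es U) j in tm u0.
 have il := Il tm; have jl' := Jl tm; have nm := nM.
 have uM : U t <= pE * (2 * pN) * pB by exact: (reach_U E8 N0 Fy0 Q0 Il wtW BmP lnX_ok r2 (leqnn _) tm).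
 have hM : Hh t <= pN * (pN * (pB * pFy)) by have [h _] := reach_Hh Il BmP r2; exact: h.
 have vM : (U t * pN * pFy + Hh t * pE) * pE <= pM.
  apply: leq_trans (_ : (pE * (2 * pN) * pB * pN * pFy + pN * (pN * (pB * pFy)) * pE) * pE <= _); last by pbt.
  by rewrite leq_mul2r leq_add ?orbT // ?leq_mul2r ?uM ?hM ?orbT.
 apply: run_sq; apply: run_asg => //=; rewrite ?ej ?(l_I L3) // -?/t; [by split=> //; lia|lia|].
 apply: run_sq; apply: run_asg => //=; rewrite ?ej ?(l_J L3) // -?/t; [by split=> //; lia|lia|].
 apply: run_sq; apply: run_asg => //=; rewrite ?ej ?(l_U L3) ?(l_H L3) // ?(f_E C3) ?(f_N C3) ?(f_Fy C3) -?/t; [by do !split=> //; lia|exact: vM|].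
 eexists; first exact: XEmt.
 split=> //=.
 + apply: cfg_setr => //.
  suff ce : cfg cap (setr 97 ((U t * pN * pFy + Hh t * pE) * pE) (setr 74 (J_ t) (setr 73 (I_ t) (tick s3)))) by case: ce => *; split.
  by do 3 (apply: cfg_setr => //); exact: cfg_tick.
 + by apply: (listed_eq L3).
 + by rewrite o3 d3 (take_nth 0 jl) map_rcons.
 + by lia.
move=> s3 [C3 L3 d3 [p3 o3] k3] _; exists cap, c, (ar s2 aX), U, Hh; split=> //=.
 by rewrite o3 take_size.
by move: (pN * (60 * m + pC + 3)) k2; lia.
Qed.

(** The rounding errors in [reach_phi], multiplied by E^2, form a polynomial in G of degree below
    20, so F absorbs them. *)
Lemma errF_ok : pE * pE * (n * pB + n * (2 * pN * (pE * pE)) * (2 * pB) + pN * (2 * (n * pB) + 1)) <= pN * pF.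
Proof.
have [_ N0 _ _] := basics; apply: leq_trans (_ : pF <= _); last by rewrite leq_pmull.
by pbt.
Qed.

Lemma unlisted_H0 cap p c X U Hh t : reach cap p c X U Hh -> t < m -> U t = 0 -> Hh t = 0.
Proof.
move=> r tm; have [E8 N0 Fy0 Q0] := basics; have [f1 _ _ _ _] := Lm_facts.
have nL : n < pLm by have := nLm; lia.
have lL : n * (2 * pN * (pE * pE)) < pLm by lia.
have LM : pLm <= pM by have := LmM; lia.
exact: (reach_H0 E8 N0 Fy0 Q0 lnX_ok nL lL LM mM XM UM bM r tm).
Qed.

End Setup.

End MainTh.

(** * Feasibility and value of the scaled output *)

Module RoundingTh.
Import Defs WeightsTh OuterTh.
Import Order.TTheory GRing.Theory Num.Theory.
Local Open Scope ring_scope.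

Section Rounding.
Variables (R : realType) (n m E N F Fy Q Wm Bm : nat) (I J W b : nat -> nat).
Notation reach := (@reach R n m E N F Fy Q I J W b).
Notation feas := (@feas R n m I J b).
Notation sm := (sm E I J b).
Notation inc := (inc I J).
Hypothesis E100 : (100 <= E)%N.
Hypothesis NE : (E * E <= N)%N.
Hypothesis Fy0 : (0 < Fy)%N.
Hypothesis QE : Q = (E * E * E)%N.
Hypothesis Il : forall t, (t < m)%N -> (I t < n)%N.
Hypothesis Jl : forall t, (t < m)%N -> (J t < n)%N.
Hypothesis IJ : forall t, (t < m)%N -> I t != J t.
Hypothesis simple : forall t t', (t < m)%N -> (t' < m)%N -> inc (I t) t' -> inc (J t) t' -> t = t'.
Hypothesis WmP : forall t, (t < m)%N -> (W t <= Wm)%N.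
Hypothesis BmP : forall i, (i < n)%N -> (b i <= Bm)%N.
Hypothesis lnX : ln (2 * (Wm * F) + 2)%:R <= N%:R * (E%:R^-1 * E%:R^-1) :> R.
Hypothesis F0 : (0 < F)%N.
Hypothesis errF : (E * E * (n * Bm + n * (2 * N * (E * E)) * (2 * Bm) + N * (2 * (n * Bm) + 1)) <= N * F)%N.

Lemma rE8 : (8 <= E)%N. Proof. by apply: leq_trans E100. Qed.
Lemma rN0 : (0 < N)%N. Proof. by apply: leq_trans NE; rewrite muln_gt0; lia. Qed.
Lemma rQ0 : (0 < Q)%N. Proof. by rewrite QE !muln_gt0; lia. Qed.

Variables (c : nat) (X U Hh : nat -> nat).
Hypothesis r : reach N c X U Hh.

Definition raw (t : nat) : R := (U t)%:R / E%:R + (Hh t)%:R / (N%:R * Fy%:R).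
(** 1/(N (1 + 20 eps)). The loads respect the vertex capacities up to N (1 + 5 eps), so a relative
    slack of about 15 eps is left for the odd sets. *)
Definition scale : R := E%:R / (N%:R * (E%:R + 20)).
Definition yout t := raw t * scale.

Lemma rER : @Order.le ring_display R 100 E%:R. Proof. by rewrite ler_nat. Qed.
Lemma rNR : @Order.lt ring_display R 0 N%:R. Proof. by rewrite ltr0n; exact: rN0. Qed.
Lemma rNER : @Order.le ring_display R (E%:R * E%:R) N%:R. Proof. by rewrite -natrM ler_nat. Qed.

Lemma raw0 t : 0 <= raw t.
Proof.
have E8 := rE8; have N0 := rN0; have Q0 := rQ0; have ER := rER; have NR := rNR; have NER := rNER.
by rewrite addr_ge0 // divr_ge0 ?mulr_ge0 ?ler0n. Qed.
Lemma scale0 : 0 < scale.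
Proof.
have E8 := rE8; have N0 := rN0; have Q0 := rQ0; have ER := rER; have NR := rNR; have NER := rNER.
by rewrite divr_gt0 // ?mulr_gt0 //; lra. Qed.
Lemma yout0 t : 0 <= yout t.
Proof.
have E8 := rE8; have N0 := rN0; have Q0 := rQ0; have ER := rER; have NR := rNR; have NER := rNER.
by rewrite mulr_ge0 ?raw0 // ltW // scale0. Qed.

Lemma yout_star i : (i < n)%N ->
 \sum_(t < m | inc i t) yout t <= (b i)%:R * ((E%:R + 5) / (E%:R + 20)).
Proof.
have E8 := rE8; have N0 := rN0; have Q0 := rQ0; have ER := rER; have NR := rNR; have NER := rNER.
move=> il; rewrite /yout -mulr_suml.
have h : \sum_(t < m | inc i t) raw t <= (b i)%:R * (N%:R * (1 + 5 * E%:R^-1)).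
 exact: (reach_load E8 N0 Fy0 Q0 WmP lnX r (leqnn _) il).
apply: le_trans (_ : (b i)%:R * (N%:R * (1 + 5 * E%:R^-1)) * scale <= _).
 by rewrite ler_wpM2r // ltW // scale0.
have E0 : E%:R != 0 :> R by apply/eqP; lra.
have E20 : E%:R + 20 != 0 :> R by apply/eqP; lra.
have N1 : N%:R != 0 :> R by rewrite gt_eqF.
rewrite -mulrA ler_wpM2l ?ler0n //.
suff -> : N%:R * (1 + 5 * E%:R^-1) * scale = (E%:R + 5) / (E%:R + 20) by [].
by rewrite /scale; field; rewrite E0 E20 N1.
Qed.

Lemma yout_zero t : (t < m)%N -> (b (I t) = 0)%N \/ (b (J t) = 0)%N -> yout t = 0.
Proof.
have E8 := rE8; have N0 := rN0; have Q0 := rQ0; have ER := rER; have NR := rNR; have NER := rNER.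
move=> tm h; have [i il [hi bi]] : exists2 i, (i < n)%N & inc i t /\ b i = 0%N.
 by case: h => h; [exists (I t)|exists (J t)]; rewrite ?Il ?Jl // /OuterTh.inc eqxx ?orbT.
have := yout_star il; rewrite bi mul0r (bigD1 (Ordinal tm)) //= => hs.
apply/eqP; rewrite eq_le yout0 andbT; apply: le_trans hs.
by rewrite lerDl sumr_ge0 // => t' _; exact: yout0.
Qed.

Section OddSet.
Variable A : pred nat.
Notation beta := (\sum_(i < n | A i) b i)%N.
Hypothesis oA : odd beta.
Notation inA t := (A (I t) && A (J t)).
Let h := (beta./2)%N.
Lemma betaE_ : beta = (2 * h + 1)%N.
Proof.
have E8 := rE8; have N0 := rN0; have Q0 := rQ0; have ER := rER; have NR := rNR; have NER := rNER.
by have := odd_double_half beta; rewrite oA -/h; lia. Qed.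

Lemma yout_double : 2 * \sum_(t < m | inA t) yout t <= beta%:R * ((E%:R + 5) / (E%:R + 20)).
Proof.
have E8 := rE8; have N0 := rN0; have Q0 := rQ0; have ER := rER; have NR := rNR; have NER := rNER.
have betaE := betaE_.
have e : \sum_(i < n) (A i)%:R * \sum_(t < m | inc i t) yout t = \sum_(t < m) yout t * ((A (I t))%:R + (A (J t))%:R) :> R.
 exact: (sum_inc Il Jl IJ yout (fun i => (A i)%:R)).
apply: (@le_trans _ _ (\sum_(t < m) yout t * ((A (I t))%:R + (A (J t))%:R))).
 rewrite mulr_sumr big_mkcond /=; apply: ler_sum => t _; have y0 := yout0 t.
 case: (A (I t)); case: (A (J t)) => /=; lra.
rewrite -e natr_sum mulr_suml [X in _ <= X]big_mkcond /=; apply: ler_sum => i _.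
by case: (A i); rewrite ?mul1r ?mul0r //; exact: yout_star.
Qed.

(** Different edges give different ordered pairs of ends, and both capacities are at least 1. So the
    count is at most the sum of b_i b_j over ordered pairs of distinct vertices of A, hence at most
    beta (beta - 1) = 2 beta h. *)
Lemma small_count : (forall i, (i < n)%N -> A i -> (b i <= E)%N) ->
 (\sum_(t < m | [&& A (I t), A (J t) & sm t]) 1 <= 2 * (beta * h))%N.
Proof.
have E8 := rE8; have N0 := rN0; have Q0 := rQ0; have ER := rER; have NR := rNR; have NER := rNER.
have betaE := betaE_.
move=> _; pose f (t : 'I_m) := (Ordinal (Il (ltn_ord t)), Ordinal (Jl (ltn_ord t))).
pose S := [set t : 'I_m | [&& A (I t), A (J t) & sm t]].
have fi : {in S &, injective f}.
 move=> t t' _ _ [e1 e2]; apply: val_inj; apply: simple; rewrite ?ltn_ord //= /OuterTh.inc ?e1 ?e2 eqxx ?orbT //.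
pose P (p : 'I_n * 'I_n) := A p.1 && (A p.2 && (p.2 != p.1)).
apply: (@leq_trans (\sum_(p | P p) b p.1 * b p.2)).
 apply: (@leq_trans (\sum_(t in S) b (f t).1 * b (f t).2)).
  rewrite [X in (X <= _)%N](eq_bigl (fun t => t \in S)); last by move=> t; rewrite inE.
  apply: leq_sum => t; rewrite inE => /and3P[_ _ /andP[/andP[b1 _] /andP[b2 _]]] /=.
  by rewrite muln_gt0 b1 b2.
 rewrite -(big_imset (fun p : 'I_n * 'I_n => b p.1 * b p.2)%N fi) /=.
 rewrite [X in (X <= _)%N]big_mkcond [X in (_ <= X)%N]big_mkcond /=; apply: leq_sum => p _.
 case: ifP => [/imsetP[t tS ->]|_]; last by [].
 have -> // : P (f t).
 by move: tS; rewrite inE /P /= => /and3P[-> -> _] /=; rewrite -val_eqE /= eq_sym IJ.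
rewrite /P -(pair_big_dep (fun i : 'I_n => A i) (fun i j : 'I_n => A j && (j != i)) (fun i j => b i * b j)%N) /=.
apply: (@leq_trans (\sum_(i < n | A i) b i * (beta - 1))).
 apply: leq_sum => i Ai; rewrite -big_distrr /=; case: (posnP (b i)) => [->|bi]; first by rewrite !mul0n.
 rewrite leq_mul2l; apply/orP; right.
 have e : (beta = b i + \sum_(j < n | A j && (j != i)) b j)%N by rewrite (bigD1 i).
 by rewrite e -addnBAC // leq_addl.
by rewrite -big_distrl /= betaE; lia.
Qed.

(** The case distinction 15 beta >= E + 20 says precisely that beta (E+5)/(E+20) <= beta - 1, and
    then the vertex constraints imply the odd set constraint. Otherwise all capacities in A are at
    most E, every loaded inner edge is small, its touch load is at most 1/E, and the inner loads
    obey the relaxed odd set bounds; the factor 1 + 20/E pays for the relaxations and the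
    touches. *)
Lemma yout_odd : \sum_(t < m | inA t) yout t <= h%:R.
Proof.
have E8 := rE8; have N0 := rN0; have Q0 := rQ0; have ER := rER; have NR := rNR; have NER := rNER.
have betaE := betaE_.
have E20 : (0 : R) < E%:R + 20 by lra.
have bR : beta%:R = 2 * h%:R + 1 :> R by rewrite betaE natrD natrM.
have h0 : (0 : R) <= h%:R by exact: ler0n.
case: (leqP (E + 20) (15 * beta)) => hb.
 have hb' : E%:R + 20 <= 15 * (2 * h%:R + 1) :> R by rewrite -bR -natrM -[20]/(20%:R) -natrD ler_nat.
 have d := yout_double; rewrite bR mulrA in d.
 have : (2 * h%:R + 1) * (E%:R + 5) / (E%:R + 20) <= 2 * h%:R :> R.
  by rewrite ler_pdivrMr //; nra.
 lra.
have bE i : (i < n)%N -> A i -> (b i <= E)%N.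
 move=> il Ai; have : (b i <= beta)%N by rewrite (bigD1 (Ordinal il)) //= leq_addr.
 by lia.
have cnt := small_count bE; set ct := (\sum_(t < m | _) 1)%N in cnt.
have [_ hH] := reach_Hh Il BmP r; have := hH A oA; rewrite -/h -/ct => hHA.
pose su := (\sum_(t < m | inA t) Hh t)%N.
have yE : \sum_(t < m | inA t) yout t <= (ct%:R / E%:R + su%:R / (N%:R * Fy%:R)) * scale.
 rewrite /yout -mulr_suml; apply: ler_wpM2r; first exact: ltW scale0.
 rewrite /raw big_split /= -!mulr_suml; apply: lerD; last by rewrite /su natr_sum.
 rewrite ler_wpM2r ?invr_ge0 ?ler0n // -natr_sum ler_nat /ct [X in (X <= _)%N]big_mkcond [X in (_ <= X)%N]big_mkcond /=.
 apply: leq_sum => t _; have tm := ltn_ord t.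
 case AI: (A (I t)); case AJ: (A (J t)) => //=; case st: (sm t); first exact: (reach_small r tm st).
 have z : yout t = 0.
  apply: yout_zero => //; have := bE _ (Il tm) AI; have := bE _ (Jl tm) AJ.
  case: (posnP (b (I t))) => [->|b1]; first by left.
  case: (posnP (b (J t))) => [->|b2]; first by right.
  by move=> q1 q2; move: st; rewrite /OuterTh.sm b1 b2 q1 q2.
 move/eqP: z; rewrite /yout mulf_eq0 (gt_eqF scale0) orbF /raw paddr_eq0 ?divr_ge0 ?mulr_ge0 ?ler0n // => /andP[z _].
 by move: z; rewrite mulf_eq0 invr_eq0 !pnatr_eq0; case/orP => /eqP e1; lia.
apply: (le_trans yE).
(* From 15 beta < E + 20 and E >= 100 follows 12 beta <= E, so the touches inside A amount to at
   most h/6 before scaling. *)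
have ct6 : (6 * ct <= E * h)%N.
 have : (12 * (beta * h) <= E * h)%N by rewrite mulnA leq_mul2r; apply/orP; right; lia.
 by move: (beta * h)%N cnt => bh; lia.
have ct6R : 6 * ct%:R <= E%:R * h%:R :> R by rewrite -!natrM ler_nat.
have FyR : (0 : R) < Fy%:R by rewrite ltr0n.
pose v : R := su%:R / (N%:R * Fy%:R); pose w : R := N%:R * h%:R.
have E0 : (0 : R) < E%:R by lra.
have Qv : E%:R ^+ 3 * v <= w * E%:R ^+ 3 + w + N%:R * ct%:R.
 rewrite /v mulrA ler_pdivrMr ?mulr_gt0 //.
 have : (Q * su)%:R <= (N * (N * (Fy * ((Q + 1) * h + ct))))%:R :> R by rewrite ler_nat.
 rewrite QE !(natrM, natrD) /w => hq.
 have -> : E%:R ^+ 3 * su%:R = E%:R * E%:R * E%:R * su%:R :> R by rewrite !exprS expr0; ring.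
 apply: (le_trans hq); apply: (@le_trans _ _ (N%:R * (N%:R * (Fy%:R * ((E%:R * E%:R * E%:R + 1) * h%:R + ct%:R))))); first by [].
 by rewrite !exprS expr0; lra.
have w0 : 0 <= w by rewrite mulr_ge0 ?ler0n.
have NctR : N%:R * (6 * ct%:R) <= N%:R * (E%:R * h%:R) :> R by rewrite ler_wpM2l // ltW.
have Nct : 6 * (N%:R * ct%:R) <= w * E%:R by rewrite /w; lra.
(* Dividing by Q = E^3: the relaxation 1/Q and the rounding units together leave a relative excess
   of at most 1/E over w = N h. *)
have vE : v * E%:R <= w * E%:R + w.
 have E3 : (0 : R) < E%:R ^+ 3 by rewrite exprn_gt0.
 rewrite -(ler_pM2l E3) mulrA.
 have q1 := ler_wpM2r (ltW E0) Qv; apply: (le_trans q1).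
 have EE : E%:R * E%:R <= E%:R ^+ 3 :> R by rewrite !exprS expr0 mulr1 mulrA ler_peMr ?mulr_ge0 //; lra.
 have q2 := ler_wpM2l w0 EE; have q3 : w * E%:R <= w * (E%:R * E%:R) by rewrite ler_wpM2l // ler_peMr //; lra.
 have q4 : 6 * (N%:R * ct%:R * E%:R) <= w * E%:R * E%:R by rewrite mulrA ler_wpM2r // ltW.
 have q5 : 2 * (w * (E%:R * E%:R)) <= w * E%:R ^+ 3.
  have -> : w * E%:R ^+ 3 = E%:R * (w * (E%:R * E%:R)) by rewrite !exprS expr0; ring.
  by apply: ler_wpM2r; [rewrite !mulr_ge0 // ltW|lra].
 lra.
rewrite -/v /scale mulrA ler_pdivrMr ?mulr_gt0 // mulrDl.
have -> : ct%:R / E%:R * E%:R = ct%:R :> R by rewrite mulfVK // gt_eqF.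
have hw : E%:R * h%:R <= w.
 rewrite /w; apply: ler_wpM2r => //; apply: le_trans NER; rewrite ler_peMr ?ltW //; lra.
have -> : h%:R * (N%:R * (E%:R + 20)) = w * E%:R + 20 * w by rewrite /w; ring.
lra.
Qed.

End OddSet.

Lemma yout_feas : feas yout.
Proof.
have E8 := rE8; have N0 := rN0; have Q0 := rQ0; have ER := rER; have NR := rNR; have NER := rNER.
split=> [t _|i il|A oA]; [exact: yout0| |exact: yout_odd].
apply: le_trans (yout_star il) _; rewrite -[X in _ <= X]mulr1 ler_wpM2l ?ler0n //.
by rewrite ler_pdivrMr; lra.
Qed.

(** 29 = 8 + 1 + 20. The 8 is the loss in [reach_phi]; the 1 is the rounding error, which is turned
    into a relative error by the hypothesis that the competitor has value at least 1; the 20 is the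
    scaling. *)
Lemma yout_val (hs : nat -> R) : feas hs -> 1 <= \sum_(t < m) (W t)%:R * hs t ->
 (1 - 29 / E%:R) * (\sum_(t < m) (W t)%:R * hs t) <= \sum_(t < m) (W t)%:R * yout t.
Proof.
have E8 := rE8; have N0 := rN0; have Q0 := rQ0; have ER := rER; have NR := rNR; have NER := rNER.
move=> fs v1; set vs := \sum_(t < m) (W t)%:R * hs t in v1 *.
have ph := reach_phi E8 N0 Fy0 Q0 Il Jl IJ BmP lnX fs r.
have P0 : 0 <= Phi R n b X by rewrite sumr_ge0 // => i _; rewrite mulr_ge0 ?ler0n.
have S0 : SB R n b <= (n * Bm)%:R.
 rewrite /SB -[n in X in _ <= X]card_ord natrM mulr_natl -sumr_const; apply: ler_sum => i _.
 by rewrite ler_nat BmP.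
have cT : c%:R <= (n * (2 * N * (E * E)))%:R :> R.
 by rewrite ler_nat; exact: (reach_cnt_le E8 N0 Fy0 Q0 Il Jl WmP lnX r (leqnn _)).
pose V := \sum_(t < m) (W t)%:R * raw t.
have VE : Val R m E N F Fy W U Hh = F%:R * V.
 by rewrite /Val /V mulr_sumr; apply: eq_bigr => t _; rewrite natrM -/(raw t); ring.
have yV : \sum_(t < m) (W t)%:R * yout t = V * scale.
 by rewrite /V mulr_suml; apply: eq_bigr => t _; rewrite mulrA.
pose err : R := SB R n b + c%:R * (2 * Bm)%:R + N%:R * (2 * SB R n b + 1).
have err1 : E%:R * E%:R * err <= N%:R * F%:R.
 have := errF; rewrite -(ler_nat R) => ef; rewrite natrM [X in _ <= X]natrM in ef; apply: le_trans ef.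
 rewrite natrM ler_wpM2l ?mulr_ge0 ?ler0n // /err.
 rewrite (natrD _ (n * Bm + n * (2 * N * (E * E)) * (2 * Bm)) (N * (2 * (n * Bm) + 1))) (natrD _ (n * Bm) (n * (2 * N * (E * E)) * (2 * Bm))).
 apply: lerD; first apply: lerD => //.
  have -> : (n * (2 * N * (E * E)) * (2 * Bm))%:R = (n * (2 * N * (E * E)))%:R * (2 * Bm)%:R :> R by exact: natrM.
  by rewrite ler_wpM2r ?ler0n.
 rewrite (natrM _ N) ler_wpM2l ?ler0n // (natrD _ (2 * (n * Bm)) 1) (natrM _ 2 (n * Bm)); lra.
have E0 : (0 : R) < E%:R by lra.
have FR : (0 : R) < F%:R by rewrite ltr0n.
pose e : R := E%:R^-1.
have eE : e * E%:R = 1 by rewrite mulVf // gt_eqF.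
have e0 : 0 < e by rewrite invr_gt0.
have e1 : e <= 100^-1 by rewrite lef_pV2 // posrE.
have p1 : e * (N%:R * ((1 - 8 * e) * (F%:R * vs))) <= e * (F%:R * V) + err.
 have evs : OuterTh.vs m W hs = vs by [].
 by move: ph; rewrite VE evs -/e /err; lra.
have p2 : N%:R * (1 - 8 * e) * vs <= V + N%:R * e.
 have q1 := ler_wpM2l (ltW E0) p1; rewrite mulrDr !mulrA [E%:R * e]mulrC eE !mul1r in q1.
 have q2 : E%:R * err <= N%:R * F%:R * e.
  by rewrite -(ler_pM2l E0) mulrA [E%:R * (_ * e)]mulrCA [E%:R * e]mulrC eE mulr1.
 rewrite -(ler_pM2l FR); lra.
have sE : scale * N%:R * (1 + 20 * e) = 1.
 rewrite /scale /e; field; apply/and3P; split; try (by apply/eqP; lra); by rewrite gt_eqF.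
rewrite yV.
have sc := scale0; have sN : 0 < scale * N%:R by rewrite mulr_gt0.
have p3 : (scale * N%:R) * ((1 - 9 * e) * vs) <= V * scale.
 have q1 := ler_wpM2l (ltW sc) p2.
 have q2 : e <= e * vs by rewrite ler_peMr // ltW.
 have q3 := ler_wpM2l (ltW sN) q2.
 lra.
apply: le_trans p3; rewrite -/e.
have q : 1 - 20 * e <= scale * N%:R by nra.
rewrite mulrA ler_wpM2r //; first lra.
have q2 : (1 - 20 * e) * (1 - 9 * e) <= scale * N%:R * (1 - 9 * e) by rewrite ler_wpM2r //; lra.
nra.
Qed.

(** A touch requires potentials below W F. So loaded edges have positive weight, and clipping
    negative weights does not alter the value of the output. *)
Lemma reach_W p' c' X' U' Hh' t : reach p' c' X' U' Hh' -> (t < m)%N -> (0 < U' t)%N -> (0 < W t)%N.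
Proof.
move=> r' tm; elim: r' => {p' c' X' U' Hh'} [X1 U1 H1 _ u0 _|p c1 X1 U1 H1 t' X' U' r' IH tm' _ _ lt _ _ hU|//].
 by rewrite u0.
by rewrite hU // /touchU; case: eqP => [->|_ /IH //]; move: lt; case: (W t').
Qed.

End Rounding.

End RoundingTh.

(** * From stream positions to the linear program on vertex sets *)

Module TransferTh.
Import Defs MachineTh OuterTh PassTh.
Import Order.TTheory GRing.Theory Num.Theory.
Local Open Scope ring_scope.

Section Transfer.
Variables (R : realType) (n : nat) (G : bgraph n) (es : seq ('I_n * 'I_n * int)).
Hypothesis n0 : (0 < n)%N.
Hypothesis pr : presents G es.
Notation m := (size es).

Definition e0 : 'I_n * 'I_n * int := (Ordinal n0, Ordinal n0, 0).
Definition nes : seq (nat * nat * nat) :=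
 [seq (nat_of_ord t.1.1, nat_of_ord t.1.2, clip t.2) | t <- es].
Definition ed (t : nat) : {set 'I_n} := [set (nth e0 es t).1.1; (nth e0 es t).1.2].
Definition wz (t : nat) : int := (nth e0 es t).2.
Notation I_ := (I_ nes). Notation J_ := (J_ nes). Notation W_ := (W_ nes).
Notation inc := (inc I_ J_).

Lemma size_nes : size nes = m. Proof. by rewrite size_map. Qed.
Lemma card_edges : #|edges G| = m.
Proof. by case: pr => /perm_size; rewrite size_map cardE. Qed.
Lemma IE t : (t < m)%N -> I_ t = (nth e0 es t).1.1.
Proof. by move=> h; rewrite /PassTh.I_ (nth_map e0). Qed.
Lemma JE t : (t < m)%N -> J_ t = (nth e0 es t).1.2.
Proof. by move=> h; rewrite /PassTh.J_ (nth_map e0). Qed.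
Lemma WE t : (t < m)%N -> W_ t = clip (wz t).
Proof. by move=> h; rewrite /PassTh.W_ (nth_map e0). Qed.

Lemma ed_perm : perm_eq [seq ed t | t <- iota 0 m] (enum (edges G)).
Proof.
case: pr => h _; suff -> : [seq ed t | t <- iota 0 m] = [seq [set t.1.1; t.1.2] | t <- es] by [].
apply: (@eq_from_nth _ set0); first by rewrite !size_map size_iota.
move=> i; rewrite size_map size_iota => im; rewrite (nth_map 0%N) ?size_iota // nth_iota // add0n.
by rewrite (nth_map e0).
Qed.

Lemma ed_in t : (t < m)%N -> ed t \in edges G.
Proof.
move=> h; rewrite -mem_enum -(perm_mem ed_perm); apply: map_f.
by rewrite mem_iota.
Qed.

Lemma ed_inj t t' : (t < m)%N -> (t' < m)%N -> ed t = ed t' -> t = t'.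
Proof.
move=> h h' e; have u : uniq [seq ed t | t <- iota 0 m] by rewrite (perm_uniq ed_perm) enum_uniq.
apply/eqP; have s1 : (t < size [seq ed t | t <- iota 0 m])%N by rewrite size_map size_iota.
have s2 : (t' < size [seq ed t | t <- iota 0 m])%N by rewrite size_map size_iota.
rewrite -(nth_uniq set0 s1 s2 u) !(nth_map 0%N) ?size_iota // !nth_iota // !add0n e eqxx //.
Qed.

Lemma wzE t : (t < m)%N -> wz t = weight G (ed t).
Proof. by move=> h; case: pr => _; apply; apply: mem_nth. Qed.

Lemma ed_card t : (t < m)%N -> #|ed t| = 2%N.
Proof. by move=> h; apply: (@edges_card2 _ G); exact: ed_in. Qed.

Lemma nes_IJ t : (t < size nes)%N -> I_ t != J_ t.
Proof.
rewrite size_nes => h; rewrite IE // JE //; have := ed_card h; rewrite /ed cards2 => c.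
by apply/eqP => /val_inj e; move: c; rewrite e eqxx.
Qed.
Lemma nes_I t : (t < size nes)%N -> (I_ t < n)%N.
Proof. by rewrite size_nes => h; rewrite IE. Qed.
Lemma nes_J t : (t < size nes)%N -> (J_ t < n)%N.
Proof. by rewrite size_nes => h; rewrite JE. Qed.

Lemma incE (i : 'I_n) t : (t < m)%N -> inc i t = (i \in ed t).
Proof. by move=> h; rewrite /OuterTh.inc IE // JE // !inE -!val_eqE /= !(eq_sym (nat_of_ord i)). Qed.

Lemma nes_simple t t' : (t < size nes)%N -> (t' < size nes)%N -> inc (I_ t) t' -> inc (J_ t) t' -> t = t'.
Proof.
rewrite size_nes => h h'; rewrite IE // JE // !incE // => i1 i2; apply: ed_inj => //.
apply/eqP; rewrite eqEcard !ed_card // leqnn andbT; apply/subsetP => x; rewrite !inE.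
by case/orP => /eqP ->; move: i1 i2; rewrite !inE.
Qed.

Lemma nes_size : (size nes <= n * n)%N.
Proof.
rewrite size_nes; pose f (t : 'I_m) := (nth e0 es t).1.
have fi : injective f by move=> t t' e; apply: val_inj; apply: ed_inj; rewrite ?ltn_ord // /ed; rewrite /f in e; rewrite e.
by have := leq_card f fi; rewrite card_prod !card_ord.
Qed.

Lemma sum_ed (P : pred {set 'I_n}) (F : {set 'I_n} -> R) :
 \sum_(e in edges G | P e) F e = \sum_(t < m | P (ed t)) F (ed t).
Proof.
have -> : \sum_(e in edges G | P e) F e = \sum_(e <- enum (edges G) | P e) F e.
 by rewrite big_enum_cond.
by rewrite -(perm_big _ ed_perm) /= big_map -[X in iota 0 X]subn0 big_mkord.
Qed.

Variable b : nat -> nat.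
Hypothesis bE : forall i : 'I_n, b i = cap G i.
Notation feas := (@feas R n m I_ J_ b).

Lemma feas_to y : lp_feasible G y -> feas (fun t => y (ed t)).
Proof.
case=> f1 f2 f3; split.
- by move=> t h; apply: f3; exact: ed_in.
- move=> i il; have := f1 (Ordinal il); rewrite sum_ed -bE /= => h.
 by rewrite (eq_bigl (fun t : 'I_m => Ordinal il \in ed t)) // => t; rewrite -incE.
- move=> A oA; pose U := [set i : 'I_n | A i].
 have eU : bnorm G U = (\sum_(i < n | A i) b i)%N.
  by rewrite /bnorm; apply: eq_big => [i|i _]; rewrite ?inE // bE.
 have := f2 U; rewrite eU sum_ed => /(_ oA) h.
 rewrite (eq_bigl (fun t : 'I_m => ed t \subset U)) // => t.
 by rewrite /ed subUset !sub1set !inE IE // JE.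
Qed.

(** On an edge the sum has exactly one term, since stream positions and edges correspond one to one;
    elsewhere it is 0. *)
Definition lift_y (yt : nat -> R) (e : {set 'I_n}) : R := \sum_(t < m | ed t == e) yt t.

Lemma lift_ed yt t : (t < m)%N -> lift_y yt (ed t) = yt t.
Proof.
move=> h; rewrite /lift_y (big_pred1 (Ordinal h)) // => t' /=.
by apply/eqP/eqP => [e|->//]; apply: val_inj; exact: (ed_inj (ltn_ord t') h e).
Qed.

Lemma sum_lift yt (P : pred {set 'I_n}) :
 \sum_(e in edges G | P e) lift_y yt e = \sum_(t < m | P (ed t)) yt t.
Proof. by rewrite sum_ed; apply: eq_bigr => t _; rewrite lift_ed. Qed.

Lemma feas_from yt : feas yt -> lp_feasible G (lift_y yt).
Proof.
case=> f1 f2 f3; split.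
- move=> i; rewrite (sum_lift yt (fun e => i \in e)) -bE; have := f2 i (ltn_ord i) => h.
 by rewrite (eq_bigl (fun t : 'I_m => inc i t)) // => t; rewrite incE.
- move=> U oU; pose A k := if insub k is Some i then i \in U else false.
 have AU (i : 'I_n) : A i = (i \in U) by rewrite /A valK.
 have eU : bnorm G U = (\sum_(i < n | A i) b i)%N.
  by rewrite /bnorm; apply: eq_big => [i|i _]; rewrite ?AU // bE.
 rewrite (sum_lift yt (fun e => e \subset U)) eU; rewrite eU in oU; have := f3 A oU => h.
 rewrite (eq_bigl (fun t : 'I_m => A (I_ t) && A (J_ t))) // => t.
 by rewrite /ed subUset !sub1set IE // JE // !AU.
- by move=> e _; rewrite sumr_ge0 // => t _; exact: f1.
Qed.

Lemma value_ed (y : {set 'I_n} -> R) : lp_value G y = \sum_(t < m) (wz t)%:~R * y (ed t).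
Proof.
have := sum_ed xpredT (fun e => (weight G e)%:~R * y e); rewrite /lp_value /= => h.
rewrite (eq_bigl (fun e => (e \in edges G) && true)) => [|e]; last by rewrite andbT.
by rewrite h; apply: eq_bigr => t _; rewrite wzE.
Qed.

Lemma clip_le (w : int) : w%:~R <= (clip w)%:R :> R.
Proof. by case: w => k //=; rewrite NegzE mulrNz oppr_le0 ler0n. Qed.

(* If some edge of positive weight has both capacities positive, the unit vector on it is feasible. *)
Lemma opt_le (q : R) yt : 0 <= q -> q <= 1 -> feas yt ->
 (forall t, (t < m)%N -> yt t != 0 -> (0 < W_ t)%N) ->
 (forall hs, feas hs -> 1 <= \sum_(t < m) (W_ t)%:R * hs t ->
  q * (\sum_(t < m) (W_ t)%:R * hs t) <= \sum_(t < m) (W_ t)%:R * yt t) ->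
 q * lp_opt R G <= lp_value G (lift_y yt).
Proof.
move=> q0 q1 fy yw H.
have yv : lp_value G (lift_y yt) = \sum_(t < m) (W_ t)%:R * yt t.
 rewrite value_ed; apply: eq_bigr => t _; rewrite lift_ed // WE //.
 have [->|nz] := eqVneq (yt t) 0; first by rewrite !mulr0.
 by have := yw t (ltn_ord t) nz; rewrite WE //; case: (wz t).
have y0 : 0 <= lp_value G (lift_y yt).
 by rewrite yv sumr_ge0 // => t _; rewrite mulr_ge0 ?ler0n //; case: fy => f _ _; exact: f.
have le1 (y : {set 'I_n} -> R) : lp_feasible G y -> lp_value G y <= \sum_(t < m) (W_ t)%:R * y (ed t).
 move=> [_ _ f3]; rewrite value_ed; apply: ler_sum => t _; rewrite WE //.
 by apply: ler_wpM2r; [apply: f3; exact: ed_in|exact: clip_le].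
have all (y : {set 'I_n} -> R) : lp_feasible G y -> q * lp_value G y <= lp_value G (lift_y yt).
 move=> fe; have fh := feas_to fe.
 case: (pickP (fun t : 'I_m => [&& (0 < W_ t)%N, (0 < b (I_ t))%N & (0 < b (J_ t))%N])) => [t0 /and3P[w0 b1 b2]|no].
  pose h1 t : R := (t == t0 :> nat)%:R.
  have s1 (P : pred nat) : \sum_(t < m | P t) h1 t = (P t0)%:R.
   rewrite big_mkcond (bigD1 t0) //= big1 ?addr0 /h1 ?eqxx; first by case: (P t0).
   by move=> t; rewrite -val_eqE /= => /negbTE ->; case: ifP.
  have f1 : feas h1.
   split=> [t _|i il|A oA]; first exact: ler0n.
    rewrite (s1 (inc i)) ler_nat.
    by case hi: (inc i t0) => //; case/orP: hi => /eqP <-.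
   rewrite (s1 (fun t => A (I_ t) && A (J_ t))) ler_nat.
   case AI: (A (I_ t0)); case AJ: (A (J_ t0)) => //=.
   have ne := nes_IJ (t := t0); rewrite size_nes in ne; have ne' := ne (ltn_ord t0).
   have i1 := nes_I (t := t0); rewrite size_nes in i1; have j1 := nes_J (t := t0); rewrite size_nes in j1.
   have i1' := i1 (ltn_ord t0); have j1' := j1 (ltn_ord t0).
   have : (2 <= \sum_(i < n | A i) b i)%N.
    rewrite (bigD1 (Ordinal i1')) //= (bigD1 (Ordinal j1')) /=; last by rewrite AJ -val_eqE /= eq_sym.
    by rewrite addnA; apply: leq_trans (leq_addr _ _); rewrite -[2%N]/(1 + 1)%N leq_add.
   by move: oA; case: (\sum_(i < n | A i) b i)%N => [|[|[|k]]].
  have v1 : 1 <= \sum_(t < m) (W_ t)%:R * h1 t.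
   rewrite (bigD1 t0) //= /h1 eqxx mulr1 -[X in X <= _]addr0; apply: lerD; first by rewrite ler1n.
   by rewrite sumr_ge0 // => t _; rewrite mulr_ge0 ?ler0n.
  (* The value guarantee is only available for competitors of value at least 1. A weaker competitor
     is dominated by the unit vector, whose value is a positive integer weight. *)
  have [g1|l1] := lerP 1 (\sum_(t < m) (W_ t)%:R * y (ed t)).
   by rewrite yv; apply: le_trans (H _ fh g1); rewrite ler_wpM2l // le1.
  rewrite yv; apply: le_trans (H _ f1 v1); rewrite ler_wpM2l //.
  by apply: (le_trans (le1 _ fe)); exact: le_trans (ltW l1) v1.
 (* Now every edge has clipped weight 0 or an end of capacity 0, so no feasible vector has positive
    value. *)
 have z0 : \sum_(t < m) (W_ t)%:R * y (ed t) <= 0.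
  rewrite big1 // => t _; have := no t => /negbT; rewrite !negb_and -!leqNgt !leqn0.
  case: fh => g0 g1 _.
  have zz i : (i < n)%N -> inc i t -> b i = 0%N -> y (ed t) = 0.
   move=> il hi bi; have := g1 i il; rewrite bi (bigD1 t) //= => hs.
   apply/eqP; rewrite eq_le (g0 t (ltn_ord t)) andbT; apply: le_trans hs.
   by rewrite lerDl sumr_ge0 // => t' _; exact: g0.
  have i1 := nes_I (t := t); rewrite size_nes in i1; have j1 := nes_J (t := t); rewrite size_nes in j1.
  case/or3P => /eqP h; first by rewrite h mul0r.
   by rewrite (zz _ (i1 (ltn_ord t)) _ h) ?mulr0 // /OuterTh.inc eqxx.
  by rewrite (zz _ (j1 (ltn_ord t)) _ h) ?mulr0 // /OuterTh.inc eqxx orbT.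
 by apply: (le_trans _ y0); rewrite mulr_ge0_le0 //; exact: le_trans (le1 _ fe) z0.
have z : lp_feasible G (fun=> 0 : R).
 split=> [i|U _|e _]; rewrite ?big1 ?ler0n //.
have [->|qn] := eqVneq q 0; first by rewrite mul0r.
have qp : 0 < q by rewrite lt_neqAle eq_sym qn.
rewrite mulrC -ler_pdivlMr //; apply: ge_sup; first by exists (lp_value G (fun=> 0)); exists (fun=> 0).
by move=> v [y fe ->]; rewrite ler_pdivlMr // mulrC; exact: all.
Qed.

End Transfer.

End TransferTh.

(** * Space and time in terms of n and delta *)

Module BoundsTh.
Import Defs MachineTh HoareTh FlowTh FindTh BumpSetTh LevelsTh WeightsTh OuterTh PassTh PhaseTh MainTh RoundingTh TransferTh.
Import Order.TTheory GRing.Theory Num.Theory.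

Lemma ln2_half (R : realType) : (2^-1 <= ln 2%:R :> R)%R.
Proof.
have h : (0 < (2%:R)^-1 :> R)%R by rewrite invr_gt0 ltr0n.
have := ln_le_sub1 h; rewrite lnV ?posrE ?ltr0n //; lra.
Qed.

Lemma mul4_le (e l z : nat) : 100 <= z -> e <= z -> l <= z -> 100 * e * e * l <= z ^ 4.
Proof.
move=> h he hl; rewrite (_ : 4 = 1 + 1 + 1 + 1) // !expnD !expn1.
by apply: leq_mul => //; apply: leq_mul => //; exact: leq_mul.
Qed.
Lemma mul3_le (e z : nat) : e <= z -> e * e * e <= z ^ 3.
Proof.
move=> he; rewrite (_ : 3 = 1 + 1 + 1) // !expnD !expn1.
by apply: leq_mul => //; exact: leq_mul.
Qed.
Lemma mul2_le (e z : nat) : 0 < z -> e <= z -> e * e <= z ^ 3.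
Proof.
move=> z0 he; rewrite (_ : 3 = 1 + 1 + 1) // !expnD !expn1.
by apply: leq_trans (leq_mul he he) _; rewrite leq_pmulr.
Qed.

Section Bounds.
Variables (R : realType) (n c dn dd : nat) (es : seq (nat * nat * nat)) (ar0 : nat -> nat -> nat).
Notation E := (pE dn dd).
Notation G := (pG n dn dd es ar0).
Notation L := (pL n dn dd es ar0).
Notation N := (pN n dn dd es ar0).
Notation Q := (pQ dn dd).
Notation D := (pD n dn dd es ar0).
Notation Lm := (pLm n dn dd es ar0).
Notation T := (pT n dn dd es ar0).
Notation C := (pC n dn dd es ar0).
Hypothesis n52 : 52 <= n.
Hypothesis hB : pB n ar0 <= n ^ c.
Hypothesis hW : pW es <= n ^ c.
Hypothesis hE : E <= n ^ 3.

Lemma G_le : G <= n ^ (c + 4).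
Proof.
have n0 : 0 < n by lia.
have e1 : n <= n ^ (c + 3) by rewrite -{1}(expn1 n) leq_pexp2l //; lia.
have e2 : n ^ c <= n ^ (c + 3) by rewrite leq_pexp2l //; lia.
have e3 : n ^ 3 <= n ^ (c + 3) by rewrite leq_pexp2l //; lia.
have e4 : 4 * n ^ (c + 3) <= n ^ (c + 4).
 by rewrite [c + 4]addnS expnS leq_mul2r; apply/orP; right; lia.
rewrite /pG; lia.
Qed.

Lemma ln_n1 : (1 <= ln n%:R :> R)%R.
Proof.
have h2 : (2^-1 <= ln 2%:R :> R)%R by exact: ln2_half.
have : (ln (2 ^ 2)%:R <= ln n%:R :> R)%R by rewrite ler_ln ?posrE ?ltr0n // ?ler_nat; lia.
rewrite natrX lnXn ?ltr0n // mulr2n; lra.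
Qed.

(** 2^(L-1) <= G <= n^(c+4) and ln 2 >= 1/2 give L <= 2 (c+4) ln n + 1, and ln n >= 1 absorbs the
    last term. *)
Lemma L_le : (L%:R <= (2 * c + 9)%:R * ln n%:R :> R)%R.
Proof.
have l1 := ln_n1; have h2 : (2^-1 <= ln 2%:R :> R)%R by exact: ln2_half.
have g0 : 0 < G by rewrite /pG; lia.
have hl : 2 ^ L.-1 <= n ^ (c + 4) by apply: leq_trans G_le; rewrite /pL /=; apply: trunc_logP.
have h : (ln (2 ^ L.-1)%:R <= ln (n ^ (c + 4))%:R :> R)%R.
 by rewrite ler_ln ?posrE ?ltr0n ?expn_gt0 ?ler_nat //; lia.
move: h; rewrite !natrX !lnXn ?ltr0n //; last by lia.
rewrite -[(ln 2%:R *+ _)%R]mulr_natl -[(ln n%:R *+ _)%R]mulr_natl => h.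
have q : (L.-1%:R * 2^-1 <= L.-1%:R * ln 2%:R :> R)%R by apply: ler_wpM2l.
have -> : (L%:R = L.-1%:R + 1 :> R)%R by rewrite natr1 prednK.
have -> : ((2 * c + 9)%:R = 2 * (c + 4)%:R + 1 :> R)%R.
 have -> : 2 * c + 9 = 2 * (c + 4) + 1 by lia.
 by rewrite (natrD _ (2 * (c + 4)) 1) (natrM _ 2 (c + 4)).
nra.
Qed.

(** E is of order 1/delta and L of order ln n, so Z is of order ln n / delta; all parameters that
    enter the costs are bounded by powers of Z. *)
Notation Z := (E * L).
Lemma Z100 : 100 <= Z.
Proof. by apply: leq_trans (E100 dn dd) _; rewrite leq_pmulr. Qed.
Lemma EZ : E <= Z. Proof. by rewrite leq_pmulr. Qed.
Lemma LZ : L <= Z. Proof. by rewrite leq_pmull //; have := E100 dn dd; lia. Qed.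
Lemma n_gt0 : 0 < n. Proof. by lia. Qed.

Lemma NZ : N <= Z ^ 4. Proof. exact: mul4_le Z100 EZ LZ. Qed.
Lemma QZ : Q <= Z ^ 3. Proof. exact: mul3_le EZ. Qed.
Lemma DZ : D <= Z ^ 8.
Proof.
have h := Z100; rewrite /pD (_ : 8 = 1 + 4 + 3) // !expnD expn1; apply: leq_mul.
 by apply: leq_mul NZ; lia.
by apply: mul2_le EZ; lia.
Qed.

Ltac zk := lazymatch goal with
 | |- is_true (leq (muln _ _) _) => eapply (pbM Z100); [zk|zk]
 | |- is_true (leq (addn _ _) _) => eapply (pbmx Z100); [zk|zk]
 | |- is_true (leq (expn _ _) _) => first [exact: leqnn | eapply (pbX Z100); zk]
 | |- is_true (leq (S _) _) => first [apply: (pbC Z100); reflexivity | eapply (pbS Z100); zk]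
 | _ => first [apply: (pbC Z100); reflexivity | exact: NZ | exact: QZ | exact: DZ | eassumption
        | apply: (pb1 Z100); first [exact: EZ|exact: LZ|exact: leqnn]]
 end.
Ltac nk := lazymatch goal with
 | |- is_true (leq (muln _ _) _) => first [eapply (nbMl Z100 n_gt0); [nk|zk] | eapply (nbMr Z100 n_gt0); [zk|nk]]
 | |- is_true (leq (addn _ _) _) => eapply (nbD Z100 n_gt0); [nk|nk]
 | |- is_true (leq (S _) _) => first [eapply (nbW Z100 n_gt0); apply: (pbC Z100); reflexivity | eapply (nbS Z100 n_gt0); nk]
 | _ => first [exact: (nb1 Z100 n_gt0) | eassumption | eapply (nbW Z100 n_gt0); zk]
 end.

Lemma cF_Z : cF Q D <= Z ^ 20. Proof. by rewrite /cF; eapply (pbU Z100); [zk|by vm_compute]. Qed.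
Lemma cCL_Z : cCL Q D <= Z ^ 40.
Proof. by have h := cF_Z; rewrite /cCL; eapply (pbU Z100); [zk|by vm_compute]. Qed.
Lemma cFIND_Z : cFIND Q D <= Z ^ 60.
Proof. by have h := cCL_Z; rewrite /cFIND; eapply (pbU Z100); [zk|by vm_compute]. Qed.
Lemma cBS_Z : cBS Q D <= Z ^ 20. Proof. by rewrite /cBS; eapply (pbU Z100); [zk|by vm_compute]. Qed.
Lemma cST_Z : cST D <= Z ^ 12. Proof. by rewrite /cST; eapply (pbU Z100); [zk|by vm_compute]. Qed.
Lemma T_Z : T <= n * Z ^ 10. Proof. by rewrite /pT /T1; eapply (nbU Z100 n_gt0); [nk|by vm_compute]. Qed.
Lemma cLEV_Z : cLEV n Q D T <= n * Z ^ 80.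
Proof.
by have h1 := cFIND_Z; have h2 := cBS_Z; have h3 := cST_Z; have h4 := T_Z; rewrite /cLEV; eapply (nbU Z100 n_gt0); [nk|by vm_compute].
Qed.
Lemma C_Z : C <= n * Z ^ 100.
Proof.
have h1 := cFIND_Z; have h2 := cBS_Z; have h3 := cST_Z; have h4 := T_Z; have h5 := cLEV_Z.
by rewrite /pC /cPH -/T; eapply (nbU Z100 n_gt0); [nk|by vm_compute].
Qed.
Lemma rest_Z : 200 + 50 * n + 5 * L + N * (C + 3) + 15 * T <= n * Z ^ 120.
Proof.
have h4 := T_Z; have h5 := C_Z; have -> : 200 = 2 * 100 by [].
by eapply (nbU Z100 n_gt0); [nk|by vm_compute].
Qed.
Lemma Lm_Z : NA * Lm + 4 * T <= n * Z ^ 120.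
Proof.
have h4 := T_Z; rewrite /NA /pLm.
by eapply (nbU Z100 n_gt0); [nk|by vm_compute].
Qed.

End Bounds.

End BoundsTh.

(** * The initial memory and auxiliary inequalities *)

Module InitTh.
Import Defs MachineTh HoareTh WeightsTh OuterTh PassTh PhaseTh MainTh RoundingTh TransferTh BoundsTh.
Import Order.TTheory GRing.Theory Num.Theory.
Local Open Scope ring_scope.

Section Init.
Variables (n : nat) (G : bgraph n) (dn dd : nat).
Definition meml : seq nat := ([:: n; dn; dd] ++ [seq cap G i | i <- enum 'I_n])%N.
Definition memn (a : nat) : nat := nth 0%N meml a.
Definition ar0 (k i : nat) : nat := memn (NA * i + k).
Definition st0 : st := St (fun=> 0%N) ar0 [::] 0 [::] 0.

Lemma mem_init a : mem (init_state G dn dd) a = Posz (memn a).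
Proof.
rewrite /memn -[LHS]/(nth 0 ([:: n%:Z; dn%:Z; dd%:Z] ++ [seq (cap G i)%:Z | i <- enum 'I_n]) a).
have -> : [:: n%:Z; dn%:Z; dd%:Z] ++ [seq (cap G i)%:Z | i <- enum 'I_n] = map Posz meml.
 by rewrite /meml map_cat /= -map_comp.
case: (ltnP a (size meml)) => h; first by rewrite (nth_map 0%N).
by rewrite !nth_default ?size_map.
Qed.

Lemma cap0E i (il : (i < n)%N) : cap0 ar0 i = cap G (Ordinal il).
Proof.
rewrite /cap0 /ar0 [(NA * _)%N]mulnC -divn_eq addn3 /memn /meml /=.
rewrite (nth_map (Ordinal il)) ?size_enum_ord //; congr (cap G _).
by apply: val_inj; rewrite /= nth_enum_ord.
Qed.

Lemma memn_le B a : (n <= B)%N -> (dn <= B)%N -> (dd <= B)%N -> (forall i, (cap G i <= B)%N) -> (memn a <= B)%N.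
Proof.
move=> h1 h2 h3 h4; rewrite /memn; case: (ltnP a (size meml)) => h; last by rewrite nth_default.
have : nth 0%N meml a \in meml by apply: mem_nth.
rewrite {2}/meml mem_cat !inE => /orP[/or3P[]/eqP->//|/mapP[i _ ->]]; exact: h4.
Qed.
End Init.

Lemma Z_pow_le (R : realType) (n z k K : nat) (a : R) : 0 <= a -> z%:R <= K%:R * a ->
 (n * z ^ k)%:R <= K%:R ^+ k * (n%:R * a ^+ k) :> R.
Proof.
move=> a0 h; rewrite natrM natrX mulrCA; apply: ler_wpM2l; first exact: ler0n.
rewrite -exprMn; apply: lerXn2r => //; rewrite nnegrE ?ler0n // mulr_ge0 ?ler0n //.
Qed.

Lemma yout_frac (R : realType) (E N Fy : nat) (U Hh : nat -> nat) t : (0 < E)%N -> (0 < N)%N -> (0 < Fy)%N ->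
 yout R E N Fy U Hh t = ((U t * N * Fy + Hh t * E) * E)%:R / (E * N * Fy * N * (E + 20))%:R.
Proof.
move=> E0 N0 F0; have ER : E%:R != 0 :> R by rewrite pnatr_eq0 -lt0n.
have NR : N%:R != 0 :> R by rewrite pnatr_eq0 -lt0n.
have FR : Fy%:R != 0 :> R by rewrite pnatr_eq0 -lt0n.
have E20 : E%:R + 20 != 0 :> R by rewrite -(natrD _ E 20) pnatr_eq0 addn_eq0 andbF.
rewrite /yout /raw /scale !natrM (natrD _ E 20) (natrD _ (U t * N * Fy)%N) !natrM.
by field; rewrite ER NR FR E20.
Qed.

Lemma mul_ge1 (R : realType) (a b : R) : 1 <= a -> 1 <= b -> 1 <= a * b.
Proof. by move=> a1 b1; apply: (le_trans a1); rewrite ler_peMr // (le_trans ler01). Qed.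

Lemma prod_le (R : realType) (e l x w : R) : 0 <= e -> 0 <= l -> e <= x -> l <= w ->
 100 * e * e * l <= 100 * x * x * w.
Proof.
move=> e0 l0 ex lw; have q : e * e <= x * x by apply: ler_pM.
have q2 : 0 <= e * e by apply: mulr_ge0.
by rewrite -!mulrA ler_pM2l // !mulrA; apply: ler_pM.
Qed.

Lemma time_sum (k n m L N C T z : nat) :
 (k <= 200 + 50 * n + 10 * m + 5 * L + N * (60 * m + C + 3) + 15 * T ->
  200 + 50 * n + 5 * L + N * (C + 3) + 15 * T <= z -> k <= 60 * (m * N.+1) + z)%N.
Proof.
have -> : (N * (60 * m + C + 3) = 60 * (m * N) + N * (C + 3))%N.
 by rewrite -addnA mulnDr [(N * (60 * m))%N]mulnCA [(N * m)%N]mulnC.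
by rewrite [(m * N.+1)%N]mulnS; move: (N * (C + 3))%N (m * N)%N; lia.
Qed.

Lemma mul5_gt0 (a b d e f : nat) : (0 < a -> 0 < b -> 0 < d -> 0 < e -> 0 < f -> 0 < a * b * d * e * f)%N.
Proof. by move=> *; do 4 (rewrite muln_gt0; apply/andP; split=> //). Qed.

End InitTh.

(** * Choice of the constants and assembly of the bounds *)

Import MachineTh HoareTh WeightsTh OuterTh PassTh PhaseTh MainTh RoundingTh TransferTh BoundsTh.
Import InitTh.
Import Order.TTheory GRing.Theory Num.Theory.
Local Open Scope ring_scope.

Theorem theorem3 (R : realType) :
  exists (p : prog) (k : nat), forall c : nat, exists (K : R) (C : nat),
  forall (n : nat) (G : bgraph n) (es : seq ('I_n * 'I_n * int))
         (dnum dden : nat),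
  let delta : R := dnum%:R / dden%:R in
  let m : nat := #|edges G| in
  let npoly : R := n%:R * (delta^-1 * ln n%:R) ^+ k in
  (0 < n)%N -> (0 < dden)%N ->
  presents G es ->
  poly_bounded c G dnum dden ->
  (Num.sqrt (5 * n%:R))^-1 < delta -> delta <= 16^-1 ->
  exists (S t : nat) (s : state) (y : {set 'I_n} -> R),
  let T : nat := passes s in
  [/\ exec (edge_stream es) S (n ^ C) p (init_state G dnum dden) t s,
      [/\ outputs G (out s) y,
          lp_feasible G y
        & (1 - 14 * delta) * lp_opt R G <= lp_value G y],
      (S + 4 * size (out s))%:R <= K * npoly,
      T%:R <= K * (delta ^- 4 * ln delta^-1 * ln n%:R)
    & t%:R <= K * ((m * T)%:R + npoly)].
Proof.
exists (comp MAIN), 120%N => c.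
(* Z is at most [Kn] times ln n / delta: the factor 200 comes from E and 2c+9 from L. *)
pose Kn := (200 * (2 * c + 9))%N.
(* A stream edge costs at most 60 ticks per pass and a tick at most 1000 instructions; 120 is the
   exponent of Z in the remaining costs. Stored values are at most G^100, hence at most n^(100
   (c+4)), and expressions at most the 31st power of that. *)
exists (60 * 1000 * Kn%:R ^+ 120), (100 * (c + 4) * 31)%N => n G es dn dd delta m npoly n0 dd0 pr [pb1 pb2 pb3 pb4] dlo dhi.
have [K0 KE] : exists v : R, v = Kn%:R ^+ 120 by eexists.
rewrite -KE.
have n5 : (0 : R) < 5 * n%:R by rewrite mulr_gt0 // ltr0n.
have d0 : 0 < delta by apply: le_lt_trans dlo; rewrite invr_ge0 sqrtr_ge0.
have dn0 : (0 < dn)%N by rewrite lt0n; apply/eqP => e; move: d0; rewrite /delta e mul0r ltxx.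
pose x : R := delta^-1.
have dx : delta * x = 1 by rewrite /x mulfV // gt_eqF.
have x0 : 0 < x by rewrite /x invr_gt0.
have x16 : 16 <= x.
  by have := ler_wpM2r (ltW x0) dhi; rewrite dx; lra.
have s0 : 0 < Num.sqrt (5 * n%:R : R) by rewrite sqrtr_gt0.
have xs : x < Num.sqrt (5 * n%:R) by rewrite /x -[X in _ < X]invrK ltf_pV2 // posrE invr_gt0.
have x2 : x * x < 5 * n%:R.
  by have := ltr_pM (ltW x0) (ltW x0) xs xs; rewrite -[X in _ < X]expr2 sqr_sqrtr // ltW.
have xx : 16 * x <= x * x by rewrite ler_wpM2r // ltW.
(* 16^2 <= 1/delta^2 < 5 n. Only from here on can numerical constants be absorbed into powers of
   n. *)
have n52 : (52 <= n)%N.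
  rewrite ltnNge; apply/negP => h; have : n%:R <= 51%:R :> R by rewrite ler_nat.
  by move: x2 xx x16; lra.
have xE : x = dd%:R / dn%:R by rewrite /x /delta invf_div.
have q1 : (dd %/ dn)%:R <= x by rewrite xE ler_pdivlMr ?ltr0n // -natrM ler_nat leq_trunc_div.
have q2 : x <= (dd %/ dn)%:R + 1.
  by rewrite xE ler_pdivrMr ?ltr0n // natr1 -natrM ler_nat ltnW // ltn_ceil.
pose E := pE dn dd.
have EEq : E%:R = 100 * ((dd %/ dn)%:R + 1) :> R by rewrite /E /pE natrM natrD.
have EU : E%:R <= 200 * x by rewrite EEq; lra.
have EL : 100 * x <= E%:R by rewrite EEq; lra.
have hE : (E <= n ^ 3)%N.
  have : (dd %/ dn <= 5 * n)%N by rewrite -(ler_nat R) natrM; move: q1 x2 xx x16; lra.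
  have -> : (n ^ 3 = n * n * n)%N by rewrite !expnS expn0 muln1 mulnA.
  have : (2704 * n <= n * n * n)%N by rewrite leq_mul2r; apply/orP; right; apply: (@leq_mul 52 52).
  rewrite /E /pE; clear -n52; move: (dd %/ dn)%N => qq; lia.
pose ne := nes es; pose A0 := ar0 G dn dd.
have sz : size ne = size es by exact: size_nes.
have mE : m = size es by rewrite /m (card_edges pr).
have capE i (il : (i < n)%N) : cap0 A0 i = cap G (Ordinal il) by exact: cap0E.
have hB : (pB n A0 <= n ^ c)%N.
  rewrite /pB; apply: (big_ind (fun v => (v <= n ^ c)%N)) => // [u v hu hv|i _]; first by rewrite geq_max hu hv.
  by rewrite capE.
have wb t : (t < size es)%N -> (`|wz es n0 t| <= n ^ c)%N.
  by move=> h; rewrite (wzE n0 pr h); apply: pb2; exact: (ed_in n0 pr h).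
have hW : (pW ne <= n ^ c)%N.
  rewrite /pW; apply: (big_ind (fun v => (v <= n ^ c)%N)) => // [u v hu hv|i _]; first by rewrite geq_max hu hv.
  have ti : (i < size es)%N by rewrite -sz.
  by rewrite (WE n0 ti); apply: leq_trans (wb _ ti); case: (wz _ _ _).
pose M := (n ^ (100 * (c + 4)))%N.
have nM k : (k <= 100 * (c + 4))%N -> (n ^ k <= M)%N by move=> h; rewrite leq_pexp2l.
have ncM : (n ^ c <= M)%N by apply: nM; clear; lia.
have n1M : (n <= M)%N by rewrite -{1}(expn1 n); apply: nM; clear; lia.
have pGM : (pP n dn dd ne A0 <= M)%N.
  have g := G_le n52 hB hW hE; rewrite /pP /M mulnC expnM leq_exp2r //.
have memM a : (memn G dn dd a <= M)%N.
  by apply: memn_le => //; [exact: leq_trans ncM|exact: leq_trans ncM|move=> i; exact: leq_trans ncM].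
have arM k i : (k < NA)%N -> (i < pLm n dn dd ne A0)%N -> (A0 k i <= M)%N by move=> _ _; exact: memM.
have mn : (size ne <= n * n)%N by exact: (nes_size n0 pr).
have Il t : (t < size ne)%N -> (PassTh.I_ ne t < n)%N by move=> h; exact: (nes_I n0 h).
have Jl t : (t < size ne)%N -> (PassTh.J_ ne t < n)%N by move=> h; exact: (nes_J n0 h).
have IJ t : (t < size ne)%N -> PassTh.I_ ne t != PassTh.J_ ne t by move=> h; exact: (nes_IJ n0 pr h).
have simple t t' : (t < size ne)%N -> (t' < size ne)%N -> inc (PassTh.I_ ne) (PassTh.J_ ne) (PassTh.I_ ne t) t' ->
   inc (PassTh.I_ ne) (PassTh.J_ ne) (PassTh.J_ ne t) t' -> t = t' by exact: (nes_simple n0 pr).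
have a0 : A0 0%N 0%N = n by []. have a1 : A0 1%N 0%N = dn by []. have a2 : A0 2%N 0%N = dd by [].
have [a' ax [cf [c' [X [U [Hh [r ce pe oe ke]]]]]]] :=
  @main_ok R n dn dd ne A0 M pGM n0 dn0 a0 a1 a2 arM mn Il Jl IJ simple (st0 G dn dd) erefl erefl erefl erefl.
pose eL := [seq (nat_of_ord t.1.1, nat_of_ord t.1.2, t.2) | t <- es].
have eS : edge_stream es = map ztr eL by rewrite /edge_stream /eL -map_comp.
have eN : ne = map ntr eL by rewrite /ne /nes /eL -map_comp.
have M100 : (100 <= M)%N.
  apply: (@leq_trans (n ^ 2)); last by apply: nM; clear; lia.
  by rewrite expnS expn1; apply: (@leq_trans (52 * 52)) => //; apply: leq_mul.
have M0W j : (j <= 31)%N -> (M ^ j <= n ^ (100 * (c + 4) * 31))%N.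
  by move=> h; rewrite expnM leq_pexp2l //; apply: leq_trans M100.
have Wadr : (NA * pLm n dn dd ne A0 <= n ^ (100 * (c + 4) * 31))%N.
  apply: leq_trans (M0W 2%N isT); have h := LmM pGM n0 dn0 a0 a1 a2 mn.
  by rewrite expnS expn1; apply: leq_mul; [exact: leq_trans M100|by apply: leq_trans h; rewrite leq_pmull].
have eLb t : t \in eL -> [/\ (t.1.1 <= M)%N, (t.1.2 <= M)%N & (`|t.2| <= M)%N].
  move=> /mapP[u us ->] /=; have [i ii ui] := nthP (e0 n0) us.
  split; try (apply: leq_trans n1M; exact: ltnW).
  by apply: leq_trans ncM; have := wb i ii; rewrite /wz ui.
have sim0 : sim (pLm n dn dd ne A0) M eL (st0 G dn dd) (init_state G dn dd).
  by split=> //; [move=> k i _ _; rewrite mem_init|exists [::]].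
have /andP[wf wc] := MAIN_wf.
have ax' : aexec (pLm n dn dd ne A0) M (map ntr eL) MAIN (st0 G dn dd) a' by rewrite -eN.
have [s' [t [ex sm' tk]]] := comp_ok M100 M0W Wadr eLb ax' wf wc sim0.
have [E8 N0 Fy0 Q0] := @basics n dn dd ne A0 M pGM n0 dn0 a0 a1 a2 mn.
pose N := pN n dn dd ne A0; pose Fy := pFy n dn dd ne A0.
pose yt : nat -> R := yout R E N Fy U Hh.
have BmP i : (i < n)%N -> (cf i <= pB n A0)%N by move=> il; rewrite ce // capB.
have cE (i : 'I_n) : cf i = cap G i.
  by rewrite ce // capE; congr (cap G _); exact: val_inj.
have E100' : (100 <= E)%N by exact: E100.
have NE' : (E * E <= N)%N.
  rewrite /N /pN -/E -[(100 * E * E)%N]mulnA; apply: (@leq_trans (1 * (E * E) * 1)); first by rewrite mul1n muln1.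
  by apply: leq_mul => //; rewrite leq_mul2r orbT.
have lnX := @lnX_ok R n dn dd ne A0 M pGM n0 dn0 a0 a1 a2 mn.
have F0 : (0 < pF n dn dd ne A0)%N by rewrite /pF expn_gt0 /pG -!addnA addn_gt0 n0.
have eF := @errF_ok n dn dd ne A0 M pGM n0 dn0 a0 a1 a2 mn.
have fy := yout_feas E100' NE' Fy0 erefl Il Jl IJ simple (@wtW ne) BmP lnX F0 eF r.
have vy := fun hs => @yout_val R n (size ne) E N (pF n dn dd ne A0) Fy _ (pW ne) (pB n A0) _ _ _ _ E100' NE' Fy0 erefl Il Jl IJ (@wtW ne) BmP lnX F0 eF c' X U Hh r hs.
have [sT _] := @size_T R n dn dd ne A0 M pGM n0 dn0 a0 a1 a2 mn Il Jl cf N c' X U Hh BmP r (leqnn _).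
have H0 t' : (t' < size ne)%N -> U t' = 0%N -> Hh t' = 0%N.
  by move=> h; exact: (@unlisted_H0 R n dn dd ne A0 M pGM n0 dn0 a0 a1 a2 mn _ _ _ _ _ _ _ r h).
have yt0 t' : (t' < size ne)%N -> U t' = 0%N -> yt t' = 0.
  by move=> h u0; rewrite /yt /yout /raw u0 (H0 _ h u0) !mul0r addr0 mul0r.
have ER0 : E%:R != 0 :> R by rewrite pnatr_eq0 -lt0n; exact: leq_trans E100'.
have NR0 : N%:R != 0 :> R by rewrite pnatr_eq0 -lt0n; exact: N0.
have FR0 : Fy%:R != 0 :> R by rewrite pnatr_eq0 -lt0n; exact: Fy0.
have E20 : E%:R + 20 != 0 :> R by rewrite -(natrD _ E 20) pnatr_eq0 addn_eq0 andbF.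
rewrite sz in fy vy.
exists (NA * pLm n dn dd ne A0)%N, t, s', (lift_y es n0 yt) => T.
have TE : T = N.+1 by rewrite /T (sim_p sm') pe.
have so : size (out s') = size (lst ne U) by rewrite (sim_o sm') size_map oe size_map.
pose Zz := (E * pL n dn dd ne A0)%N.
pose a : R := delta^-1 * ln n%:R.
have l1 : 1 <= ln n%:R :> R by first [exact: (ln_n1 R n52) | exact: (@ln_n1 R n n52) | exact: (ln_n1 R n52 hB hW hE) | apply: ln_n1; eassumption].
have Ll := @L_le R n c dn dd ne A0 n52 hB hW hE.
have a1' : 0 <= a by rewrite mulr_ge0 ?invr_ge0 ?ltW //; apply: lt_le_trans l1.
have L00 : (0 : R) <= (pL n dn dd ne A0)%:R by exact: ler0n.
have c0 : (0 : R) <= (2 * c + 9)%:R by exact: ler0n.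
have cl0 : (0 : R) <= (2 * c + 9)%:R * ln n%:R by rewrite mulr_ge0 //; apply: le_trans l1.
have Za : Zz%:R <= Kn%:R * a.
  rewrite /Zz natrM; apply: (@le_trans _ _ (200 * x * ((2 * c + 9)%:R * ln n%:R))).
    by apply: ler_pM; rewrite ?ler0n.
  have -> : Kn%:R = 200 * (2 * c + 9)%:R :> R by rewrite /Kn (natrM _ 200).
  by rewrite /a -/x le_eqVlt; apply/orP; left; apply/eqP; ring.
have K1 : 1 <= Kn%:R :> R by rewrite ler1n /Kn muln_gt0 addn_gt0 orbT.
have KK : 1 <= K0 by rewrite KE; exact: exprn_ege1.
have np0 : 0 <= npoly by rewrite mulr_ge0 ?ler0n // exprn_ge0.
have zb := @Z_pow_le R n Zz 120 Kn a a1' Za; rewrite -/npoly -KE in zb.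
have b4 : (200%:R * (2 * c + 9)%:R) <= K0.
  by rewrite KE -natrM -/Kn exprS ler_peMr ?ler0n //; exact: exprn_ege1.
clear KE.
have Kp : 0 <= K0 * npoly by rewrite mulr_ge0 //; apply: le_trans KK.
have Kp' : npoly <= K0 * npoly by rewrite ler_peMl.
split.
- by rewrite eS.
- split.
  (* The stored edges are exactly those with positive touch load; all others carry no load of either
     kind, so the sparse output is complete. *)
  + pose ys := [seq ((nth (e0 n0) es t').1, Posz ((U t' * N * Fy + Hh t' * E) * E), Posz (E * N * Fy * N * (E + 20))) | t' <- lst ne U].
    have memys t' : t' \in lst ne U -> (t' < size es)%N /\ (0 < U t')%N.
      by rewrite mem_filter mem_iota -sz => /andP[-> /andP[_ ->]].
    have edm : map (fun r : 'I_n * 'I_n * int * int => [set r.1.1.1; r.1.1.2]) ys = map (ed es n0) (lst ne U).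
      by rewrite -map_comp; apply: eq_map.
    exists ys; split.
    * rewrite (sim_o sm') oe -!map_comp; apply/eq_in_map => t' /memys[h _] /=.
      by rewrite /outrec /z4 /= (IE n0 h) (JE n0 h).
    * rewrite edm map_inj_in_uniq ?filter_uniq ?iota_uniq // => t1 t2 /memys[h1 _] /memys[h2 _].
      exact: (ed_inj pr).
    * move=> r0 /mapP[t' /memys[h _] ->] /=; split; first exact: (ed_in n0 pr h).
        by rewrite eqz_nat -lt0n; apply: mul5_gt0; rewrite ?addn_gt0 ?orbT //; apply: leq_trans E100'.
      rewrite -/(ed es n0 t') (lift_ed n0 pr yt h).
      by apply: yout_frac => //; apply: leq_trans E100'.
    * move=> e ee ne'; rewrite /lift_y big1 // => t' /eqP et; apply: yt0; first by rewrite sz.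
      apply/eqP; rewrite -leqn0 leqNgt; apply/negP => u0; case/negP: ne'.
      by rewrite edm -et; apply: map_f; rewrite mem_filter u0 mem_iota /= sz ltn_ord.
  + exact: (feas_from n0 pr cE fy).
  + have q0 : 0 <= 1 - 14 * delta by clear -dhi; lra.
    apply: (opt_le n0 pr cE q0 _ fy); first by clear -d0; lra.
      move=> t' h nz; rewrite -sz in h; apply: (reach_W r h); rewrite lt0n; apply/eqP => u0.
      by move/eqP: nz; apply; exact: (yt0 _ h u0).
    move=> hs fh v1; apply: le_trans (vy hs fh v1); apply: ler_wpM2r; first by apply: le_trans v1.
    (* E >= 100/delta makes 29/E at most 0.29 delta. *)
    have : 29 / E%:R <= 29 * delta / 100.
      rewrite ler_pdivrMr ?ltr0n; last by apply: leq_trans E100'.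
      by have := ler_wpM2l (ltW d0) EL; rewrite mulrCA dx mulr1; lra.
    by lra.
- apply: (@le_trans _ _ (n * Zz ^ 120)%:R).
    rewrite ler_nat so; apply: leq_trans (Lm_Z n52 hB hW hE).
    by rewrite leq_add2l leq_mul2l sT.
  by apply: (le_trans zb); clear -Kp; lra.
- have lx : 1 <= ln x.
    have h4 : ln (4 : R) <= ln x by rewrite ler_ln ?posrE //; clear -x16; lra.
    have e4 : ln (4 : R) = ln 2 + ln 2 by rewrite -lnM ?posrE ?ltr0n // -natrM.
    have := @ln2_half R; clear -h4 e4; lra.
  have NEq : N%:R = 100 * E%:R * E%:R * (pL n dn dd ne A0)%:R :> R by rewrite /N /pN !natrM.
  have b1 : N%:R <= 100 * (200 * x) * (200 * x) * ((2 * c + 9)%:R * ln n%:R).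
    by rewrite NEq; apply: prod_le; rewrite ?ler0n.
  (* The number of passes is of order delta^-2 ln n; it fits the claimed bound because 1/delta >= 16
     and ln(1/delta) >= 1. *)
  have x4 : x * x <= x ^+ 4 * ln x.
    have h : x * x <= x ^+ 4.
      by rewrite (_ : x ^+ 4 = x * x * (x * x)) ?ler_peMr ?mulr_ge0 ?ltW //; [clear -x16 xx; lra|ring].
    by apply: (le_trans h); rewrite ler_peMr // exprn_ge0 // ltW.
  rewrite TE -natr1 -exprVn -/x.
  have b2 : (x * x) * ((2 * c + 9)%:R * ln n%:R) <= (x ^+ 4 * ln x) * ((2 * c + 9)%:R * ln n%:R) by rewrite ler_wpM2r.
  have b3 : 1 <= (x * x) * ((2 * c + 9)%:R * ln n%:R).
    have c9 : (1 : R) <= (2 * c + 9)%:R by rewrite ler1n addn_gt0 orbT.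
    have h1 : 1 <= x * x by clear -x16 xx; lra.
    have h2 : 1 <= (2 * c + 9)%:R * ln n%:R :> R by apply: mul_ge1.
    by apply: mul_ge1.
  have w0 : 0 <= x ^+ 4 * ln x * ln n%:R.
    by rewrite !mulr_ge0 ?exprn_ge0 //; first [exact: ltW | exact: (le_trans ler01 lx) | exact: (le_trans ler01 l1)].
  have b5 := ler_wpM2l w0 b4.
  clear -b1 b2 b3 b5; lra.
- have tc : (t <= 1000 * clk a')%N by move: tk; rewrite /KC /= muln0 addn0.
  have rz := rest_Z n52 hB hW hE.
  have ck : (clk a' <= 60 * (m * T) + n * Zz ^ 120)%N.
    by rewrite mE TE -sz; exact: (time_sum ke rz).
  have this_ : t%:R <= 1000%:R * (60%:R * (m * T)%:R + (n * Zz ^ 120)%:R) :> R.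
    rewrite -!(natrM, natrD) ler_nat; apply: leq_trans tc _; by rewrite leq_mul2l ck orbT.
  have mT0 : (0 : R) <= (m * T)%:R by exact: ler0n.
  have mTK : (m * T)%:R <= K0 * (m * T)%:R :> R by rewrite ler_peMl.
  clear -this_ mT0 mTK zb Kp Kp'; lra.
Qed.
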